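(* Let $\mathbb{F}$ be a field and let $A=\bigoplus_{n\in\mathbb{N}}A_n$ be a strong tower of algebras over $\mathbb{F}$ with conjugation $\Psi$. Then the following statements are equivalent. (1) The tower $A$ is dualizing. (2) $\Psi^{\otimes2}\Delta\Psi^{-1}(P)\cong\Delta(P)$ for all $P\in A\text{-pmod}$. (3) $\Psi^{\otimes2}\Delta\Psi^{-1}=\Delta$ as maps $\mathcal{K}(A)\to\mathcal{K}(A)\otimes\mathcal{K}(A)$. In particular, $A$ is dualizing if each $A_n$ is a symmetric algebra (i.e. if $\Psi=\mathrm{Id}$) or, more generally, if $\Psi$ acts trivially on $\mathcal{K}(A)$.
   Context: $B\text{-mod}$ (resp. $B\text{-pmod}$) is the category of finitely generated (resp. finitely generated projective) left $B$-modules; $G_0(B)$ is the Grothendieck group of the abelian category $B\text{-mod}$, $K_0(B)$ the split Grothendieck group of $B\text{-pmod}$. A tower of algebras is a graded $\mathbb{F}$-algebra $A=\bigoplus_{n\in\mathbb{N}}A_n$ with multiplication $\rho$ such that: (TA1) each $A_n$ is itself a finite dimensional unital algebra (with a different multiplication) with unit $1_n$, and $A_0\cong\mathbb{F}$; (TA2) $\rho_{m,n}\colon A_m\otimes A_n\to A_{m+n}$ is a unital algebra homomorphism for all $m,n$; (TA3) $A_{m+n}$ is projective as a left and as a right $(A_m\otimes A_n)$-module via $\rho_{m,n}$; (TA4) the pairing $K_0(A_n)\times G_0(A_n)\to\mathbb{Z}$, $\langle[P],[M]\rangle=\dim_\mathbb{F}\mathrm{Hom}_{A_n}(P,M)$,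 is perfect for each $n$. $A\text{-mod}=\bigoplus_nA_n\text{-mod}$, $A\text{-mod}^{\otimes r}=\bigoplus_{n_1,\dots,n_r}(A_{n_1}\otimes\dots\otimes A_{n_r})\text{-mod}$, and similarly for pmod. $S_{ij}$ is the endofunctor of $A\text{-mod}^{\otimes r}$ interchanging the $i$th and $j$th factors. $\nabla\colon A\text{-mod}^{\otimes2}\to A\text{-mod}$ is $\mathrm{Ind}^{A_{m+n}}_{A_m\otimes A_n}=A_{m+n}\otimes_{A_m\otimes A_n}-$ on $(A_m\otimes A_n)\text{-mod}$; $\Delta\colon A\text{-mod}\to A\text{-mod}^{\otimes2}$ is $\bigoplus_{k+\ell=n}\mathrm{Res}^{A_n}_{A_k\otimes A_\ell}$ on $A_n\text{-mod}$ (restriction along $\rho_{k,\ell}$). The same formulas define these functors on projectives. Algebra automorphisms $\psi_n$ of $A_n$ ($n\in\mathbb{N}$) give, by twisting the action, an automorphism $\Psi$ of the categories $A\text{-mod}$, $A\text{-pmod}$, and of $\mathcal{G}(A)$, $\mathcal{K}(A)$. $A$ is strong with conjugation $\Psi$ if for some such $\psi_n$ the functor $\nabla$ is right adjoint to $\Psi^{\otimes2}\Delta\Psi^{-1}$ (induction is conjugate right adjoint to restriction), and there is an isomorphism of functors $\Delta\nabla\cong\nabla^{\otimes2}S_{23}\Delta^{\otimes2}$. $\mathcal{G}(A)=\bigoplus_nG_0(A_n)$ and $\mathcal{K}(A)=\bigoplus_nK_0(A_n)$ carry the multiplication and comultiplication induced by $\nabla$, $\Delta$, and the unit and counit induced by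 $\eta\colon\mathrm{Vect}\cong A_0\text{-mod}\hookrightarrow A\text{-mod}$ and the projection $\varepsilon\colon A\text{-mod}\to A_0\text{-mod}\cong\mathrm{Vect}$. $A$ is dualizing if under these operations $\mathcal{K}(A)$ and $\mathcal{G}(A)$ are (graded connected) Hopf algebras over $\mathbb{Z}$ which are graded dual to each other under the perfect pairing $\mathcal{K}(A)\times\mathcal{G}(A)\to\mathbb{Z}$, $\langle[P],[M]\rangle=\dim_\mathbb{F}\mathrm{Hom}_{A_n}(P,M)$ for $P\in A_n\text{-pmod}$, $M\in A_n\text{-mod}$ (and $0$ in different degrees), i.e. this pairing is a Hopf pairing: $\langle ab,x\rangle=\langle a\otimes b,\Delta(x)\rangle$, $\langle a,xy\rangle=\langle\Delta(a),x\otimes y\rangle$, $\langle1,x\rangle=\varepsilon(x)$, $\langle a,1\rangle=\varepsilon(a)$. *)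

(* Defs.v *)
From HB Require Import structures.
From mathcomp Require Import all_boot all_order all_algebra all_field.
From mathcomp Require Import boolp classical_sets cardinality fsbigop.
From mathcomp Require Import generic_quotient ring_quotient freeg.

Set Implicit Arguments.
Unset Strict Implicit.
Unset Printing Implicit Defensive.

Import GRing.Theory.
Local Open Scope quotient_scope.
Local Open Scope ring_scope.

(* [tens U V] is the tensor product over F, modelled by coordinate matrices   *)
(* in the bases [vbasis] of U and V; [tens_bilin], [tliftE] and [tens_ext]    *)
(* give its universal property.                                               *)

Section Bilinear.
Variables (F : fieldType) (U V W : lmodType F).

Definition bilin (f : U -> V -> W) : Prop :=
  (forall u, linear (f u)) /\ (forall v, linear (f^~ v)).

Variable f : U -> V -> W.
Hypothesis bf : bilin f.

Let lr u : {linear V -> W} := HB.pack (f u) (GRing.isLinear.Build _ _ _ _ _ (bf.1 u)).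
Let ll v : {linear U -> W} := HB.pack (f^~ v) (GRing.isLinear.Build _ _ _ _ _ (bf.2 v)).

Lemma bilinDr u v w : f u (v + w) = f u v + f u w.
Proof. exact: (raddfD (lr u)). Qed.
Lemma bilinDl u v w : f (u + v) w = f u w + f v w.
Proof. exact: (raddfD (ll w)). Qed.
Lemma bilinZr u a v : f u (a *: v) = a *: f u v.
Proof. exact: (linearZZ (lr u)). Qed.
Lemma bilinZl a u v : f (a *: u) v = a *: f u v.
Proof. exact: (linearZZ (ll v)). Qed.
Lemma bilin_sumr I (r : seq I) (P : pred I) (E : I -> V) u :
  f u (\sum_(i <- r | P i) E i) = \sum_(i <- r | P i) f u (E i).
Proof. exact: (raddf_sum (lr u)). Qed.
Lemma bilin_suml I (r : seq I) (P : pred I) (E : I -> U) v :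
  f (\sum_(i <- r | P i) E i) v = \sum_(i <- r | P i) f (E i) v.
Proof. exact: (raddf_sum (ll v)). Qed.
End Bilinear.

Section LinearFun.
Variables (F : fieldType) (U V : lmodType F) (f : U -> V).
Hypothesis lf : linear f.
Let lin : {linear U -> V} := HB.pack f (GRing.isLinear.Build _ _ _ _ _ lf).

Lemma linear0f : f 0 = 0. Proof. exact: (raddf0 lin). Qed.
Lemma linearDf u v : f (u + v) = f u + f v. Proof. exact: (raddfD lin). Qed.
Lemma linearNf u : f (- u) = - f u. Proof. exact: (raddfN lin). Qed.
Lemma linearBf u v : f (u - v) = f u - f v. Proof. exact: (raddfB lin). Qed.
Lemma linearZf a u : f (a *: u) = a *: f u. Proof. exact: (linearZZ lin). Qed.
Lemma linear_sumf I (r : seq I) (P : pred I) (E : I -> U) :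
  f (\sum_(i <- r | P i) E i) = \sum_(i <- r | P i) f (E i).
Proof. exact: (raddf_sum lin). Qed.
End LinearFun.

Lemma linear_comp (F : fieldType) (U V W : lmodType F) (g : V -> W) (f : U -> V) :
  linear g -> linear f -> linear (g \o f).
Proof. by move=> lg lf a u v; rewrite /= lf lg. Qed.

Definition tens (F : fieldType) (U V : vectType F) : Type :=
  'M[F]_(\dim {:U}, \dim {:V}).

HB.instance Definition _ (F : fieldType) (U V : vectType F) :=
  Vector.copy (tens U V) 'M[F]_(\dim {:U}, \dim {:V}).

Section Tensor.
Variables (F : fieldType) (U V : vectType F).
Local Notation eU i := ((vbasis {:U})`_i).
Local Notation eV j := ((vbasis {:V})`_j).

Definition tpure (u : U) (v : V) : tens U V :=
  \matrix_(i, j) (coord (vbasis {:U}) i u * coord (vbasis {:V}) j v).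

Definition tlift (W : lmodType F) (f : U -> V -> W) (t : tens U V) : W :=
  \sum_i \sum_j (t : 'M_(_, _)) i j *: f (eU i) (eV j).

Lemma tens_bilin : bilin tpure.
Proof.
split=> [u|v] a x y; apply/matrixP=> i j; rewrite !mxE !linearP /=.
  by rewrite mulrDr mulrCA.
by rewrite mulrDl mulrA.
Qed.

Lemma tlift_linear (W : lmodType F) (f : U -> V -> W) : linear (tlift f).
Proof.
move=> a x y; rewrite /tlift scaler_sumr -big_split /=; apply: eq_bigr => i _.
rewrite scaler_sumr -big_split /=; apply: eq_bigr => j _.
by rewrite !mxE scalerDl scalerA.
Qed.

Lemma tlift_linear_param (X W : lmodType F) (f : X -> U -> V -> W) t :
  (forall u v, linear (fun x => f x u v)) -> linear (fun x => tlift (f x) t).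
Proof.
move=> lf a x y; rewrite /tlift scaler_sumr -big_split /=; apply: eq_bigr => i _.
rewrite scaler_sumr -big_split /=; apply: eq_bigr => j _.
by rewrite lf scalerDr !scalerA mulrC.
Qed.

HB.instance Definition _ (W : lmodType F) (f : U -> V -> W) :=
  GRing.isLinear.Build F (tens U V) W _ (tlift f) (tlift_linear f).

Lemma tliftE (W : lmodType F) (f : U -> V -> W) u v :
  bilin f -> tlift f (tpure u v) = f u v.
Proof.
move=> bf; rewrite [in RHS](coord_vbasis (memvf u)) (bilin_suml bf).
apply: eq_bigr => i _; rewrite (bilinZl bf).
rewrite [in RHS](coord_vbasis (memvf v)) (bilin_sumr bf) scaler_sumr.
by apply: eq_bigr => j _; rewrite (bilinZr bf) !mxE scalerA.
Qed.

Lemma tensE (t : tens U V) : t = tlift tpure t.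
Proof.
apply/matrixP=> i j; rewrite /tlift summxE (bigD1 i) //= summxE (bigD1 j) //=.
have bU := basis_free (vbasisP {:U}); have bV := basis_free (vbasisP {:V}).
rewrite !mxE !coord_free // !eqxx !mulr1 big1 ?addr0 => [|k kj]; last first.
  by rewrite !mxE !coord_free // (negPf kj) !mulr0.
rewrite big1 ?addr0 // => k ki; rewrite summxE big1 // => l _.
by rewrite !mxE !coord_free // (negPf ki) mul0r mulr0.
Qed.

Lemma tens_ext (W : lmodType F) (f g : tens U V -> W) :
  linear f -> linear g -> (forall u v, f (tpure u v) = g (tpure u v)) -> f =1 g.
Proof.
move=> lf lg fg t; rewrite [t]tensE /tlift (linear_sumf lf) (linear_sumf lg).
apply: eq_bigr => i _; rewrite (linear_sumf lf) (linear_sumf lg).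
by apply: eq_bigr => j _; rewrite (linearZf lf) (linearZf lg) fg.
Qed.
End Tensor.

Notation "u ⊗ v" := (tpure u v) (at level 40, left associativity) : ring_scope.

Section TensorMap.
Variables (F : fieldType) (U V U' V' : vectType F).

Definition tmap (f : U -> U') (g : V -> V') : tens U V -> tens U' V' :=
  tlift (fun u v => f u ⊗ g v).

Lemma tmap_linear f g : linear (tmap f g).
Proof. exact: tlift_linear. Qed.

Lemma tmapE f g u v : linear f -> linear g -> tmap f g (u ⊗ v) = f u ⊗ g v.
Proof.
move=> lf lg; rewrite /tmap tliftE //; split=> [x|y] a z t /=.
  by rewrite lg (tens_bilin _ _).1.
by rewrite lf (tens_bilin _ _).2.
Qed.
End TensorMap.

Section TensorAlgebra.
Variables (F : fieldType) (A B : falgType F).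
Implicit Types x y z : tens A B.

Definition tone : tens A B := 1 ⊗ 1.
Definition tmul x y : tens A B :=
  tlift (fun a b => tlift (fun a' b' => (a * a') ⊗ (b * b')) y) x.

Let bmul (a : A) (b : B) : bilin (fun a' b' => (a * a') ⊗ (b * b')).
Proof.
split=> [u|v] c s t /=.
  by rewrite mulrDr -scalerAr (tens_bilin _ _).1.
by rewrite mulrDr -scalerAr (tens_bilin _ _).2.
Qed.

Let bmul2 y : bilin (fun a b => tlift (fun a' b' => (a * a') ⊗ (b * b')) y).
Proof.
split=> [u|v]; apply: tlift_linear_param => a' b' c s t /=.
  by rewrite mulrDl -scalerAl (tens_bilin _ _).1.
by rewrite mulrDl -scalerAl (tens_bilin _ _).2.
Qed.

Lemma tmulE a b a' b' : tmul (a ⊗ b) (a' ⊗ b') = (a * a') ⊗ (b * b').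
Proof. by rewrite /tmul tliftE // tliftE. Qed.

Lemma tmul_bilin : bilin tmul.
Proof.
split=> [x|y]; last exact: tlift_linear.
by apply: tlift_linear_param => a b; exact: tlift_linear.
Qed.

Lemma tmulA : associative tmul.
Proof.
move=> x y z; have [lr ll] := tmul_bilin.
apply: (tens_ext (f := fun x => tmul x (tmul y z))
                 (g := fun x => tmul (tmul x y) z)).
- by move=> c s t; rewrite !ll.
- by move=> c s t; rewrite !ll.
move=> a b; apply: (tens_ext (f := fun y => tmul (a ⊗ b) (tmul y z))
                             (g := fun y => tmul (tmul (a ⊗ b) y) z)).
- by move=> c s t; rewrite ll lr.
- by move=> c s t; rewrite lr ll.
move=> a' b'; apply: (tens_ext (f := fun z => tmul (a ⊗ b) (tmul (a' ⊗ b') z))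
                               (g := fun z => tmul (tmul (a ⊗ b) (a' ⊗ b')) z)).
- by move=> c s t; rewrite !lr.
- by move=> c s t; rewrite !lr.
by move=> a'' b''; rewrite !tmulE !mulrA.
Qed.

Lemma tmul1x : left_id tone tmul.
Proof.
suff: tmul tone =1 id by []; apply: tens_ext => //.
  exact: tmul_bilin.1.
by move=> a b; rewrite tmulE !mul1r.
Qed.

Lemma tmulx1 : right_id tone tmul.
Proof.
suff: tmul^~ tone =1 id by []; apply: tens_ext => //.
  exact: tmul_bilin.2.
by move=> a b; rewrite tmulE !mulr1.
Qed.

Lemma tmulDl : left_distributive tmul +%R.
Proof. by move=> x y z; rewrite (bilinDl tmul_bilin). Qed.
Lemma tmulDr : right_distributive tmul +%R.
Proof. by move=> x y z; rewrite (bilinDr tmul_bilin). Qed.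

Lemma vect_neq0_coord (V : vectType F) (v : V) :
  v != 0 -> exists i, coord (vbasis {:V}) i v != 0.
Proof.
move=> v0; apply/existsP; apply: contraNT v0; rewrite negb_exists => /forallP h.
rewrite (coord_vbasis (memvf v)) big1 // => i _.
by have := h i; rewrite negbK => /eqP ->; rewrite scale0r.
Qed.

Lemma tone_neq0 : tone != 0.
Proof.
have [i ci] := vect_neq0_coord (oner_neq0 A).
have [j cj] := vect_neq0_coord (oner_neq0 B).
apply/eqP => /matrixP /(_ i j) /eqP; rewrite !mxE mulf_eq0.
by rewrite (negPf ci) (negPf cj).
Qed.

HB.instance Definition _ := GRing.Zmodule_isNzRing.Build (tens A B)
  tmulA tmul1x tmulx1 tmulDl tmulDr tone_neq0.

Lemma tscalerAl (c : F) x y : c *: (x * y) = (c *: x) * y.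
Proof. by rewrite [RHS](bilinZl tmul_bilin). Qed.
HB.instance Definition _ := GRing.Lmodule_isLalgebra.Build F (tens A B) tscalerAl.

Lemma tscalerAr (c : F) x y : c *: (x * y) = x * (c *: y).
Proof. by rewrite [RHS](bilinZr tmul_bilin). Qed.
HB.instance Definition _ := GRing.Lalgebra_isAlgebra.Build F (tens A B) tscalerAr.
HB.instance Definition _ := Algebra_isFalgebra.Build F (tens A B).

Lemma tensM a b a' b' : (a ⊗ b : tens A B) * (a' ⊗ b') = (a * a') ⊗ (b * b').
Proof. exact: tmulE. Qed.
Lemma tens1 : 1 = 1 ⊗ 1 :> tens A B.
Proof. by []. Qed.

Lemma mul_linr (a : A) : linear (fun x : A => a * x).
Proof. by move=> c x y; rewrite mulrDr scalerAr. Qed.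
Lemma mul_linl (a : A) : linear (fun x : A => x * a).
Proof. by move=> c x y; rewrite mulrDl scalerAl. Qed.

Lemma tens_monoid (C : falgType F) (f : tens A B -> C) : linear f ->
  f (1 ⊗ 1) = 1 ->
  (forall a b a' b', f ((a * a') ⊗ (b * b')) = f (a ⊗ b) * f (a' ⊗ b')) ->
  monoid_morphism f.
Proof.
move=> lf f1 fM; split=> // x y.
apply: (tens_ext (f := fun x => f (x * y)) (g := fun x => f x * f y)).
- by move=> c s t; rewrite mulrDl -scalerAl lf.
- by move=> c s t; rewrite lf mulrDl scalerAl.
move=> a b; apply: (tens_ext (f := fun y => f ((a ⊗ b) * y)) (g := fun y => f (a ⊗ b) * f y)).
- by move=> c s t; rewrite mulrDr -scalerAr lf.
- by move=> c s t; rewrite lf mulrDr scalerAr.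
by move=> a' b'; rewrite tensM fM.
Qed.
End TensorAlgebra.

Section TensorAlgebraMap.
Variables (F : fieldType) (A B A' B' : falgType F).
Variables (f : {lrmorphism A -> A'}) (g : {lrmorphism B -> B'}).

Lemma tmap_monoid : monoid_morphism (tmap f g).
Proof.
have E a b : tmap f g (a ⊗ b) = f a ⊗ g b by apply: tmapE; exact: linearP.
apply: tens_monoid; first exact: tmap_linear.
  by rewrite E !rmorph1.
by move=> a b a' b'; rewrite !E !rmorphM tensM.
Qed.
HB.instance Definition _ :=
  GRing.isLinear.Build F (tens A B) (tens A' B') _ (tmap f g) (tmap_linear f g).
HB.instance Definition _ :=
  GRing.isMonoidMorphism.Build (tens A B) (tens A' B') (tmap f g) tmap_monoid.
Definition tmor : {lrmorphism tens A B -> tens A' B'} := tmap f g.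
End TensorAlgebraMap.

Section TensorSwap.
Variables (F : fieldType) (A B C D : falgType F).

Definition tswap_fun : tens (tens A B) (tens C D) -> tens (tens A C) (tens B D) :=
  tlift (fun x y => tlift (fun a b => tlift (fun c d => (a ⊗ c) ⊗ (b ⊗ d)) y) x).

Lemma tswapE a b c d : tswap_fun ((a ⊗ b) ⊗ (c ⊗ d)) = (a ⊗ c) ⊗ (b ⊗ d).
Proof.
have b1 (a' : A) (b' : B) :
    bilin (fun (c : C) (d : D) => (a' ⊗ c) ⊗ (b' ⊗ d)).
  split=> [u|v] k s t /=; rewrite (tens_bilin _ _).1.
    by rewrite (tens_bilin _ _).1.
  by rewrite (tens_bilin _ _).2.
have b2 y : bilin (fun (a : A) (b : B) =>
    tlift (fun (c : C) (d : D) => (a ⊗ c) ⊗ (b ⊗ d)) y).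
  split=> [u|v]; apply: tlift_linear_param => c' d' k s t.
    by rewrite (tens_bilin _ _).2 (tens_bilin _ _).1.
  by rewrite !(tens_bilin _ _).2.
rewrite /tswap_fun tliftE; first by rewrite tliftE // tliftE.
split=> [x|y]; last exact: tlift_linear.
by apply: tlift_linear_param => a' b'; exact: tlift_linear.
Qed.

Lemma tswap_linear : linear tswap_fun.
Proof. exact: tlift_linear. Qed.

Lemma tswap_monoid : monoid_morphism tswap_fun.
Proof.
have lin := tswap_linear.
split; first by rewrite !tens1 tswapE.
move=> x y; have [lr ll] := tmul_bilin (tens A B) (tens C D).
have step a b c d a' b' c' d' :
  tswap_fun (((a ⊗ b) ⊗ (c ⊗ d)) * ((a' ⊗ b') ⊗ (c' ⊗ d')))
  = tswap_fun ((a ⊗ b) ⊗ (c ⊗ d)) * tswap_fun ((a' ⊗ b') ⊗ (c' ⊗ d')).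
  by rewrite !tensM !tswapE !tensM.
have ext (G H : tens (tens A B) (tens C D) -> tens (tens A C) (tens B D)) :
    linear G -> linear H ->
    (forall a b c d, G ((a ⊗ b) ⊗ (c ⊗ d)) = H ((a ⊗ b) ⊗ (c ⊗ d))) -> G =1 H.
  move=> lG lH GH; apply: tens_ext => // u v.
  apply: (tens_ext (f := fun u => G (u ⊗ v)) (g := fun u => H (u ⊗ v))).
  - by move=> k s t; rewrite (tens_bilin _ _).2 lG.
  - by move=> k s t; rewrite (tens_bilin _ _).2 lH.
  move=> a b.
  apply: (tens_ext (f := fun v => G ((a ⊗ b) ⊗ v)) (g := fun v => H ((a ⊗ b) ⊗ v))).
  - by move=> k s t; rewrite (tens_bilin _ _).1 lG.
  - by move=> k s t; rewrite (tens_bilin _ _).1 lH.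
  by move=> c d; rewrite GH.
apply: (ext (fun x => tswap_fun (x * y)) (fun x => tswap_fun x * tswap_fun y)).
- by move=> k s t; rewrite mulrDl -scalerAl lin.
- by move=> k s t; rewrite lin mulrDl scalerAl.
move=> a b c d.
apply: (ext (fun y => tswap_fun (((a ⊗ b) ⊗ (c ⊗ d)) * y))
            (fun y => tswap_fun ((a ⊗ b) ⊗ (c ⊗ d)) * tswap_fun y)).
- by move=> k s t; rewrite mulrDr -scalerAr lin.
- by move=> k s t; rewrite lin mulrDr scalerAr.
by move=> a' b' c' d'; rewrite step.
Qed.
HB.instance Definition _ := GRing.isLinear.Build F _ _ _ tswap_fun tswap_linear.
HB.instance Definition _ := GRing.isMonoidMorphism.Build _ _ tswap_fun tswap_monoid.
Definition tswap :
  {lrmorphism tens (tens A B) (tens C D) -> tens (tens A C) (tens B D)} := tswap_fun.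
End TensorSwap.

(* Quotient of a vector space by a subspace, modelled on a complement.        *)
Section VectorQuotient.
Variables (F : fieldType) (V : vectType F) (U : {vspace V}).

Definition vquot : Type := subvs_of (U^C)%VS.
HB.instance Definition _ := Vector.copy vquot (subvs_of (U^C)%VS).

Definition vrepr (x : vquot) : V := vsval (x : subvs_of _).
Definition vpi (v : V) : vquot := vsproj (U^C) (daddv_pi (U^C) U v).

Lemma vpi_linear : linear vpi.
Proof. by move=> a u v; rewrite /vpi !linearP. Qed.
Lemma vrepr_linear : linear vrepr.
Proof. by move=> a u v; rewrite /vrepr linearP. Qed.

Let capCU : (U^C :&: U = 0)%VS. Proof. by rewrite capvC capv_compl. Qed.
Let addCU : (U^C + U = fullv)%VS. Proof. by rewrite addvC addv_complf. Qed.

Lemma vreprK : cancel vrepr vpi.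
Proof.
move=> x; apply: val_inj; rewrite /vpi /vrepr /= daddv_pi_id ?subvsP //.
by rewrite vsprojK // subvsP.
Qed.

Lemma vpiK v : v - vrepr (vpi v) \in U.
Proof.
rewrite /vrepr /vpi vsprojK ?memv_pi //.
rewrite -{1}(@daddv_pi_add _ _ _ _ v capCU) ?addCU ?memvf //.
by rewrite addrC addKr memv_pi.
Qed.

Lemma vpi_eq0 v : (vpi v == 0) = (v \in U).
Proof.
apply/eqP/idP => [v0|vU].
  by have := vpiK v; rewrite v0 (linear0f vrepr_linear) subr0.
have: vrepr (vpi v) \in (U^C :&: U)%VS.
  by rewrite memv_cap subvsP -[vrepr _](subKr v) memvB // vpiK.
by rewrite capCU memv0 => /eqP v0; rewrite -[LHS]vreprK v0 (linear0f vpi_linear).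
Qed.

Lemma vpi_eq u v : (vpi u == vpi v) = (u - v \in U).
Proof. by rewrite -vpi_eq0 (linearBf vpi_linear) subr_eq0. Qed.
End VectorQuotient.

(* Finitely generated left B-modules: as B is finite dimensional they are the *)
(* modules of finite dimension over F (see [fingen_fmod] below).              *)
Record fmod (F : fieldType) (B : falgType F) := FMod {
  fcar :> vectType F;
  fact : B -> fcar -> fcar;
  fact_bilin : bilin fact;
  fact1 : forall x, fact 1 x = x;
  factM : forall a b x, fact (a * b) x = fact a (fact b x)
}.

Notation "b · x" := (fact b x) (at level 40, left associativity) : ring_scope.

Record fhom (F : fieldType) (B : falgType F) (M N : fmod B) := FHom {
  fhom_fun :> M -> N;
  fhom_linear : linear fhom_fun;
  fhom_act : forall b x, fhom_fun (b · x) = b · fhom_fun x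
}.

Section Hom.
Variables (F : fieldType) (B : falgType F).
Implicit Types M N P : fmod B.

Lemma fhom_ext M N (f g : fhom M N) : f =1 g -> f = g.
Proof.
case: f g => [f lf bf] [g lg bg] /= /funext fg; case: g / fg lg bg => lg bg.
by rewrite (Prop_irrelevance lf lg) (Prop_irrelevance bf bg).
Qed.

Definition fid M : fhom M M.
Proof. by exists id. Defined.

Definition fcomp M N P (g : fhom N P) (f : fhom M N) : fhom M P.
Proof.
exists (fun x => g (f x)).
  exact: linear_comp (fhom_linear g) (fhom_linear f).
by move=> b x; rewrite !fhom_act.
Defined.

Definition fzero M N : fhom M N.
Proof.
exists (fun=> 0) => [a x y|b x]; first by rewrite scaler0 addr0.
by rewrite (linear0f ((fact_bilin N).1 b)).
Defined.

Definition fiso M N : Prop :=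
  exists (f : fhom M N) (g : fhom N M), cancel f g /\ cancel g f.

Definition homs M N : {vspace 'Hom(M, N)} :=
  (\bigcap_(i < \dim {:B})
     lker (linfun (fun f : 'Hom(M, N) =>
       ((f \o linfun (fact (vbasis {:B})`_i))
        - (linfun (fact (vbasis {:B})`_i) \o f))%VF)))%VS.

Definition dim_hom M N : nat := \dim (homs M N).

Lemma homsP M N (f : 'Hom(M, N)) :
  reflect (forall b x, f (b · x) = b · f x) (f \in homs M N).
Proof.
have actE (P : fmod B) b (x : P) : linfun (fact b) x = b · x.
  pose l : {linear P -> P} :=
    HB.pack (fact b) (GRing.isLinear.Build _ _ _ _ _ ((fact_bilin P).1 b)).
  exact: (lfunE l).
have mem i : (f \in lker (linfun (fun f : 'Hom(M, N) =>
       ((f \o linfun (fact (vbasis {:B})`_i))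
        - (linfun (fact (vbasis {:B})`_i) \o f))%VF)))
   = (f \o linfun (fact (vbasis {:B})`_i)
        == linfun (fact (vbasis {:B})`_i) \o f)%VF.
  set h := fun f : 'Hom(M, N) => _.
  have lh : linear h.
    move=> a u v; apply/lfunP=> x.
    rewrite /h; do !rewrite ?add_lfunE ?scale_lfunE ?opp_lfunE ?comp_lfunE ?linearP.
    by rewrite /= scalerBr -scalerN addrACA.
  pose l : {linear 'Hom(M, N) -> 'Hom(M, N)} :=
    HB.pack h (GRing.isLinear.Build _ _ _ _ _ lh).
  by rewrite memv_ker (lfunE l f : linfun h f = h f) subr_eq0.
apply: (iffP idP) => [/subv_bigcapP fh b x | fh].
  have E i : f ((vbasis {:B})`_i · x) = (vbasis {:B})`_i · f x.
    case: (ltnP i (\dim {:B})) => [ib|bi].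
      have := fh (Ordinal ib) isT; rewrite -memvE mem => /eqP/lfunP/(_ x).
      by rewrite !comp_lfunE !actE.
    rewrite nth_default ?size_tuple // (linear0f ((fact_bilin M).2 x)).
    by rewrite (linear0f ((fact_bilin N).2 _)) linear0.
  rewrite (coord_vbasis (memvf b)) (bilin_suml (fact_bilin M)).
  rewrite (bilin_suml (fact_bilin N)) linear_sum; apply: eq_bigr => i _.
  by rewrite (bilinZl (fact_bilin M)) (bilinZl (fact_bilin N)) linearZ /= E.
apply/subv_bigcapP => i _; rewrite -memvE mem; apply/eqP/lfunP => x.
by rewrite !comp_lfunE !actE fh.
Qed.

(* Lifting property against epimorphisms of finitely generated modules.       *)
Definition projective P : Prop :=
  forall M N (g : fhom M N) (f : fhom P N),
    (forall y, exists x, g x = y) -> exists h : fhom P M, forall x, g (h x) = f x.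

Definition zero_mod : fmod B.
Proof.
exists ('rV[F]_0 : vectType F) (fun=> id).
- by split=> [b|x] a u v //; rewrite !thinmx0.
- by [].
- by [].
Defined.

Section DirectSum.
Variables M N : fmod B.
Definition sum_act (b : B) (x : M * N) : M * N := (b · x.1, b · x.2).

Lemma sum_bilin : bilin sum_act.
Proof.
have [lM rM] := fact_bilin M; have [lN rN] := fact_bilin N.
split=> [b|x] a u v; rewrite /sum_act /=; first by rewrite lM lN.
by rewrite rM rN.
Qed.

Definition sum_mod : fmod B.
Proof.
exists (M * N)%type sum_act; first exact: sum_bilin.
- by case=> x y; rewrite /sum_act !fact1.
- by move=> a b x; rewrite /sum_act !factM.
Defined.
End DirectSum.

Definition sum_hom M M' N N' (f : fhom M M') (g : fhom N N') :
  fhom (sum_mod M N) (sum_mod M' N').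
Proof.
exists (fun x : M * N => (f x.1, g x.2)) => [a x y|b x] /=.
  by rewrite !fhom_linear.
by rewrite /sum_act !fhom_act.
Defined.

Fixpoint sums (T : Type) (s : seq T) (M : T -> fmod B) : fmod B :=
  if s is t :: s' then sum_mod (M t) (sums s' M) else zero_mod.

Fixpoint sums_hom (T : Type) (s : seq T) (M N : T -> fmod B)
    (f : forall t, fhom (M t) (N t)) : fhom (sums s M) (sums s N) :=
  match s with
  | [::] => fid zero_mod
  | t :: s' => sum_hom (f t) (sums_hom s' f)
  end.

Definition bigsum (T : finType) (M : T -> fmod B) : fmod B := sums (enum T) M.
Definition bigsum_hom (T : finType) (M N : T -> fmod B)
    (f : forall t, fhom (M t) (N t)) : fhom (bigsum M) (bigsum N) :=
  sums_hom (enum T) f.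

Lemma bigsum_hom1 (T : finType) (M : T -> fmod B) :
  bigsum_hom (fun t => fid (M t)) = fid (bigsum M).
Proof.
apply: fhom_ext => x; rewrite /bigsum_hom /bigsum in x *.
by elim: (enum T) x => [//|t s IHs] [x y] /=; rewrite IHs.
Qed.

Lemma bigsum_homM (T : finType) (M N P : T -> fmod B)
    (g : forall t, fhom (N t) (P t)) (f : forall t, fhom (M t) (N t)) :
  bigsum_hom (fun t => fcomp (g t) (f t)) = fcomp (bigsum_hom g) (bigsum_hom f).
Proof.
apply: fhom_ext => x; rewrite /bigsum_hom /bigsum in x *.
by elim: (enum T) x => [//|t s IHs] [x y] /=; rewrite IHs.
Qed.

Definition stable M (U : {vspace M}) : Prop :=
  forall b x, x \in U -> b · x \in U.

Section Quotient.
Variables (M : fmod B) (U : {vspace M}) (sU : stable U).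
Definition quot_act (b : B) (x : vquot U) : vquot U := vpi U (b · vrepr x).

Lemma quot_actE b x : quot_act b (vpi U x) = vpi U (b · x).
Proof.
apply/eqP; rewrite vpi_eq -(linearBf ((fact_bilin M).1 b)); apply: sU.
by rewrite -opprB memvN vpiK.
Qed.

Lemma quot_bilin : bilin quot_act.
Proof.
have [l r] := fact_bilin M.
split=> [b|x] a u v; rewrite /quot_act.
  by rewrite vrepr_linear l vpi_linear.
by rewrite r vpi_linear.
Qed.

Definition quot_mod : fmod B.
Proof.
exists (vquot U) quot_act; first exact: quot_bilin.
- by move=> x; rewrite /quot_act fact1 vreprK.
- by move=> a b x; rewrite {1}/quot_act factM -quot_actE.
Defined.
End Quotient.

Definition quot_hom M N (U : {vspace M}) (V : {vspace N}) (sU : stable U)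
    (sV : stable V) (f : fhom M N) (fUV : forall x, x \in U -> f x \in V) :
  fhom (quot_mod sU) (quot_mod sV).
Proof.
exists (fun x : vquot U => vpi V (f (vrepr x)) : quot_mod sV).
  by move=> a x y; rewrite vrepr_linear fhom_linear vpi_linear.
move=> b x /=; rewrite quot_actE // -fhom_act; apply/eqP.
rewrite vpi_eq -(linearBf (fhom_linear f)); apply: fUV.
by rewrite -opprB memvN vpiK.
Defined.

Lemma quot_homE M N (U : {vspace M}) (V : {vspace N}) (sU : stable U)
    (sV : stable V) (f : fhom M N) (fUV : forall x, x \in U -> f x \in V) x :
  quot_hom sU sV fUV (vpi U x) = vpi V (f x).
Proof.
apply/eqP; rewrite /= vpi_eq -(linearBf (fhom_linear f)); apply: fUV.
by rewrite -opprB memvN vpiK.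
Qed.
End Hom.

Definition reg_mod (F : fieldType) (B : falgType F) : fmod B.
Proof.
exists (B : vectType F) (fun b x => b * x).
- by split=> [b|x]; [exact: mul_linr | exact: mul_linl].
- exact: mul1r.
- by move=> a b x; rewrite mulrA.
Defined.

Section Restriction.
Variables (F : fieldType) (C B : falgType F) (phi : {lrmorphism C -> B}).

Definition res_mod (M : fmod B) : fmod C.
Proof.
exists (M : vectType F) (fun c x => phi c · x).
- have [l r] := fact_bilin M; split=> [c|x] a u v; first exact: l.
  by rewrite linearP r.
- by move=> x; rewrite rmorph1 fact1.
- by move=> a b x; rewrite rmorphM factM.
Defined.

Definition res_hom (M N : fmod B) (f : fhom M N) : fhom (res_mod M) (res_mod N) :=
  @FHom F C (res_mod M) (res_mod N) f (fhom_linear f)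
    (fun c x => fhom_act f (phi c) x).
End Restriction.

Section ExternalProduct.
Variables (F : fieldType) (A B : falgType F) (M : fmod A) (N : fmod B).

Definition ext_act (t : tens A B) (x : tens M N) : tens M N :=
  tlift (fun a b => tmap (fact a) (fact b) x) t.

Lemma ext_actE a b m n : ext_act (a ⊗ b) (m ⊗ n) = (a · m) ⊗ (b · n).
Proof.
have [lM rM] := fact_bilin M; have [lN rN] := fact_bilin N.
rewrite /ext_act tliftE ?tmapE //.
split=> [u|v]; apply: tlift_linear_param => x y k s t.
  by rewrite rN (tens_bilin _ _).1.
by rewrite rM (tens_bilin _ _).2.
Qed.

Lemma ext_bilin : bilin ext_act.
Proof.
split=> [t|x]; last exact: tlift_linear.
by apply: tlift_linear_param => a b; exact: tmap_linear.
Qed.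

Definition ext_mod : fmod (tens A B).
Proof.
exists (tens M N : vectType F) ext_act; have [l r] := ext_bilin => //.
- apply: (tens_ext (f := ext_act 1) (g := id)) => // m n.
  by rewrite tens1 ext_actE !fact1.
- move=> s t x; move: s.
  apply: (tens_ext (f := fun s => ext_act (s * t) x)
                   (g := fun s => ext_act s (ext_act t x))) => [k u v|k u v|a b].
  + by rewrite mulrDl -scalerAl r.
  + by rewrite r.
  move: t.
  apply: (tens_ext (f := fun t => ext_act ((a ⊗ b) * t) x)
            (g := fun t => ext_act (a ⊗ b) (ext_act t x))) => [k u v|k u v|a' b'].
  + by rewrite mulrDr -scalerAr r.
  + by rewrite r l.
  move: x.
  apply: (tens_ext (f := fun x => ext_act ((a ⊗ b) * (a' ⊗ b')) x)
     (g := fun x => ext_act (a ⊗ b) (ext_act (a' ⊗ b') x))) => [|k u v|m n].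
  + exact: l.
  + by rewrite !l.
  by rewrite tensM !ext_actE !factM.
Defined.
End ExternalProduct.

(* Induction along phi : C -> B, i.e. B ⊗_C M, the quotient of B ⊗_F M by the *)
(* span of the elements (b phi(c)) ⊗ m - b ⊗ (c m).                           *)
Section Induction.
Variables (F : fieldType) (C B : falgType F) (phi : {lrmorphism C -> B}).

Section Object.
Variable M : fmod C.

Definition tensl_act (b : B) (x : tens B M) : tens B M :=
  tmap (fun b' => b * b') id x.

Lemma tensl_actE b b' m : tensl_act b (b' ⊗ m) = (b * b') ⊗ m.
Proof. by rewrite /tensl_act tmapE //; exact: mul_linr. Qed.

Lemma tensl_bilin : bilin tensl_act.
Proof.
split=> [b|x]; first exact: tmap_linear.
apply: tlift_linear_param => b' m k s t.
by rewrite mulrDl -scalerAl (tens_bilin _ _).2.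
Qed.

Definition tensl_mod : fmod B.
Proof.
exists (tens B M : vectType F) tensl_act; have [l r] := tensl_bilin => //.
- apply: (tens_ext (f := tensl_act 1) (g := id)) => // b m.
  by rewrite tensl_actE mul1r.
- move=> a b; apply: (tens_ext (f := tensl_act (a * b))
    (g := fun x => tensl_act a (tensl_act b x))) => // [k u v|b' m].
    by rewrite !l.
  by rewrite !tensl_actE mulrA.
Defined.

Definition bal_fun : tens (tens B C) M -> tens B M :=
  tlift (fun x m => tlift (fun b c => (b * phi c) ⊗ m - b ⊗ (c · m)) x).

Lemma bal_funE b c m : bal_fun ((b ⊗ c) ⊗ m) = (b * phi c) ⊗ m - b ⊗ (c · m).
Proof.
have [lM rM] := fact_bilin M.
rewrite /bal_fun !tliftE //.
  split=> [u|v] k s t /=.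
    rewrite linearP mulrDr -scalerAr (tens_bilin _ _).2 rM (tens_bilin _ _).1.
    by rewrite scalerBr opprD addrACA.
  rewrite mulrDl -scalerAl !(tens_bilin _ _).2.
  by rewrite scalerBr opprD addrACA.
split=> [x|y]; last exact: tlift_linear.
apply: tlift_linear_param => b' c' k s t.
rewrite lM !(tens_bilin _ _).1 scalerBr opprD addrACA //.
Qed.

Lemma bal_fun_linear : linear bal_fun.
Proof. exact: tlift_linear. Qed.
HB.instance Definition _ := GRing.isLinear.Build F _ _ _ bal_fun bal_fun_linear.

Definition bal : {vspace tensl_mod} := limg (linfun bal_fun).

Lemma mem_bal b c m : (b * phi c) ⊗ m - b ⊗ (c · m) \in bal.
Proof. by rewrite -bal_funE -[bal_fun _]lfunE memv_img ?memvf. Qed.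

Lemma bal_ind (P : tensl_mod -> Prop) : P 0 ->
  (forall a x y, P x -> P y -> P (a *: x + y)) ->
  (forall b c m, P ((b * phi c) ⊗ m - b ⊗ (c · m))) ->
  forall x, x \in bal -> P x.
Proof.
move=> P0 PL PE x /memv_imgP [t _ ->]; rewrite lfunE /=.
have Psum (I : Type) (r : seq I) (E : I -> tensl_mod) (k : I -> F) :
    (forall i, P (E i)) -> P (\sum_(i <- r) k i *: E i).
  by move=> PEi; elim/big_rec: _ => // i y _; exact: PL.
rewrite [t]tensE /tlift (linear_sumf bal_fun_linear).
under eq_bigr => i _ do rewrite -[bal_fun _]scale1r; apply: (Psum) => i.
rewrite (linear_sumf bal_fun_linear).
under eq_bigr => j _ do rewrite (linearZf bal_fun_linear); apply: (Psum) => j.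
set u := (vbasis _)`_i; set v := (vbasis _)`_j.
rewrite [u]tensE /tlift (bilin_suml (@tens_bilin _ _ _)).
rewrite (linear_sumf bal_fun_linear).
under eq_bigr => i' _ do rewrite -[bal_fun _]scale1r; apply: (Psum) => i'.
rewrite (bilin_suml (@tens_bilin _ _ _)) (linear_sumf bal_fun_linear).
under eq_bigr => j' _ do
  rewrite (bilinZl (@tens_bilin _ _ _)) (linearZf bal_fun_linear).
by apply: (Psum) => j'; rewrite bal_funE.
Qed.

Lemma bal_stable : stable bal.
Proof.
move=> b x; have [l _] := tensl_bilin.
apply: (bal_ind (P := fun x => b · x \in bal)) => [|a y z yb zb|b' c m] /=.
- by rewrite (linear0f (l b)) mem0v.
- by rewrite l memvD ?memvZ.
by rewrite (linearBf (l b)) !tensl_actE mulrA mem_bal.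
Qed.

Definition ind_mod : fmod B := quot_mod bal_stable.

Definition ind_pure (b : B) (m : M) : ind_mod := vpi bal (b ⊗ m).

Lemma ind_pure_bal b c m : ind_pure (b * phi c) m = ind_pure b (c · m).
Proof. by apply/eqP; rewrite vpi_eq mem_bal. Qed.
End Object.

Section Morphism.
Variables (M N : fmod C) (f : fhom M N).

Definition tensl_hom : fhom (tensl_mod M) (tensl_mod N).
Proof.
apply: (@FHom _ _ (tensl_mod M) (tensl_mod N) (tmap id f)).
  exact: tmap_linear.
move=> b; have lf := fhom_linear f; have [lM _] := tensl_bilin M; have [lN _] := tensl_bilin N.
apply: (tens_ext (f := fun x => tmap id f (tensl_act b x))
                 (g := fun x => tensl_act b (tmap id f x))) => [k u v|k u v|b' m].
- by rewrite lM (tmap_linear id f).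
- by rewrite (tmap_linear id f) lN.
by rewrite tensl_actE !tmapE // tensl_actE.
Defined.

Lemma tensl_hom_bal x : x \in bal M -> tensl_hom x \in bal N.
Proof.
have lf := fhom_linear f; have lt := fhom_linear tensl_hom.
apply: (bal_ind (P := fun x => tensl_hom x \in bal N)) => [|a y z yb zb|b c m].
- by rewrite (linear0f lt) mem0v.
- by rewrite lt memvD ?memvZ.
by rewrite (linearBf lt) /= !tmapE // fhom_act mem_bal.
Qed.

Definition ind_hom : fhom (ind_mod M) (ind_mod N) :=
  quot_hom (@bal_stable M) (@bal_stable N) tensl_hom_bal.
End Morphism.

Lemma ind_hom1 M : ind_hom (fid M) = fid (ind_mod M).
Proof.
apply: fhom_ext => x /=; rewrite -[RHS]vreprK; congr vpi.
by apply: (tens_ext (f := tmap id id) (g := id)) (vrepr x) => // [|b m];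
  [exact: tmap_linear | rewrite tmapE].
Qed.

Lemma ind_homM M N P (g : fhom N P) (f : fhom M N) :
  ind_hom (fcomp g f) = fcomp (ind_hom g) (ind_hom f).
Proof.
apply: fhom_ext => x; rewrite -[RHS]/(ind_hom g (vpi _ _)) quot_homE.
congr vpi; move: (vrepr x) => {}x.
have lf := fhom_linear f; have lg := fhom_linear g.
suff: tensl_hom (fcomp g f) =1 (fun x => tensl_hom g (tensl_hom f x)) by [].
apply: tens_ext => [||b m].
- exact: (fhom_linear (tensl_hom (fcomp g f))).
- exact: linear_comp (fhom_linear (tensl_hom g)) (fhom_linear (tensl_hom f)).
by rewrite /= !tmapE //; exact: linear_comp.
Qed.
End Induction.

Section FinitelyGenerated.
Variables (F : fieldType) (B : falgType F).

Lemma vspace_of_pred (V : vectType F) (S : V -> Prop) :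
  S 0 -> (forall a x y, S x -> S y -> S (a *: x + y)) ->
  exists U : {vspace V}, forall x, x \in U <-> S x.
Proof.
move=> S0 SL.
pose P k := `[< exists U : {vspace V}, \dim U = k /\ forall x, x \in U -> S x >].
have exP : exists k, P k.
  exists 0%N; apply/asboolP; exists 0%VS; split; first exact: dimv0.
  by move=> x; rewrite memv0 => /eqP ->.
have ubP k : P k -> (k <= \dim {:V})%N.
  by move=> /asboolP [U [<- _]]; exact: dimvS (subvf U).
case: (ex_maxnP exP ubP) => k /asboolP [U [dU US]] maxU.
exists U => x; split=> [|Sx]; first exact: US.
have UxS : forall y, y \in (U + <[x]>)%VS -> S y.
  move=> y /memv_addP [u uU [_ /vlineP [a ->] ->]].
  by rewrite addrC; apply: SL => //; exact: US.
have : P (\dim (U + <[x]>)) by apply/asboolP; exists (U + <[x]>)%VS.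
move=> /maxU; rewrite -dU => dle.
have /eqP -> : U == (U + <[x]>)%VS by rewrite eqEdim addvSl.
exact: subvP (addvSr _ _) _ (memv_line x).
Qed.

Definition free_mod (n : nat) : fmod B.
Proof.
apply: (@FMod F B {ffun 'I_n -> B} (fun b x => [ffun i => b * x i])).
- split=> [b|x] a u v; apply/ffunP => i; rewrite !ffunE.
    by rewrite mulrDr -scalerAr.
  by rewrite mulrDl -scalerAl.
- by move=> x; apply/ffunP => i; rewrite !ffunE mul1r.
- by move=> a b x; apply/ffunP => i; rewrite !ffunE mulrA.
Defined.

Lemma fingen_fmod (V : lmodType B) (n : nat) (s : 'I_n -> V) :
  (forall v, exists c : 'I_n -> B, v = \sum_i c i *: s i) ->
  exists (M : fmod B) (f : M -> V),
    [/\ bijective f, {morph f : x y / x + y} & forall b x, f (b · x) = b *: f x].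
Proof.
move=> gen.
pose g (x : free_mod n) : V := \sum_i (x : {ffun 'I_n -> B}) i *: s i.
have gL a x y : g (a *: x + y) = a%:A *: g x + g y.
  rewrite /g scaler_sumr -big_split /=; apply: eq_bigr => i _.
  by rewrite !ffunE scalerDl scalerA -scalerAl mul1r.
have gA b (x : free_mod n) : g (b · x) = b *: g x.
  by rewrite /g scaler_sumr; apply: eq_bigr => i _; rewrite ffunE scalerA.
have g0 : g 0 = 0 by rewrite /g big1 // => i _; rewrite ffunE scale0r.
have gB x y : g (x - y) = g x - g y.
  have -> : x - y = (-1) *: y + x by rewrite scaleN1r addrC.
  by rewrite gL scaleNr scale1r scaleN1r addrC.
have [||U UP] := @vspace_of_pred (free_mod n) (fun x => g x = 0).
- exact: g0.
- by move=> a x y x0 y0; rewrite gL x0 y0 scaler0 addr0.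
have sU : stable U by move=> b x /UP x0; apply/UP; rewrite gA x0 scaler0.
pose f (x : quot_mod sU) := g (vrepr (x : vquot U)).
have fpi x : f (vpi U x) = g x.
  by apply/eqP; rewrite eq_sym -subr_eq0 -gB; apply/eqP; apply: (UP _).1; exact: vpiK.
have fD : {morph f : x y / x + y}.
  move=> x y; rewrite -[x]vreprK -[y]vreprK -[vpi U _ in LHS]scale1r.
  by rewrite -vpi_linear !fpi gL !scale1r.
exists (quot_mod sU), f; split=> //; last first.
  by move=> b x; rewrite /= /quot_act fpi gA.
have finj : injective f.
  move=> x y fxy; apply/eqP; rewrite -[x]vreprK -[y]vreprK vpi_eq.
  by apply/UP; rewrite gB -/(f x) -/(f y) fxy subrr.
have fsurj v : {x | f x = v}.
  apply: cid; have [c ->] := gen v; exists (vpi U [ffun i => c i]).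
  by rewrite fpi; apply: eq_bigr => i _; rewrite ffunE.
exists (fun v => sval (fsurj v)) => [x|v]; last exact: (svalP (fsurj v)).
by apply: finj; rewrite (svalP (fsurj (f x))).
Qed.
End FinitelyGenerated.

Record category := Category {
  ob :> Type;
  mor : ob -> ob -> Type;
  idm : forall X, mor X X;
  compm : forall X Y Z, mor Y Z -> mor X Y -> mor X Z;
  comp1m : forall X Y (f : mor X Y), compm (idm Y) f = f;
  compm1 : forall X Y (f : mor X Y), compm f (idm X) = f;
  compmA : forall X Y Z T (h : mor Z T) (g : mor Y Z) (f : mor X Y),
    compm h (compm g f) = compm (compm h g) f
}.
Arguments idm {c} X.
Arguments compm {c X Y Z}.

Definition isom (C : category) (X Y : C) : Prop :=
  exists (f : mor X Y) (g : mor Y X), compm g f = idm X /\ compm f g = idm Y.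

Record functor (C D : category) := Functor {
  fob :> C -> D;
  fmor : forall X Y, mor X Y -> mor (fob X) (fob Y);
  fmor1 : forall X, fmor (idm X) = idm (fob X);
  fmorM : forall X Y Z (g : mor Y Z) (f : mor X Y),
    fmor (compm g f) = compm (fmor g) (fmor f)
}.

Definition id_functor (C : category) : functor C C.
Proof. by exists (fun X => X) (fun X Y f => f). Defined.

Definition comp_functor (C D E : category) (G : functor D E) (H : functor C D) :
  functor C E.
Proof.
exists (fun X => G (H X)) (fun X Y f => fmor G (fmor H f)) => [X|X Y Z g f].
  by rewrite !fmor1.
by rewrite !fmorM.
Defined.
Notation "G ∘ H" := (comp_functor G H) (at level 40, left associativity).

Definition functor_iso (C D : category) (G H : functor C D) : Prop :=
  exists (eta : forall X, mor (G X) (H X)) (theta : forall X, mor (H X) (G X)),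
    [/\ forall X Y (f : mor X Y), compm (eta Y) (fmor G f) = compm (fmor H f) (eta X),
        forall X, compm (theta X) (eta X) = idm (G X) &
        forall X, compm (eta X) (theta X) = idm (H X)].

Definition right_adjoint (C D : category) (R : functor D C) (L : functor C D) : Prop :=
  exists Phi : forall (X : C) (Y : D), mor (L X) Y -> mor X (R Y),
    (forall X Y, bijective (@Phi X Y)) /\
    (forall X X' Y Y' (u : mor X' X) (v : mor Y Y') (f : mor (L X) Y),
       Phi X' Y' (compm v (compm f (fmor L u)))
       = compm (fmor R v) (compm (Phi X Y f) u)).

Definition is_zero_mod (F : fieldType) (B : falgType F) (M : fmod B) : Prop :=
  forall x : M, x = 0.

Record gmod (F : fieldType) (I : Type) (B : I -> falgType F) := GMod {
  gcomp :> forall i, fmod (B i);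
  gmod_finite : finite_set [set i | ~ is_zero_mod (gcomp i)]
}.

Definition gmodc (F : fieldType) (I : Type) (B : I -> falgType F) : category.
Proof.
exists (gmod B) (fun M N => forall i, fhom (M i) (N i)) (fun M i => fid (M i))
  (fun M N P g f i => fcomp (g i) (f i)).
all: by move=> *; apply: functional_extensionality_dep => i; apply: fhom_ext.
Defined.

Record pull_data (F : fieldType) (I J : Type)
    (B : I -> falgType F) (C : J -> falgType F) := PullData {
  pidx : J -> I;
  pidx_fin : forall i, finite_set [set j | pidx j = i];
  pmap : forall j, {lrmorphism C j -> B (pidx j)}
}.

Section Pull.
Variables (F : fieldType) (I J : Type) (B : I -> falgType F) (C : J -> falgType F).
Variable D : pull_data B C.

Lemma pidx_finite (S : set I) :
  finite_set S -> finite_set [set j | S (pidx D j)].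
Proof.
move=> fS; apply: (@sub_finite_set _ _
  (\bigcup_(i in S) [set j | pidx D j = i])%classic); last first.
  by apply: bigcup_finite => // i _; exact: pidx_fin.
by move=> j /= Sj; exists (pidx D j).
Qed.

Definition pull_ob (M : gmod B) : gmod C.
Proof.
exists (fun j => res_mod (pmap D j) (M (pidx D j))).
exact: (pidx_finite (gmod_finite M)).
Defined.

Definition pull : functor (gmodc B) (gmodc C).
Proof.
exists (pull_ob : gmodc B -> gmodc C)
       (fun M N f j => res_hom (pmap D j) (f (pidx D j))).
- by move=> M; apply: functional_extensionality_dep => j; apply: fhom_ext.
- by move=> M N P g f; apply: functional_extensionality_dep => j; apply: fhom_ext.
Defined.
End Pull.

Record push_data (F : fieldType) (I J : Type)
    (B : I -> falgType F) (C : J -> falgType F) := PushData {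
  sty : J -> finType;
  sidx : forall j, sty j -> I;
  stgt : I -> J;
  sidxK : forall j (t : sty j), stgt (sidx t) = j;
  smap : forall j (t : sty j), {lrmorphism B (sidx t) -> C j}
}.

Lemma bigsum_zero (F : fieldType) (B : falgType F) (T : finType) (M : T -> fmod B) :
  (forall t, is_zero_mod (M t)) -> is_zero_mod (bigsum M).
Proof.
move=> M0; rewrite /bigsum; elim: (enum T) => [|t s IHs] /= x.
  by rewrite [x]thinmx0.
by case: x => y z; rewrite [y]M0 [z]IHs.
Qed.

Lemma ind_zero (F : fieldType) (C B : falgType F) (phi : {lrmorphism C -> B})
  (M : fmod C) : is_zero_mod M -> is_zero_mod (ind_mod phi M).
Proof.
move=> M0 x; rewrite -[x]vreprK.
suff -> : vrepr x = 0 by rewrite (linear0f (vpi_linear _)).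
suff: id =1 (fun=> 0 : tens B M) by exact.
apply: tens_ext => // [a y z|b m]; first by rewrite scaler0 addr0.
by rewrite [m]M0 (linear0f ((tens_bilin _ _).1 b)).
Qed.

Section Push.
Variables (F : fieldType) (I J : Type) (B : I -> falgType F) (C : J -> falgType F).
Variable D : push_data B C.

Lemma sidx_finite (S : set I) (T : set J) : finite_set S ->
  (forall j, T j -> exists t : sty D j, S (sidx t)) -> finite_set T.
Proof.
move=> fS ST; apply: (@sub_finite_set _ _ ((@stgt _ _ _ _ _ D) @` S)%classic).
  by move=> j /ST[t St]; exists (sidx t) => //; exact: sidxK.
exact: finite_image.
Qed.

Definition push_ob (M : gmod B) : gmod C.
Proof.
exists (fun j => bigsum (fun t : sty D j => ind_mod (smap t) (M (sidx t)))).
apply: sidx_finite (gmod_finite M) _ => j /= nz; apply: contrapT => h; apply: nz.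
apply: bigsum_zero => t; apply: ind_zero; apply: contrapT => nt.
by apply: h; exists t.
Defined.

Definition push : functor (gmodc B) (gmodc C).
Proof.
exists (push_ob : gmodc B -> gmodc C)
  (fun M N f j => bigsum_hom (fun t : sty D j => ind_hom (smap t) (f (sidx t)))).
- move=> M; apply: functional_extensionality_dep => j /=.
  rewrite -bigsum_hom1; congr bigsum_hom.
  by apply: functional_extensionality_dep => t; rewrite ind_hom1.
- move=> M N P g f; apply: functional_extensionality_dep => j /=.
  rewrite -bigsum_homM; congr bigsum_hom.
  by apply: functional_extensionality_dep => t; rewrite ind_homM.
Defined.
End Push.

Section Presented.
Variables (X : choiceType) (R : {freeg X / int} -> Prop).

Definition relspan : {pred {freeg X / int}} := fun z =>
  `[< forall S : {freeg X / int} -> Prop,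
        S 0 -> (forall x y, S x -> S y -> S (x - y)) ->
        (forall r, R r -> S r) -> S z >].

Lemma relspan_closed : zmod_closed relspan.
Proof.
split=> [|x y /asboolP xs /asboolP ys]; apply/asboolP => S S0 SB SR //.
by apply: (SB); [exact: xs | exact: ys].
Qed.
HB.instance Definition _ := GRing.isZmodClosed.Build _ relspan relspan_closed.

Definition pgroup : Type := {ideal_quot relspan}.
HB.instance Definition _ := GRing.Zmodule.copy pgroup {ideal_quot relspan}.

Definition pclass (z : {freeg X / int}) : pgroup := \pi_{ideal_quot relspan} z.
Definition pgen (x : X) : pgroup := pclass << x >>.

Lemma pclassB x y : pclass (x - y) = pclass x - pclass y.
Proof. by rewrite /pclass !piE. Qed.

Section Lift.
Variables (W : zmodType) (f : X -> W).

Definition fgsum (z : {freeg X / int}) : W := @fglift int (zmodule W) X f z.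

Lemma fgsumB x y : fgsum (x - y) = fgsum x - fgsum y.
Proof. exact: (@lift_is_additive int X (zmodule W) f). Qed.
Lemma fgsum_gen x : fgsum << x >> = f x.
Proof. by rewrite /fgsum (@liftU int (zmodule W)) scale1r. Qed.

Definition respects : Prop := forall r, R r -> fgsum r = 0.

(* The morphism pgroup -> W extending f if f respects the relations, and 0    *)
(* otherwise.                                                                 *)
Definition plift (g : pgroup) : W :=
  if pselect respects then fgsum (repr (g : {ideal_quot relspan})) else 0.

Lemma fgsum_relspan z : respects -> z \in relspan -> fgsum z = 0.
Proof.
move=> fR /asboolP /(_ (fun z => fgsum z = 0)); apply=> // [|x y x0 y0].
  by have := fgsumB 0 0; rewrite !subrr.
by rewrite fgsumB x0 y0 subrr.
Qed.

Lemma plift_class z : respects -> plift (pclass z) = fgsum z.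
Proof.
move=> fR; rewrite /plift; case: (pselect respects) => [?|//]; apply/eqP.
rewrite -subr_eq0 -fgsumB; apply/eqP; apply: fgsum_relspan => //.
have -> := Quotient.idealrBE (relspan : zmodClosed _) (repr (pclass z)) z.
by rewrite reprK.
Qed.

Lemma pliftE x : respects -> plift (pgen x) = f x.
Proof. by move=> fR; rewrite plift_class // fgsum_gen. Qed.

Lemma plift_additive : zmod_morphism plift.
Proof.
have pK g : pclass (repr (g : {ideal_quot relspan})) = g by exact: reprK.
move=> g h; case: (pselect respects) => fR; last first.
  by rewrite /plift; case: (pselect respects) => // ?; rewrite subrr.
by rewrite -[g]pK -[h]pK -pclassB !plift_class // fgsumB.
Qed.
End Lift.

Lemma plift_zero (W : zmodType) g : plift (fun=> 0 : W) g = 0.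
Proof.
have z0 z : fgsum (fun=> 0 : W) z = 0.
  by rewrite -[z]Freeg_dom /fgsum fglift_Freeg /prelift big1 // => i _; rewrite scaler0.
by rewrite /plift; case: pselect => [?|//]; rewrite z0.
Qed.
End Presented.

Section ZTensor.
Variables (U V : zmodType).

Definition ztens_rel (r : {freeg (U * V)%type / int}) : Prop :=
  (exists u u' v, r = << (u + u', v) >> - << (u, v) >> - << (u', v) >>) \/
  (exists u v v', r = << (u, v + v') >> - << (u, v) >> - << (u, v') >>).

Definition ztens : zmodType := pgroup ztens_rel.
Definition zpure (u : U) (v : V) : ztens := pgen ztens_rel (u, v).

Definition zlift (W : zmodType) (b : U -> V -> W) : ztens -> W :=
  plift (R := ztens_rel) (fun p => b p.1 p.2).

Definition biadditive (W : zmodType) (b : U -> V -> W) : Prop :=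
  (forall u u' v, b (u + u') v = b u v + b u' v) /\
  (forall u v v', b u (v + v') = b u v + b u v').

Lemma zliftE (W : zmodType) (b : U -> V -> W) u v :
  biadditive b -> zlift b (zpure u v) = b u v.
Proof.
move=> [bl br]; rewrite /zlift pliftE //= => r [] [x [y [z ->]]].
all: rewrite !fgsumB !fgsum_gen /=.
  by rewrite bl addrAC addrK subrr.
by rewrite br addrAC addrK subrr.
Qed.

Lemma zlift_additive (W : zmodType) (b : U -> V -> W) : zmod_morphism (zlift b).
Proof. exact: plift_additive. Qed.
End ZTensor.

Definition ztmap (U V U' V' : zmodType) (f : U -> U') (g : V -> V') :
  ztens U V -> ztens U' V' := zlift (fun u v => zpure (f u) (g v)).

Definition ztassoc (U V W : zmodType) :
  ztens (ztens U V) W -> ztens U (ztens V W) :=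
  zlift (fun t w => zlift (fun u v => zpure u (zpure v w)) t).

Record dsum (I : Type) (V : I -> zmodType) := DSum {
  dcomp :> forall i, V i;
  dsum_finite : finite_set [set i | dcomp i != 0]
}.

HB.instance Definition _ (I : Type) (V : I -> zmodType) := gen_eqMixin (dsum V).
HB.instance Definition _ (I : Type) (V : I -> zmodType) := gen_choiceMixin (dsum V).

Section DSum.
Variables (I : Type) (V : I -> zmodType).
Implicit Types x y z : dsum V.

Lemma dsum_ext x y : (forall i, x i = y i) -> x = y.
Proof.
case: x y => [x fx] [y fy] /= xy.
have {}xy : x = y by exact: functional_extensionality_dep.
by case: y / xy fy => fy; rewrite (Prop_irrelevance fx fy).
Qed.

Definition dsum0 : dsum V.
Proof.
exists (fun i => 0); apply: sub_finite_set (finite_set0 I) => i /=.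
by rewrite eqxx.
Defined.

Definition dsum_opp x : dsum V.
Proof.
exists (fun i => - x i); apply: sub_finite_set (dsum_finite x) => i /=.
by rewrite oppr_eq0.
Defined.

Definition dsum_add x y : dsum V.
Proof.
exists (fun i => x i + y i).
apply: (sub_finite_set (B := ([set i | x i != 0] `|` [set i | y i != 0])%classic)).
  move=> i /=; case: (eqVneq (x i) 0) => [->|]; last by left.
  by rewrite add0r; right.
by rewrite finite_setU; split; exact: dsum_finite.
Defined.

Lemma dsum_addA : associative dsum_add.
Proof. by move=> x y z; apply: dsum_ext => i; exact: addrA. Qed.
Lemma dsum_addC : commutative dsum_add.
Proof. by move=> x y; apply: dsum_ext => i; exact: addrC. Qed.
Lemma dsum_add0 : left_id dsum0 dsum_add.
Proof. by move=> x; apply: dsum_ext => i; exact: add0r. Qed.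
Lemma dsum_addN : left_inverse dsum0 dsum_opp dsum_add.
Proof. by move=> x; apply: dsum_ext => i; exact: addNr. Qed.
HB.instance Definition _ := GRing.isZmodule.Build (dsum V)
  dsum_addA dsum_addC dsum_add0 dsum_addN.

Definition homog (i : I) x : Prop := forall j, j <> i -> x j = 0.
End DSum.

Definition dsum_inj (I : eqType) (V : I -> zmodType) (i : I) (v : V i) : dsum V.
Proof.
exists (fun j => match i =P j with
                 | ReflectT e => ecast k (V k) e v
                 | ReflectF _ => 0 end).
apply: sub_finite_set (finite_set1 i) => j /=.
by case: eqP => // _; rewrite eqxx.
Defined.

(* Generators of the Grothendieck groups: the modules with underlying space   *)
(* 'rV_n represent all isomorphism classes (see [coord_mod_iso]), while the   *)
(* type [fmod B] is too large a universe to carry an eqType structure.        *)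
Record cmod (F : fieldType) (B : falgType F) := CMod {
  cdim : nat;
  cact : B -> 'rV[F]_cdim -> 'rV[F]_cdim;
  cact_bilin : bilin cact;
  cact1 : forall x, cact 1 x = x;
  cactM : forall a b x, cact (a * b) x = cact a (cact b x)
}.

Definition fmod_of (F : fieldType) (B : falgType F) (M : cmod B) : fmod B :=
  @FMod F B ('rV[F]_(cdim M)) (@cact F B M) (cact_bilin M) (@cact1 F B M)
    (@cactM F B M).
Coercion fmod_of : cmod >-> fmod.

Section Coordinates.
Variables (F : fieldType) (B : falgType F) (M : fmod B).
Local Notation to_rV := (passmx.rVof (vbasis {:M})).
Local Notation of_rV := (passmx.vecof (vbasis {:M})).

Let to_rVK : cancel to_rV of_rV.
Proof. by apply: passmx.rVofK; exact: vbasisP. Qed.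
Let of_rVK : cancel of_rV to_rV.
Proof. by apply: passmx.vecofK; exact: vbasisP. Qed.

Definition coord_mod : cmod B.
Proof.
exists (\dim {:M}) (fun b x => to_rV (b · of_rV x)).
- have [l r] := fact_bilin M; split=> [b|x] a u v; last by rewrite r passmx.rVof_linear.
  by rewrite passmx.vecof_linear l passmx.rVof_linear.
- by move=> x; rewrite fact1 of_rVK.
- by move=> a b x; rewrite to_rVK factM.
Defined.

Lemma coord_mod_iso : fiso M coord_mod.
Proof.
have hto b x : to_rV (b · x) = to_rV (b · of_rV (to_rV x)) by rewrite to_rVK.
have hof b x : of_rV (to_rV (b · of_rV x)) = b · of_rV x by rewrite to_rVK.
have lto : linear to_rV := passmx.rVof_linear _.
have lof : linear of_rV := passmx.vecof_linear _.
by exists (@FHom _ _ M coord_mod _ lto hto), (@FHom _ _ coord_mod M _ lof hof).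
Qed.
End Coordinates.

Record pmod (F : fieldType) (B : falgType F) := PMod {
  pcar :> cmod B;
  pmod_projective : projective pcar
}.

HB.instance Definition _ (F : fieldType) (B : falgType F) := gen_eqMixin (cmod B).
HB.instance Definition _ (F : fieldType) (B : falgType F) := gen_choiceMixin (cmod B).
HB.instance Definition _ (F : fieldType) (B : falgType F) := gen_eqMixin (pmod B).
HB.instance Definition _ (F : fieldType) (B : falgType F) := gen_choiceMixin (pmod B).

Section Grothendieck.
Variables (F : fieldType) (B : falgType F).

Definition short_exact (L M N : fmod B) (i : fhom L M) (p : fhom M N) : Prop :=
  [/\ injective i, (forall y, exists x, p x = y) &
      forall y, p y = 0 <-> exists x, i x = y].

Definition G0_rel (r : {freeg (cmod B) / int}) : Prop :=
  exists (L M N : cmod B) (i : fhom L M) (p : fhom M N),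
    short_exact i p /\ r = << M >> - << L >> - << N >>.

Definition K0_rel (r : {freeg (pmod B) / int}) : Prop :=
  exists P Q R : pmod B,
    fiso P (sum_mod Q R) /\ r = << P >> - << Q >> - << R >>.

Definition G0 : zmodType := pgroup G0_rel.
Definition K0 : zmodType := pgroup K0_rel.

Definition G0_class (M : fmod B) : G0 := pgen G0_rel (coord_mod M).

(* By convention 0 on modules that are not projective; it is applied below    *)
(* only to modules obtained from projective ones by operations preserving     *)
(* projectivity.                                                              *)
Definition K0_class (M : fmod B) : K0 :=
  if pselect (projective (coord_mod M)) is left pM then pgen K0_rel (PMod pM) else 0.

Definition G0_lift (W : zmodType) (f : fmod B -> W) : G0 -> W :=
  plift (R := G0_rel) (fun M : cmod B => f M).
Definition K0_lift (W : zmodType) (f : fmod B -> W) : K0 -> W :=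
  plift (R := K0_rel) (fun P : pmod B => f P).

Definition G0_lift_additive (W : zmodType) (f : fmod B -> W) :
  zmod_morphism (G0_lift f) := plift_additive _.
Definition K0_lift_additive (W : zmodType) (f : fmod B -> W) :
  zmod_morphism (K0_lift f) := plift_additive _.
Definition G0_lift_zero (W : zmodType) (x : G0) :
  G0_lift (fun=> 0 : W) x = 0 := plift_zero W x.
Definition K0_lift_zero (W : zmodType) (x : K0) :
  K0_lift (fun=> 0 : W) x = 0 := plift_zero W x.

(* <[P], [M]> = dim Hom_B(P, M) *)
Definition KG_pairing (x : K0) (y : G0) : int :=
  K0_lift (fun P => G0_lift (fun M => (dim_hom P M)%:Z) y) x.
End Grothendieck.

Definition perfect (U V : zmodType) (b : U -> V -> int) : Prop :=
  (forall f : {additive V -> int}, exists! u, forall v, b u v = f v) /\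
  (forall f : {additive U -> int}, exists! v, forall u, b u v = f u).

Record groth (F : fieldType) := Groth {
  gr : falgType F -> zmodType;
  gclass : forall B : falgType F, fmod B -> gr B;
  glift : forall (B : falgType F) (W : zmodType), (fmod B -> W) -> gr B -> W;
  glift_additive : forall (B : falgType F) (W : zmodType) (f : fmod B -> W),
    zmod_morphism (glift f);
  glift_zero : forall (B : falgType F) (W : zmodType) (x : gr B),
    glift (fun=> 0 : W) x = 0
}.
Arguments gclass {F g B} M.
Arguments glift {F g B W} f x.

Definition G_theory (F : fieldType) : groth F :=
  @Groth F (@G0 F) (@G0_class F) (@G0_lift F) (@G0_lift_additive F)
    (@G0_lift_zero F).
Definition K_theory (F : fieldType) : groth F :=
  @Groth F (@K0 F) (@K0_class F) (@K0_lift F) (@K0_lift_additive F)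
    (@K0_lift_zero F).

Lemma glift0 (F : fieldType) (T : groth F) (B : falgType F) (W : zmodType)
  (f : fmod B -> W) : glift (g := T) f 0 = 0.
Proof. by have := glift_additive (g := T) f 0 0; rewrite !subrr. Qed.

Section Induced.
Variables (F : fieldType) (T : groth F) (I J : Type).
Variables (B : I -> falgType F) (C : J -> falgType F).

Definition pull_gr (D : pull_data B C) (x : dsum (fun i => gr T (B i))) :
  dsum (fun j => gr T (C j)).
Proof.
exists (fun j => glift (fun M => gclass (res_mod (pmap D j) M)) (x (pidx D j))).
apply: sub_finite_set (pidx_finite D (dsum_finite x)) => j /=.
by apply: contra => /eqP ->; rewrite glift0.
Defined.

Definition push_gr (D : push_data B C) (x : dsum (fun i => gr T (B i))) :
  dsum (fun j => gr T (C j)).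
Proof.
exists (fun j => \sum_(t : sty D j)
  glift (fun M => gclass (ind_mod (smap t) M)) (x (sidx t))).
apply: (sidx_finite (D := D) (dsum_finite x)) => j /=.
apply: contra_neqP => h; apply: big1 => t _.
suff -> : x (sidx t) = 0 by rewrite glift0.
by apply/eqP; apply: contrapT => /negP nz; apply: h; exists t.
Defined.
End Induced.

Section Kappa.
Variables (F : fieldType) (T : groth F) (A : nat -> falgType F).
Local Notation H := (dsum (fun n => gr T (A n))).
Local Notation H2 := (dsum (fun p : nat * nat => gr T (tens (A p.1) (A p.2)))).

Definition ext_gr (B C : falgType F) (x : gr T B) (y : gr T C) : gr T (tens B C) :=
  glift (fun M => glift (fun N => gclass (ext_mod M N)) y) x.

Definition ext_dsum (x y : H) : H2.
Proof.
exists (fun p => ext_gr (x p.1) (y p.2)).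
apply: (sub_finite_set (B :=
  ([set m | x m != 0] `*` [set n | y n != 0])%classic)); last first.
  by apply: finite_setX; exact: dsum_finite.
move=> [m n] /= nz; split; move: nz; rewrite /ext_gr; apply: contra => /eqP ->.
  by rewrite glift0.
by under eq_fun do rewrite glift0; rewrite glift_zero.
Defined.

Definition kappa : ztens H H -> H2 := zlift ext_dsum.
End Kappa.

Definition aopp (F : fieldType) (B : falgType F) : Type := B.

Section Opposite.
Variables (F : fieldType) (B : falgType F).
HB.instance Definition _ := Vector.copy (aopp B) B.

Definition omul (x y : aopp B) : aopp B := (y : B) * x.
Lemma omulA : associative omul.
Proof. by move=> x y z; rewrite /omul mulrA. Qed.
Lemma omul1 : left_id (1 : B) omul.
Proof. by move=> x; rewrite /omul mulr1. Qed.
Lemma o1mul : right_id (1 : B) omul.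
Proof. by move=> x; rewrite /omul mul1r. Qed.
Lemma omulDl : left_distributive omul +%R.
Proof. by move=> x y z; rewrite /omul mulrDr. Qed.
Lemma omulDr : right_distributive omul +%R.
Proof. by move=> x y z; rewrite /omul mulrDl. Qed.
HB.instance Definition _ := GRing.Zmodule_isNzRing.Build (aopp B)
  omulA omul1 o1mul omulDl omulDr (oner_neq0 B).
Lemma oscalerAl (c : F) (x y : aopp B) : c *: (x * y : aopp B) = (c *: x : aopp B) * y.
Proof. exact (@scalerAr F B c y x). Qed.
HB.instance Definition _ := GRing.Lmodule_isLalgebra.Build F (aopp B) oscalerAl.
Lemma oscalerAr (c : F) (x y : aopp B) : c *: (x * y : aopp B) = x * (c *: y : aopp B).
Proof. exact (@scalerAl F B c y x). Qed.
HB.instance Definition _ := GRing.Lalgebra_isAlgebra.Build F (aopp B) oscalerAr.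
HB.instance Definition _ := Algebra_isFalgebra.Build F (aopp B).
End Opposite.

Definition left_via (F : fieldType) (C B : falgType F) (phi : {lrmorphism C -> B}) :
  fmod C := res_mod phi (reg_mod B).

Definition right_via (F : fieldType) (C B : falgType F) (phi : {lrmorphism C -> B}) :
  fmod (aopp C).
Proof.
apply: (@FMod F (aopp C) B (fun c x => x * phi c)).
- split=> [c|x] a u v /=; first exact: mul_linl.
  by rewrite linearP mul_linr.
- by move=> x; rewrite rmorph1 mulr1.
- by move=> a b x; rewrite -mulrA -rmorphM.
Defined.

Record tower (F : fieldType) := Tower {
  talg :> nat -> falgType F;
  rho : forall m n, {lrmorphism tens (talg m) (talg n) -> talg (m + n)};
  (* equalities in the disjoint union of the A_n, to avoid casts *)
  rhoA : forall m n p (a : talg m) (b : talg n) (c : talg p),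
    existT (fun k => talg k : Type) _ (rho _ _ (a ⊗ rho _ _ (b ⊗ c)))
    = existT (fun k => talg k : Type) _ (rho _ _ (rho _ _ (a ⊗ b) ⊗ c));
  rho1 : talg 0;
  rho1l : forall n (a : talg n),
    existT (fun k => talg k : Type) _ (rho _ _ (rho1 ⊗ a)) = existT _ n a;
  rho1r : forall n (a : talg n),
    existT (fun k => talg k : Type) _ (rho _ _ (a ⊗ rho1)) = existT _ n a;
  talg0 : bijective (fun c : F => c%:A : talg 0);
  rho_projl : forall m n, projective (left_via (rho m n));
  rho_projr : forall m n, projective (right_via (rho m n));
  talg_perfect : forall n, perfect (@KG_pairing F (talg n))
}.

Record algebra_aut (F : fieldType) (B : falgType F) := AlgebraAut {
  aut_fun : {lrmorphism B -> B};
  aut_inv : {lrmorphism B -> B};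
  aut_funK : cancel aut_fun aut_inv;
  aut_invK : cancel aut_inv aut_fun
}.

Definition conjugation (F : fieldType) (A : tower F) : Type :=
  forall n, algebra_aut (A n).

Section Tower.
Variables (F : fieldType) (A : tower F).

Definition A2 (p : nat * nat) : falgType F := tens (A p.1) (A p.2).
Definition A4 (p : (nat * nat) * (nat * nat)) : falgType F := tens (A2 p.1) (A2 p.2).

Definition Amod : category := gmodc A.
Definition Amod2 : category := gmodc A2.
Definition Amod4 : category := gmodc A4.

Definition rho_to m n N (e : m + n = N) : {lrmorphism tens (A m) (A n) -> A N} :=
  ecast k {lrmorphism tens (A m) (A n) -> A k} e (rho A m n).

Lemma fin_add n : finite_set [set p : nat * nat | (p.1 + p.2)%N = n].
Proof.
apply: (sub_finite_set (B := (`I_n.+1 `*` `I_n.+1)%classic)).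
  by move=> [k l] /= <-; split; rewrite /= ltnS ?leq_addr ?leq_addl.
by apply: finite_setX; exact: finite_II.
Qed.

(* Δ(M)_{(k,l)} = Res M_{k+l} along rho_{k,l} *)
Definition delta_data : pull_data A A2 :=
  @PullData F nat (nat * nat)%type A A2 (fun p => (p.1 + p.2)%N) fin_add
    (fun p => rho A p.1 p.2).

(* ∇(M)_N = ⊕_{i <= N} Ind M_{(i,N-i)} *)
Definition nabla_data : push_data A2 A :=
  @PushData F (nat * nat)%type nat A2 A (fun N => 'I_N.+1)
    (fun N i => (nat_of_ord i, N - i)%N) (fun p => (p.1 + p.2)%N)
    (fun N i => subnKC (leq_ord i))
    (fun N i => rho_to (subnKC (leq_ord i))).

Definition delta : functor Amod Amod2 := pull delta_data.
Definition nabla : functor Amod2 Amod := push nabla_data.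

Lemma fin_add2 (q : nat * nat) :
  finite_set [set p : (nat * nat) * (nat * nat) | (p.1.1 + p.1.2, p.2.1 + p.2.2)%N = q].
Proof.
apply: (sub_finite_set (B := ([set p : nat * nat | (p.1 + p.2)%N = q.1]
   `*` [set p : nat * nat | (p.1 + p.2)%N = q.2])%classic)).
  by move=> [p p'] /= <-.
by apply: finite_setX; exact: fin_add.
Qed.

(* Δ ⊗ Δ *)
Definition delta2_data : pull_data A2 A4 :=
  @PullData F _ _ A2 A4 (fun p => (p.1.1 + p.1.2, p.2.1 + p.2.2)%N) fin_add2
    (fun p => tmor (rho A p.1.1 p.1.2) (rho A p.2.1 p.2.2)).

Lemma nabla2_idx (p : nat * nat) (t : 'I_p.1.+1 * 'I_p.2.+1) :
  (t.1 + (p.1 - t.1), t.2 + (p.2 - t.2))%N = p.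
Proof. by rewrite !subnKC ?leq_ord //; case: p {t}. Qed.

(* ∇ ⊗ ∇ *)
Definition nabla2_data : push_data A4 A2 :=
  @PushData F _ _ A4 A2 (fun p => ('I_p.1.+1 * 'I_p.2.+1)%type)
    (fun p t => ((nat_of_ord t.1, p.1 - t.1), (nat_of_ord t.2, p.2 - t.2))%N)
    (fun p => (p.1.1 + p.1.2, p.2.1 + p.2.2)%N) nabla2_idx
    (fun p t => tmor (rho_to (subnKC (leq_ord t.1))) (rho_to (subnKC (leq_ord t.2)))).

Definition swap23 (p : (nat * nat) * (nat * nat)) :=
  ((p.1.1, p.2.1), (p.1.2, p.2.2)).

Lemma swap23_fin q : finite_set [set p | swap23 p = q].
Proof.
apply: (sub_finite_set (B := [set swap23 q])); last exact: finite_set1.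
by move=> [[a b] [c d]] /= <-.
Qed.

Definition S23_data : pull_data A4 A4 :=
  @PullData F _ _ A4 A4 swap23 swap23_fin
    (fun p => tswap (A p.1.1) (A p.1.2) (A p.2.1) (A p.2.2)).

Definition delta2 : functor Amod2 Amod4 := pull delta2_data.
Definition nabla2 : functor Amod4 Amod2 := push nabla2_data.
Definition S23 : functor Amod4 Amod4 := pull S23_data.

Section Twist.
Variable f : forall n, {lrmorphism A n -> A n}.

Lemma fin_id (I : Type) (i : I) : finite_set [set j | j = i].
Proof. exact: finite_set1. Qed.

(* the underlying space of M with a ∈ A_n acting as f_n(a) *)
Definition twist_data : pull_data A A :=
  @PullData F _ _ A A id (@fin_id nat) f.
Definition twist2_data : pull_data A2 A2 :=
  @PullData F _ _ A2 A2 id (@fin_id (nat * nat)) (fun p => tmor (f p.1) (f p.2)).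
End Twist.

Section Conjugation.
Variable Psi : conjugation A.

Definition psi_data : pull_data A A := twist_data (fun n => aut_fun (Psi n)).
Definition psi_inv_data : pull_data A A := twist_data (fun n => aut_inv (Psi n)).
Definition psi2_data : pull_data A2 A2 := twist2_data (fun n => aut_fun (Psi n)).

Definition psi : functor Amod Amod := pull psi_data.
Definition psi_inv : functor Amod Amod := pull psi_inv_data.
Definition psi2 : functor Amod2 Amod2 := pull psi2_data.

Definition strong : Prop :=
  right_adjoint nabla (psi2 ∘ delta ∘ psi_inv) /\
  functor_iso (delta ∘ nabla) (nabla2 ∘ S23 ∘ delta2).
End Conjugation.

Section Operations.
Variable T : groth F.

Definition gr_tower : zmodType := dsum (fun n => gr T (A n)).
Local Notation H := gr_tower.

Definition gr_mul (x y : H) : H := push_gr nabla_data (kappa (zpure x y)).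

(* The class of the A_0-module F: as A_0 = F it is the regular module.        *)
Definition gr_one : H :=
  @dsum_inj nat (fun n => gr T (A n)) 0%N (gclass (reg_mod (A 0))).

(* [kappa] is the identification of the tensor square of ⊕ K_0(A_n) (resp.    *)
(* ⊕ G_0(A_n)) with the Grothendieck group of A-pmod⊗2 (resp. A-mod⊗2); it is *)
(* bijective because the pairings [talg_perfect] are perfect, so the preimage *)
(* below exists and is unique.                                                *)
Definition gr_comul (x : H) : ztens H H :=
  xget 0 [set t | kappa t = pull_gr delta_data x]%classic.

Definition gr_counit (x : H) : int :=
  glift (fun M : fmod (A 0) => (\dim {:M})%:Z) (x 0%N).

Definition gr_psi (Psi : conjugation A) : H -> H := pull_gr (psi_data Psi).
Definition gr_psi_inv (Psi : conjugation A) : H -> H := pull_gr (psi_inv_data Psi).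
End Operations.

Definition KA : zmodType := gr_tower (K_theory F).
Definition GA : zmodType := gr_tower (G_theory F).

Definition pairing (x : KA) (y : GA) : int :=
  \sum_(n \in [set: nat]) KG_pairing (x n) (y n).

Definition pairing2 (s : ztens KA KA) (t : ztens GA GA) : int :=
  zlift (fun a b => zlift (fun x y => pairing a x * pairing b y) t) s.
End Tower.

Record is_hopf (H : zmodType) (mul : H -> H -> H) (one : H)
    (comul : H -> ztens H H) (counit : H -> int) : Prop := IsHopf {
  hopf_mul_biadd : biadditive mul;
  hopf_mulA : associative mul;
  hopf_mul1l : left_id one mul;
  hopf_mul1r : right_id one mul;
  hopf_comul_add : zmod_morphism comul;
  hopf_counit_add : zmod_morphism counit;
  hopf_coassoc : forall x,
    ztassoc (ztmap comul id (comul x)) = ztmap id comul (comul x);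
  hopf_counitl : forall x, zlift (fun a b => b *~ counit a) (comul x) = x;
  hopf_counitr : forall x, zlift (fun a b => a *~ counit b) (comul x) = x;
  hopf_comulM : forall x y,
    comul (mul x y)
    = zlift (fun a b => zlift (fun c d => zpure (mul a c) (mul b d)) (comul y))
        (comul x);
  hopf_comul1 : comul one = zpure one one;
  hopf_counitM : forall x y, counit (mul x y) = counit x * counit y;
  hopf_counit1 : counit one = 1;
  hopf_antipode : exists S : {additive H -> H},
    (forall x, zlift (fun a b => mul (S a) b) (comul x) = one *~ counit x) /\
    (forall x, zlift (fun a b => mul a (S b)) (comul x) = one *~ counit x)
}.

Record is_graded_connected (V : nat -> zmodType) (H := dsum V : zmodType)
    (mul : H -> H -> H) (one : H) (comul : H -> ztens H H) (counit : H -> int) :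
    Prop := IsGradedConnected {
  graded_mul : forall m n (x y : dsum V),
    homog m x -> homog n y -> homog (m + n)%N (mul x y);
  graded_one : homog 0%N one;
  graded_comul : forall n (x : dsum V), homog n x ->
    exists s : seq (dsum V * dsum V),
      comul x = \sum_(p <- s) zpure p.1 p.2 /\
      (forall p, p \in s ->
         exists k l, [/\ (k + l)%N = n, homog k p.1 & homog l p.2]);
  graded_counit : forall n (x : dsum V), n <> 0%N -> homog n x -> counit x = 0;
  graded_connected : forall x : dsum V, homog 0%N x -> exists c : int, x = one *~ c
}.

Definition is_gc_hopf (F : fieldType) (A : tower F) (T : groth F) : Prop :=
  is_hopf (@gr_mul F A T) (@gr_one F A T) (@gr_comul F A T) (@gr_counit F A T) /\
  @is_graded_connected (fun n => gr T (A n))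
    (@gr_mul F A T) (@gr_one F A T) (@gr_comul F A T) (@gr_counit F A T).

Record is_hopf_pairing (F : fieldType) (A : tower F) : Prop := IsHopfPairing {
  pairing_mul : forall (a b : KA A) (x : GA A),
    pairing (gr_mul a b) x = pairing2 (zpure a b) (gr_comul x);
  pairing_comul : forall (a : KA A) (x y : GA A),
    pairing a (gr_mul x y) = pairing2 (gr_comul a) (zpure x y);
  pairing_one : forall x : GA A, pairing (gr_one A (K_theory F)) x = gr_counit x;
  pairing_counit : forall a : KA A, pairing a (gr_one A (G_theory F)) = gr_counit a
}.

Definition dualizing (F : fieldType) (A : tower F) : Prop :=
  [/\ is_gc_hopf A (K_theory F), is_gc_hopf A (G_theory F) & is_hopf_pairing A].

Definition symmetric_algebra (F : fieldType) (B : falgType F) : Prop :=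
  exists tr : {scalar B},
    (forall a b, tr (a * b) = tr (b * a)) /\
    (forall a, (forall b, tr (a * b) = 0) -> a = 0).

(* Main.v *)
(* For each n the perfect pairing forces dim End(S) = 1 for the simple        *)
(* A_n-modules S, and gives finite dual bases of K_0(A_n) and G_0(A_n);       *)
(* hence K(A)⊗K(A) and G(A)⊗G(A) are the Grothendieck groups of the tensor    *)
(* categories, and the pairing on tensor squares is nondegenerate.  Frobenius *)
(* reciprocity gives <ab, x> = <a ⊗ b, Δ x>, and the conjugate adjunction     *)
(* gives <a, xy> = <Δ' a, x ⊗ y> with Δ' = Ψ⊗Ψ Δ Ψ^-1, for every strong       *)
(* tower.  So the pairing is Hopf iff Δ' = Δ on K(A); the Hopf axioms follow: *)
(* products are associative and unital by transitivity of induction,          *)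
(* coproducts are coassociative and counital by duality, Δ is multiplicative  *)
(* by the Mackey isomorphism, and antipodes exist by gradedness.  Projective  *)
(* modules are determined by the dimensions of their Homs to simple modules,  *)
(* so Δ' = Δ on classes lifts to isomorphisms.  Over symmetric algebras       *)
(* dim Hom(P, M) = dim Hom(M, P) for P projective, so that                    *)
(* dim Hom(P, Ind Z) = dim Hom(Res P, Z) by Frobenius reciprocity.            *)
Require Import Defs.
From HB Require Import structures.
From Stdlib Require Eqdep_dec.
From mathcomp Require Import all_boot all_order all_algebra all_field.
From mathcomp Require Import boolp classical_sets cardinality fsbigop.
From mathcomp Require Import freeg.

Set Implicit Arguments.
Unset Strict Implicit.
Unset Printing Implicit Defensive.

Import Order.TTheory GRing.Theory Num.Theory.
Local Open Scope ring_scope.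

(** * Linear algebra *)

(** Of the four axioms of a Hopf pairing, three are automatic. Frobenius reciprocity gives <ab, x> =
    <a ⊗ b, Δ x> ([tower_pairing_mul]), and A_0 = F gives the two axioms on units and counits
    ([tower_pairing_one], [tower_pairing_counit]). For the fourth, the conjugate adjunction of a
    strong tower yields <a, xy> = <Δ' a, x ⊗ y> with Δ' = Ψ⊗Ψ Δ Ψ^-1 ([adjoint_pairing]). As the
    pairing on tensor squares is nondegenerate, the fourth axiom says exactly that Δ' = Δ on K(A)
    ([adjoint_comul_dual]).

    A Hopf pairing then transports the Hopf axioms. Products are associative by transitivity of
    induction ([gr_mulA]), so coproducts on the dual side are coassociative ([dual_coassoc]), and
    likewise for units and counits. The Mackey isomorphism descends to Grothendieck groups and makes
    Δ multiplicative ([gr_comulM]). The antipode is a geometric series, finite on each element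
    because the algebra is graded and connected ([antipode_exists]). [comul_dualP] collects all
    this.

    These arguments need K_0 and G_0 of A_m ⊗ A_n to be the tensor products of those of A_m and A_n.
    Perfection of the pairing forces End(S) = F for each simple S ([perfect_dim_end]), so the simple
    modules and their projective covers form dual bases ([dual_basis_exists]), external products
    generate ([G0_tens_ind], [K0_tens_ind]), and [kappa] is bijective ([kappa_surj], [kappaG_inj],
    [kappaK_inj]).

    Statements (2) and (3) agree because a projective module is determined up to isomorphism by the
    dimensions of its Homs to simple modules ([projective_isoP]). Over a symmetric algebra the trace
    puts Hom(P, M) and Hom(M, P) in duality for P projective ([symmetric_dim_hom]); so Ind behaves
    on dimensions as a right adjoint of Res, and the fourth axiom follows directly
    ([symmetric_comul_dual]). *)

Section LinearAlgebra.
Variable F : fieldType.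

Lemma linfunE (U V : vectType F) (f : U -> V) : linear f -> linfun f =1 f.
Proof.
move=> lf x; pose l : {linear U -> V} := HB.pack f (GRing.isLinear.Build _ _ _ _ _ lf).
exact: (lfunE l).
Qed.

Lemma linear_dim_le (U V : vectType F) (f : U -> V) :
  linear f -> (forall x, f x = 0 -> x = 0) -> (\dim {:U} <= \dim {:V})%N.
Proof.
move=> lf f0; have lE := linfunE lf.
rewrite -(@limg_dim_eq _ _ _ (linfun f)); first exact: dimvS (subvf _).
apply/eqP; rewrite -subv0; apply/subvP => x; rewrite memv_cap memv_ker lE.
by case/andP=> _ /eqP /f0 ->; rewrite memv0.
Qed.

(** Exact sequences of vector spaces split. A splitting, being made of maps and identities, is
    preserved by tensoring. *)
Lemma linear_split (U V W : vectType F) (i : U -> V) (p : V -> W) :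
  linear i -> linear p -> injective i -> (forall z, exists y, p y = z) ->
  (forall y, p y = 0 <-> exists x, i x = y) ->
  exists (r : V -> U) (s : W -> V),
    [/\ linear r, linear s, cancel i r, cancel s p & forall y, i (r y) + s (p y) = y].
Proof.
move=> li lp ii ps ex; have iE := linfunE li; have pE := linfunE lp.
have iK : cancel i (linfun i)^-1%VF.
  move=> x; rewrite -iE; apply: lker0_lfunK; rewrite -subv0.
  apply/subvP => y; rewrite memv_ker iE => /eqP y0.
  by rewrite memv0 -(inj_eq ii) y0 (linear0f li).
have pK : cancel (linfun p)^-1%VF p.
  move=> z; have [y <-] := ps z; rewrite -[LHS]pE -[p y]pE.
  by rewrite limg_lfunVK // memv_img ?memvf.
pose s := (linfun p)^-1%VF.
(* [y - s (p y)] lies in the kernel of [p], that is in the image of [i], where the pseudo-inverse of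
   [i] is a true inverse. *)
exists (fun y => (linfun i)^-1%VF (y - s (p y))), s; split=> //.
- move=> a x y; rewrite -linearP; congr (_ _).
  by rewrite lp linearP scalerBr opprD addrACA.
- exact: linearP.
- by move=> x; have /ex -> : exists z, i z = i x by [exists x]; rewrite linear0 subr0 iK.
move=> y; have [|x e] := (ex (y - s (p y))).1.
  by rewrite (linearBf lp) pK subrr.
by rewrite -e iK e subrK.
Qed.

Lemma linear_exact_dim (U V W : vectType F) (i : U -> V) (p : V -> W) :
  linear i -> linear p -> injective i -> (forall z, exists y, p y = z) ->
  (forall y, p y = 0 <-> exists x, i x = y) ->
  \dim {:V} = (\dim {:U} + \dim {:W})%N.
Proof.
move=> li lp ii ps ex; have iE := linfunE li; have pE := linfunE lp.
rewrite -(limg_ker_dim (linfun p) fullv) capfv; congr (_ + _)%N; last first.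
  congr (\dim _); apply/vspaceP => z; rewrite memvf.
  by have [y <-] := ps z; rewrite -pE memv_img ?memvf.
have -> : lker (linfun p) = limg (linfun i).
  apply/vspaceP => y; rewrite memv_ker pE; apply/eqP/idP.
    by case/ex => x <-; rewrite -iE memv_img ?memvf.
  by case/memv_imgP => x _ ->; rewrite iE; apply/ex; exists x.
apply/limg_dim_eq/eqP; rewrite -subv0; apply/subvP => x; rewrite memv_cap memv_ker iE.
by case/andP=> _ /eqP x0; rewrite memv0 -(inj_eq ii) x0 (linear0f li).
Qed.

Lemma tmap_id (U V : vectType F) (t : tens U V) : tmap id id t = t.
Proof.
by apply: (tens_ext (g := id)) t => [||u v] //; [exact: tmap_linear|rewrite tmapE].
Qed.

Lemma tmap_comp (U V U' V' U'' V'' : vectType F) (f' : U' -> U'') (g' : V' -> V'')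
    (f : U -> U') (g : V -> V') t :
  linear f -> linear g -> linear f' -> linear g' ->
  tmap f' g' (tmap f g t) = tmap (f' \o f) (g' \o g) t.
Proof.
move=> lf lg lf' lg'.
apply: (tens_ext (f := tmap f' g' \o tmap f g)) t => [||u v].
- exact: linear_comp (tmap_linear _ _) (tmap_linear _ _).
- exact: tmap_linear.
by rewrite /= !tmapE //; exact: linear_comp.
Qed.

Lemma eq_tmap (U V U' V' : vectType F) (f f' : U -> U') (g g' : V -> V') :
  f =1 f' -> g =1 g' -> tmap f g =1 tmap f' g'.
Proof. by move=> /funext -> /funext ->. Qed.

Lemma tmapDr (U V U' V' : vectType F) (f : U -> U') (g g' : V -> V') t :
  linear f -> linear g -> linear g' ->
  tmap f (fun v => g v + g' v) t = tmap f g t + tmap f g' t.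
Proof.
move=> lf lg lg'.
have lD : linear (fun v => g v + g' v).
  by move=> a x y; rewrite lg lg' scalerDr addrACA.
apply: (tens_ext (g := fun t => tmap f g t + tmap f g' t)) t => [||u v].
- exact: tmap_linear.
- by move=> a x y; rewrite !(tmap_linear _ _ _ _) scalerDr addrACA.
by rewrite !tmapE // (bilinDr (@tens_bilin _ _ _)).
Qed.

Lemma tmapDl (U V U' V' : vectType F) (f f' : U -> U') (g : V -> V') t :
  linear f -> linear f' -> linear g ->
  tmap (fun v => f v + f' v) g t = tmap f g t + tmap f' g t.
Proof.
move=> lf lf' lg.
have lD : linear (fun v => f v + f' v).
  by move=> a x y; rewrite lf lf' scalerDr addrACA.
apply: (tens_ext (g := fun t => tmap f g t + tmap f' g t)) t => [||u v].
- exact: tmap_linear.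
- by move=> a x y; rewrite !(tmap_linear _ _ _ _) scalerDr addrACA.
by rewrite !tmapE // (bilinDl (@tens_bilin _ _ _)).
Qed.

(* Tensoring over a field is exact because exact sequences split linearly.    *)
Lemma tmap_exactr (X U V W : vectType F) (i : U -> V) (p : V -> W) :
  linear i -> linear p -> injective i -> (forall z, exists y, p y = z) ->
  (forall y, p y = 0 <-> exists x, i x = y) ->
  [/\ injective (tmap id i : tens X U -> tens X V),
      (forall z : tens X W, exists y : tens X V, tmap id p y = z) &
      forall y : tens X V, tmap id p y = 0 <-> exists x : tens X U, tmap id i x = y].
Proof.
move=> li lp ii ps ex.
have [r [s [lr ls ir sp irsp]]] := linear_split li lp ii ps ex.
have lid (Y : vectType F) : linear (@id Y) by [].
have K (Y Z : vectType F) (f : Y -> Z) (g : Z -> Y) :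
    linear f -> linear g -> cancel f g -> cancel (tmap (@id X) f) (tmap id g).
  move=> lf lg fg t; rewrite tmap_comp // -[RHS]tmap_id; exact: eq_tmap.
split; first by apply: can_inj (K _ _ _ _ li lr ir).
  by move=> z; exists (tmap id s z); exact: K.
move=> y; split=> [y0|[x <-]].
  exists (tmap id r y); rewrite -[RHS]tmap_id.
  have -> : tmap id id y = tmap id (fun y => i (r y) + s (p y)) y.
    by apply: eq_tmap => // v; rewrite irsp.
  rewrite tmapDr //; [|exact: linear_comp|exact: linear_comp].
  have <- : tmap id i (tmap id r y) = tmap id (fun v => i (r v)) y by rewrite tmap_comp.
  have <- : tmap id s (tmap id p y) = tmap id (fun v => s (p v)) y by rewrite tmap_comp.
  by rewrite y0 (linear0f (tmap_linear _ _)) addr0.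
rewrite tmap_comp // (@eq_tmap _ _ _ _ _ id _ (fun=> 0)) //; last first.
  by move=> v /=; apply/ex; exists v.
have l0 : linear (fun _ : U => 0 : W) by move=> a u v; rewrite scaler0 addr0.
apply: (tens_ext (g := fun=> 0)) x => [||u v].
- exact: tmap_linear.
- by move=> a u v; rewrite scaler0 addr0.
by rewrite tmapE // (linear0f ((tens_bilin _ _).1 u)).
Qed.

Lemma tmap_exactl (X U V W : vectType F) (i : U -> V) (p : V -> W) :
  linear i -> linear p -> injective i -> (forall z, exists y, p y = z) ->
  (forall y, p y = 0 <-> exists x, i x = y) ->
  [/\ injective (tmap i id : tens U X -> tens V X),
      (forall z : tens W X, exists y : tens V X, tmap p id y = z) &
      forall y : tens V X, tmap p id y = 0 <-> exists x : tens U X, tmap i id x = y].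
Proof.
move=> li lp ii ps ex.
have [r [s [lr ls ir sp irsp]]] := linear_split li lp ii ps ex.
have lid (Y : vectType F) : linear (@id Y) by [].
have K (Y Z : vectType F) (f : Y -> Z) (g : Z -> Y) :
    linear f -> linear g -> cancel f g -> cancel (tmap f (@id X)) (tmap g id).
  move=> lf lg fg t; rewrite tmap_comp // -[RHS]tmap_id; exact: eq_tmap.
split; first by apply: can_inj (K _ _ _ _ li lr ir).
  by move=> z; exists (tmap s id z); exact: K.
move=> y; split=> [y0|[x <-]].
  exists (tmap r id y); rewrite -[RHS]tmap_id.
  have -> : tmap id id y = tmap (fun y => i (r y) + s (p y)) id y.
    by apply: eq_tmap => // v; rewrite irsp.
  rewrite tmapDl //; [|exact: linear_comp|exact: linear_comp].
  have <- : tmap i id (tmap r id y) = tmap (fun v => i (r v)) id y by rewrite tmap_comp.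
  have <- : tmap s id (tmap p id y) = tmap (fun v => s (p v)) id y by rewrite tmap_comp.
  by rewrite y0 (linear0f (tmap_linear _ _)) addr0.
rewrite tmap_comp // (@eq_tmap _ _ _ _ _ (fun=> 0) _ id) //; last first.
  by move=> v /=; apply/ex; exists v.
have l0 : linear (fun _ : U => 0 : W) by move=> a u v; rewrite scaler0 addr0.
apply: (tens_ext (g := fun=> 0)) x => [||u v].
- exact: tmap_linear.
- by move=> a u v; rewrite scaler0 addr0.
by rewrite tmapE // (linear0f ((tens_bilin _ _).2 v)).
Qed.
End LinearAlgebra.

(** * Finite-dimensional modules *)

Section Modules.
Variables (F : fieldType) (B : falgType F).
Implicit Types L M N P Q S : fmod B.

Lemma fact_linear M b : linear (fact b : M -> M).
Proof. exact: (fact_bilin M).1. Qed.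

Lemma fact0 M b : b · (0 : M) = 0. Proof. exact: linear0f (@fact_linear M b). Qed.

Lemma fhom0 M N (f : fhom M N) : f 0 = 0.
Proof. exact: linear0f (fhom_linear f). Qed.

Lemma fhomB M N (f : fhom M N) x y : f (x - y) = f x - f y.
Proof. exact: linearBf (fhom_linear f) _ _. Qed.

Lemma fhomD M N (f : fhom M N) x y : f (x + y) = f x + f y.
Proof. exact: linearDf (fhom_linear f) _ _. Qed.

Lemma fhom_inj M N (f : fhom M N) : (forall x, f x = 0 -> x = 0) -> injective f.
Proof.
by move=> f0 x y /eqP; rewrite -subr_eq0 -fhomB => /eqP/f0/eqP; rewrite subr_eq0 => /eqP.
Qed.

Definition fadd M N (f g : fhom M N) : fhom M N.
Proof.
exists (fun x => f x + g x) => [a x y|b x].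
  by rewrite !fhom_linear scalerDr addrACA.
by rewrite !fhom_act (linearDf (@fact_linear N b)).
Defined.

Definition fscale M N (a : F) (f : fhom M N) : fhom M N.
Proof.
exists (fun x => a *: f x) => [c x y|b x].
  by rewrite fhom_linear scalerDr !scalerA mulrC.
by rewrite fhom_act (linearZf (@fact_linear N b)).
Defined.

Lemma fiso_refl M : fiso M M.
Proof. by exists (fid M), (fid M). Qed.

Lemma fiso_sym M N : fiso M N -> fiso N M.
Proof. by move=> [f [g [fg gf]]]; exists g, f. Qed.

Lemma fiso_trans N M P : fiso M N -> fiso N P -> fiso M P.
Proof.
move=> [f [g [fg gf]]] [f' [g' [fg' gf']]]; exists (fcomp f' f), (fcomp g g').
by split=> x /=; rewrite ?fg' ?fg ?gf ?gf'.
Qed.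

Lemma bij_fiso M N (f : fhom M N) :
  injective f -> (forall y, exists x, f x = y) -> fiso M N.
Proof.
move=> fi /choice [g fg].
have gL : linear g by move=> a x y; apply: fi; rewrite fg fhom_linear !fg.
have gA b x : g (b · x) = b · g x by apply: fi; rewrite fg fhom_act fg.
by exists f, (FHom gL gA); split=> // x; apply: fi; rewrite /= fg.
Qed.

Lemma fiso_dim M N : fiso M N -> \dim {:M} = \dim {:N}.
Proof.
move=> [f [g [fg gf]]]; apply/eqP; rewrite eqn_leq; apply/andP; split.
  apply: (linear_dim_le (fhom_linear f)) => x x0.
  by rewrite -(fg x) x0 fhom0.
apply: (linear_dim_le (fhom_linear g)) => x x0.
by rewrite -(gf x) x0 fhom0.
Qed.

Lemma sum_fiso M M' N N' : fiso M M' -> fiso N N' -> fiso (sum_mod M N) (sum_mod M' N').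
Proof.
move=> [f [g [fg gf]]] [f' [g' [fg' gf']]]; exists (sum_hom f f'), (sum_hom g g').
by split=> -[x y] /=; rewrite ?fg ?gf ?fg' ?gf'.
Qed.

Lemma sumA_fiso L M N : fiso (sum_mod L (sum_mod M N)) (sum_mod (sum_mod L M) N).
Proof.
pose f (x : sum_mod L (sum_mod M N)) : sum_mod (sum_mod L M) N := ((x.1, x.2.1), x.2.2).
pose g (x : sum_mod (sum_mod L M) N) : sum_mod L (sum_mod M N) := (x.1.1, (x.1.2, x.2)).
have fl : linear f by [].
have fa b x : f (b · x) = b · f x by [].
have gl : linear g by [].
have ga b x : g (b · x) = b · g x by [].
by exists (FHom fl fa), (FHom gl ga); split=> [[x [y z]]|[[x y] z]].
Qed.

Lemma sumC_fiso M N : fiso (sum_mod M N) (sum_mod N M).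
Proof.
have fl (P Q : fmod B) : linear (fun x : sum_mod P Q => (x.2, x.1) : sum_mod Q P) by [].
have fa (P Q : fmod B) b (x : sum_mod P Q) :
  ((b · x).2, (b · x).1) = b · ((x.2, x.1) : sum_mod Q P) by [].
by exists (FHom (@fl M N) (@fa M N)), (FHom (@fl N M) (@fa N M)); split=> -[x y].
Qed.

Definition in1 M N : fhom M (sum_mod M N).
Proof.
exists (fun x : M => (x, 0 : N)) => [a x y|b x].
  by apply/eqP; rewrite xpair_eqE /= scaler0 addr0 !eqxx.
by rewrite /= /sum_act /= fact0.
Defined.

Definition in2 M N : fhom N (sum_mod M N).
Proof.
exists (fun x : N => (0 : M, x)) => [a x y|b x].
  by apply/eqP; rewrite xpair_eqE /= scaler0 addr0 !eqxx.
by rewrite /= /sum_act /= fact0.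
Defined.

Definition pr1 M N : fhom (sum_mod M N) M.
Proof. by exists (fun x : M * N => x.1). Defined.

Definition pr2 M N : fhom (sum_mod M N) N.
Proof. by exists (fun x : M * N => x.2). Defined.

Definition copair M N P (f : fhom M P) (g : fhom N P) : fhom (sum_mod M N) P.
Proof.
exists (fun x : M * N => f x.1 + g x.2) => [a x y|b x].
  by rewrite !fhom_linear scalerDr addrACA.
by rewrite /= !fhom_act (linearDf (@fact_linear P b)).
Defined.

Definition pair_hom M N P (f : fhom P M) (g : fhom P N) : fhom P (sum_mod M N).
Proof.
exists (fun x : P => (f x, g x) : M * N) => [a x y|b x].
  by rewrite !fhom_linear.
by rewrite /= !fhom_act.
Defined.

Lemma sum_short_exact M N : short_exact (in1 M N) (pr2 M N).
Proof.
split=> [x y [] //|y|[x y]]; first by exists (0, y).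
by split=> [/= -> |[z [_ <-]]] //; exists x.
Qed.

(** [fhom] is a bare record; the subspace [homs] of linear maps supplies a vector space structure,
    of dimension [dim_hom]. [to_homV] and [of_homV] pass between the two. *)
Definition homV M N : vectType F := subvs_of (homs M N).

Lemma linfun_homs M N (f : fhom M N) : linfun f \in homs M N.
Proof. by apply/homsP => b x; rewrite !(linfunE (fhom_linear f)) fhom_act. Qed.

Definition to_homV M N (f : fhom M N) : homV M N := Subvs (linfun_homs f).

Definition of_homV M N (v : homV M N) : fhom M N.
Proof.
exists (vsval v); first exact: linearP.
exact/homsP/subvsP.
Defined.

Lemma to_homVK M N (f : fhom M N) x : of_homV (to_homV f) x = f x.
Proof. exact: linfunE (fhom_linear f) x. Qed.

Lemma homV_ext M N (u v : homV M N) : of_homV u =1 of_homV v -> u = v.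
Proof. by move=> uv; apply: subvs_inj; apply/lfunP => x; exact: uv. Qed.

Lemma of_homV_lin M N a (u v : homV M N) x :
  of_homV (a *: u + v) x = a *: of_homV u x + of_homV v x.
Proof.
by rewrite -[LHS]/(vsval (a *: u + v) x) linearP add_lfunE scale_lfunE.
Qed.

Lemma of_homV0 M N x : of_homV (0 : homV M N) x = 0.
Proof. by rewrite -[LHS]/(vsval (0 : homV M N) x) linear0 zero_lfunE. Qed.

Lemma dim_homV M N : \dim {:homV M N} = dim_hom M N.
Proof. by rewrite dimvf. Qed.

Section SubModule.
Variables (M : fmod B) (U : {vspace M}) (sU : stable U).

Definition sub_act (b : B) (x : subvs_of U) : subvs_of U := vsproj U (b · vsval x).

Lemma sub_actE b x : vsval (sub_act b x) = b · vsval x.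
Proof. by rewrite vsprojK //; apply: sU; exact: subvsP. Qed.

Definition sub_mod : fmod B.
Proof.
exists (subvs_of U : vectType F) sub_act.
- split=> [b|x] a u v; rewrite /sub_act.
    by rewrite linearP fact_linear linearP.
  by rewrite (fact_bilin M).2 linearP.
- by move=> x; apply: subvs_inj; rewrite sub_actE fact1.
- by move=> a b x; apply: subvs_inj; rewrite !sub_actE factM.
Defined.

Lemma dim_sub_mod : \dim {:sub_mod} = \dim U. Proof. exact: dimvf. Qed.

Definition sub_incl : fhom sub_mod M.
Proof. exists (@vsval _ _ U : sub_mod -> M) => [|b x]; [exact: linearP|exact: sub_actE]. Defined.

Lemma sub_incl_inj : injective sub_incl. Proof. exact: subvs_inj. Qed.

Lemma sub_incl_in x : sub_incl x \in U. Proof. exact: subvsP. Qed.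

Lemma sub_inclP x : x \in U <-> exists y, sub_incl y = x.
Proof.
by split=> [xU|[y <-]]; [exists (Subvs xU) | exact: subvsP].
Qed.

Definition sub_corestr N (f : fhom N M) (fU : forall x, f x \in U) : fhom N sub_mod.
Proof.
exists (fun x => Subvs (fU x) : sub_mod) => [a x y|b x]; apply: subvs_inj.
  by rewrite -[RHS]/(vsval (_ *: _ + _)) linearP -[LHS]/(f _) fhom_linear.
by rewrite [RHS]sub_actE -[LHS]/(f _) fhom_act.
Defined.

Lemma sub_corestrE N (f : fhom N M) (fU : forall x, f x \in U) x :
  sub_incl (sub_corestr fU x) = f x.
Proof. by []. Qed.

Definition quot_pi : fhom M (quot_mod sU).
Proof.
exists (vpi U : M -> quot_mod sU) => [|b x]; first exact: vpi_linear.
by rewrite /= quot_actE.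
Defined.

Lemma quot_pi_surj y : exists x, quot_pi x = y.
Proof. by exists (vrepr (y : vquot U)); exact: vreprK. Qed.

Lemma quot_pi0 x : quot_pi x = 0 <-> x \in U.
Proof. by rewrite -vpi_eq0; split=> /eqP. Qed.

Lemma quot_short_exact : short_exact sub_incl quot_pi.
Proof.
split; [exact: sub_incl_inj|exact: quot_pi_surj|move=> y].
by rewrite quot_pi0 sub_inclP.
Qed.
End SubModule.

Definition ker M N (f : fhom M N) : {vspace M} := lker (linfun f).
Definition im M N (f : fhom M N) : {vspace N} := limg (linfun f).

Lemma kerP M N (f : fhom M N) x : x \in ker f <-> f x = 0.
Proof. by rewrite memv_ker (linfunE (fhom_linear f)); split=> /eqP. Qed.

Lemma imP M N (f : fhom M N) y : y \in im f <-> exists x, f x = y.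
Proof.
have fE := linfunE (fhom_linear f).
split=> [/memv_imgP [x _ ->]|[x <-]]; first by exists x; rewrite fE.
by rewrite -fE memv_img ?memvf.
Qed.

Lemma ker_stable M N (f : fhom M N) : stable (ker f).
Proof. by move=> b x /kerP x0; apply/kerP; rewrite fhom_act x0 fact0. Qed.

Lemma im_stable M N (f : fhom M N) : stable (im f).
Proof. by move=> b _ /imP [x <-]; apply/imP; exists (b · x); rewrite fhom_act. Qed.

Lemma ker_short_exact M N (p : fhom M N) :
  (forall y, exists x, p x = y) -> short_exact (sub_incl (@ker_stable _ _ p)) p.
Proof.
move=> ps; split=> //; first exact: sub_incl_inj.
by move=> y; rewrite -kerP (@sub_inclP _ _ (@ker_stable _ _ p)).
Qed.

Lemma im_short_exact M N (i : fhom M N) :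
  injective i -> short_exact i (quot_pi (@im_stable _ _ i)).
Proof.
move=> ii; split=> //; first exact: quot_pi_surj.
by move=> y; rewrite quot_pi0 imP.
Qed.

Lemma short_exact_dim L M N (i : fhom L M) (p : fhom M N) :
  short_exact i p -> \dim {:M} = (\dim {:L} + \dim {:N})%N.
Proof.
by case; apply: linear_exact_dim; exact: fhom_linear.
Qed.

Lemma dim_eq0 M : \dim {:M} = 0%N <-> is_zero_mod M.
Proof.
split=> [/eqP|M0]; first by rewrite dimv_eq0 => /eqP e x; apply/eqP; rewrite -memv0 -e memvf.
by apply/eqP; rewrite dimv_eq0; apply/eqP/vspaceP => x; rewrite (M0 x) !mem0v.
Qed.

Lemma dim_gt0 M : (0 < \dim {:M})%N <-> exists x : M, x <> 0.
Proof.
rewrite lt0n; split=> [/eqP h|[x x0]].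
  apply: contrapT => h'; apply: h; apply/dim_eq0 => x; apply: contrapT => x0.
  by apply: h'; exists x.
by apply/eqP => /dim_eq0 /(_ x).
Qed.

Definition simple S : Prop :=
  (exists x : S, x <> 0) /\
  forall U : {vspace S}, stable U -> U = 0%VS \/ U = fullv.

(** Half of Schur's lemma: the kernel is stable, so it is 0 or everything. The image plays this role
    in [simple_surj]. *)
Lemma simple_inj S M (f : fhom S M) : simple S -> (exists x, f x <> 0) -> injective f.
Proof.
move=> [_ /(_ _ (@ker_stable _ _ f)) [k0 _|kT [x []]]]; last first.
  by apply/kerP; rewrite kT memvf.
by apply: fhom_inj => x /kerP; rewrite k0 memv0 => /eqP.
Qed.

Lemma simple_surj S M (f : fhom M S) :
  simple S -> (exists x, f x <> 0) -> forall y, exists x, f x = y.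
Proof.
move=> [_ /(_ _ (@im_stable _ _ f)) [k0 [x []]|kT _ y]].
  by apply/eqP; rewrite -memv0 -k0; apply/imP; exists x.
by apply/imP; rewrite kT memvf.
Qed.

(** The choice of a least dimension yields simple submodules, simple quotients and projective
    covers. *)
Lemma minimal_module (P : fmod B -> Prop) M : P M ->
  exists N, P N /\ forall N', P N' -> (\dim {:N} <= \dim {:N'})%N.
Proof.
move=> PM; have ex : exists k, `[< exists N, P N /\ \dim {:N} = k >].
  by exists (\dim {:M}); apply/asboolP; exists M.
case: (ex_minnP ex) => k /asboolP [N [PN <-]] mink.
by exists N; split=> // N' PN'; apply: mink; apply/asboolP; exists N'.
Qed.

(** A nonzero module of least dimension among those embedding in [M] is simple, since its submodules
    embed in [M] as well. *)
Lemma simple_sub M : (exists x : M, x <> 0) ->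
  exists S (f : fhom S M), simple S /\ injective f.
Proof.
move=> M0.
have [|S [[[x x0] [f fi]] minS]] := @minimal_module
  (fun S => (exists x : S, x <> 0) /\ exists f : fhom S M, injective f) M.
  by split=> //; exists (fid M).
exists S, f; split=> //; split; first by exists x.
move=> U sU; case: (pselect (exists y : sub_mod sU, y <> 0)) => [U0|U0].
  right; apply/eqP; rewrite eqEdim subvf /=.
  rewrite -(dim_sub_mod sU); apply: minS; split=> //.
  by exists (fcomp f (sub_incl sU)) => u v /fi /sub_incl_inj.
left; apply/vspaceP => y; rewrite memv0; apply/idP/eqP => [yU|->]; last exact: mem0v.
apply: contrapT => y0; apply: U0; exists (Subvs yU : sub_mod sU) => e.
by apply: y0; rewrite -[y]/(sub_incl sU (Subvs yU)) e fhom0.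
Qed.

Lemma simple_quot M : (exists x : M, x <> 0) ->
  exists S (f : fhom M S), simple S /\ forall y, exists x, f x = y.
Proof.
move=> M0.
have [|S [[[x x0] [f fs]] minS]] := @minimal_module
  (fun S => (exists x : S, x <> 0) /\
            exists f : fhom M S, forall y, exists x, f x = y) M.
  by split=> //; exists (fid M) => y; exists y.
exists S, f; split=> //; split; first by exists x.
move=> U sU; have dU := short_exact_dim (quot_short_exact sU).
case: (pselect (exists y : quot_mod sU, y <> 0)) => [U0|U0].
  left; apply/eqP; rewrite -dimv_eq0 -leqn0 -(leq_add2r (\dim {:quot_mod sU})) add0n.
  rewrite -(dim_sub_mod sU) -dU; apply: minS; split=> //; exists (fcomp (quot_pi sU) f) => y.
  by have [z <-] := quot_pi_surj y; have [w <-] := fs z; exists w.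
right; apply/vspaceP => y; rewrite memvf; apply/(quot_pi0 sU).
by apply: contrapT => y0; apply: U0; exists (quot_pi sU y).
Qed.

Lemma simple_iso S S' (f : fhom S S') :
  simple S -> simple S' -> (exists x, f x <> 0) -> fiso S S'.
Proof.
by move=> sS sS' f0; apply: (bij_fiso (simple_inj sS f0)); exact: simple_surj f0.
Qed.

Lemma dim_hom_eq0 M N : dim_hom M N = 0%N <-> forall (f : fhom M N) x, f x = 0.
Proof.
rewrite -dim_homV; split=> [/eqP|h].
  rewrite dimv_eq0 => /eqP e f x; rewrite -(to_homVK f).
  have : to_homV f \in fullv by rewrite memvf.
  by rewrite e memv0 => /eqP ->; rewrite of_homV0.
apply/eqP; rewrite dimv_eq0; apply/eqP/vspaceP => v; rewrite memvf memv0.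
by apply/esym/eqP; apply: homV_ext => x; rewrite of_homV0 h.
Qed.

Lemma dim_hom_gt0 M N : (0 < dim_hom M N)%N <-> exists (f : fhom M N) x, f x <> 0.
Proof.
rewrite lt0n; split=> [/eqP h|[f [x x0]]].
  apply: contrapT => h'; apply: h; apply/dim_hom_eq0 => f x; apply: contrapT => x0.
  by apply: h'; exists f, x.
by apply/eqP => /dim_hom_eq0 /(_ f x).
Qed.
End Modules.

(** * Dimensions of Hom spaces *)

Section DimHom.
Variable F : fieldType.

(** Inequalities of Hom dimensions come from injective linear operators. As [fhom] has no vector
    space structure, linearity of [T] is stated pointwise, for any [h] that equals [a *: f + g] as a
    function. *)
Lemma dim_hom_le (B B' : falgType F) (M N : fmod B) (M' N' : fmod B')
    (T : fhom M N -> fhom M' N') :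
  (forall (a : F) (f g h : fhom M N), (forall x, h x = a *: f x + g x) ->
     forall x, T h x = a *: T f x + T g x) ->
  (forall f : fhom M N, (forall x, T f x = 0) -> forall x, f x = 0) ->
  (dim_hom M N <= dim_hom M' N')%N.
Proof.
move=> TL T0; rewrite -!dim_homV.
apply: (@linear_dim_le _ _ _ (fun v : homV M N => to_homV (T (of_homV v)))).
  move=> a u v; apply: homV_ext => x.
  by rewrite of_homV_lin !to_homVK; apply: TL => y; rewrite of_homV_lin.
move=> v v0; apply: homV_ext => x; rewrite of_homV0; apply: T0 => y.
by rewrite -(to_homVK (T _)) v0 of_homV0.
Qed.

Lemma dim_hom_leV (B : falgType F) (M N : fmod B) (V : vectType F)
    (T : fhom M N -> V) :
  (forall (a : F) (f g h : fhom M N), (forall x, h x = a *: f x + g x) -> T h = a *: T f + T g) ->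
  (forall f : fhom M N, T f = 0 -> forall x, f x = 0) ->
  (dim_hom M N <= \dim {:V})%N.
Proof.
move=> TL T0; rewrite -dim_homV.
apply: (@linear_dim_le _ _ _ (fun v : homV M N => T (of_homV v))).
  by move=> a u v; apply: TL => y; rewrite of_homV_lin.
by move=> v v0; apply: homV_ext => x; rewrite of_homV0; exact: T0.
Qed.

Lemma dim_hom_geV (B : falgType F) (M N : fmod B) (V : vectType F)
    (T : V -> fhom M N) :
  (forall (a : F) u v x, T (a *: u + v) x = a *: T u x + T v x) ->
  (forall v, (forall x, T v x = 0) -> v = 0) ->
  (\dim {:V} <= dim_hom M N)%N.
Proof.
move=> TL T0; rewrite -dim_homV.
apply: (@linear_dim_le _ _ _ (fun v => to_homV (T v))).
  by move=> a u v; apply: homV_ext => x; rewrite of_homV_lin !to_homVK TL.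
by move=> v v0; apply: T0 => x; rewrite -to_homVK v0 of_homV0.
Qed.

Variable B : falgType F.
Implicit Types L M N P Q S : fmod B.

Lemma fiso_dim_hom M M' N N' : fiso M M' -> fiso N N' -> dim_hom M N = dim_hom M' N'.
Proof.
have le M1 M1' N1 N1' : fiso M1 M1' -> fiso N1 N1' -> (dim_hom M1 N1 <= dim_hom M1' N1')%N.
  move=> [f [g [fg gf]]] [f' [g' [fg' gf']]].
  apply: (dim_hom_le (T := fun h => fcomp f' (fcomp h g))) => [a h k l hkl x|h h0 x] /=.
    by rewrite hkl fhom_linear.
  by have := h0 (f x); rewrite /= fg => hx; rewrite -(fg' (h x)) hx fhom0.
by move=> i j; apply/eqP; rewrite eqn_leq !le //; exact: fiso_sym.
Qed.

Lemma dim_hom_exactr P L M N (i : fhom L M) (p : fhom M N) :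
  projective P -> short_exact i p -> dim_hom P M = (dim_hom P L + dim_hom P N)%N.
Proof.
move=> pP [ii ps ex]; rewrite -!dim_homV.
apply: (@linear_exact_dim _ _ _ _
  (fun v : homV P L => to_homV (fcomp i (of_homV v)))
  (fun v : homV P M => to_homV (fcomp p (of_homV v)))).
- move=> a u v; apply: homV_ext => x.
  by rewrite of_homV_lin !to_homVK /= -fhom_linear -(of_homV_lin a u v).
- move=> a u v; apply: homV_ext => x.
  by rewrite of_homV_lin !to_homVK /= -fhom_linear -(of_homV_lin a u v).
- move=> u v uv; apply: homV_ext => x; apply: ii.
  by rewrite -[LHS](to_homVK (fcomp i (of_homV u))) uv to_homVK.
- move=> z; have [h hz] := pP _ _ p (of_homV z) ps; exists (to_homV h).
  by apply: homV_ext => x; rewrite to_homVK /= -[RHS]hz -[h x](to_homVK h).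
move=> y; split=> [y0|[x <-]].
  (* A morphism killed by [p] lands in the image of [i]; projectivity of [P] lifts it through the
     surjection from [L] onto that image. *)
  have y1 x : of_homV y x \in im i.
    by apply/imP/ex; rewrite -[LHS](to_homVK (fcomp p (of_homV y))) y0 of_homV0.
  have iS : forall z : sub_mod (@im_stable _ _ _ _ i), exists x, sub_corestr (U := im i)
     (@im_stable _ _ _ _ i) (f := i) (fun x => (imP i _).2 (ex_intro _ x erefl)) x = z.
    move=> z; have /imP [x xz] := sub_incl_in z; exists x.
    by apply: sub_incl_inj; rewrite sub_corestrE.
  have [h hy] := pP _ _ _ (sub_corestr (@im_stable _ _ _ _ i) y1) iS.
  exists (to_homV h); apply: homV_ext => x; rewrite to_homVK.
  rewrite -[RHS](sub_corestrE (@im_stable _ _ _ _ i) y1) -hy sub_corestrE /=.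
  by rewrite -[h x](to_homVK h).
apply: homV_ext => z; rewrite to_homVK of_homV0.
rewrite -[LHS]/(p (of_homV (to_homV (fcomp i (of_homV x))) z)) to_homVK.
by apply/ex; exists (of_homV x z).
Qed.

Lemma dim_hom_suml M N P : dim_hom (sum_mod M N) P = (dim_hom M P + dim_hom N P)%N.
Proof.
rewrite -!dim_homV addnC.
apply: (@linear_exact_dim _ _ _ _
  (fun v : homV N P => to_homV (fcomp (of_homV v) (pr2 M N)))
  (fun v : homV (sum_mod M N) P => to_homV (fcomp (of_homV v) (in1 M N)))).
- by move=> a u v; apply: homV_ext => x; rewrite of_homV_lin !to_homVK; exact: of_homV_lin.
- by move=> a u v; apply: homV_ext => x; rewrite of_homV_lin !to_homVK; exact: of_homV_lin.
- move=> u v uv; apply: homV_ext => x.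
  have := to_homVK (fcomp (of_homV u) (pr2 M N)) (0, x).
  by rewrite uv to_homVK /=.
- move=> z; exists (to_homV (fcomp (of_homV z) (pr1 M N))); apply: homV_ext => x.
  by rewrite to_homVK; exact: (to_homVK (fcomp (of_homV z) (pr1 M N)) (x, 0)).
move=> y; split=> [y0|[x <-]].
  exists (to_homV (fcomp (of_homV y) (in2 M N))); apply: homV_ext => -[u v].
  rewrite to_homVK -[LHS]/(of_homV (to_homV (fcomp (of_homV y) (in2 M N))) v) to_homVK.
  have e : of_homV y (in1 M N u) = 0.
    by rewrite -[LHS](to_homVK (fcomp (of_homV y) (in1 M N))) y0 of_homV0.
  have -> : (u, v) = in1 M N u + in2 M N v by congr (_, _); rewrite ?addr0 ?add0r.
  by rewrite fhomD e add0r.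
apply: homV_ext => z; rewrite to_homVK of_homV0.
rewrite -[LHS]/(of_homV (to_homV (fcomp (of_homV x) (pr2 M N))) (z, 0)) to_homVK.
exact: fhom0.
Qed.

Lemma dim_hom_reg M : dim_hom (reg_mod B) M = \dim {:M}.
Proof.
apply/eqP; rewrite eqn_leq; apply/andP; split.
  apply: (@dim_hom_leV _ (reg_mod B) M M (fun f => f (1 : B))) => [a f g h -> //|f f0 x].
  have -> : x = (x : B) · (1 : reg_mod B) by rewrite /= mulr1.
  by rewrite fhom_act f0 fact0.
have L (m : M) : linear (fun b : B => b · m) by exact: (fact_bilin M).2.
have Aa (m : M) b (x : reg_mod B) : (b · x : B) · m = b · (x · m) by exact: factM.
apply: (@dim_hom_geV _ (reg_mod B) M M (fun m => @FHom _ _ (reg_mod B) M _ (L m) (Aa m))).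
  by move=> a u v x /=; rewrite fact_linear.
by move=> v /(_ (1 : B)) /=; rewrite fact1.
Qed.
End DimHom.

(** * Projective modules *)

Section Projectives.
Variables (F : fieldType) (B : falgType F).
Implicit Types L M N P Q S X Y Z : fmod B.

Definition summand Y P : Prop := exists Z, fiso Y (sum_mod P Z).

Lemma retract_projective P Q (i : fhom P Q) (p : fhom Q P) :
  cancel i p -> projective Q -> projective P.
Proof.
move=> ip pQ M N g f gs; have [h gh] := pQ _ _ g (fcomp f p) gs.
by exists (fcomp h i) => x; rewrite /= gh /= ip.
Qed.

Lemma projective_fiso P Q : fiso P Q -> projective Q -> projective P.
Proof. by move=> [i [p [ip _]]]; exact: retract_projective ip. Qed.

Lemma projective_sum P Q : projective P -> projective Q -> projective (sum_mod P Q).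
Proof.
move=> pP pQ M N g f gs.
have [h gh] := pP _ _ g (fcomp f (in1 P Q)) gs.
have [k gk] := pQ _ _ g (fcomp f (in2 P Q)) gs.
exists (copair h k) => -[x y]; rewrite /= fhomD gh gk.
have -> : (x, y) = in1 P Q x + in2 P Q y by congr (_, _); rewrite ?addr0 ?add0r.
by rewrite fhomD.
Qed.

Lemma projective_suml P Q : projective (sum_mod P Q) -> projective P.
Proof. by apply: (@retract_projective _ _ (in1 P Q) (pr1 P Q)). Qed.

Lemma projective_sumr P Q : projective (sum_mod P Q) -> projective Q.
Proof. by apply: (@retract_projective _ _ (in2 P Q) (pr2 P Q)). Qed.

Lemma projective_summand Y P : summand Y P -> projective Y -> projective P.
Proof.
by move=> [Z /fiso_sym iY] pY; exact: projective_suml (projective_fiso iY pY).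
Qed.

Lemma projective_reg : projective (reg_mod B).
Proof.
move=> M N g f gs; have [m gm] := gs (f (1 : B)).
have L (x : M) : linear (fun b : B => b · x) by exact: (fact_bilin M).2.
have Aa (x : M) b (c : reg_mod B) : (b · c : B) · x = b · (c · x) by exact: factM.
exists (@FHom _ _ (reg_mod B) M _ (L m) (Aa m)) => b.
rewrite -[LHS]/(g ((b : B) · m)) fhom_act gm -fhom_act; congr (f _).
exact: mulr1.
Qed.

Lemma projective_zero M : is_zero_mod M -> projective M.
Proof.
by move=> M0 N P g f gs; exists (fzero M N) => x; rewrite [x]M0 !fhom0.
Qed.

(** The complement is the kernel of the retraction. *)
Lemma retract_summand P Y (i : fhom P Y) (p : fhom Y P) : cancel i p -> summand Y P.
Proof.
move=> ip; pose K := sub_mod (@ker_stable _ _ _ _ p).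
exists K; apply: fiso_sym; apply: (bij_fiso (f := copair i (sub_incl (@ker_stable _ _ _ _ p)))).
  apply: fhom_inj => -[x k] /= e.
  have k0 : p (sub_incl (@ker_stable _ _ _ _ p) k) = 0 by apply/kerP; exact: sub_incl_in.
  have x0 : x = 0 by rewrite -(ip x) -[p _]addr0 -k0 -fhomD e fhom0.
  congr (_, _) => //; apply: (@sub_incl_inj _ _ _ _ (@ker_stable _ _ _ _ p)).
  by move: e; rewrite x0 !fhom0 add0r.
move=> y; have /(sub_inclP (@ker_stable _ _ _ _ p)) [k kE] : y - i (p y) \in ker p.
  by apply/kerP; rewrite fhomB ip subrr.
by exists (p y, k); rewrite -[LHS]/(_ + _) kE addrC subrK.
Qed.

Lemma summand_trans Y P Q : summand Y P -> summand P Q -> summand Y Q.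
Proof.
move=> [Z iY] [Z' iP]; exists (sum_mod Z' Z); apply: fiso_trans iY _.
apply: fiso_trans (fiso_sym (sumA_fiso _ _ _)).
exact: sum_fiso iP (fiso_refl _).
Qed.

Lemma summand_refl Y : summand Y Y.
Proof. exact: (retract_summand (i := fid Y) (p := fid Y)). Qed.

Lemma sum0_fiso M N : is_zero_mod M -> fiso N (sum_mod M N).
Proof.
move=> M0; apply: (bij_fiso (f := in2 M N)) => [x y []//|[x y]].
by exists y; rewrite [x]M0.
Qed.

Definition fiter P (u : fhom P P) k : fhom P P := iter k (fcomp u) (fid P).

Lemma fiterE P (u : fhom P P) k x : fiter u k x = iter k u x.
Proof. by elim: k => //= k <-. Qed.

Lemma fhom_surj_inj M N (f : fhom M N) : (\dim {:M} <= \dim {:N})%N ->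
  (forall y, exists x, f x = y) -> injective f.
Proof.
move=> le fs; have := short_exact_dim (ker_short_exact fs).
move=> e; have /dim_eq0 k0 : \dim {:sub_mod (@ker_stable _ _ _ _ f)} = 0%N.
  by apply/eqP; rewrite -leqn0 -(leq_add2r (\dim {:N})) -e.
apply: fhom_inj => x /kerP /(sub_inclP (@ker_stable _ _ _ _ f)) [y <-].
by rewrite (k0 y) fhom0.
Qed.

Lemma fhom_inj_surj M N (f : fhom M N) : (\dim {:N} <= \dim {:M})%N ->
  injective f -> forall y, exists x, f x = y.
Proof.
move=> le fi; have e := short_exact_dim (im_short_exact fi).
have /dim_eq0 k0 : \dim {:quot_mod (@im_stable _ _ _ _ f)} = 0%N.
  by apply/eqP; rewrite -leqn0 -(leq_add2l (\dim {:M})) addn0 -e.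
by move=> y; apply/imP/(quot_pi0 (@im_stable _ _ _ _ f)).
Qed.

Lemma fhom_inv M N (f : fhom M N) : injective f -> (forall y, exists x, f x = y) ->
  exists g : fhom N M, cancel f g /\ cancel g f.
Proof.
move=> fi /choice [g fg].
have gL : linear g by move=> a x y; apply: fi; rewrite fg fhom_linear !fg.
have gA b x : g (b · x) = b · g x by apply: fi; rewrite fg fhom_act fg.
by exists (FHom gL gA); split=> // x; apply: fi; rewrite /= fg.
Qed.

(** Fitting's lemma. If the image of [u^k] has least dimension, then [u^(2k)] has the same image, so
    [u^k] is invertible on this image [Q], which is therefore a retract. The condition [0 < k] lets
    surjectivity of [u^k] imply that of [u]. *)
Lemma fitting P (u : fhom P P) : exists k Q (j : fhom Q P) (q : fhom P Q),
  [/\ (0 < k)%N, cancel j q &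
    forall x, (exists y, j y = x) <-> exists y, iter k u y = x].
Proof.
have ex : exists d, `[< exists k, (0 < k)%N /\ \dim (im (fiter u k)) = d >].
  by exists (\dim (im (fiter u 1))); apply/asboolP; exists 1%N.
case: (ex_minnP ex) => d /asboolP [k [k0 <-]] mind.
pose v := fiter u k; pose sI := @im_stable _ _ _ _ v.
have vI x : v x \in im v by apply/imP; exists x.
pose c := sub_corestr sI vI.
have imv2 : im (fiter u (k + k)) = im v.
  apply/eqP; rewrite eqEdim mind ?andbT; last first.
    by apply/asboolP; exists (k + k)%N; rewrite addn_gt0 k0.
  apply/subvP => _ /imP [x <-]; apply/imP; exists (v x).
  by rewrite !fiterE iterD.
have cs : forall y, exists x, fcomp c (sub_incl sI) x = y.
  move=> y; have /imP [x xE] : sub_incl sI y \in im (fiter u (k + k)).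
    by rewrite imv2; exact: sub_incl_in.
  exists (c x); apply: (@sub_incl_inj _ _ _ _ sI); rewrite -xE.
  by rewrite -[LHS]/(v (v x)) !fiterE iterD.
have [g [fg gf]] := fhom_inv (fhom_surj_inj (leqnn _) cs) cs.
exists k, (sub_mod sI), (sub_incl sI), (fcomp g c); split=> // x.
rewrite -(sub_inclP sI); split=> [/imP [y <-]|[y <-]]; first by exists y; rewrite fiterE.
by rewrite -fiterE; exact: vI.
Qed.

Definition proj_cover P S (p : fhom P S) : Prop :=
  [/\ projective P, forall y, exists x, p x = y &
    forall h : fhom P P, (forall x, p (h x) = p x) ->
      injective h /\ forall y, exists x, h x = y].

(** Take a summand [P] of [Y] of least dimension with a nonzero morphism [p] to [S]. If [h]
    preserves [p], the Fitting summand of [h] still maps nontrivially to [S]; by minimality it is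
    all of [P], so [h] is onto. *)
Lemma cover_exists Y S : projective Y -> simple S -> (0 < dim_hom Y S)%N ->
  exists P (p : fhom P S), proj_cover p /\ summand Y P.
Proof.
move=> pY sS dY.
have [|P [[sP dP] minP]] := @minimal_module _ _
   (fun P => summand Y P /\ (0 < dim_hom P S)%N) Y.
  by split=> //; exact: summand_refl.
have [p p0] := (dim_hom_gt0 _ _).1 dP.
exists P, p; split=> //; split; first exact: projective_summand sP pY.
  exact: simple_surj p0.
move=> h ph.
have [k [Q [j [q [k0 jq jE]]]]] := fitting h.
have pk n x : p (iter n h x) = p x by elim: n => //= n IH; rewrite ph.
have dQ : (0 < dim_hom Q S)%N.
  apply/dim_hom_gt0; exists (fcomp p j); have [x x0] := p0.
  by have [|y yE] := (jE (iter k h x)).2; [exists x | exists y; rewrite /= yE pk].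
have le := minP Q (conj (summand_trans sP (retract_summand jq)) dQ).
have hs : forall y, exists x, h x = y.
  move=> y; have /jE [x <-] := fhom_inj_surj le (can_inj jq) y.
  by case: k k0 {pk jE} => // k _; exists (iter k h x).
by split=> //; exact: fhom_surj_inj hs.
Qed.

(** Lift [p] and a nonzero morphism from [X] to [S] through one another. The composite endomorphism
    of [P] preserves [p], hence is invertible, and [P] is a retract of [X]. *)
Lemma cover_summand P S (p : fhom P S) X : simple S -> proj_cover p -> projective X ->
  (0 < dim_hom X S)%N -> summand X P.
Proof.
move=> sS [pP ps pC] pX /dim_hom_gt0 [f f0].
have fs := simple_surj sS f0.
have [i iE] := pP _ _ f p fs; have [q qE] := pX _ _ p f ps.
have [|ui us] := pC (fcomp q i); first by move=> x; rewrite /= qE iE.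
have [w [uw wu]] := fhom_inv ui us.
exact: (@retract_summand _ _ i (fcomp w q)).
Qed.

Lemma simple_dim_gt0 S : simple S -> (0 < \dim {:S})%N.
Proof. by move=> [h _]; apply/dim_gt0. Qed.

(* Krull-Schmidt in the form needed here: split off the projective cover of a *)
(* simple quotient of [Y], which is also a summand of [X].                    *)
Lemma projective_summandP X Y : projective X -> projective Y ->
  (forall S, simple S -> dim_hom Y S <= dim_hom X S)%N -> summand X Y.
Proof.
have [n] := ubnP (\dim {:Y}); elim: n X Y => // n IH X Y dY pX pY le.
case: (pselect (is_zero_mod Y)) => [Y0|nY].
  by exists X; exact: sum0_fiso.
have [|S [f [sS fs]]] := @simple_quot _ _ Y.
  by apply: contrapT => h; apply: nY => y; apply: contrapT => y0; apply: h; exists y.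
have dS : (0 < dim_hom Y S)%N.
  by apply/dim_hom_gt0; have [[s s0] _] := sS; have [y yE] := fs s; exists f, y; rewrite yE.
have [P [p [cP [Y' iY]]]] := cover_exists pY sS dS.
have [X' iX] := cover_summand sS cP pX (leq_trans dS (le _ sS)).
have dP : (0 < \dim {:P})%N.
  case: cP => _ ps _; have [[s s0] _] := sS; have [x xE] := ps s.
  by apply/dim_gt0; exists x => x0; apply: s0; rewrite -xE x0 fhom0.
have [||||Z iZ] := IH X' Y'.
- move: dY; rewrite ltnS (fiso_dim iY) (short_exact_dim (sum_short_exact P Y')).
  by apply: leq_trans; rewrite -addn1 addnC leq_add2r.
- exact: projective_sumr (projective_fiso (fiso_sym iX) pX).
- exact: projective_sumr (projective_fiso (fiso_sym iY) pY).
- move=> T sT; have := le T sT; rewrite (fiso_dim_hom iX (fiso_refl T)).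
  by rewrite (fiso_dim_hom iY (fiso_refl T)) !dim_hom_suml leq_add2l.
exists Z; apply: fiso_trans iX _; apply: fiso_trans (sum_fiso (fiso_refl _) iZ) _.
apply: fiso_trans (sumA_fiso _ _ _) _; apply: sum_fiso (fiso_refl _).
exact: fiso_sym.
Qed.

Lemma zero_mod_simple M : (forall S, simple S -> dim_hom M S = 0%N) -> is_zero_mod M.
Proof.
move=> h x; apply: contrapT => x0.
have [|S [f [sS fs]]] := @simple_quot _ _ M; first by exists x.
have /dim_hom_eq0 f0 := h S sS; have [[s s0] _] := sS.
by have [y yE] := fs s; apply: s0; rewrite -yE f0.
Qed.

(** The complement of [Y] in [X] has no nonzero morphism to a simple module, so it has no simple
    quotient and vanishes. This is how an equality of numbers becomes an isomorphism. *)
Lemma projective_isoP X Y : projective X -> projective Y ->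
  (forall S, simple S -> dim_hom X S = dim_hom Y S) -> fiso X Y.
Proof.
move=> pX pY e; have [|Z iZ] := @projective_summandP X Y pX pY.
  by move=> S sS; rewrite e.
have Z0 : is_zero_mod Z.
  apply: zero_mod_simple => S sS; have := e S sS.
  rewrite (fiso_dim_hom iZ (fiso_refl S)) dim_hom_suml => /eqP.
  by rewrite -[X in _ == X]addn0 eqn_add2l => /eqP.
apply: fiso_trans iZ _; apply: fiso_trans (sumC_fiso _ _) _.
exact: fiso_sym (sum0_fiso _ Z0).
Qed.
End Projectives.

(** * External products, restriction and induction *)

Section External.
Variables (F : fieldType) (A B : falgType F).

Lemma tens_act_pure (X Y : fmod (tens A B)) (D : X -> Prop) (h : X -> Y) : linear h ->
  (forall a b x, D x -> h ((a ⊗ b : tens A B) · x) = (a ⊗ b : tens A B) · h x) ->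
  forall t x, D x -> h (t · x) = t · h x.
Proof.
move=> lh hD t x Dx; move: t; apply: tens_ext => [a u v|a u v|a b]; last exact: hD.
  by rewrite (fact_bilin X).2 lh.
by rewrite (fact_bilin Y).2.
Qed.

Lemma ext_pure (M : fmod A) (N : fmod B) a b m n :
  (a ⊗ b : tens A B) · (m ⊗ n : ext_mod M N) = (a · m) ⊗ (b · n).
Proof. exact: ext_actE. Qed.

Section ExtHom.
Variables (M M' : fmod A) (N N' : fmod B).

Lemma ext_act_ext (X : fmod (tens A B)) (h : tens M N -> X) : linear h ->
  (forall a b m n, h ((a · m) ⊗ (b · n)) = (a ⊗ b : tens A B) · h (m ⊗ n)) ->
  forall t (x : ext_mod M N), h (t · x) = t · h x.
Proof.
move=> lh hE t x.
apply: (@tens_act_pure (ext_mod M N) X (fun _ => True) h) => // a b {}x _.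
move: x; apply: tens_ext => [k u v|k u v|m n].
- by rewrite (@fact_linear _ _ (ext_mod M N)) lh.
- by rewrite lh (@fact_linear _ _ X).
by rewrite [X in h X]ext_pure hE.
Qed.

Definition ext_lift (X : fmod (tens A B)) (f : M -> N -> X) (bf : bilin f)
    (fE : forall a b m n, f (a · m) (b · n) = (a ⊗ b : tens A B) · f m n) :
  fhom (ext_mod M N) X.
Proof.
exists (tlift f : tens M N -> X); first exact: tlift_linear.
apply: ext_act_ext => [|a b m n]; first exact: tlift_linear.
by rewrite !tliftE.
Defined.

Lemma ext_liftE (X : fmod (tens A B)) (f : M -> N -> X) (bf : bilin f)
    (fE : forall a b m n, f (a · m) (b · n) = (a ⊗ b : tens A B) · f m n) m n :
  ext_lift bf fE (m ⊗ n) = f m n.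
Proof. exact: tliftE. Qed.

Lemma ext_hom_ext (X : fmod (tens A B)) (f g : fhom (ext_mod M N) X) :
  (forall m n, f (m ⊗ n) = g (m ⊗ n)) -> f =1 g.
Proof.
exact: (@tens_ext F M N X f g (fhom_linear f) (fhom_linear g)).
Qed.

Definition ext_hom (f : fhom M M') (g : fhom N N') : fhom (ext_mod M N) (ext_mod M' N').
Proof.
exists (tmap f g : tens M N -> ext_mod M' N'); first exact: tmap_linear.
apply: ext_act_ext => [|a b m n]; first exact: tmap_linear.
rewrite !tmapE; try exact: fhom_linear.
by rewrite [RHS]ext_pure !fhom_act.
Defined.

End ExtHom.

Lemma ext_exactr (X : fmod A) (L M N : fmod B) (i : fhom L M) (p : fhom M N) :
  short_exact i p -> short_exact (ext_hom (fid X) i) (ext_hom (fid X) p).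
Proof. by case=> ii ps ex; apply: tmap_exactr ex => //; exact: fhom_linear. Qed.

Lemma ext_exactl (X : fmod B) (L M N : fmod A) (i : fhom L M) (p : fhom M N) :
  short_exact i p -> short_exact (ext_hom i (fid X)) (ext_hom p (fid X)).
Proof. by case=> ii ps ex; apply: tmap_exactl ex => //; exact: fhom_linear. Qed.

Definition tinl (a : A) : tens A B := a ⊗ 1.
Definition tinr (b : B) : tens A B := 1 ⊗ b.

Lemma tinl_linear : linear tinl. Proof. exact: (tens_bilin _ _).2. Qed.
Lemma tinr_linear : linear tinr. Proof. exact: (tens_bilin _ _).1. Qed.
Lemma tinl_monoid : monoid_morphism tinl.
Proof. by split=> [|x y]; rewrite /tinl ?tensM ?mulr1. Qed.
Lemma tinr_monoid : monoid_morphism tinr.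
Proof. by split=> [|x y]; rewrite /tinr ?tensM ?mulr1. Qed.
HB.instance Definition _ := GRing.isLinear.Build F _ _ _ tinl tinl_linear.
HB.instance Definition _ := GRing.isMonoidMorphism.Build _ _ tinl tinl_monoid.
HB.instance Definition _ := GRing.isLinear.Build F _ _ _ tinr tinr_linear.
HB.instance Definition _ := GRing.isMonoidMorphism.Build _ _ tinr tinr_monoid.
Definition tinlm : {lrmorphism A -> tens A B} := tinl.
Definition tinrm : {lrmorphism B -> tens A B} := tinr.

Lemma tinlr (a : A) (b : B) : tinl a * tinr b = a ⊗ b.
Proof. by rewrite /tinl /tinr tensM mulr1 mul1r. Qed.
Lemma tinrl (a : A) (b : B) : tinr b * tinl a = a ⊗ b.
Proof. by rewrite /tinl /tinr tensM mulr1 mul1r. Qed.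

(* Hom_B(Q, X) as an A-module, for an (A ⊗ B)-module X.                       *)
Section HomModule.
Variables (Q : fmod B) (X : fmod (tens A B)).
Local Notation XB := (res_mod tinrm X).

Definition hom_post (a : A) (f : fhom Q XB) : fhom Q XB.
Proof.
exists (fun q => tinl a · (f q : X) : XB) => [k u v|b q].
  by rewrite fhom_linear (@fact_linear _ _ X).
by rewrite fhom_act -[LHS]factM -[RHS]factM tinlr -tinrl.
Defined.

Definition hom_mod : fmod A.
Proof.
exists (homV Q XB) (fun a h => to_homV (hom_post a (of_homV h))).
- split=> [a|h] k u v; apply: homV_ext => q; rewrite of_homV_lin !to_homVK.
    by rewrite -[LHS]/(tinl a · (of_homV (k *: u + v) q : X)) of_homV_lin (@fact_linear _ _ X).
  by rewrite -[LHS]/(tinl _ · (of_homV h q : X)) linearP (fact_bilin X).2.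
- move=> h; apply: homV_ext => q; rewrite to_homVK.
  by rewrite -[LHS]/(tinl 1 · (of_homV h q : X)) (rmorph1 tinlm) fact1.
- move=> a b h; apply: homV_ext => q; rewrite !to_homVK.
  rewrite -[LHS]/(tinl _ · (of_homV h q : X)) (rmorphM tinlm) factM.
  rewrite -[RHS]/(tinl a · (of_homV (to_homV (hom_post b (of_homV h))) q : X)).
  by rewrite to_homVK.
Defined.

Lemma hom_mod_act a (h : hom_mod) q :
  of_homV (a · h) q = tinl a · (of_homV (h : homV Q XB) q : X).
Proof. exact: to_homVK. Qed.

Variable P : fmod A.

Definition curry_fun (f : fhom (ext_mod P Q) X) (p : P) : fhom Q XB.
Proof.
exists (fun q => f (p ⊗ q) : XB) => [k u v|b q].
  by rewrite (tens_bilin _ _).1 fhom_linear.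
rewrite -[RHS]/(tinr b · (f (p ⊗ q) : X)) -fhom_act; congr (f _).
by rewrite [RHS]ext_pure fact1.
Defined.

(** Together with [uncurry], the adjunction between - ⊗ Q and Hom_B(Q, -). *)
Definition curry (f : fhom (ext_mod P Q) X) : fhom P hom_mod.
Proof.
exists (fun p => to_homV (curry_fun f p) : hom_mod) => [k u v|a p].
  apply: homV_ext => q; rewrite of_homV_lin !to_homVK.
  by rewrite -[LHS]/(f _) (tens_bilin _ _).2 fhom_linear.
apply: homV_ext => q; rewrite hom_mod_act !to_homVK.
rewrite -[RHS]/(tinl a · (f (p ⊗ q) : X)) -fhom_act; congr (f _).
by rewrite [RHS]ext_pure fact1.
Defined.

Lemma curryE f p q : of_homV (curry f p) q = f (p ⊗ q).
Proof. exact: to_homVK. Qed.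

Lemma uncurry_bilin (g : fhom P hom_mod) :
  bilin (fun p q => of_homV (g p : homV Q XB) q : X).
Proof.
split=> [p|q] k u v; first exact: (fhom_linear (of_homV (g p : homV Q XB))).
by rewrite fhom_linear of_homV_lin.
Qed.

Definition uncurry (g : fhom P hom_mod) : fhom (ext_mod P Q) X.
Proof.
apply: (ext_lift (uncurry_bilin g)) => a b p q.
by rewrite (fhom_act g) hom_mod_act fhom_act -[LHS]factM tinlr.
Defined.

Lemma uncurryE g p q : uncurry g (p ⊗ q) = of_homV (g p : homV Q XB) q.
Proof. by rewrite /uncurry ext_liftE. Qed.
End HomModule.

Lemma hom_modS (Q : fmod B) (X Y : fmod (tens A B)) (g : fhom X Y) :
  exists h : fhom (hom_mod Q X) (hom_mod Q Y),
    forall v q, of_homV (h v : homV Q (res_mod tinrm Y)) q = g (of_homV (v : homV Q (res_mod tinrm X)) q).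
Proof.
pose h (v : hom_mod Q X) : hom_mod Q Y := to_homV (fcomp (res_hom tinrm g) (of_homV (v : homV _ _))).
have hE v q : of_homV (h v : homV Q (res_mod tinrm Y)) q = g (of_homV (v : homV Q (res_mod tinrm X)) q).
  exact: to_homVK.
have hL : linear h.
  by move=> k u v; apply: homV_ext => q; rewrite of_homV_lin !hE of_homV_lin fhom_linear.
have hA a v : h (a · v) = a · h v.
  by apply: homV_ext => q; rewrite hE !hom_mod_act hE fhom_act.
by exists (FHom hL hA).
Qed.

(** Hom(P ⊗ Q, -) is Hom_A(P, Hom_B(Q, -)), a composite of two functors that preserve
    surjections. *)
Lemma projective_ext (P : fmod A) (Q : fmod B) :
  projective P -> projective Q -> projective (ext_mod P Q).
Proof.
move=> pP pQ M N g f gs; have [h hE] := hom_modS Q g.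
have hs : forall y, exists x, h x = y.
  move=> y; have [k kE] := pQ _ _ (res_hom tinrm g) (of_homV (y : homV _ _)) gs.
  exists (to_homV k); apply: homV_ext => q; rewrite hE to_homVK; exact: kE.
have [k kE] := pP _ _ h (curry f) hs.
exists (uncurry k); apply: (ext_hom_ext (f := fcomp g (uncurry k))) => p q.
by rewrite -[LHS]/(g (uncurry k _)) uncurryE -hE kE curryE.
Qed.
End External.

(** * Restriction, coinduction and induction *)

Section ResInd.
Variables (F : fieldType) (C B : falgType F) (phi : {lrmorphism C -> B}).

Lemma res_exact (L M N : fmod B) (i : fhom L M) (p : fhom M N) :
  short_exact i p -> short_exact (res_hom phi i) (res_hom phi p).
Proof. by []. Qed.

(* The coinduced module Hom_C(B, N), right adjoint to restriction.            *)
Section Coinduction.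
Variable N : fmod C.

Definition hom_pre (b : B) (f : fhom (left_via phi) N) : fhom (left_via phi) N.
Proof.
exists (fun x : B => f (x * b)) => [k u v|c x].
  by rewrite (mul_linl _ _ _) fhom_linear.
rewrite -fhom_act; congr (f _); exact: esym (mulrA _ _ _).
Defined.

Definition coind_mod : fmod B.
Proof.
exists (homV (left_via phi) N) (fun b h => to_homV (hom_pre b (of_homV h))).
- split=> [b|h] k u v; apply: homV_ext => x; rewrite of_homV_lin !to_homVK.
    exact: of_homV_lin.
  rewrite -[LHS]/(of_homV h ((x : B) * (k *: u + v) : left_via phi)) mul_linr.
  exact: fhom_linear.
- move=> h; apply: homV_ext => x; rewrite to_homVK.
  congr (of_homV h _); exact: mulr1.
- move=> a b h; apply: homV_ext => x; rewrite !to_homVK.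
  rewrite -[RHS]/(of_homV (to_homV (hom_pre b (of_homV h))) ((x : B) * a : left_via phi)).
  rewrite to_homVK; congr (of_homV h _); exact: mulrA.
Defined.

Lemma coind_act b (h : coind_mod) (x : B) :
  of_homV (b · h) (x : left_via phi) = of_homV (h : homV (left_via phi) N) (x * b).
Proof. exact: to_homVK. Qed.
End Coinduction.

(** Coinduction preserves surjections because [B] is projective over [C]; hence its left adjoint,
    restriction, preserves projectives. *)
Lemma projective_res (P : fmod B) :
  projective (left_via phi) -> projective P -> projective (res_mod phi P).
Proof.
move=> pB pP M N g f gs.
pose h (v : coind_mod M) : coind_mod N := to_homV (fcomp g (of_homV (v : homV _ _))).
have hE v x : of_homV (h v : homV (left_via phi) N) x = g (of_homV (v : homV (left_via phi) M) x).
  exact: to_homVK.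
have hL : linear h.
  by move=> k u v; apply: homV_ext => q; rewrite of_homV_lin !hE of_homV_lin fhom_linear.
have hA a v : h (a · v) = a · h v.
  by apply: homV_ext => q; rewrite hE !coind_act hE.
have hs : forall y, exists x, FHom hL hA x = y.
  move=> y; have [k kE] := pB _ _ g (of_homV (y : homV _ _)) gs.
  exists (to_homV k); apply: homV_ext => q; rewrite hE to_homVK; exact: kE.
have fpL p : linear (fun b : left_via phi => f ((b : B) · p)).
  by move=> k u v; rewrite (fact_bilin P).2 fhom_linear.
have fpA p c (b : left_via phi) : f ((c · b : B) · p) = c · f ((b : B) · p).
  by rewrite -fhom_act; congr (f _); exact: (@factM _ _ P (phi c) b p).
pose fp p : fhom (left_via phi) N := FHom (fpL p) (fpA p).
have f'L : linear (fun p : P => to_homV (fp p) : coind_mod N).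
  move=> k u v; apply: homV_ext => b; rewrite of_homV_lin !to_homVK.
  by rewrite -[LHS]/(f ((b : B) · _)) fact_linear fhom_linear.
have f'A b p : to_homV (fp (b · p)) = b · (to_homV (fp p) : coind_mod N).
  apply: homV_ext => x; rewrite coind_act !to_homVK.
  congr (f _); exact: esym (@factM _ _ P x b p).
have [k kE] := pP _ _ _ (FHom f'L f'A) hs.
(* Evaluation at 1 is the counit: it turns a morphism into the coinduced module into a morphism out
   of the restriction. *)
have k'L : linear (fun p : res_mod phi P => of_homV (k p : homV (left_via phi) M) (1 : B)).
  by move=> a u v; rewrite fhom_linear of_homV_lin.
have k'A c (p : res_mod phi P) : of_homV (k (c · p) : homV (left_via phi) M) (1 : B)
   = c · of_homV (k p : homV (left_via phi) M) (1 : B).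
  rewrite -fhom_act -[c · p]/(phi c · (p : P)) fhom_act coind_act mul1r; congr (of_homV _ _).
  by rewrite -[RHS]/(phi c * 1) mulr1.
exists (FHom k'L k'A) => p; rewrite -[LHS]/(g (of_homV (k p : homV (left_via phi) M) (1 : B))).
by rewrite -hE -[h (k p)]/(FHom hL hA (k p)) kE to_homVK -[LHS]/(f (1 · (p : P))) fact1.
Qed.

(** An isomorphism makes [B] the regular [C]-module. This serves the automorphisms of the
    conjugation and the interchange [tswap]. *)
Lemma bijective_left_via_projective (phi' : B -> C) :
  cancel phi phi' -> cancel phi' phi -> projective (left_via phi).
Proof.
move=> K K'; have L : linear (phi : reg_mod C -> left_via phi) by exact: linearP.
have Aa c (x : reg_mod C) : phi (c · x) = c · (phi x : left_via phi) by exact: rmorphM.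
apply: (projective_fiso _ (@projective_reg _ C)); apply: fiso_sym.
apply: (bij_fiso (f := FHom L Aa)) => [|y]; first exact: can_inj K.
by exists (phi' y); exact: K'.
Qed.

Section Ind.
Variable M : fmod C.

Lemma ind_pure_bilin : bilin (@ind_pure F C B phi M).
Proof.
split=> [b|m] k u v; rewrite /ind_pure.
  by rewrite (tens_bilin _ _).1 vpi_linear.
by rewrite (tens_bilin _ _).2 vpi_linear.
Qed.

Lemma ind_pure_act (b' b : B) (m : M) : b' · (ind_pure phi b m) = ind_pure phi (b' * b) m.
Proof.
rewrite [LHS](quot_actE (@bal_stable _ _ _ phi M)); congr (vpi _ _).
exact: tensl_actE.
Qed.

Lemma ind_pureE (b : B) (m : M) : ind_pure phi b m = b · ind_pure phi 1 m.
Proof. by rewrite ind_pure_act mulr1. Qed.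

Lemma ind_lin_ext (X : vectType F) (f g : ind_mod phi M -> X) : linear f -> linear g ->
  (forall b m, f (ind_pure phi b m) = g (ind_pure phi b m)) -> f =1 g.
Proof.
move=> lf lg fg x; rewrite -[x]vreprK; move: (vrepr _).
apply: (tens_ext (f := fun t => f (vpi _ t)) (g := fun t => g (vpi _ t))) => [k u v|k u v|b m].
- by rewrite vpi_linear lf.
- by rewrite vpi_linear lg.
exact: fg.
Qed.

Lemma ind_hom_ext (X : fmod B) (f g : fhom (ind_mod phi M) X) :
  (forall m, f (ind_pure phi 1 m) = g (ind_pure phi 1 m)) -> f =1 g.
Proof.
move=> fg; apply: ind_lin_ext => [||b m]; try exact: fhom_linear.
by rewrite ind_pureE !fhom_act fg.
Qed.

Definition ind_unit : fhom M (res_mod phi (ind_mod phi M)).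
Proof.
exists (fun m => ind_pure phi 1 m : res_mod phi (ind_mod phi M)) => [k u v|c m].
  exact: ind_pure_bilin.1.
by rewrite -ind_pure_bal mul1r [RHS]ind_pure_act mulr1.
Defined.

(** The target is only a vector space because the section built in [flat_retract] is F-linear but in
    general not [B]-linear. *)
Lemma ind_lin_lift (X : vectType F) (f : B -> M -> X) : bilin f ->
  (forall b c m, f (b * phi c) m = f b (c · m)) ->
  exists g : ind_mod phi M -> X,
    linear g /\ forall b m, g (ind_pure phi b m) = f b m.
Proof.
move=> bf fE; have lt := tlift_linear f.
have f0 t : t \in bal phi M -> tlift f t = 0.
  move=> tb; apply: (@bal_ind _ _ _ phi M (fun t => tlift f t = 0) _ _ _ t tb) => [|a x y x0 y0|b c m].
  - by rewrite (linear0f lt).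
  - by rewrite lt x0 y0 scaler0 addr0.
  by rewrite (linearBf lt) !tliftE // fE subrr.
exists (fun x => tlift f (vrepr (x : vquot _))); split=> [k u v|b m].
  by rewrite vrepr_linear lt.
rewrite -[RHS](tliftE b m bf); apply/esym/eqP; rewrite -subr_eq0 -(linearBf lt).
by apply/eqP/f0; exact: vpiK.
Qed.

Lemma ind_lift (X : fmod B) (f : fhom M (res_mod phi X)) :
  { g : fhom (ind_mod phi M) X | forall b m, g (ind_pure phi b m) = b · (f m : X) }.
Proof.
apply: cid; have [|b c m|g [gL gE]] := @ind_lin_lift X (fun b m => b · (f m : X)).
- split=> [b|m]; last exact: (fact_bilin X).2.
  by move=> k u v; rewrite fhom_linear (@fact_linear _ _ X).
- by rewrite factM fhom_act.
have gA b x : g (b · x) = b · g x.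
  move: x; apply: ind_lin_ext => [k u v|k u v|b' m].
  - by rewrite fact_linear gL.
  - by rewrite gL fact_linear.
  by rewrite ind_pure_act !gE factM.
by exists (FHom gL gA).
Qed.

(** Frobenius reciprocity. Composition with [ind_unit] and extension by [ind_lift] give the two
    inequalities. *)
Lemma dim_hom_ind (X : fmod B) : dim_hom (ind_mod phi M) X = dim_hom M (res_mod phi X).
Proof.
apply/eqP; rewrite eqn_leq; apply/andP; split.
  apply: (dim_hom_le (T := fun f => fcomp (res_hom phi f) ind_unit)) => [a f g h hE x|f f0 x].
    exact: hE.
  by apply: (ind_hom_ext (g := fzero _ _)) x => m; exact: f0.
apply: (dim_hom_le (T := fun f => sval (ind_lift f))) => [a f g h hE x|f f0 x].
  move: x; apply: ind_lin_ext => [||b m]; first exact: fhom_linear.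
    by move=> k u v; rewrite !fhom_linear !scalerDr addrACA !scalerA mulrC.
  by rewrite !(svalP (ind_lift _)) hE (@fact_linear _ _ X).
by rewrite -[LHS](@fact1 _ _ X) -(svalP (ind_lift f)) f0.
Qed.

(** Induction is left adjoint to restriction, which preserves surjections. *)
Lemma projective_ind : projective M -> projective (ind_mod phi M).
Proof.
move=> pM X Y g f gs.
have [h hE] := pM _ _ (res_hom phi g) (fcomp (res_hom phi f) ind_unit) gs.
exists (sval (ind_lift h)); apply: (ind_hom_ext (f := fcomp g _)) => m.
rewrite -[LHS]/(g (sval (ind_lift h) _)) (svalP (ind_lift h)) fact1.
by rewrite -[LHS]/(res_hom phi g (h m)) hE.
Qed.
End Ind.

Lemma ind_homE (M N : fmod C) (f : fhom M N) b m :
  ind_hom phi f (ind_pure phi b m) = ind_pure phi b (f m).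
Proof.
rewrite [LHS]quot_homE; congr (vpi _ _).
by rewrite -[LHS]/(tmap id f _) tmapE //; exact: fhom_linear.
Qed.

Definition rmulp (c : C) : tens B C -> tens B C := tmap id (fun c' => c' * c).
Definition mulp : tens B C -> B := tlift (fun b c => b * phi c).

Lemma mulpE b c : mulp (b ⊗ c) = b * phi c.
Proof.
by apply: tliftE; split=> [x|y] k u v; rewrite ?linearP ?mul_linr ?mul_linl.
Qed.

Lemma rmulpE c b c' : rmulp c (b ⊗ c') = b ⊗ (c' * c).
Proof. by rewrite /rmulp tmapE //; exact: mul_linl. Qed.

(* [B] is a direct summand of the free right [C]-module B ⊗ C.                *)
Definition flat : Prop := exists s : B -> tens B C,
  [/\ linear s, forall b c, s (b * phi c) = rmulp c (s b) & cancel s mulp].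

Definition rfree : fmod (aopp C).
Proof.
apply: (@FMod F (aopp C) (tens B C) (fun c x => rmulp (c : C) x)).
- split=> [c|x]; first exact: tmap_linear.
  apply: tlift_linear_param => b c k u v.
  by rewrite mul_linr (tens_bilin _ _).1.
- by move=> x; rewrite -[RHS]tmap_id; apply: eq_tmap => // c; exact: mulr1.
- move=> a b x; rewrite /rmulp tmap_comp //; try exact: mul_linl.
  by apply: eq_tmap => // c; exact: mulrA.
Defined.

(** Multiplication from the free right module B ⊗ C onto [B] is right [C]-linear and surjective, so
    it splits. *)
Lemma projective_flat : projective (right_via phi) -> flat.
Proof.
move=> pB; have mL : linear (mulp : rfree -> right_via phi) by exact: tlift_linear.
have mA (c : aopp C) (x : rfree) : mulp (c · x) = c · (mulp x : right_via phi).
  move: x; apply: tens_ext => [k u v|k u v|b c'].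
  - by rewrite (@fact_linear _ _ rfree) mL.
  - by rewrite mL (@fact_linear _ _ (right_via phi)).
  rewrite -[c · _]/(rmulp c _) rmulpE.
  by rewrite -[RHS]/(mulp (b ⊗ c') * phi c) !mulpE rmorphM mulrA.
have ms : forall y, exists x, FHom mL mA x = y.
  by move=> y; exists (y ⊗ 1); rewrite -[LHS]/(mulp _) mulpE rmorph1 mulr1.
have [s sE] := pB _ _ _ (fid _) ms.
exists s; split; [exact: (fhom_linear s)|move=> b c|exact: sE].
exact: (fhom_act s (c : aopp C)).
Qed.

Section Flat.
Hypothesis fphi : flat.

(** A section s of multiplication induces, naturally in [M], the F-linear section b ⊗ m ↦ s(b) m of
    the quotient map from B ⊗_F M to B ⊗_C M. Induction is thus a natural retract of B ⊗_F -. *)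
Lemma flat_retract : exists r : forall M : fmod C, ind_mod phi M -> tens B M,
  [/\ forall M, linear (r M),
      forall M x, vpi (bal phi M) (r M x) = x &
      forall M N (f : fhom M N) x, r N (ind_hom phi f x) = tmap id f (r M x)].
Proof.
have [s [sL sC sK]] := fphi.
pose g (M : fmod C) (b : B) (m : M) : tens B M := tmap id (fun c => c · m) (s b).
have bg (M : fmod C) : bilin (@g M).
  split=> [b|m]; last exact: linear_comp (tmap_linear _ _) sL.
  apply: tlift_linear_param => b' c k u v.
  by rewrite fact_linear (tens_bilin _ _).1.
have gC (M : fmod C) b c (m : M) : g M (b * phi c) m = g M b (c · m).
  rewrite /g sC /rmulp tmap_comp //.
  - by apply: eq_tmap => // c'; exact: factM.
  - exact: mul_linl.
  exact: (fact_bilin M).2.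
pose r (M : fmod C) := projT1 (cid (ind_lin_lift (bg M) (gC M))).
have rL M : linear (r M) by rewrite /r; case: cid => ? [].
have rE M b m : r M (ind_pure phi b m) = g M b m by rewrite /r; case: cid => ? [].
exists r; split=> // [M|M N f].
  apply: ind_lin_ext => [||b m] //.
    exact: linear_comp (@vpi_linear _ _ (bal phi M)) (rL M).
  rewrite rE /g -[in RHS](sK b); move: (s b).
  have lm : linear (fun c : C => c · m) by exact: (fact_bilin M).2.
  apply: (tens_ext (f := fun t => vpi (bal phi M) (tmap id (fun c => c · m) t))
    (g := fun t => ind_pure phi (mulp t) m)) => [||b' c].
  - exact: linear_comp (@vpi_linear _ _ (bal phi M)) (tmap_linear _ _).
  - by apply: linear_comp ((ind_pure_bilin M).2 m) _; exact: tlift_linear.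
  by rewrite tmapE // mulpE ind_pure_bal.
have lf := fhom_linear f.
apply: ind_lin_ext => [||b m].
- exact: linear_comp (rL N) (fhom_linear _).
- exact: linear_comp (tmap_linear _ _) (rL M).
rewrite ind_homE !rE /g tmap_comp //; last exact: (fact_bilin M).2.
by apply: eq_tmap => // c /=; rewrite fhom_act.
Qed.

(** A natural retract of the exact functor B ⊗_F - is exact. *)
Lemma ind_exact (L M N : fmod C) (i : fhom L M) (p : fhom M N) :
  short_exact i p -> short_exact (ind_hom phi i) (ind_hom phi p).
Proof.
move=> [ii ps ex]; have [r [rL rK rN]] := flat_retract.
have [] := @tmap_exactr _ B _ _ _ _ _ (fhom_linear i) (fhom_linear p) ii ps ex.
move=> ti tp tex; split.
- move=> x y e; rewrite -(rK _ x) -(rK _ y); congr (vpi _ _); apply: ti.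
  by rewrite -!rN e.
- move=> y; have [t tE] := tp (vrepr (y : vquot _)).
  exists (vpi (bal phi M) t); rewrite [LHS]quot_homE -[RHS]vreprK -tE; congr (vpi _ _).
move=> y; split=> [y0|[x <-]].
  have /tex [t tE] : tmap id p (r _ y) = 0 by rewrite -rN y0 (linear0f (rL N)).
  by exists (vpi (bal phi L) t); rewrite [LHS]quot_homE -[RHS]rK -tE; congr (vpi _ _).
move: x; apply: ind_lin_ext => [||b m].
- exact: linear_comp (fhom_linear _) (fhom_linear _).
- by move=> k u v; rewrite scaler0 addr0.
rewrite !ind_homE (_ : p (i m) = 0); last by apply/ex; exists m.
exact: linear0f ((ind_pure_bilin N).1 b).
Qed.
End Flat.
End ResInd.

(** * Flatness and projectivity of tensor products of algebra maps *)

Section FlatTensor.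
Variables (F : fieldType) (C B C' B' : falgType F).
Variables (phi : {lrmorphism C -> B}) (phi' : {lrmorphism C' -> B'}).

(** Tensor the two sections and interchange the inner factors; the identities are checked on pure
    tensors, one variable at a time. *)
Lemma flat_tmor : flat phi -> flat phi' -> flat (tmor phi phi').
Proof.
move=> [s [sL sC sK]] [s' [sL' sC' sK']].
pose w : tens (tens B C) (tens B' C') -> tens (tens B B') (tens C C') := @tswap_fun F B C B' C'.
have wL : linear w := @tswap_linear _ _ _ _ _.
have tL (U V U' V' : vectType F) (f : U -> U') (g : V -> V') := tmap_linear f g.
exists (fun x => w (tmap s s' x)); split.
- exact: linear_comp wL (tL _ _ _ _ _ _).
- move=> x y; move: x.
  apply: (tens_ext (f := fun x => w (tmap s s' (x * tmor phi phi' y)))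
     (g := fun x => rmulp y (w (tmap s s' x)))) => [||b b'].
  + by move=> k u v; rewrite mulrDl -scalerAl tL wL.
  + by move=> k u v; rewrite tL wL /rmulp tL.
  move: y; apply: (tens_ext (f := fun y => w (tmap s s' (b ⊗ b' * tmor phi phi' y)))
     (g := fun y => rmulp y (w (tmap s s' (b ⊗ b'))))) => [||c c'].
  + by move=> k u v; rewrite linearP mulrDr -scalerAr tL wL.
  + apply: tlift_linear_param => u v k x y.
    by rewrite mulrDr -scalerAr (tens_bilin _ _).1.
  have -> : tmor phi phi' (c ⊗ c') = phi c ⊗ phi' c'.
    by apply: tmapE; exact: linearP.
  rewrite tensM !tmapE // sC sC'; move: (s b) (s' b') => t t'.
  move: t'; apply: (tens_ext (f := fun t' => w (rmulp c t ⊗ rmulp c' t'))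
     (g := fun t' => rmulp (c ⊗ c') (w (t ⊗ t')))) => [||b2 c2].
  + by move=> k u v; rewrite /rmulp tL (tens_bilin _ _).1 wL.
  + by move=> k u v; rewrite (tens_bilin _ _).1 wL /rmulp tL.
  move: t; apply: (tens_ext (f := fun t => w (rmulp c t ⊗ rmulp c' (b2 ⊗ c2)))
     (g := fun t => rmulp (c ⊗ c') (w (t ⊗ (b2 ⊗ c2))))) => [||b1 c1].
  + by move=> k u v; rewrite /rmulp tL (tens_bilin _ _).2 wL.
  + by move=> k u v; rewrite (tens_bilin _ _).2 wL /rmulp tL.
  by rewrite !rmulpE /w !tswapE rmulpE tensM.
have mL (E D : falgType F) (f : {lrmorphism E -> D}) : linear (mulp f) by exact: tlift_linear.
apply: (tens_ext (g := id)) => [|//|b b'].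
  by move=> k u v; rewrite tL wL mL.
rewrite tmapE // -[in RHS](sK b) -[in RHS](sK' b'); move: (s b) (s' b') => t t'.
move: t'; apply: (tens_ext (f := fun t' => mulp (tmor phi phi') (w (t ⊗ t')))
   (g := fun t' => mulp phi t ⊗ mulp phi' t')) => [||b2 c2].
- by move=> k u v; rewrite (tens_bilin _ _).1 wL mL.
- by move=> k u v; rewrite mL (tens_bilin _ _).1.
move: t; apply: (tens_ext (f := fun t => mulp (tmor phi phi') (w (t ⊗ (b2 ⊗ c2))))
   (g := fun t => mulp phi t ⊗ mulp phi' (b2 ⊗ c2))) => [||b1 c1].
- by move=> k u v; rewrite (tens_bilin _ _).2 wL mL.
- by move=> k u v; rewrite mL (tens_bilin _ _).2.
rewrite /w tswapE !mulpE.
have -> : tmor phi phi' (c1 ⊗ c2) = phi c1 ⊗ phi' c2 by apply: tmapE; exact: linearP.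
by rewrite tensM.
Qed.

(** The identity map is an isomorphism onto the external product of the two restricted regular
    modules. *)
Lemma left_via_tmor : projective (left_via phi) -> projective (left_via phi') ->
  projective (left_via (tmor phi phi')).
Proof.
move=> pp pp'; apply: (projective_fiso _ (projective_ext pp pp')).
have fL : linear (id : left_via (tmor phi phi') -> ext_mod (left_via phi) (left_via phi')) by [].
have gL : linear (id : ext_mod (left_via phi) (left_via phi') -> left_via (tmor phi phi')) by [].
have gA : forall t (x : ext_mod (left_via phi) (left_via phi')),
    (t · x : left_via (tmor phi phi')) = t · (x : left_via (tmor phi phi')).
  apply: (ext_act_ext gL) => a b m n.
  rewrite -[RHS]/((tmor phi phi' (a ⊗ b) : tens B B') * (m ⊗ n)).
  have -> : tmor phi phi' (a ⊗ b) = phi a ⊗ phi' b by apply: tmapE; exact: linearP.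
  by rewrite tensM.
have fA t (x : left_via (tmor phi phi')) :
    (t · x : ext_mod (left_via phi) (left_via phi')) = t · (x : ext_mod (left_via phi) (left_via phi')).
  by rewrite gA.
by exists (FHom fL fA), (FHom gL gA).
Qed.
End FlatTensor.

(** * Grothendieck groups *)

Section AdditiveFun.
Variables (U V : zmodType) (f : U -> V).
Hypothesis zf : zmod_morphism f.
Let add : {additive U -> V} := HB.pack f (GRing.isZmodMorphism.Build _ _ _ zf).

Lemma addf0 : f 0 = 0. Proof. exact: (raddf0 add). Qed.
Lemma addfD x y : f (x + y) = f x + f y. Proof. exact: (raddfD add). Qed.
Lemma addfN x : f (- x) = - f x. Proof. exact: (raddfN add). Qed.
Lemma addfMz x n : f (x *~ n) = f x *~ n. Proof. exact: (raddfMz add). Qed.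
Lemma addf_sum I (r : seq I) (P : pred I) (E : I -> U) :
  f (\sum_(i <- r | P i) E i) = \sum_(i <- r | P i) f (E i).
Proof. exact: (raddf_sum add). Qed.
Definition additive_of : {additive U -> V} := add.
End AdditiveFun.

Lemma zmod_morphism_comp (U V W : zmodType) (g : V -> W) (f : U -> V) :
  zmod_morphism g -> zmod_morphism f -> zmod_morphism (g \o f).
Proof. by move=> zg zf x y; rewrite /= zf zg. Qed.

Lemma zmod_morphismD (U V : zmodType) (f : U -> V) :
  (forall x y, f (x + y) = f x + f y) -> zmod_morphism f.
Proof. by move=> fD x y; apply/eqP; rewrite eq_sym subr_eq -fD subrK. Qed.

Lemma subr_interchange (V : zmodType) (a b c d : V) : a - b - (c - d) = a - c - (b - d).
Proof. by rewrite !opprB addrACA [- b - c]addrC -addrACA. Qed.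

Lemma biadditiveP (U V W : zmodType) (b : U -> V -> W) :
  (forall y, zmod_morphism (b^~ y)) -> (forall x, zmod_morphism (b x)) -> biadditive b.
Proof.
by move=> bl br; split=> [x x' y|x y y']; [exact: (addfD (bl y)) | exact: (addfD (br x))].
Qed.

Lemma pgroup_ind (X : choiceType) (R : {freeg X / int} -> Prop) (Q : pgroup R -> Prop) :
  Q 0 -> (forall x y, Q x -> Q y -> Q (x - y)) -> (forall x, Q (pgen R x)) ->
  forall g, Q g.
Proof.
move=> Q0 QB Qg g.
have QN x : Q x -> Q (- x) by move=> Qx; rewrite -[- x]add0r; exact: QB.
have QD x y : Q x -> Q y -> Q (x + y) by move=> Qx Qy; rewrite -[y]opprK; exact/QB/QN.
have cz : zmod_morphism (pclass R) by exact: pclassB.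
have <- : pclass R (repr (g : {ideal_quot relspan R})) = g by exact: reprK.
rewrite -[repr _]freeg_sumE (addf_sum cz); elim/big_rec: _ => // x y _ Qy.
apply: (QD _ _ _ Qy); set k := coeff _ _.
have -> : pclass R << k *g x >> = pgen R x *~ k.
  by rewrite /pgen -(addfMz cz) freegU_mulz intz.
have Qn n : Q (pgen R x *+ n) by elim: n => // n IH; rewrite mulrS; exact: QD.
by case: k => n; [exact: Qn | exact/QN/Qn].
Qed.

Lemma pgen_rel (X : choiceType) (R : {freeg X / int} -> Prop) r : R r -> pclass R r = 0.
Proof.
move=> Rr; have -> : 0 = pclass R 0 :> pgroup R by have := pclassB R 0 0; rewrite !subrr.
apply/eqP; have := Quotient.idealrBE (relspan R : zmodClosed _) r 0.
rewrite subr0 => <-; apply/asboolP => S S0 SB SR; exact: SR.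
Qed.

(* [tok] singles out the modules that have a class: all of them for G_0, the  *)
(* projective ones for K_0; [theory] is what both groups have in common.      *)
Record theory (F : fieldType) (T : groth F) := Theory {
  tok : forall B : falgType F, fmod B -> Prop;
  tok_zero : forall (B : falgType F) (M : fmod B), is_zero_mod M -> tok M;
  tok_sum : forall (B : falgType F) (M N : fmod B), tok M -> tok N -> tok (sum_mod M N);
  tok_sumr : forall (B : falgType F) (M N : fmod B), tok (sum_mod M N) -> tok N;
  tok_fiso : forall (B : falgType F) (M N : fmod B), fiso M N -> tok N -> tok M;
  tok_reg : forall B : falgType F, tok (reg_mod B);
  tok_ext : forall (B C : falgType F) (M : fmod B) (N : fmod C),
    tok M -> tok N -> tok (ext_mod M N);
  tok_ind : forall (C B : falgType F) (phi : {lrmorphism C -> B}) (M : fmod C),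
    tok M -> tok (ind_mod phi M);
  tok_res : forall (C B : falgType F) (phi : {lrmorphism C -> B}) (M : fmod B),
    projective (left_via phi) -> tok M -> tok (res_mod phi M);
  gclass_exact : forall (B : falgType F) (L M N : fmod B) (i : fhom L M) (p : fhom M N),
    tok L -> tok M -> tok N -> short_exact i p ->
    gclass (g := T) M = gclass L + gclass N;
  gliftE : forall (B : falgType F) (W : zmodType) (f : fmod B -> W) (M : fmod B),
    (forall (L M N : fmod B) (i : fhom L M) (p : fhom M N),
      tok L -> tok M -> tok N -> short_exact i p -> f M = f L + f N) ->
    tok M -> glift (g := T) f (gclass M) = f M;
  gr_ind : forall (B : falgType F) (Q : gr T B -> Prop),
    Q 0 -> (forall x y, Q x -> Q y -> Q (x - y)) ->
    (forall M : fmod B, tok M -> Q (gclass M)) -> forall x, Q x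
}.

Lemma fiso_exact (F : fieldType) (B : falgType F) (L M N : fmod B) :
  fiso M (sum_mod L N) -> exists (i : fhom L M) (p : fhom M N), short_exact i p.
Proof.
move=> [f [g [fg gf]]]; exists (fcomp g (in1 L N)), (fcomp (pr2 L N) f); split.
- by move=> x y /= /(can_inj gf) [].
- by move=> y; exists (g (0, y)); rewrite -[LHS]/(f _).2 gf.
move=> y; rewrite -[fcomp _ _ _]/(f y).2; split=> [e|[x <-]].
  exists (f y).1; rewrite -[LHS]/(g (_, 0)) -[RHS]fg; congr (g _).
  by rewrite [RHS]surjective_pairing e.
by rewrite -[fcomp _ _ _]/(g (x, 0)) gf.
Qed.

(** The splitting makes classes in the split group K_0 additive on exact sequences of projectives,
    so that [theory] can treat K_0 and G_0 alike. *)
Lemma exact_fiso (F : fieldType) (B : falgType F) (L M N : fmod B)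
    (i : fhom L M) (p : fhom M N) :
  projective N -> short_exact i p -> fiso M (sum_mod L N).
Proof.
move=> pN [ii ps ex]; have [s sE] := pN _ _ p (fid N) ps.
apply: fiso_sym; apply: (bij_fiso (f := copair i s)) => [|y].
  apply: fhom_inj => -[x z]; rewrite -[LHS]/(i x + s z) => e.
  have z0 : z = 0.
    rewrite -[z]/(fid N z) -sE -[LHS]add0r -[X in X + _](_ : p (i x) = 0).
      by rewrite -fhomD e fhom0.
    by apply/ex; exists x.
  by congr (_, _) => //; apply: ii; rewrite fhom0 -e z0 fhom0 addr0.
have /ex [x xE] : p (y - s (p y)) = 0 by rewrite fhomB sE subrr.
by exists (x, p y); rewrite -[LHS]/(i x + s (p y)) xE subrK.
Qed.

Section ExactAdditive.
Variables (F : fieldType) (B : falgType F) (ok : fmod B -> Prop) (W : zmodType).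
Variable f : fmod B -> W.
Hypothesis ok0 : forall M, is_zero_mod M -> ok M.
Hypothesis ok_iso : forall M N : fmod B, fiso M N -> ok N -> ok M.
Hypothesis fA : forall (L M N : fmod B) (i : fhom L M) (p : fhom M N),
  ok L -> ok M -> ok N -> short_exact i p -> f M = f L + f N.

Lemma zero_is_zero : is_zero_mod (zero_mod B).
Proof. by move=> x; rewrite [x]thinmx0 [RHS]thinmx0. Qed.

(** For a zero module the sequence M → M → M is short exact, whence f M = f M + f M. *)
Lemma exact_additive0 M : is_zero_mod M -> f M = 0.
Proof.
move=> M0; have okM := ok0 M0.
have [i [p ip]] := fiso_exact (sum0_fiso M M0).
by have /eqP := fA okM okM okM ip; rewrite -[X in X == _]addr0 (inj_eq (addrI _)) => /eqP.
Qed.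

Lemma exact_additive_fiso M N : ok M -> fiso M N -> f M = f N.
Proof.
move=> okM iMN; have okN := ok_iso (fiso_sym iMN) okM.
have z0 := zero_is_zero.
have [i [p ip]] := fiso_exact (fiso_trans iMN (sum0_fiso N z0)).
by rewrite (fA (ok0 z0) okM okN ip) exact_additive0 // add0r.
Qed.
End ExactAdditive.

Section Theories.
Variable F : fieldType.

(** [G0_class] passes through [coord_mod], so it yields the generator of an isomorphic copy of [M].
    Relations involving a zero module identify the generators of isomorphic modules. *)
Lemma G0_class_cmod (B : falgType F) (M : cmod B) : G0_class M = pgen (@G0_rel F B) M.
Proof.
have rel (X Y Z : cmod B) (i : fhom X Y) (p : fhom Y Z) : short_exact i p ->
    pgen (@G0_rel F B) Y = pgen (@G0_rel F B) X + pgen (@G0_rel F B) Z.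
  move=> se; have := @pgen_rel _ (@G0_rel F B) (<< Y >> - << X >> - << Z >>).
  rewrite !pclassB => h; apply/eqP; rewrite -subr_eq0 opprD addrA h //.
  by exists X, Y, Z, i, p.
pose z := coord_mod (zero_mod B).
have z0 : is_zero_mod z.
  have [f [g [fg gf]]] := coord_mod_iso (zero_mod B).
  by move=> x; rewrite -(gf x) (zero_is_zero (g x)) fhom0.
have pz : pgen (@G0_rel F B) z = 0.
  have [i [p ip]] := fiso_exact (sum0_fiso z z0).
  by have /eqP := rel _ _ _ i p ip; rewrite -[X in X == _]addr0 (inj_eq (addrI _)) => /eqP.
have isoM : fiso (coord_mod M) M by apply/fiso_sym/coord_mod_iso.
have [i [p ip]] := fiso_exact (fiso_trans isoM (sum0_fiso M z0)).
by rewrite /G0_class (rel _ _ _ i p ip) pz add0r.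
Qed.

Lemma G0_class_exact (B : falgType F) (L M N : fmod B) (i : fhom L M) (p : fhom M N) :
  short_exact i p -> G0_class M = G0_class L + G0_class N.
Proof.
move=> [ii ps ex].
have [f [f' [ff' f'f]]] := coord_mod_iso L.
have [g [g' [gg' g'g]]] := coord_mod_iso M.
have [h [h' [hh' h'h]]] := coord_mod_iso N.
have := @pgen_rel _ (@G0_rel F B)
  (<< coord_mod M >> - << coord_mod L >> - << coord_mod N >>).
rewrite !pclassB => e; apply/eqP; rewrite -subr_eq0 opprD addrA e //.
exists (coord_mod L), (coord_mod M), (coord_mod N).
exists (fcomp g (fcomp i f')), (fcomp h (fcomp p g')); split=> //; split.
- by move=> x y /= /(can_inj gg') /ii /(can_inj f'f).
- move=> y; have [x xE] := ps (h' y); exists (g x).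
  by rewrite /= gg' xE h'h.
move=> y; split=> [/= y0|[x <-]].
  have /ex [x xE] : p (g' y) = 0 by apply: (can_inj hh'); rewrite y0 fhom0.
  by exists (f x); rewrite /= ff' xE g'g.
by rewrite /= gg' (_ : p _ = 0) ?fhom0 //; apply/ex; exists (f' x).
Qed.

(** Every module has a class, so [tok] is trivial; the definition is transparent so that [tok]
    computes. *)
Definition G_theoryP : theory (G_theory F).
Proof.
apply: (@Theory F (G_theory F) (fun B M => True)) => //.
- by move=> B L M N i p _ _ _; exact: G0_class_exact.
- move=> B W f M fA _.
  have fA' X Y Z (i : fhom X Y) (p : fhom Y Z) : short_exact i p -> f Y = f X + f Z by exact: fA.
  rewrite [LHS]pliftE => [|r [L [P [N [i [p [se ->]]]]]]].
    by apply: (exact_additive_fiso (ok := fun=> True)) => //; apply/fiso_sym/coord_mod_iso.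
  by rewrite !fgsumB !fgsum_gen (fA' _ _ _ _ _ se) addrAC addrK subrr.
- move=> B Q Q0 QB Qc; apply: pgroup_ind => // M.
  by rewrite -G0_class_cmod; exact: Qc.
Defined.

(** Discards the default value 0 of [K0_class]: the coordinate module of [M] is isomorphic to [P],
    hence projective. *)
Lemma K0_classE (B : falgType F) (P : pmod B) (M : fmod B) : fiso M P ->
  K0_class M = pgen (@K0_rel F B) P.
Proof.
have rel (X Y Z : pmod B) : fiso X (sum_mod Y Z) ->
    pgen (@K0_rel F B) X = pgen (@K0_rel F B) Y + pgen (@K0_rel F B) Z.
  move=> se; have := @pgen_rel _ (@K0_rel F B) (<< X >> - << Y >> - << Z >>).
  rewrite !pclassB => h; apply/eqP; rewrite -subr_eq0 opprD addrA h //.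
  by exists X, Y, Z.
have z0' : is_zero_mod (coord_mod (zero_mod B)).
  have [f [g [fg gf]]] := coord_mod_iso (zero_mod B).
  by move=> x; rewrite -(gf x) (zero_is_zero (g x)) fhom0.
pose z := PMod (projective_zero z0').
have z0 : is_zero_mod z by [].
have pz : pgen (@K0_rel F B) z = 0.
  have /eqP := rel _ _ _ (sum0_fiso z z0).
  by rewrite -[X in X == _]addr0 (inj_eq (addrI _)) => /eqP.
move=> iM; rewrite /K0_class; case: pselect => [pM|[]].
  have iP := fiso_trans (fiso_sym (coord_mod_iso M)) iM.
  by rewrite (@rel (PMod pM) z P) ?pz ?add0r //; exact: fiso_trans iP (sum0_fiso _ z0).
apply: projective_fiso (fiso_trans (fiso_sym (coord_mod_iso M)) iM) _.
exact: pmod_projective.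
Qed.

Definition pmod_of (B : falgType F) (M : fmod B) (pM : projective M) : pmod B :=
  PMod (projective_fiso (fiso_sym (coord_mod_iso M)) pM).

Lemma K0_class_pmod_of (B : falgType F) (M : fmod B) (pM : projective M) :
  K0_class M = pgen (@K0_rel F B) (pmod_of pM).
Proof. exact/K0_classE/coord_mod_iso. Qed.

Definition K_theoryP : theory (K_theory F).
Proof.
apply: (@Theory F (K_theory F) (fun B M => projective M)).
- by move=> B M; exact: projective_zero.
- by move=> B M N; exact: projective_sum.
- by move=> B M N; exact: projective_sumr.
- by move=> B M N; exact: projective_fiso.
- by move=> B; exact: projective_reg.
- by move=> B C M N; exact: projective_ext.
- by move=> C B phi M; exact: projective_ind.
- by move=> C B phi M; exact: projective_res.
- move=> B L M N i p pL pM pN se.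
  have := @pgen_rel _ (@K0_rel F B) (<< pmod_of pM >> - << pmod_of pL >> - << pmod_of pN >>).
  rewrite !pclassB => h; apply/eqP.
  rewrite /= (K0_class_pmod_of pM) (K0_class_pmod_of pL) (K0_class_pmod_of pN).
  rewrite -subr_eq0 opprD addrA h //; exists (pmod_of pM), (pmod_of pL), (pmod_of pN); split=> //.
  apply: fiso_trans (fiso_sym (coord_mod_iso M)) _.
  apply: fiso_trans (exact_fiso pN se) _.
  by apply: sum_fiso; exact: coord_mod_iso.
- move=> B W f M fA pM; rewrite /= (K0_class_pmod_of pM).
  rewrite /K0_lift pliftE => [|r [P [Q [R [iP ->]]]]].
    apply: (exact_additive_fiso (ok := fun M => projective M) _ _ fA).
    + exact: projective_zero.
    + exact: projective_fiso.
    + exact: pmod_projective.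
    by apply/fiso_sym/coord_mod_iso.
  have [i [p ip]] := fiso_exact iP.
  have e : f P = f Q + f R by apply: (fA _ _ _ i p) => //; exact: pmod_projective.
  by rewrite !fgsumB !fgsum_gen e addrAC addrK subrr.
- move=> B Q Q0 QB Qc; apply: pgroup_ind => // P.
  rewrite -(K0_classE (fiso_refl P)); apply: Qc; exact: pmod_projective.
Defined.
End Theories.

Section TheoryLemmas.
Variables (F : fieldType) (T : groth F) (th : theory T).
Local Notation ok := (tok th).
Local Notation cl := (gclass (g := T)).

Definition exactly_additive (B : falgType F) (W : zmodType) (f : fmod B -> W) : Prop :=
  forall (L M N : fmod B) (i : fhom L M) (p : fhom M N),
    ok L -> ok M -> ok N -> short_exact i p -> f M = f L + f N.

Lemma glift_class (B : falgType F) (W : zmodType) (f : fmod B -> W) M :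
  exactly_additive f -> ok M -> glift f (cl M) = f M.
Proof. exact: gliftE. Qed.

Lemma gclass0 (B : falgType F) (M : fmod B) : is_zero_mod M -> cl M = 0.
Proof.
by apply: (exact_additive0 (ok := @tok _ _ th B)); [exact: tok_zero|exact: gclass_exact].
Qed.

Lemma gclass_fiso (B : falgType F) (M N : fmod B) : ok M -> fiso M N -> cl M = cl N.
Proof.
apply: (exact_additive_fiso (ok := @tok _ _ th B)).
- exact: tok_zero.
- exact: tok_fiso.
exact: gclass_exact.
Qed.

Lemma gclass_sum (B : falgType F) (M N : fmod B) : ok M -> ok N ->
  cl (sum_mod M N) = cl M + cl N.
Proof.
move=> oM oN; have [i [p ip]] := fiso_exact (fiso_refl (sum_mod M N)).
exact: gclass_exact oM (tok_sum oM oN) oN ip.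
Qed.

Lemma tok_bigsum (B : falgType F) (I : finType) (M : I -> fmod B) :
  (forall i, ok (M i)) -> ok (bigsum M).
Proof.
move=> oM; rewrite /bigsum; elim: (enum I) => [|i s IH] /=; last exact: tok_sum.
by apply: tok_zero; exact: zero_is_zero.
Qed.

Lemma gclass_bigsum (B : falgType F) (I : finType) (M : I -> fmod B) :
  (forall i, ok (M i)) -> cl (bigsum M) = \sum_i cl (M i).
Proof.
move=> oM; rewrite /bigsum -big_enum /=.
have h (s : seq I) : ok (sums s M) /\ cl (sums s M) = \sum_(i <- s) cl (M i).
  elim: s => [|i s [oS IH]] /=; last by rewrite big_cons -IH gclass_sum //; split=> //; exact: tok_sum.
  rewrite big_nil gclass0; last exact: zero_is_zero.
  by split=> //; apply: tok_zero; exact: zero_is_zero.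
by have [] := h (enum I).
Qed.

Lemma res_gr_additive (C B : falgType F) (phi : {lrmorphism C -> B}) :
  projective (left_via phi) -> exactly_additive (fun M : fmod B => cl (res_mod phi M)).
Proof.
move=> pphi L M N i p oL oM oN se.
by apply: (gclass_exact (t := th) _ _ _ (res_exact phi se)); exact: tok_res.
Qed.

Lemma ind_gr_additive (C B : falgType F) (phi : {lrmorphism C -> B}) :
  flat phi -> exactly_additive (fun M : fmod C => cl (ind_mod phi M)).
Proof.
move=> fphi L M N i p oL oM oN se.
by apply: (gclass_exact (t := th) _ _ _ (ind_exact fphi se)); exact: tok_ind.
Qed.

Lemma ext_gr_additiver (B C : falgType F) (M : fmod B) : ok M ->
  exactly_additive (fun N : fmod C => cl (ext_mod M N)).
Proof.
move=> oM L N P i p oL oN oP se.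
by apply: (gclass_exact (t := th) _ _ _ (ext_exactr M se)); exact: tok_ext.
Qed.

(** [ext_gr] lifts in the first variable with an arbitrary class [y] in the second; induction on [y]
    reduces to the class of a module. *)
Lemma ext_gr_additivel (B C : falgType F) (y : gr T C) :
  exactly_additive (fun M : fmod B => glift (fun N => cl (ext_mod M N)) y).
Proof.
move=> L M N i p oL oM oN se; move: y; apply: (gr_ind (t := th)).
- by rewrite !glift0 addr0.
- by move=> x y ex ey; rewrite !glift_additive ex ey opprD addrACA.
move=> P oP; rewrite !glift_class //; try exact: ext_gr_additiver.
by apply: (gclass_exact (t := th) _ _ _ (ext_exactl P se)); exact: tok_ext.
Qed.

Lemma ext_gr_class (B C : falgType F) (M : fmod B) (N : fmod C) : ok M -> ok N ->
  ext_gr (cl M) (cl N) = cl (ext_mod M N).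
Proof.
move=> oM oN; rewrite /ext_gr glift_class //; last exact: ext_gr_additivel.
by rewrite glift_class //; exact: ext_gr_additiver.
Qed.

Lemma ext_gr_zmodl (B C : falgType F) (y : gr T C) :
  zmod_morphism (fun x : gr T B => ext_gr x y).
Proof. exact: glift_additive. Qed.

Lemma ext_gr_zmodr (B C : falgType F) (x : gr T B) :
  zmod_morphism (fun y : gr T C => ext_gr x y).
Proof.
move=> y y'; move: x; apply: (gr_ind (t := th)).
- by rewrite !(addf0 (ext_gr_zmodl _)) subr0.
- by move=> x x' ex ex'; rewrite !(ext_gr_zmodl _) ex ex' subr_interchange.
move=> M oM; rewrite /ext_gr !glift_class //; try exact: ext_gr_additivel.
exact: glift_additive.
Qed.

Lemma ext_gr_biadditive (B C : falgType F) : biadditive (@ext_gr F T B C).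
Proof. by apply: biadditiveP; [exact: ext_gr_zmodl|exact: ext_gr_zmodr]. Qed.
End TheoryLemmas.

(** * The pairing of K_0 and G_0 of one algebra *)

Section Pairing.
Variables (F : fieldType) (B : falgType F).

Lemma G0_lift_class (W : zmodType) (f : fmod B -> W) M :
  exactly_additive (G_theoryP F) f -> G0_lift f (G0_class M) = f M.
Proof. by move=> fA; exact: (glift_class (th := G_theoryP F) fA). Qed.

Lemma K0_lift_class (W : zmodType) (f : fmod B -> W) M :
  exactly_additive (K_theoryP F) f -> projective M -> K0_lift f (K0_class M) = f M.
Proof. exact: (glift_class (th := K_theoryP F)). Qed.

Lemma K0_class_sum (P Q : fmod B) : projective P -> projective Q ->
  K0_class (sum_mod P Q) = K0_class P + K0_class Q.
Proof. exact: (gclass_sum (th := K_theoryP F)). Qed.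

Lemma K0_class0 (P : fmod B) : is_zero_mod P -> K0_class P = 0.
Proof. exact: (gclass0 (K_theoryP F)). Qed.

Lemma K0_class_fiso (P Q : fmod B) : projective P -> fiso P Q -> K0_class P = K0_class Q.
Proof. exact: (gclass_fiso (th := K_theoryP F)). Qed.

Lemma G0_class0 (M : fmod B) : is_zero_mod M -> G0_class M = 0.
Proof. exact: (gclass0 (G_theoryP F)). Qed.

Lemma G0_class_fiso (M N : fmod B) : fiso M N -> G0_class M = G0_class N.
Proof. exact: (gclass_fiso (th := G_theoryP F)). Qed.

Lemma dim_hom_additiver (P : fmod B) : projective P ->
  exactly_additive (G_theoryP F) (fun M : fmod B => (dim_hom P M)%:Z).
Proof. by move=> pP L M N i p _ _ _ se; rewrite (dim_hom_exactr pP se). Qed.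

(** Exact sequences of projectives split, so Hom(-, M) turns them into direct sums. *)
Lemma dim_hom_additivel (y : G0 B) :
  exactly_additive (K_theoryP F) (fun P : fmod B => G0_lift (fun M => (dim_hom P M)%:Z) y).
Proof.
move=> L M N i p pL pM pN se; move: y; apply: (gr_ind (t := G_theoryP F)).
- by rewrite !(addf0 (G0_lift_additive _)) addr0.
- by move=> x y ex ey; rewrite !G0_lift_additive ex ey opprD addrACA.
move=> P _.
rewrite !G0_lift_class //; try exact: dim_hom_additiver.
by rewrite (fiso_dim_hom (exact_fiso pN se) (fiso_refl P)) dim_hom_suml.
Qed.

Lemma KG_pairing_class (P M : fmod B) : projective P ->
  KG_pairing (K0_class P) (G0_class M) = dim_hom P M.
Proof.
move=> pP; rewrite /KG_pairing K0_lift_class //; last exact: dim_hom_additivel.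
by rewrite G0_lift_class //; exact: dim_hom_additiver.
Qed.

Lemma KG_pairing_zmodl (y : G0 B) : zmod_morphism (fun x : K0 B => KG_pairing x y).
Proof. exact: K0_lift_additive. Qed.

Lemma KG_pairing_zmodr (x : K0 B) : zmod_morphism (fun y : G0 B => KG_pairing x y).
Proof.
move=> y y'; move: x; apply: (gr_ind (t := K_theoryP F)).
- by rewrite !(addf0 (KG_pairing_zmodl _)) subr0.
- by move=> x x' ex ex'; rewrite !(KG_pairing_zmodl _) ex ex' subr_interchange.
move=> P pP; rewrite /KG_pairing !K0_lift_class //; try exact: dim_hom_additivel.
exact: G0_lift_additive.
Qed.

Lemma KG_pairingMzl (u : K0 B) n (x : G0 B) : KG_pairing (u *~ n) x = KG_pairing u x * n.
Proof. by rewrite (addfMz (KG_pairing_zmodl x)) -mulrzr intz. Qed.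

Lemma KG_pairingMzr (u : K0 B) n (x : G0 B) : KG_pairing u (x *~ n) = KG_pairing u x * n.
Proof. by rewrite (addfMz (KG_pairing_zmodr u)) -mulrzr intz. Qed.

Lemma KG_pairing_suml I (r : seq I) (E : I -> K0 B) (x : G0 B) :
  KG_pairing (\sum_(i <- r) E i) x = \sum_(i <- r) KG_pairing (E i) x.
Proof. exact: (addf_sum (KG_pairing_zmodl x)). Qed.

Lemma KG_pairing_sumr I (r : seq I) (u : K0 B) (E : I -> G0 B) :
  KG_pairing u (\sum_(i <- r) E i) = \sum_(i <- r) KG_pairing u (E i).
Proof. exact: (addf_sum (KG_pairing_zmodr u)). Qed.
End Pairing.

(** * Algebras whose Cartan pairing is perfect *)

Section TensorCoordinates.
Variables (F : fieldType) (U V : vectType F).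

(** Contraction of the first factor with the i-th coordinate functional. *)
Definition tcoord (i : 'I_(\dim {:U})) : tens U V -> V :=
  tlift (fun u v => coord (vbasis {:U}) i u *: v).

Lemma tcoord_linear i : linear (tcoord i). Proof. exact: tlift_linear. Qed.

Lemma tcoordE i u v : tcoord i (u ⊗ v) = coord (vbasis {:U}) i u *: v.
Proof.
apply: tliftE; split=> [x|y] a s t /=; first by rewrite scalerDr !scalerA mulrC.
by rewrite linearP scalerDl scalerA.
Qed.

Lemma tens_coord (t : tens U V) : t = \sum_(i < \dim {:U}) (vbasis {:U})`_i ⊗ tcoord i t.
Proof.
apply: (tens_ext (f := id)
  (g := fun t => \sum_(i < \dim {:U}) (vbasis {:U})`_i ⊗ tcoord i t)) => [//||u v].
  move=> a x y; rewrite scaler_sumr -big_split; apply: eq_bigr => i _ /=.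
  by rewrite tcoord_linear (tens_bilin _ _).1.
rewrite {1}(coord_vbasis (memvf u)) (bilin_suml (@tens_bilin _ _ _)).
apply: eq_bigr => i _; rewrite tcoordE.
by rewrite (bilinZl (@tens_bilin _ _ _)) (bilinZr (@tens_bilin _ _ _)).
Qed.

Lemma vect_coord0 (u : U) : (forall i, coord (vbasis {:U}) i u = 0) -> u = 0.
Proof.
by move=> u0; rewrite (coord_vbasis (memvf u)) big1 // => i _; rewrite u0 scale0r.
Qed.
End TensorCoordinates.

(** * Hom spaces between external products *)

Section DimHomExt.
Variables (F : fieldType) (A B : falgType F).
Variables (P U : fmod A) (Q V : fmod B).

Let d := \dim {:homV Q V}.
Let psi (k : 'I_d) : homV Q V := (vbasis {:homV Q V})`_k.

(** A coordinate functional of [U] turns the hypothesis into a linear relation between the basis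
    vectors psi_k. *)
Lemma psi_free (u : 'I_d -> U) :
  (forall q, \sum_k u k ⊗ of_homV (psi k) q = 0 :> tens U V) -> forall k, u k = 0.
Proof.
move=> u0 k; apply: vect_coord0 => i.
have /freeP fr := basis_free (vbasisP {:homV Q V}).
apply: (fr (fun k => coord (vbasis {:U}) i (u k))); apply: homV_ext => q.
rewrite of_homV0 -[RHS](linear0f (@tcoord_linear _ U V i)) -(u0 q).
rewrite (linear_sumf (@tcoord_linear _ U V i)).
rewrite (linear_sumf (f := fun v : homV Q V => of_homV v q)) => [|a v w]; last exact: of_homV_lin.
apply: eq_bigr => l _; rewrite tcoordE.
by rewrite (linearZf (f := fun v : homV Q V => of_homV v q)) // => a v w; exact: of_homV_lin.
Qed.

(** For fixed p, each [U]-coordinate of q ↦ f(p ⊗ q) lies in Hom_B(Q, V) and expands in the basis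
    psi. By [psi_free] the resulting coefficients are unique, so they are linear and [A]-equivariant
    in p. *)
Lemma ext_hom_coord (f : fhom (ext_mod P Q) (ext_mod U V)) :
  exists g : 'I_d -> fhom P U, forall p q,
    f (p ⊗ q) = \sum_k g k p ⊗ of_homV (psi k) q.
Proof.
have lp (p : P) i : linear (fun q : Q => tcoord i (f (p ⊗ q) : tens U V)).
  by move=> a x y; rewrite (tens_bilin _ _).1 fhom_linear tcoord_linear.
have lb (p : P) i b (q : Q) : tcoord i (f (p ⊗ (b · q)) : tens U V) = b · tcoord i (f (p ⊗ q) : tens U V).
  have -> : p ⊗ (b · q) = (1 ⊗ b : tens A B) · (p ⊗ q : ext_mod P Q).
    by rewrite ext_pure fact1.
  rewrite fhom_act; move: (f _).
  apply: (tens_ext (f := fun t : tens U V => tcoord i ((1 ⊗ b : tens A B) · (t : ext_mod U V)) : V)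
    (g := fun t : tens U V => b · (tcoord i t : V))) => [a x y|a x y|u v].
  - by rewrite (@fact_linear _ _ (ext_mod U V)) tcoord_linear.
  - by rewrite tcoord_linear fact_linear.
  have -> : (1 ⊗ b : tens A B) · (u ⊗ v : ext_mod U V) = u ⊗ (b · v) :> tens U V.
    by rewrite ext_pure fact1.
  by rewrite !tcoordE (linearZf (@fact_linear _ _ V b)).
pose h p i : homV Q V := to_homV (FHom (lp p i) (lb p i)).
have [u uE] : exists u : P -> {ffun 'I_d -> U}, forall p q,
    f (p ⊗ q) = \sum_k u p k ⊗ of_homV (psi k) q.
  exists (fun p => [ffun k => \sum_i coord (vbasis {:homV Q V}) k (h p i) *: (vbasis {:U})`_(nat_of_ord i)]).
  move=> p q; rewrite [LHS](@tens_coord _ U V).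
  under eq_bigr => i _.
    rewrite -[tcoord _ _]/(FHom (lp p i) (lb p i) q) -to_homVK -/(h p i).
    rewrite (coord_vbasis (memvf (h p i))).
    rewrite (linear_sumf (f := fun v : homV Q V => of_homV v q)) => [|a v w]; last exact: of_homV_lin.
    rewrite (bilin_sumr (@tens_bilin _ _ _)).
    over.
  rewrite exchange_big; apply: eq_bigr => k _.
  rewrite ffunE (bilin_suml (@tens_bilin _ _ _)); apply: eq_bigr => i _.
  rewrite (linearZf (f := fun v : homV Q V => of_homV v q)) => [|a v w]; last exact: of_homV_lin.
  by rewrite (bilinZl (@tens_bilin _ _ _)) (bilinZr (@tens_bilin _ _ _)).
have uniq (v w : 'I_d -> U) :
    (forall q, \sum_k v k ⊗ of_homV (psi k) q = \sum_k w k ⊗ of_homV (psi k) q :> tens U V) -> v =1 w.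
  move=> vw k; apply/eqP; rewrite -subr_eq0; apply/eqP; move: k.
  apply: (psi_free (u := fun k => v k - w k)) => q.
  under eq_bigr => k _ do rewrite (linearBf ((@tens_bilin _ U V).2 _)).
  by rewrite sumrB vw subrr.
have uL k : linear (fun p => u p k).
  move=> a x y.
  apply: (uniq (fun k => u (a *: x + y) k) (fun k => a *: u x k + u y k)) => q.
  rewrite -uE (tens_bilin _ _).2 fhom_linear !uE scaler_sumr -big_split; apply: eq_bigr => l _.
  by rewrite (tens_bilin _ _).2.
have uA k a p : u (a · p) k = a · u p k.
  apply: (uniq (fun k => u (a · p) k) (fun k => a · u p k)) => q.
  rewrite -uE.
  have -> : (a · p) ⊗ q = (a ⊗ 1 : tens A B) · (p ⊗ q : ext_mod P Q).
    by rewrite ext_pure fact1.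
  rewrite fhom_act uE (linear_sumf (@fact_linear _ _ (ext_mod U V) _)).
  by apply: eq_bigr => l _; rewrite ext_pure fact1.
by exists (fun k => FHom (uL k) (uA k)) => p q; rewrite uE.
Qed.

(** The Hom space is Hom_A(P, U) ⊗ Hom_B(Q, V), modelled by d-tuples in Hom_A(P, U) with d the
    dimension of Hom_B(Q, V). *)
Lemma dim_hom_ext : dim_hom (ext_mod P Q) (ext_mod U V) = (dim_hom P U * dim_hom Q V)%N.
Proof.
have dE : \dim {:{ffun 'I_d -> homV P U}} = (dim_hom P U * dim_hom Q V)%N.
  by rewrite !dimvf /dim /= card_ord mulnC -dim_homV /d !dimvf.
have bil (g : {ffun 'I_d -> homV P U}) :
    bilin (fun p q => \sum_k of_homV (g k) p ⊗ of_homV (psi k) q : ext_mod U V).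
  split=> [p|q] a x y; rewrite scaler_sumr -big_split; apply: eq_bigr => k _.
    by rewrite fhom_linear (tens_bilin _ _).1.
  by rewrite fhom_linear (tens_bilin _ _).2.
have act (g : {ffun 'I_d -> homV P U}) a b p q :
    \sum_k of_homV (g k) (a · p) ⊗ of_homV (psi k) (b · q) =
    (a ⊗ b : tens A B) · (\sum_k of_homV (g k) p ⊗ of_homV (psi k) q : ext_mod U V).
  rewrite (linear_sumf (@fact_linear _ _ (ext_mod U V) _)).
  by apply: eq_bigr => l _; rewrite ext_pure !fhom_act.
rewrite -dE; apply/eqP; rewrite eqn_leq; apply/andP; split; last first.
  apply: (dim_hom_geV (T := fun g => ext_lift (bil g) (act g))) => [a g h|g g0].
    apply: (ext_hom_ext (g := fadd (fscale a _) _)) => p q.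
    rewrite -[RHS]/(a *: ext_lift (bil g) (act g) _ + ext_lift (bil h) (act h) _) !ext_liftE.
    rewrite scaler_sumr -big_split; apply: eq_bigr => k _.
    by rewrite !ffunE of_homV_lin (tens_bilin _ _).2.
  apply/ffunP => k; rewrite ffunE; apply: homV_ext => p; rewrite of_homV0.
  apply: (psi_free (u := fun k => of_homV (g k) p)) => q.
  by rewrite -[LHS](ext_liftE (bil g) (act g)).
pose T f := projT1 (cid (ext_hom_coord f)).
have TE (f : fhom (ext_mod P Q) (ext_mod U V)) p q : f (p ⊗ q) = \sum_k T f k p ⊗ of_homV (psi k) q.
  by rewrite /T; case: cid.
apply: (dim_hom_leV (T := fun f => [ffun k => to_homV (T f k)])) => [a f g h hE|f f0].
  apply/ffunP => k; rewrite !ffunE; apply: homV_ext => p; rewrite of_homV_lin !to_homVK.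
  apply/eqP; rewrite -subr_eq0; apply/eqP; move: k.
  apply: (psi_free (u := fun k => T h k p - (a *: T f k p + T g k p))) => q.
  under eq_bigr => k _ do rewrite (linearBf ((@tens_bilin _ U V).2 _)) (tens_bilin _ _).2.
  rewrite sumrB -TE big_split -scaler_sumr /= -!TE hE subrr //.
apply: (ext_hom_ext (g := fzero _ _)) => p q; rewrite TE big1 // => k _.
have := congr1 (fun g : {ffun 'I_d -> homV P U} => g k) f0; rewrite !ffunE => e.
by rewrite -(to_homVK (T f k) p) e of_homV0 (linear0f ((@tens_bilin _ U V).2 _)).
Qed.
End DimHomExt.

(** * Simple modules, projective covers and dual bases *)

Section PerfectAlgebra.
Variables (F : fieldType) (B : falgType F).
Implicit Types M N P S T : fmod B.
Local Notation z := (zero_mod B).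

(** Composition series as an induction principle: a nonzero module has a simple submodule, with
    quotient of smaller dimension. *)
Lemma module_ind (Q : fmod B -> Prop) :
  (forall M, is_zero_mod M -> Q M) ->
  (forall S M N (i : fhom S M) (p : fhom M N), simple S -> short_exact i p -> Q N -> Q M) ->
  forall M, Q M.
Proof.
move=> Q0 QS M; have [n] := ubnP (\dim {:M}); elim: n M => // n IH M dM.
case: (pselect (is_zero_mod M)) => [|nM]; first exact: Q0.
have [|S [i [sS ii]]] := @simple_sub _ _ M.
  by apply: contrapT => h; apply: nM => x; apply: contrapT => x0; apply: h; exists x.
have dS := simple_dim_gt0 sS; apply: QS sS (im_short_exact ii) (IH _ _).
move: dM; rewrite ltnS (short_exact_dim (im_short_exact ii)); apply: leq_trans.
by rewrite -add1n leq_add2r.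
Qed.

Lemma factor_surj M N P (p : fhom M N) (f : fhom M P) :
  (forall y, exists x, p x = y) -> (forall x, p x = 0 -> f x = 0) ->
  exists g : fhom N P, forall x, g (p x) = f x.
Proof.
move=> ps pf; have /choice [s sE] := ps.
have fs y : f (s (p y)) = f y.
  by apply/eqP; rewrite -subr_eq0 -fhomB; apply/eqP/pf; rewrite fhomB sE subrr.
have gL : linear (fun y => f (s y)).
  by move=> a x y; rewrite -fhom_linear -[RHS]fs fhom_linear !sE.
have gA b y : f (s (b · y)) = b · f (s y).
  by rewrite -fhom_act -[RHS]fs fhom_act sE.
by exists (FHom gL gA) => x; exact: fs.
Qed.

(** Distinctness has to hold up to isomorphism, so it is stated on indices; [z] is only the default
    of [nth]. *)
Definition simple_list (l : seq (fmod B)) : Prop :=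
  (forall i, (i < size l)%N -> simple (nth z l i)) /\
  (forall i j, (i < size l)%N -> (j < size l)%N ->
     fiso (nth z l i) (nth z l j) -> i = j).

(** A nonzero morphism from [M] to [T] is nonzero on the simple submodule or factors through the
    quotient, so each step adds at most one simple module. Since [dim_hom_reg] gives every simple
    module a morphism from the regular module, the list for that module is complete. *)
Lemma simple_list_exists M : exists l, simple_list l /\
  forall T, simple T -> (0 < dim_hom M T)%N ->
    exists i, (i < size l)%N /\ fiso T (nth z l i).
Proof.
move: M; apply: module_ind => [M M0|S M N i p sS [ii ps ex] [l [[lS lD] lM]]].
  exists [::]; split=> // T _; rewrite (dim_hom_eq0 M T).2 // => f x.
  by rewrite (M0 x) fhom0.
have key T (f : fhom M T) : simple T -> (exists x, f x <> 0) ->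
    fiso T S \/ (0 < dim_hom N T)%N.
  move=> sT f0; case: (pselect (exists x, f (i x) <> 0)) => [h|h].
    by left; apply: fiso_sym; exact: (simple_iso (f := fcomp f i)) h.
  right; apply/dim_hom_gt0.
  have fi x : f (i x) = 0 by apply: contrapT => h'; apply: h; exists x.
  have [x px|g gE] := factor_surj (f := f) ps; first by have [x' <-] := (ex x).1 px.
  by exists g; have [x x0] := f0; exists (p x); rewrite gE.
case: (pselect (exists i, (i < size l)%N /\ fiso S (nth z l i))) => [[k [kl Sk]]|nS].
  exists l; split=> // T sT /dim_hom_gt0 [f f0].
  have [TS|] := key T f sT f0; last exact: lM.
  by exists k; split=> //; exact: fiso_trans TS Sk.
exists (S :: l); split; last first.
  move=> T sT /dim_hom_gt0 [f f0]; have [TS|dN] := key T f sT f0; first by exists 0%N.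
  by have [k [kl Tk]] := lM T sT dN; exists k.+1.
split=> [[|k] //|]; first exact: lS.
move=> [|k] [|k'] //= kl kl' e; [case: nS|case: nS|by congr _.+1; exact: lD].
- by exists k'.
- by exists k; split=> //; exact: fiso_sym.
Qed.

(** Otherwise [g] maps the kernel of [p] onto [T], and (p, g) maps [P] onto S ⊕ T. A lift h of (p,
    0) through (p, g) satisfies p h = p and g h = 0; the first makes h onto, and then g = 0. *)
Lemma cover_hom P S (p : fhom P S) T (g : fhom P T) :
  simple S -> proj_cover p -> simple T -> forall x, p x = 0 -> g x = 0.
Proof.
move=> sS [pP ps pC] sT x px; apply: contrapT => gx.
pose sK := @ker_stable _ _ _ _ p.
have /(sub_inclP sK) [k kE] : x \in ker p by apply/kerP.
have gs : forall t, exists k, g (sub_incl sK k) = t.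
  by apply: (simple_surj (f := fcomp g (sub_incl sK))) => //; exists k; rewrite -[fcomp _ _ _]/(g (sub_incl sK k)) kE.
have pgs : forall y, exists x, pair_hom p g x = y.
  move=> [s t]; have [y yE] := ps s; have [l lE] := gs (t - g y).
  exists (y + sub_incl sK l); rewrite -[LHS]/(p _, g _) !fhomD yE lE [g y + _]addrC subrK.
  by have /kerP -> := sub_incl_in l; rewrite addr0.
have [h hE] := pP _ _ _ (pair_hom p (fzero P T)) pgs.
have [|_ hs] := pC h; first by move=> y; have := hE y; rewrite -[LHS]/(_, _) => -[].
have [y yE] := hs x; apply: gx; rewrite -yE.
by have := hE y; rewrite -[LHS]/(_, _) => -[].
Qed.

Lemma dim_hom_cover P S (p : fhom P S) T :
  simple S -> proj_cover p -> simple T -> dim_hom P T = dim_hom S T.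
Proof.
move=> sS cp sT; have [pP ps pC] := cp; apply/eqP; rewrite eqn_leq; apply/andP; split.
  pose G g := projT1 (cid (factor_surj ps (@cover_hom P S p T g sS cp sT))).
  have GE g x : G g (p x) = g x by rewrite /G; case: cid.
  apply: (dim_hom_le (T := G)) => [a f g h hE y|f f0 x].
    by have [x <-] := ps y; rewrite !GE hE.
  by rewrite -GE f0.
apply: (dim_hom_le (T := fun f => fcomp f p)) => [a f g h hE y|f f0 y]; first exact: hE.
by have [x <-] := ps y; exact: f0.
Qed.

Lemma dim_hom_self_gt0 S : simple S -> (0 < dim_hom S S)%N.
Proof. by move=> [[x x0] _]; apply/dim_hom_gt0; exists (fid S), x. Qed.

Lemma simple_cover S : simple S -> exists P (p : fhom P S), proj_cover p.
Proof.
move=> sS; have [||P [p [cp _]]] := @cover_exists _ _ (reg_mod B) S _ sS.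
- exact: projective_reg.
- by rewrite dim_hom_reg simple_dim_gt0.
by exists P, p.
Qed.

Lemma K0_diff (u : K0 B) : exists X Y : fmod B,
  [/\ projective X, projective Y & u = K0_class X - K0_class Y].
Proof.
have th := K_theoryP F; move: u; apply: (gr_ind (t := K_theoryP F)).
- exists z, z; split; try exact: (projective_zero (@zero_is_zero _ B)).
  by rewrite subrr.
- move=> _ _ [X [Y [pX pY ->]]] [X' [Y' [pX' pY' ->]]].
  exists (sum_mod X Y'), (sum_mod Y X'); split; try exact: projective_sum.
  rewrite !K0_class_sum // opprB opprD !addrA; congr (_ + _).
  exact: addrAC.
move=> M pM; exists M, z; split=> //; first exact: (projective_zero (@zero_is_zero _ B)).
by rewrite (K0_class0 (@zero_is_zero _ B)) subr0.
Qed.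

(** Write u = X - Y with X and Y projective: pairing with simple modules shows X ≅ Y by
    [projective_isoP]. *)
Lemma K0_nondegenerate (u : K0 B) : (forall x, KG_pairing u x = 0) -> u = 0.
Proof.
have [X [Y [pX pY ->]]] := K0_diff u => e; apply/eqP; rewrite subr_eq0; apply/eqP.
apply: K0_class_fiso => //; apply: projective_isoP => // S _.
have /eqP := e (G0_class S); rewrite (KG_pairing_zmodl _) !KG_pairing_class // subr_eq0.
by rewrite eqz_nat => /eqP.
Qed.

Hypothesis pB : perfect (@KG_pairing F B).

(* The functional dim Hom(P, -) / dim End(S), for P the projective cover of S,*)
(* is represented by some X - Y, whence X = Y + Z with dim Hom(Z, S) = 1.     *)
Lemma perfect_dim_end S : simple S -> dim_hom S S = 1%N.
Proof.
move=> sS; have [P [p cp]] := simple_cover sS; have [pP ps _] := cp.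
set d := dim_hom S S; have d0 : (0 < d)%N := dim_hom_self_gt0 sS.
have dT T : simple T -> dim_hom P T = if `[< fiso S T >] then d else 0%N.
  move=> sT; rewrite (dim_hom_cover sS cp sT); case: asboolP => [iST|nST].
    exact: fiso_dim_hom (fiso_refl _) (fiso_sym iST).
  apply/dim_hom_eq0 => f x; apply: contrapT => fx; apply: nST.
  by apply: (simple_iso (f := f)) => //; exists x.
(* The quotient [k] is the multiplicity of [S] as a composition factor of [M]. *)
have dvd M : exists k, dim_hom P M = (k * d)%N.
  move: M; apply: module_ind => [M M0|T M N i q sT se [k kE]].
    exists 0%N; apply/dim_hom_eq0 => f x; exact: M0.
  rewrite (dim_hom_exactr pP se) kE dT //; case: asboolP => _; last by exists k.
  by exists k.+1; rewrite mulSn.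
have dvdx x : exists k : int, KG_pairing (K0_class P) x = k * d%:Z.
  move: x; apply: (gr_ind (t := G_theoryP F)).
  - by exists 0; rewrite (addf0 (KG_pairing_zmodr _)) mul0r.
  - move=> x y [k kE] [l lE]; exists (k - l).
    by rewrite (KG_pairing_zmodr _) kE lE mulrBl.
  move=> M _; have [k kE] := dvd M; exists k%:Z.
  by rewrite KG_pairing_class // kE PoszM.
pose phi x := projT1 (cid (dvdx x)).
have phiE x : KG_pairing (K0_class P) x = phi x * d%:Z by rewrite /phi; case: cid.
have dn0 : d%:Z != 0 :> int by rewrite eqz_nat -lt0n.
have phiA : zmod_morphism phi.
  by move=> x y; apply: (mulIf dn0); rewrite -phiE mulrBl -!phiE; exact: KG_pairing_zmodr.
have [u [uE _]] := pB.1 (additive_of phiA).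
have [X [Y [pX pY uXY]]] := K0_diff u.
have dXY T : simple T -> (dim_hom X T)%:Z - (dim_hom Y T)%:Z = `[< fiso S T >]%:Z.
  move=> sT; have := uE (G0_class T); rewrite uXY (KG_pairing_zmodl _).
  rewrite !KG_pairing_class // => ->.
  apply: (mulIf dn0); rewrite -[LHS]phiE KG_pairing_class // dT //.
  by case: asboolP => _; rewrite ?mul1r ?mul0r.
have [|Z iZ] := @projective_summandP _ _ X Y pX pY.
  move=> T sT; rewrite -lez_nat -subr_ge0 dXY //.
have dZ : dim_hom Z S = 1%N.
  have := dXY S sS; rewrite (fiso_dim_hom iZ (fiso_refl S)) dim_hom_suml PoszD.
  rewrite addrC addKr asboolT; last exact: fiso_refl.
  by case.
have [f f0] : exists (f : fhom Z S) x, f x <> 0 by apply/dim_hom_gt0; rewrite dZ.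
have fs := simple_surj sS f0.
apply/eqP; rewrite eqn_leq d0 andbT -dZ.
(* End(S) embeds in the line Hom(Z, S) by composition with the surjection [f]. *)
apply: (dim_hom_le (T := fun h => fcomp h f)) => [a g h k hE y|h h0 y]; first exact: hE.
by have [x <-] := fs y; exact: h0.
Qed.

(** An endomorphism that is not a scalar would be independent of the identity, making End(S) of
    dimension at least 2. *)
Lemma simple_end_scalar S (e : fhom S S) : simple S -> exists c : F, forall x, e x = c *: x.
Proof.
move=> sS; apply: contrapT => ne.
have /eqP := perfect_dim_end sS; apply/negP; rewrite neq_ltn; apply/orP; right.
pose V2 : vectType F := (F^o * F^o)%type.
have -> : 2%N = \dim {:V2} by rewrite dimvf.
apply: (@dim_hom_geV _ _ S S V2 (fun v => fadd (fscale (v.1 : F) e) (fscale (v.2 : F) (fid S)))).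
  by move=> a u v x /=; rewrite !scalerDl scalerDr !scalerA addrACA.
move=> [a b] /= h; have [a0|a0] := eqVneq a 0.
  rewrite a0; congr (_, _); have [[x x0] _] := sS; have /eqP := h x.
  rewrite a0 scale0r add0r scaler_eq0 => /orP [/eqP //|/eqP //].
case: ne; exists (- (a^-1 * b)) => x; have /eqP := h x.
rewrite addr_eq0 => /eqP e'; rewrite scaleNr -scalerA -scalerN -e'.
by rewrite scalerA mulVf // scale1r.
Qed.

(** S runs over the simple modules and P over their covers. Since dim End(S_i) = 1, the matrix of
    dim Hom(P_i, S_j) is the identity; composition series expand G_0, and nondegeneracy then expands
    K_0. *)
Lemma dual_basis_exists : exists n (P S : 'I_n -> fmod B),
  [/\ forall i, projective (P i),
      forall x : G0 B, x = \sum_i G0_class (S i) *~ KG_pairing (K0_class (P i)) x &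
      forall u : K0 B, u = \sum_i K0_class (P i) *~ KG_pairing u (G0_class (S i))].
Proof.
have [l [[lS lD] lM]] := simple_list_exists (reg_mod B).
pose n := size l; pose S (i : 'I_n) := nth z l i.
have sS i : simple (S i) by apply: lS.
have /choice [P PP] : forall i : 'I_n, exists P : fmod B, exists p : fhom P (S i), proj_cover p.
  by move=> i; exact: simple_cover.
have pP i : projective (P i) by have [p []] := PP i.
have dPS i j : dim_hom (P i) (S j) = (i == j)%N.
  have [p cp] := PP i; rewrite (dim_hom_cover (sS i) cp (sS j)).
  case: eqVneq => [->|ij]; first exact: perfect_dim_end.
  apply/dim_hom_eq0 => f x; apply: contrapT => fx; case/eqP: ij.
  apply/val_inj/lD; try exact: ltn_ord.
  by apply: (@simple_iso _ _ (S i) (S j) f) => //; exists x.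
have GM M : G0_class M = \sum_i G0_class (S i) *~ (dim_hom (P i) M)%:Z.
  move: M; apply: module_ind => [M M0|T M N i q sT se IH].
    rewrite G0_class0 // big1 // => i _.
    by rewrite (dim_hom_eq0 (P i) M).2 // => f x; exact: M0.
  have [|k [kl Tk]] := lM T sT; first by rewrite dim_hom_reg simple_dim_gt0.
  rewrite (G0_class_exact se) IH.
  under [RHS]eq_bigr => j _ do rewrite (dim_hom_exactr (pP j) se) PoszD mulrzDr.
  rewrite big_split; congr (_ + _); pose k' : 'I_n := Ordinal kl.
  rewrite (bigD1 k') //= big1 ?addr0 => [|j jk].
    rewrite (fiso_dim_hom (fiso_refl _) Tk) -[nth z l k]/(S k') dPS eqxx.
    by rewrite -(G0_class_fiso Tk).
  by rewrite (fiso_dim_hom (fiso_refl _) Tk) -[nth z l k]/(S k') dPS (negPf jk).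
have GE (x : G0 B) : x = \sum_i G0_class (S i) *~ KG_pairing (K0_class (P i)) x.
  move: x; apply: (gr_ind (t := G_theoryP F)).
  - by rewrite big1 // => i _; rewrite (addf0 (KG_pairing_zmodr _)) mulr0z.
  - move=> x y ex ey; rewrite {1}ex {1}ey -sumrB; apply: eq_bigr => i _.
    by rewrite (KG_pairing_zmodr _) mulrzBr.
  move=> M _; under eq_bigr => i _ do rewrite KG_pairing_class //; exact: GM.
exists n, P, S; split=> // u; apply/eqP; rewrite -subr_eq0; apply/eqP.
apply: K0_nondegenerate => x; rewrite (KG_pairing_zmodl x) KG_pairing_suml.
rewrite {1}(GE x) KG_pairing_sumr -sumrB big1 // => i _.
by rewrite KG_pairingMzr KG_pairingMzl mulrC subrr.
Qed.
End PerfectAlgebra.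

(** * Grothendieck groups of a tensor product of algebras *)

Section TensorGeneration.
Variables (F : fieldType) (B C : falgType F).
Hypotheses (pB : perfect (@KG_pairing F B)) (pC : perfect (@KG_pairing F C)).

(* The kernel of evaluation contains no simple C-module: its embedding would  *)
(* be s |-> h ⊗ s with h a nonzero morphism vanishing on S.                   *)
Lemma eval_inj (S : fmod C) (M : fmod (tens B C)) :
  simple S -> injective (uncurry (fid (hom_mod S M))).
Proof.
move=> sS; set ev := uncurry _; pose sK := @ker_stable _ _ _ _ ev.
apply: fhom_inj => t0 t00; apply: contrapT => t0n.
pose H := hom_mod S M; pose X := res_mod (tinrm B C) (ext_mod H S).
have [|W [w [sW wi]]] := @simple_sub _ _ (res_mod (tinrm B C) (sub_mod sK)).
  have /(sub_inclP sK) [k kE] : t0 \in ker ev by apply/kerP.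
  by exists k => k0; apply: t0n; rewrite -kE k0 fhom0.
pose iota : fhom W X := fcomp (res_hom (tinrm B C) (sub_incl sK)) w.
have iotai : injective iota by move=> x y /(@sub_incl_inj _ _ _ _ sK) /wi.
have eviota x : ev (iota x) = 0 by apply/kerP; exact: (sub_incl_in (w x : sub_mod sK)).
have prA k c (t : X) : tcoord k (c · t : tens H S) = c · (tcoord k (t : tens H S) : S).
  move: t; apply: (tens_ext (f := fun t : tens H S => tcoord k (c · (t : X) : tens H S) : S)
     (g := fun t : tens H S => c · (tcoord k t : S))) => [a x y|a x y|h s].
  - by rewrite (@fact_linear _ _ X) tcoord_linear.
  - by rewrite tcoord_linear fact_linear.
  have -> : c · (h ⊗ s : X) = h ⊗ (c · s) :> tens H S.
    by rewrite -[LHS]/(tinr B c · (h ⊗ s : ext_mod H S)) /tinr ext_pure fact1.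
  by rewrite !tcoordE (linearZf (@fact_linear _ _ S c)).
pose pr k : fhom X S := @FHom _ _ X S _ (@tcoord_linear _ H S k) (prA k).
have [[x0 x0n] _] := sW.
have [k kn] : exists k, pr k (iota x0) <> 0.
  apply: contrapT => nk; apply: x0n; apply: iotai; rewrite fhom0.
  rewrite [LHS](@tens_coord _ H S) big1 // => k _.
  rewrite (_ : tcoord _ _ = 0); first exact: linear0f ((@tens_bilin _ H S).1 _).
  by apply: contrapT => h; apply: nk; exists k.
have pki : injective (fcomp (pr k) iota) by apply: simple_inj => //; exists x0.
have pks : forall y, exists x, fcomp (pr k) iota x = y by apply: simple_surj => //; exists x0.
have [th [thK Kth]] := fhom_inv pki pks.
(* Here End(S) = F enters: every coordinate of the embedding of [S] is a scalar. *)
have /choice [c cE] : forall l, exists c : F, forall s, fcomp (pr l) (fcomp iota th) s = c *: s.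
  by move=> l; exact: simple_end_scalar.
pose h : H := \sum_l c l *: (vbasis {:H})`_l.
have thE s : iota (th s) = h ⊗ s :> tens H S.
  rewrite [LHS](@tens_coord _ H S) /h (bilin_suml (@tens_bilin _ H S)).
  apply: eq_bigr => l _; rewrite (bilinZl (@tens_bilin _ H S)) -(bilinZr (@tens_bilin _ H S)).
  by rewrite -cE.
have h0 : h = 0.
  apply: homV_ext => s; rewrite of_homV0 -(uncurryE (fid (hom_mod S M))) /= -thE.
  exact: eviota.
have [[s sn] _] := sS; apply: sn.
have : iota (th s) = 0 by rewrite thE h0; exact: linear0f ((@tens_bilin _ H S).2 s).
by rewrite -(fhom0 iota) => /iotai e; rewrite -[s]Kth e fhom0.
Qed.

(** Choose a simple [C]-submodule S of the module M. By [eval_inj], evaluation embeds Hom_C(S, M) ⊗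
    S in M; its image is nonzero, so induction applies to the quotient. *)
Lemma G0_tens_ind (Q : G0 (tens B C) -> Prop) :
  Q 0 -> (forall x y, Q x -> Q y -> Q (x - y)) ->
  (forall (M : fmod B) (N : fmod C), Q (G0_class (ext_mod M N))) -> forall x, Q x.
Proof.
move=> Q0 QB Qe; apply: (gr_ind (t := G_theoryP F)) => // M _.
rewrite -[gclass M]/(G0_class M).
have [n] := ubnP (\dim {:M}); elim: n M => // n IH M dM.
case: (pselect (is_zero_mod M)) => [M0|nM]; first by rewrite G0_class0.
have [|S [i [sS ii]]] := @simple_sub _ _ (res_mod (tinrm B C) M).
  by apply: contrapT => h; apply: nM => x; apply: contrapT => x0; apply: h; exists x.
have ei := @eval_inj S M sS; have se := im_short_exact ei.
rewrite (G0_class_exact se) -[X in _ + X]opprK; apply: (QB) => //.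
rewrite -sub0r; apply: (QB) => //; apply: IH.
move: dM; rewrite ltnS (short_exact_dim se); apply: leq_trans.
rewrite -add1n leq_add2r; apply/dim_gt0.
have [[s s0] _] := sS.
exists ((to_homV i : hom_mod S M) ⊗ s) => e; apply: s0; apply: ii; rewrite fhom0.
rewrite -(to_homVK i) -[LHS](uncurryE (fid (hom_mod S M)) (to_homV i)) e fhom0 //.
Qed.

(** Products of the dual bases of the two factors are dual again by [dim_hom_ext]; by [G0_tens_ind]
    and [K0_nondegenerate] the expansion may be tested on external products. *)
Lemma K0_tensE : exists n m (P : 'I_n -> fmod B) (Q : 'I_m -> fmod C) S T,
  [/\ forall i, projective (P i), forall j, projective (Q j) &
  forall u : K0 (tens B C), u = \sum_i \sum_j
    K0_class (ext_mod (P i) (Q j)) *~ KG_pairing u (G0_class (ext_mod (S i) (T j)))].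
Proof.
have [n [P [S [pP GP KP]]]] := dual_basis_exists pB.
have [m [Q [T [pQ GQ KQ]]]] := dual_basis_exists pC.
exists n, m, P, Q, S, T; split=> // u; apply/eqP; rewrite -subr_eq0; apply/eqP.
apply: K0_nondegenerate; apply: G0_tens_ind.
- exact: (addf0 (KG_pairing_zmodr _)).
- by move=> x y ex ey; rewrite (KG_pairing_zmodr _) ex ey subrr.
move=> M N; rewrite (KG_pairing_zmodl _) KG_pairing_suml.
have GMN : G0_class (ext_mod M N) = \sum_i \sum_j
    G0_class (ext_mod (S i) (T j)) *~ (dim_hom (P i) M * dim_hom (Q j) N)%N.
  have okT (D : falgType F) (Y : fmod D) : tok (G_theoryP F) Y by [].
  have E (Y : fmod B) (Z : fmod C) :
      @ext_gr F (G_theory F) B C (G0_class Y) (G0_class Z) = G0_class (ext_mod Y Z).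
    exact: (ext_gr_class (th := G_theoryP F)).
  rewrite -E {1}(GP (G0_class M)) {1}(GQ (G0_class N)).
  rewrite (addf_sum (ext_gr_zmodl _)); apply: eq_bigr => i _.
  rewrite (addf_sum (ext_gr_zmodr (G_theoryP F) _)); apply: eq_bigr => j _.
  rewrite (addfMz (ext_gr_zmodl _)) (addfMz (ext_gr_zmodr (G_theoryP F) _)) E.
  by rewrite !KG_pairing_class // -mulrzA mulrC PoszM.
rewrite {1}GMN KG_pairing_sumr -sumrB big1 // => i _.
rewrite KG_pairing_sumr KG_pairing_suml -sumrB big1 // => j _.
rewrite KG_pairingMzr KG_pairingMzl KG_pairing_class; last exact: projective_ext.
by rewrite dim_hom_ext mulrC subrr.
Qed.

Lemma K0_tens_ind (Q : K0 (tens B C) -> Prop) :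
  Q 0 -> (forall x y, Q x -> Q y -> Q (x - y)) ->
  (forall (M : fmod B) (N : fmod C), projective M -> projective N ->
     Q (K0_class (ext_mod M N))) -> forall x, Q x.
Proof.
move=> Q0 QB Qe x; have [n [m [P [R [S [T [pP pR xE]]]]]]] := K0_tensE.
rewrite (xE x).
have QN y : Q y -> Q (- y) by move=> Qy; rewrite -sub0r; exact: QB.
have QD y w : Q y -> Q w -> Q (y + w) by move=> Qy Qw; rewrite -[w]opprK; exact/QB/QN.
have Qz y k : Q y -> Q (y *~ k).
  have Qn l : Q y -> Q (y *+ l) by move=> Qy; elim: l => // l IH; rewrite mulrS; exact: QD.
  by case: k => l Qy; [exact: Qn|exact/QN/Qn].
elim/big_rec: _ => // i y _ Qy; apply: (QD) => //.
elim/big_rec: _ => // j w _ Qw; apply: (QD) => //.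
exact/Qz/Qe.
Qed.
End TensorGeneration.

(** * Tensor products of abelian groups and duality *)

Section ZTensorTheory.
Variables (U V : zmodType).

Lemma zpure_biadditive : biadditive (@zpure U V).
Proof.
split=> [u u' v|u v v']; apply/eqP; rewrite -subr_eq0 opprD addrA /zpure /pgen.
  rewrite -!pclassB pgen_rel //; by left; exists u, u', v.
rewrite -!pclassB pgen_rel //; by right; exists u, v, v'.
Qed.

Lemma zpure_zmodl v : zmod_morphism (fun u => @zpure U V u v).
Proof. by apply: zmod_morphismD => x y; exact: zpure_biadditive.1. Qed.

Lemma zpure_zmodr u : zmod_morphism (@zpure U V u).
Proof. by apply: zmod_morphismD => x y; exact: zpure_biadditive.2. Qed.

Lemma ztens_sum (t : ztens U V) :
  exists s : seq (U * V), t = \sum_(q <- s) zpure q.1 q.2.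
Proof.
move: t; apply: pgroup_ind => [|_ _ [s ->] [s' ->]|[u v]].
- by exists [::]; rewrite big_nil.
- exists (s ++ [seq (- q.1, q.2) | q <- s']); rewrite big_cat big_map; congr (_ + _).
  by rewrite -sumrN; apply: eq_bigr => q _; rewrite (addfN (zpure_zmodl _)).
by exists [:: (u, v)]; rewrite big_seq1.
Qed.

Lemma zlift_sum (W : zmodType) (b : U -> V -> W) (s : seq (U * V)) : biadditive b ->
  zlift b (\sum_(q <- s) zpure q.1 q.2) = \sum_(q <- s) b q.1 q.2.
Proof.
move=> bb; rewrite (addf_sum (zlift_additive b)).
by apply: eq_bigr => q _; rewrite zliftE.
Qed.

Lemma ztens_ext (W : zmodType) (f g : ztens U V -> W) :
  zmod_morphism f -> zmod_morphism g ->
  (forall u v, f (zpure u v) = g (zpure u v)) -> f =1 g.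
Proof.
move=> zf zg fg t; have [s ->] := ztens_sum t.
by rewrite (addf_sum zf) (addf_sum zg); apply: eq_bigr.
Qed.

Lemma biadditive_zmodl (W : zmodType) (b : U -> V -> W) v :
  biadditive b -> zmod_morphism (fun u => b u v).
Proof. by move=> [bl _]; apply: zmod_morphismD. Qed.

Lemma biadditive_zmodr (W : zmodType) (b : U -> V -> W) u :
  biadditive b -> zmod_morphism (b u).
Proof. by move=> [_ br]; apply: zmod_morphismD. Qed.
End ZTensorTheory.

Lemma biadditive_comp (U V U' V' W : zmodType) (b : U' -> V' -> W) (f : U -> U') (g : V -> V') :
  biadditive b -> zmod_morphism f -> zmod_morphism g ->
  biadditive (fun u v => b (f u) (g v)).
Proof.
by move=> [bl br] zf zg; split=> [u u' v|u v v']; rewrite ?(addfD zf) ?(addfD zg) ?bl ?br.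
Qed.

Lemma zmod_id (U : zmodType) : zmod_morphism (@id U). Proof. by []. Qed.
#[local] Hint Resolve zmod_id : core.

Lemma ztmapE (U V U' V' : zmodType) (f : U -> U') (g : V -> V') u v :
  zmod_morphism f -> zmod_morphism g -> ztmap f g (zpure u v) = zpure (f u) (g v).
Proof.
by move=> zf zg; apply: zliftE; exact: biadditive_comp (@zpure_biadditive _ _) zf zg.
Qed.

Lemma ztmap_zmod (U V U' V' : zmodType) (f : U -> U') (g : V -> V') :
  zmod_morphism (ztmap f g).
Proof. exact: zlift_additive. Qed.

Lemma zlift_biadditive (U V U' V' W : zmodType) (b : U -> V -> U' -> V' -> W) t :
  (forall u v, biadditive (b u v)) ->
  (forall u' v', biadditive (fun u v => b u v u' v')) ->
  biadditive (fun u v => zlift (b u v) t).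
Proof.
move=> b1 b2; have [s ->] := ztens_sum t.
split=> [x y v|u x y]; rewrite !zlift_sum // -big_split; apply: eq_bigr => q _.
  exact: (b2 _ _).1.
exact: (b2 _ _).2.
Qed.

(** * Pairings on tensor products *)

Section TensorPairing.
Variables (K G K' G' : zmodType) (p : K -> G -> int) (p' : K' -> G' -> int).
Hypotheses (bp : biadditive p) (bp' : biadditive p').

(** [pairing2] is the case where both factors are the pairing of the tower. Two distinct pairings
    are allowed so that triple tensors are covered by iteration. *)
Definition tpair (s : ztens K K') (t : ztens G G') : int :=
  zlift (fun a b => zlift (fun x y => p a x * p' b y) t) s.

Lemma tpair_biaddr a b : biadditive (fun x y => p a x * p' b y).
Proof.
by split=> [x y z|x y z]; rewrite ?(bp.2) ?(bp'.2) (mulrDl, mulrDr).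
Qed.

Lemma tpair_biaddl x y : biadditive (fun a b => p a x * p' b y).
Proof.
by split=> [a b c|a b c]; rewrite ?(bp.1) ?(bp'.1) (mulrDl, mulrDr).
Qed.

Lemma tpair_zmodl t : zmod_morphism (fun s => tpair s t).
Proof. exact: zlift_additive. Qed.

Lemma tpair_purel a b t : tpair (zpure a b) t = zlift (fun x y => p a x * p' b y) t.
Proof.
by rewrite /tpair zliftE //; apply: zlift_biadditive; [exact: tpair_biaddr|exact: tpair_biaddl].
Qed.

Lemma tpairE a b x y : tpair (zpure a b) (zpure x y) = p a x * p' b y.
Proof. by rewrite tpair_purel zliftE //; exact: tpair_biaddr. Qed.

Lemma tpair_zmodr s : zmod_morphism (tpair s).
Proof.
move=> t t'; move: s; apply: (ztens_ext (f := fun s => tpair s (t - t'))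
  (g := fun s => tpair s t - tpair s t')).
- exact: tpair_zmodl.
- by move=> x y; rewrite !(tpair_zmodl _) subr_interchange.
by move=> a b; rewrite !tpair_purel; exact: zlift_additive.
Qed.

Lemma tpair_biadd : biadditive tpair.
Proof. by apply: biadditiveP; [exact: tpair_zmodl|exact: tpair_zmodr]. Qed.

Lemma tpair_sumr a b (s : seq (G * G')) :
  tpair (zpure a b) (\sum_(q <- s) zpure q.1 q.2) = \sum_(q <- s) p a q.1 * p' b q.2.
Proof. by rewrite tpair_purel zlift_sum //; exact: tpair_biaddr. Qed.

End TensorPairing.

Lemma tpairC (K G K' G' : zmodType) (p : K -> G -> int) (p' : K' -> G' -> int) s t :
  biadditive p -> biadditive p' ->
  tpair (fun x a => p a x) (fun x a => p' a x) t s = tpair p p' s t.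
Proof.
have flip (A B : zmodType) (q : A -> B -> int) : biadditive q -> biadditive (fun x a => q a x).
  by move=> [ql qr].
move=> bp bp'; have [s' ->] := ztens_sum s; have [t' ->] := ztens_sum t.
rewrite (addf_sum (tpair_zmodl _ _ _)).
under eq_bigr => q _ do rewrite (tpair_sumr (flip _ _ _ bp) (flip _ _ _ bp')).
rewrite exchange_big (addf_sum (tpair_zmodl _ _ _)); apply: eq_bigr => q _.
by rewrite tpair_sumr.
Qed.

(* Finitely many elements of [G] always lie in the span of a finite family    *)
(* with a dual family in [K]; unlike nondegeneracy, this passes to tensors.   *)
Definition locally_dual (K G : zmodType) (p : K -> G -> int) : Prop :=
  forall s : seq G, exists e : seq (K * G), forall x, x \in s ->
    x = \sum_(q <- e) q.2 *~ p q.1 x.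

Lemma locally_dual_nondegenerate (K G : zmodType) (p : K -> G -> int) :
  biadditive p -> locally_dual p ->
  forall x y, (forall a, p a x = p a y) -> x = y.
Proof.
move=> bp ld x y xy; have [e eE] := ld [:: x; y].
rewrite [LHS]eE ?mem_head // [RHS]eE ?inE ?eqxx ?orbT //.
by apply: eq_bigr => q _; rewrite xy.
Qed.

(** Write the given tensors as finite sums, take dual families for all first and for all second
    components, and form the products of the two families. *)
Lemma locally_dual_tens (K G K' G' : zmodType) (p : K -> G -> int) (p' : K' -> G' -> int) :
  biadditive p -> biadditive p' -> locally_dual p -> locally_dual p' ->
  locally_dual (tpair p p').
Proof.
move=> bp bp' ld ld' ts; have /choice [rep repE] := @ztens_sum G G'.
have [e eE] := ld [seq q.1 | q <- flatten [seq rep t | t <- ts]].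
have [e' eE'] := ld' [seq q.2 | q <- flatten [seq rep t | t <- ts]].
exists [seq (zpure i.1 j.1, zpure i.2 j.2) | i <- e, j <- e'] => t tts.
rewrite big_allpairs_dep [t]repE /=.
under [RHS]eq_bigr => i _ do under eq_bigr => j _ do rewrite tpair_sumr // mulrz_sumr.
under [RHS]eq_bigr => i _ do rewrite exchange_big.
rewrite exchange_big big_seq_cond [RHS]big_seq_cond; apply: eq_bigr => q; rewrite andbT => qt.
have qf : q \in flatten [seq rep t | t <- ts] by apply/flatten_mapP; exists t.
have E1 := eE _ (map_f fst qf); have E2 := eE' _ (map_f snd qf).
rewrite [in LHS]E1 [in LHS]E2.
rewrite (addf_sum (zpure_zmodl _)); apply: eq_bigr => i _.
rewrite (addf_sum (zpure_zmodr _)); apply: eq_bigr => j _.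
by rewrite (addfMz (zpure_zmodl _)) (addfMz (zpure_zmodr _)) -mulrzA mulrC.
Qed.

(** Testing on pure tensors is enough, since they generate. *)
Lemma tpair_nondegenerate (K G K' G' : zmodType) (p : K -> G -> int) (p' : K' -> G' -> int) :
  biadditive p -> biadditive p' -> locally_dual p -> locally_dual p' ->
  forall t t', (forall a b, tpair p p' (zpure a b) t = tpair p p' (zpure a b) t') -> t = t'.
Proof.
move=> bp bp' ld ld' t t' e.
apply: (locally_dual_nondegenerate (tpair_biadd bp bp') (locally_dual_tens bp bp' ld ld')) => s.
by move: s; apply: ztens_ext => [||a b]; [exact: tpair_zmodl|exact: tpair_zmodl|exact: e].
Qed.

Lemma ztassocE (U V W : zmodType) (t : ztens U V) (w : W) :
  ztassoc (zpure t w) = zlift (fun u v => zpure u (zpure v w)) t.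
Proof.
have bw (w1 : W) : biadditive (fun (u : U) (v : V) => zpure u (zpure v w1)).
  exact: biadditive_comp (@zpure_biadditive _ _) (@zmod_id _) (@zpure_zmodl _ _ _).
rewrite /ztassoc zliftE //; split=> [t1 t2 w1|t1 w1 w2].
  by rewrite (addfD (zlift_additive _)).
have [r ->] := ztens_sum t1.
rewrite (zlift_sum _ (bw _)) (zlift_sum _ (bw w1)) (zlift_sum _ (bw w2)) -big_split.
by apply: eq_bigr => q _ /=; rewrite !(zpure_biadditive _ _).2.
Qed.

(** * Coalgebra axioms as transposes of algebra axioms *)

Section Duality.
Variables (K G : zmodType) (p : K -> G -> int).
Hypotheses (bp : biadditive p) (ld : locally_dual p).
Variables (mulK : K -> K -> K) (comG : G -> ztens G G).
Hypotheses (bmulK : biadditive mulK) (zcomG : zmod_morphism comG).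
Hypothesis mul_com : forall a b x, p (mulK a b) x = tpair p p (zpure a b) (comG x).

Lemma tpair_com a b x (s : seq (G * G)) : comG x = \sum_(q <- s) zpure q.1 q.2 ->
  p (mulK a b) x = \sum_(q <- s) p a q.1 * p b q.2.
Proof. by move=> e; rewrite mul_com e tpair_sumr. Qed.

(** Paired with a ⊗ b ⊗ c, the two sides give <(ab)c, x> and <a(bc), x>, and the triple pairing is
    nondegenerate. *)
Lemma dual_coassoc : associative mulK ->
  forall x, ztassoc (ztmap comG id (comG x)) = ztmap id comG (comG x).
Proof.
move=> mA x; have bq := tpair_biadd bp bp.
have [s sE] := ztens_sum (comG x).
have pA : zmod_morphism (@ztassoc G G G) by exact: zlift_additive.
apply: (tpair_nondegenerate bp bq ld (locally_dual_tens bp bp ld ld)) => a t.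
  move: t; apply: ztens_ext => [||b c].
  - by move=> t t'; rewrite (zpure_zmodr _) (tpair_zmodl _ _ _).
  - by move=> t t'; rewrite (zpure_zmodr _) (tpair_zmodl _ _ _).
  transitivity (p (mulK (mulK a b) c) x).
    rewrite (tpair_com _ _ sE) sE (addf_sum (ztmap_zmod _ _)) (addf_sum pA).
    rewrite (addf_sum (tpair_zmodr bp bq _)); apply: eq_bigr => q _.
    rewrite ztmapE // ztassocE; have [r rE] := ztens_sum (comG q.1).
    rewrite (tpair_com _ _ rE) rE zlift_sum; last first.
      exact: biadditive_comp (@zpure_biadditive _ _) (@zmod_id _) (@zpure_zmodl _ _ _).
    rewrite (addf_sum (tpair_zmodr bp bq _)) mulr_suml; apply: eq_bigr => i _.
    by rewrite !tpairE // mulrA.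
  rewrite -mA (tpair_com _ _ sE) sE (addf_sum (ztmap_zmod _ _)).
  rewrite (addf_sum (tpair_zmodr bp bq _)); apply: eq_bigr => q _.
  by rewrite ztmapE // tpairE // mul_com.
Qed.

Variables (oneK : K) (epsG : G -> int).
Hypothesis zepsG : zmod_morphism epsG.
Hypothesis one_eps : forall x, p oneK x = epsG x.

Lemma pairMz a x n : p a (x *~ n) = p a x * n.
Proof. by rewrite (addfMz (biadditive_zmodr a bp)) -mulrzr intz. Qed.

Lemma dual_counitl : left_id oneK mulK ->
  forall x, zlift (fun a b => b *~ epsG a) (comG x) = x.
Proof.
move=> m1 x; apply: (locally_dual_nondegenerate bp ld) => a.
have [s sE] := ztens_sum (comG x).
rewrite -[in RHS](m1 a) (tpair_com _ _ sE) sE zlift_sum; last first.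
  split=> [u v w|u v w]; first by rewrite (addfD zepsG) mulrzDr.
  by rewrite mulrzDl.
rewrite (addf_sum (biadditive_zmodr a bp)); apply: eq_bigr => q _.
by rewrite pairMz one_eps mulrC.
Qed.

Lemma dual_counitr : right_id oneK mulK ->
  forall x, zlift (fun a b => a *~ epsG b) (comG x) = x.
Proof.
move=> m1 x; apply: (locally_dual_nondegenerate bp ld) => a.
have [s sE] := ztens_sum (comG x).
rewrite -[in RHS](m1 a) (tpair_com _ _ sE) sE zlift_sum; last first.
  split=> [u v w|u v w]; first by rewrite mulrzDl.
  by rewrite (addfD zepsG) mulrzDr.
rewrite (addf_sum (biadditive_zmodr a bp)); apply: eq_bigr => q _.
by rewrite pairMz one_eps.
Qed.

Variables (mulG : G -> G -> G) (oneG : G) (comK : K -> ztens K K) (epsK : K -> int).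
Hypotheses (bmulG : biadditive mulG) (zcomK : zmod_morphism comK).
Hypothesis com_mul : forall a x y, p a (mulG x y) = tpair p p (comK a) (zpure x y).
Hypothesis eps_one : forall a, p a oneG = epsK a.

(** The transpose of the multiplicativity of the counit of [K]. *)
Lemma dual_comul1 : (forall a b, epsK (mulK a b) = epsK a * epsK b) ->
  comG oneG = zpure oneG oneG.
Proof.
move=> eM; apply: (tpair_nondegenerate bp bp ld ld) => a b.
by rewrite tpairE // -mul_com !eps_one eM.
Qed.

(** The product of the tensor square, in a form convertible to the right-hand side of
    [hopf_comulM]. *)
Definition ztmul (H : zmodType) (mul : H -> H -> H) (t t' : ztens H H) : ztens H H :=
  zlift (fun a b => zlift (fun c d => zpure (mul a c) (mul b d)) t') t.

Lemma ztmul_sum (H : zmodType) (mul : H -> H -> H) (s s' : seq (H * H)) : biadditive mul ->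
  ztmul mul (\sum_(q <- s) zpure q.1 q.2) (\sum_(q <- s') zpure q.1 q.2) =
  \sum_(q <- s) \sum_(r <- s') zpure (mul q.1 r.1) (mul q.2 r.2).
Proof.
move=> bm; have br a b : biadditive (fun c d => zpure (mul a c) (mul b d)).
  exact: biadditive_comp (@zpure_biadditive _ _) (biadditive_zmodr _ bm) (biadditive_zmodr _ bm).
have bl c d : biadditive (fun a b => zpure (mul a c) (mul b d)).
  exact: biadditive_comp (@zpure_biadditive _ _) (biadditive_zmodl _ bm) (biadditive_zmodl _ bm).
rewrite /ztmul zlift_sum; last exact: zlift_biadditive.
by apply: eq_bigr => q _; rewrite zlift_sum.
Qed.

End Duality.

Lemma finite_set_ub (S : set nat) : finite_set S -> exists N, forall n, S n -> (n < N)%N.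
Proof.
move=> /finite_seqP [s ->]; exists (\max_(i <- s) i).+1 => n /= ns.
by rewrite ltnS; exact: leq_bigmax_seq.
Qed.

Section DirectSums.
Variables (I : eqType) (V : I -> zmodType).

Lemma dsumB (x y : dsum V) i : (x - y) i = x i - y i. Proof. by []. Qed.
Lemma dcomp_zmod i : zmod_morphism (fun x : dsum V => x i). Proof. by []. Qed.

Lemma dsum_sumE J (r : seq J) (E : J -> dsum V) i :
  (\sum_(j <- r) E j) i = \sum_(j <- r) E j i.
Proof. exact: (addf_sum (@dcomp_zmod i)). Qed.

Lemma dsum_inj_eq i (v : V i) : dsum_inj v i = v.
Proof.
rewrite /dsum_inj /=; case: eqP => // e.
by rewrite (eq_axiomK e).
Qed.

Lemma dsum_inj_neq i j (v : V i) : i != j -> dsum_inj v j = 0.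
Proof. by rewrite /dsum_inj /=; case: eqP. Qed.

Lemma dsum_inj_zmod i : zmod_morphism (@dsum_inj I V i).
Proof.
move=> x y; apply: dsum_ext => j; rewrite dsumB.
have [<-|ij] := eqVneq i j; first by rewrite !dsum_inj_eq.
by rewrite !dsum_inj_neq // subrr.
Qed.

Lemma dsum_inj_homog i (v : V i) : homog i (dsum_inj v).
Proof. by move=> j /eqP ji; rewrite dsum_inj_neq // eq_sym. Qed.

Lemma homog_inj i (x : dsum V) : homog i x -> x = dsum_inj (x i).
Proof.
move=> hx; apply: dsum_ext => j; have [<-|ij] := eqVneq i j; first by rewrite dsum_inj_eq.
by rewrite dsum_inj_neq // hx //; apply/eqP; rewrite eq_sym.
Qed.

Lemma dsum_decomp (x : dsum V) : exists s : seq I, uniq s /\ x = \sum_(i <- s) dsum_inj (x i).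
Proof.
have /finite_seqP [s sE] := dsum_finite x; exists (undup s); split; first exact: undup_uniq.
apply: dsum_ext => i; rewrite dsum_sumE.
have [si|si] := boolP (i \in s).
  rewrite (bigD1_seq i) ?mem_undup ?undup_uniq // big1 => [|j ji].
    by rewrite dsum_inj_eq; exact: esym (addr0 _).
  by rewrite dsum_inj_neq.
rewrite big_seq big1 => [|j]; last first.
  by rewrite mem_undup => js; rewrite dsum_inj_neq //; apply: contraNneq si => <-.
apply/eqP; apply: contraNT si => xi.
by have : [set i | x i != 0]%classic i by []; rewrite sE.
Qed.

Lemma dsum_ind (Q : dsum V -> Prop) :
  Q 0 -> (forall x y, Q x -> Q y -> Q (x + y)) -> (forall i (v : V i), Q (dsum_inj v)) ->
  forall x, Q x.
Proof.
move=> Q0 QD Qi x; have [s [_ ->]] := dsum_decomp x.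
by elim/big_rec: _ => // i y _; exact: QD.
Qed.
End DirectSums.

(** * Antipodes of graded connected bialgebras *)

Section Antipode.
Variables (V : nat -> zmodType).
Local Notation H := (dsum V : zmodType).
Variables (mul : H -> H -> H) (one : H) (com : H -> ztens H H) (eps : H -> int).
Hypotheses (bmul : biadditive mul) (mulA : associative mul).
Hypotheses (mul1 : left_id one mul) (mulr1' : right_id one mul).
Hypotheses (zcom : zmod_morphism com) (zeps : zmod_morphism eps).
Hypothesis coassoc : forall x, ztassoc (ztmap com id (com x)) = ztmap id com (com x).
Hypothesis counitl : forall x, zlift (fun a b => b *~ eps a) (com x) = x.
Hypothesis counitr : forall x, zlift (fun a b => a *~ eps b) (com x) = x.
Hypothesis eps1 : eps one = 1.
Hypothesis gr : is_graded_connected mul one com eps.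

Definition conv (f g : H -> H) (x : H) : H := zlift (fun a b => mul (f a) (g b)) (com x).
Definition unit_counit (x : H) : H := one *~ eps x.
(** Write J for this map. Since [unit_counit] is the unit for convolution and the identity is
    [unit_counit] - J, the convolution inverse of the identity is the geometric series in J, whose
    terms are [jpow]. *)
Definition jmap (x : H) : H := unit_counit x - x.
Fixpoint jpow k : H -> H := if k is k'.+1 then conv jmap (jpow k') else unit_counit.

Lemma zmod_unit_counit : zmod_morphism unit_counit.
Proof. by move=> x y; rewrite /unit_counit zeps mulrzBr. Qed.
Lemma zmod_jmap : zmod_morphism jmap.
Proof. by move=> x y; rewrite /jmap zmod_unit_counit subr_interchange. Qed.

Lemma conv_biadd (f g : H -> H) : zmod_morphism f -> zmod_morphism g ->
  biadditive (fun a b => mul (f a) (g b)).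
Proof. exact: biadditive_comp. Qed.

Lemma zmod_conv f g : zmod_morphism (conv f g).
Proof. by move=> x y; rewrite /conv zcom zlift_additive. Qed.

Lemma zmod_jpow k : zmod_morphism (jpow k).
Proof. by case: k => [|k]; [exact: zmod_unit_counit|exact: zmod_conv]. Qed.

Lemma convE f g x (s : seq (H * H)) : zmod_morphism f -> zmod_morphism g ->
  com x = \sum_(q <- s) zpure q.1 q.2 -> conv f g x = \sum_(q <- s) mul (f q.1) (g q.2).
Proof. by move=> zf zg e; rewrite /conv e zlift_sum //; exact: conv_biadd. Qed.

(** Apply a ⊗ (b ⊗ c) ↦ f(a) (g(b) h(c)) to both sides of coassociativity. *)
Lemma convA f g h x : zmod_morphism f -> zmod_morphism g -> zmod_morphism h ->
  conv (conv f g) h x = conv f (conv g h) x.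
Proof.
move=> zf zg zh; have [s sE] := ztens_sum (com x).
have zfg := zmod_conv f g; have zgh := zmod_conv g h.
pose Phi : ztens H (ztens H H) -> H :=
  zlift (fun a t => mul (f a) (zlift (fun b c => mul (g b) (h c)) t)).
have zPhi : zmod_morphism Phi by exact: zlift_additive.
have PhiE a t : Phi (zpure a t) = mul (f a) (zlift (fun b c => mul (g b) (h c)) t).
  by apply: zliftE; apply: biadditive_comp bmul zf _; exact: zlift_additive.
have bgh := conv_biadd zg zh; have bfg := conv_biadd zf zg.
have := congr1 Phi (coassoc x); rewrite sE !(addf_sum (ztmap_zmod _ _)).
rewrite (addf_sum (zlift_additive _ : zmod_morphism (@ztassoc H H H))) !(addf_sum zPhi).
rewrite (convE zfg zh sE) (convE zf zgh sE).
have E1 q : Phi (ztmap id com (zpure q.1 q.2)) = mul (f q.1) (conv g h q.2).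
  by rewrite ztmapE // PhiE.
have E2 q : Phi (ztassoc (ztmap com id (zpure q.1 q.2))) = mul (conv f g q.1) (h q.2).
  rewrite ztmapE // ztassocE; have [r rE] := ztens_sum (com q.1).
  rewrite (convE zf zg rE) rE zlift_sum; last first.
    exact: biadditive_comp (@zpure_biadditive _ _) (@zmod_id _) (@zpure_zmodl _ _ _).
  rewrite (addf_sum zPhi) (addf_sum (biadditive_zmodl (h q.2) bmul)); apply: eq_bigr => i _.
  by rewrite PhiE zliftE // mulA.
under eq_bigr => q _ do rewrite E2; move=> ->.
by apply: eq_bigr => q _; rewrite E1.
Qed.

Lemma mulMzl x y n : mul (x *~ n) y = mul x y *~ n.
Proof. exact: (addfMz (biadditive_zmodl y bmul)). Qed.
Lemma mulMzr x y n : mul x (y *~ n) = mul x y *~ n.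
Proof. exact: (addfMz (biadditive_zmodr x bmul)). Qed.

Lemma conv_unitl f x : zmod_morphism f -> conv unit_counit f x = f x.
Proof.
move=> zf; have [s sE] := ztens_sum (com x).
rewrite (convE zmod_unit_counit zf sE) -[in RHS](counitl x) sE zlift_sum; last first.
  split=> [u v w|u v w]; last by rewrite mulrzDl.
  by rewrite (addfD zeps) mulrzDr.
rewrite (addf_sum zf); apply: eq_bigr => q _.
by rewrite (addfMz zf) mulMzl mul1.
Qed.

Lemma conv_unitr f x : zmod_morphism f -> conv f unit_counit x = f x.
Proof.
move=> zf; have [s sE] := ztens_sum (com x).
rewrite (convE zf zmod_unit_counit sE) -[in RHS](counitr x) sE zlift_sum; last first.
  split=> [u v w|u v w]; first by rewrite mulrzDl.
  by rewrite (addfD zeps) mulrzDr.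
rewrite (addf_sum zf); apply: eq_bigr => q _.
by rewrite (addfMz zf) mulMzr mulr1'.
Qed.

Lemma conv_jmapr k x : conv (jpow k) jmap x = jpow k.+1 x.
Proof.
have zj := zmod_jmap; elim: k x => [|k IH] x.
  by rewrite /= conv_unitl // conv_unitr.
rewrite [LHS](convA _ zj (zmod_jpow k) zj).
by congr (zlift _ (com x)); apply/funext => a; apply/funext => b; rewrite IH.
Qed.

(** J kills degree 0 by connectedness, so every convolution factor consumes at least one degree. *)
Lemma jpow_homog k n (x : H) : homog n x -> (n < k)%N -> jpow k x = 0.
Proof.
elim: k n x => // k IH n x hx nk.
have [s [sE sH]] := graded_comul gr hx.
rewrite [LHS](convE zmod_jmap (zmod_jpow k) sE) big_seq big1 // => q qs.
have [i [j [ij hi hj]]] := sH q qs.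
case: i ij hi => [|i] ij hi.
  have [c cE] := graded_connected gr hi.
  have -> : jmap q.1 = 0.
    by rewrite cE /jmap /unit_counit (addfMz zeps) eps1 intz subrr.
  exact: (addf0 (biadditive_zmodl _ bmul)).
rewrite (IH j) //; first exact: (addf0 (biadditive_zmodr _ bmul)).
by rewrite -ltnS (leq_trans _ nk) // ltnS -ij addSn ltnS leq_addl.
Qed.

Lemma jpow_eventually (x : H) : exists N, forall k, (N <= k)%N -> jpow k x = 0.
Proof.
move: x; apply: dsum_ind => [|x y [N xN] [M yM]|n v].
- by exists 0%N => k _; exact: (addf0 (zmod_jpow k)).
- exists (maxn N M) => k; rewrite geq_max => /andP [Nk Mk].
  by rewrite (addfD (zmod_jpow k)) xN // yM // addr0.
by exists n.+1 => k nk; exact: jpow_homog (dsum_inj_homog v) nk.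
Qed.

Lemma antipode_exists : exists S : {additive H -> H},
  (forall x, zlift (fun a b => mul (S a) b) (com x) = one *~ eps x) /\
  (forall x, zlift (fun a b => mul a (S b)) (com x) = one *~ eps x).
Proof.
have /choice [N NE] := jpow_eventually.
pose S x := \sum_(k < N x) jpow k x.
have SE x M : (N x <= M)%N -> S x = \sum_(k < M) jpow k x.
  move=> le; rewrite -(subnKC le) big_split_ord /= [X in _ + X]big1 ?addr0 // => k _.
  by apply: NE; exact: leq_addr.
have zS : zmod_morphism S.
  move=> x y; pose M := maxn (N (x - y)) (maxn (N x) (N y)).
  rewrite !(@SE _ M) ?leq_max ?leqnn ?orbT // -sumrB; apply: eq_bigr => k _.
  exact: zmod_jpow.
(* A single truncation order serves [x] and all components of its coproduct. *)
have bound (I : eqType) (r : seq I) (f : I -> H) x :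
    exists M, (N x <= M)%N /\ forall i, i \in r -> (N (f i) <= M)%N.
  exists (maxn (N x) (\max_(i <- r) N (f i))); split=> [|i ir]; first exact: leq_maxl.
  have h : (N (f i) <= \max_(j <- r) N (f j))%N by apply: leq_bigmax_seq.
  by rewrite leq_max h orbT.
have jE x : x = unit_counit x - jmap x by rewrite /jmap subKr.
(* Convolving J^k with the identity gives J^k - J^(k+1), and the sum of these differences telescopes
   to [unit_counit x]. *)
have tele x M : (N x <= M)%N ->
    \sum_(k < M) (jpow k x - jpow k.+1 x) = one *~ eps x.
  move=> le; rewrite -(big_mkord xpredT (fun k => jpow k x - jpow k.+1 x)).
  under eq_bigr => k _ do rewrite -opprB.
  by rewrite sumrN telescope_sumr // opprB (NE x M) // subr0.
exists (additive_of zS); split=> x; have [s sE] := ztens_sum (com x).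
  have [M [xM sM]] := bound _ s fst x.
  rewrite -(tele x M xM) -[LHS]/(conv S id x) (convE zS (@zmod_id _) sE).
  rewrite big_seq; under eq_bigr => q qs do rewrite (SE _ M (sM q qs)) (addf_sum (biadditive_zmodl _ bmul)).
  rewrite -big_seq exchange_big; apply: eq_bigr => k _.
  rewrite -conv_jmapr (convE (zmod_jpow k) zmod_jmap sE) -(conv_unitr x (zmod_jpow k)).
  rewrite (convE (zmod_jpow k) zmod_unit_counit sE) -sumrB; apply: eq_bigr => q _.
  by rewrite -(biadditive_zmodr _ bmul) -jE.
have [M [xM sM]] := bound _ s snd x.
rewrite -(tele x M xM) -[LHS]/(conv id S x) (convE (@zmod_id _) zS sE).
rewrite big_seq; under eq_bigr => q qs do rewrite (SE _ M (sM q qs)) (addf_sum (biadditive_zmodr _ bmul)).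
rewrite -big_seq exchange_big; apply: eq_bigr => k _.
rewrite -[in RHS](conv_unitl x (zmod_jpow k)) [jpow k.+1 x](convE zmod_jmap (zmod_jpow k) sE).
rewrite (convE zmod_unit_counit (zmod_jpow k) sE) -sumrB; apply: eq_bigr => q _.
by rewrite -(biadditive_zmodl _ bmul) -jE.
Qed.
End Antipode.

(** * Induced modules by their universal property *)

Section UniversalInduction.
Variable F : fieldType.

(** Working with the universal property makes transitivity and products of inductions formal. [phi]
    is a bare function so that it can be composed with reassociation maps that are not bundled as
    algebra morphisms. *)
Definition is_ind (C B : falgType F) (phi : C -> B) (X : fmod C) (Y : fmod B)
    (u : X -> Y) : Prop :=
  [/\ linear u, forall c x, u (c · x) = phi c · u x,
      forall (Z : fmod B) (f : X -> Z), linear f ->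
        (forall c x, f (c · x) = phi c · f x) ->
        exists g : fhom Y Z, forall x, g (u x) = f x &
      forall (Z : fmod B) (g g' : fhom Y Z), (forall x, g (u x) = g' (u x)) -> g =1 g'].

Lemma ind_is_ind (C B : falgType F) (phi : {lrmorphism C -> B}) (X : fmod C) :
  is_ind phi (fun x : X => ind_pure phi 1 x).
Proof.
split=> [|c x|Z f lf fE|Z g g']; first exact: (ind_pure_bilin phi X).1.
- by rewrite -ind_pure_bal mul1r [RHS]ind_pure_act mulr1.
- pose f' : fhom X (res_mod phi Z) := @FHom _ _ X (res_mod phi Z) f lf fE.
  exists (sval (ind_lift f')) => x; rewrite (svalP (ind_lift f')); exact: fact1.
exact: ind_hom_ext.
Qed.

Lemma is_ind_fiso (C B : falgType F) (phi : C -> B) (X : fmod C) (Y Y' : fmod B)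
    (u : X -> Y) (u' : X -> Y') :
  is_ind phi u -> is_ind phi u' -> fiso Y Y'.
Proof.
move=> [lu uE ue uu] [lu' uE' ue' uu'].
have [f fE] := ue _ _ lu' uE'; have [g gE] := ue' _ _ lu uE.
exists f, g; split.
  by apply: (uu Y (fcomp g f) (fid Y)) => x; rewrite /= fE gE.
by apply: (uu' Y' (fcomp f g) (fid Y')) => x; rewrite /= gE fE.
Qed.

Lemma eq_is_ind (C B : falgType F) (phi phi' : C -> B) (X : fmod C) (Y : fmod B)
    (u : X -> Y) : phi =1 phi' -> is_ind phi u -> is_ind phi' u.
Proof. by move=> /funext ->. Qed.

Lemma is_ind_id (C : falgType F) (X : fmod C) : is_ind id (@id X).
Proof.
split=> // Z f lf fE; first by exists (FHom lf fE).
Qed.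

(** Transitivity of induction: extend first to [Y], viewing the target as a [C]-module, then to
    [Z]. *)
Lemma is_ind_comp (D C B : falgType F) (psi : {lrmorphism C -> B}) (phi : D -> C)
    (X : fmod D) (Y : fmod C) (Z : fmod B) (u : X -> Y) (v : Y -> Z) :
  is_ind phi u -> is_ind psi v -> is_ind (psi \o phi) (v \o u).
Proof.
move=> [lu uE ue uu] [lv vE ve vu]; split=> [|c x|W f lf fE|W g g' gg'].
- exact: linear_comp.
- by rewrite /= uE vE.
- have [g gE] := ue (res_mod psi W) f lf fE.
  by have [h hE] := ve W g (fhom_linear g) (fhom_act g); exists h => x; rewrite /= hE gE.
have gvA (h : fhom Z W) c y : h (v (c · y)) = psi c · h (v y) by rewrite vE fhom_act.
have gvL (h : fhom Z W) : linear (fun y => h (v y)).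
  by move=> a x y; rewrite lv fhom_linear.
apply: vu => y; pose gv h := @FHom _ _ Y (res_mod psi W) _ (gvL h) (gvA h).
exact: (uu _ (gv g) (gv g') gg').
Qed.

(** Extend one variable at a time. For each x the map f(x ⊗ -) extends to [Y'], giving a map from
    [X] to Hom(Y', Z); this extends to [Y], and uncurrying gives the required morphism. *)
Lemma is_ind_ext (C B C' B' : falgType F) (phi : {lrmorphism C -> B})
    (phi' : {lrmorphism C' -> B'}) (X : fmod C) (Y : fmod B) (X' : fmod C') (Y' : fmod B')
    (u : X -> Y) (u' : X' -> Y') :
  is_ind phi u -> is_ind phi' u' ->
  is_ind (tmor phi phi') (tmap u u' : ext_mod X X' -> ext_mod Y Y').
Proof.
move=> [lu uE ue uu] [lu' uE' ue' uu'].
have tE c c' : tmor phi phi' (c ⊗ c') = phi c ⊗ phi' c' by apply: tmapE; exact: linearP.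
have tuE x x' : tmap u u' (x ⊗ x') = u x ⊗ u' x' by exact: tmapE.
split=> [|t x|Z f lf fE|Z g g' gg'].
- exact: tmap_linear.
- pose Y2 := res_mod (tmor phi phi') (ext_mod Y Y').
  apply: (@ext_act_ext _ _ _ X X' Y2 (tmap u u')); first exact: tmap_linear.
  move=> a b m n; rewrite !tuE uE uE'.
  by rewrite -[RHS]/(tmor phi phi' (a ⊗ b) · (u m ⊗ u' n : ext_mod Y Y')) tE ext_pure.
- have hL x : linear (fun y : X' => f (x ⊗ y)).
    by move=> a y z; rewrite (tens_bilin _ _).1 lf.
  have hA x c (y : X') : f (x ⊗ (c · y)) = phi' c · (f (x ⊗ y) : res_mod (tinrm B B') Z).
    have -> : x ⊗ (c · y) = (1 ⊗ c : tens C C') · (x ⊗ y : ext_mod X X').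
      by rewrite ext_pure fact1.
    by rewrite fE tE rmorph1.
  have /choice [k kE] x := ue' (res_mod (tinrm B B') Z) _ (hL x) (hA x).
  pose H x : hom_mod Y' Z := to_homV (k x).
  have lH : linear H.
    move=> a x y; apply: homV_ext => z; rewrite of_homV_lin !to_homVK.
    apply: (uu' _ (k _) (fadd (fscale a (k x)) (k y))) => {}z /=.
    by rewrite !kE (tens_bilin _ _).2 lf.
  have HA c x : H (c · x) = phi c · H x.
    apply: homV_ext => z; rewrite hom_mod_act !to_homVK.
    apply: (uu' _ (k _) (hom_post (phi c) (k x))) => {}z /=; rewrite !kE.
    have -> : (c · x) ⊗ z = (c ⊗ 1 : tens C C') · (x ⊗ z : ext_mod X X').
      by rewrite ext_pure fact1.
    by rewrite fE tE rmorph1.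
  have [G GE] := ue _ H lH HA.
  exists (uncurry G).
  apply: (tens_ext (f := fun t => uncurry G (tmap u u' t))) => [||x y].
  + by move=> a s t; rewrite tmap_linear fhom_linear.
  + exact: lf.
  by rewrite tuE uncurryE GE to_homVK kE.
apply: ext_hom_ext => y y'; rewrite -(curryE g) -(curryE g').
suff -> : curry g y = curry g' y by [].
move: y; apply: uu => x; apply: homV_ext; apply: uu' => {}y.
by rewrite !curryE -tuE gg'.
Qed.

(** Transport of the source along [theta]; surjectivity of [alpha] turns equivariance over [C'] into
    equivariance over [C]. *)
Lemma is_ind_twist (C' C B : falgType F) (phi : C -> B) (alpha : C' -> C)
    (X' : fmod C') (X : fmod C) (Y : fmod B) (u : X -> Y) (theta : X' -> X) :
  is_ind phi u -> (forall c, exists c', alpha c' = c) -> linear theta -> bijective theta ->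
  (forall c x, theta (c · x) = alpha c · theta x) ->
  is_ind (phi \o alpha) (u \o theta).
Proof.
move=> [lu uE ue uu] als lt [th' tK Kt] tE; split=> [|c x|Z f lf fE|Z g g' gg'].
- exact: linear_comp.
- by rewrite /= tE uE.
- have [||g gE] := ue Z (f \o th').
  + by move=> a x y /=; rewrite -lf; congr (f _); apply: (can_inj tK); rewrite lt !Kt.
  + move=> c x; have [c' <-] := als c; rewrite /= -fE; congr (f _).
    by apply: (can_inj tK); rewrite tE !Kt.
  by exists g => x; rewrite /= gE /= tK.
by apply: uu => x; rewrite -(Kt x); exact: gg'.
Qed.

Lemma is_ind_bij (C B : falgType F) (alpha : C -> B) (X : fmod C) (Y : fmod B)
    (theta : X -> Y) :
  (forall b, exists c, alpha c = b) -> linear theta -> bijective theta ->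
  (forall c x, theta (c · x) = alpha c · theta x) -> is_ind alpha theta.
Proof. by move=> als lt bt tE; exact: is_ind_twist (is_ind_id Y) als lt bt tE. Qed.
End UniversalInduction.

(** * Associativity and units for induced external products *)

Section TensorAssoc.
Variable F : fieldType.

Definition tassoc (U V W : vectType F) : tens U (tens V W) -> tens (tens U V) W :=
  tlift (fun u t => tlift (fun v w => (u ⊗ v) ⊗ w) t).

Definition tassoc_inv (U V W : vectType F) : tens (tens U V) W -> tens U (tens V W) :=
  tlift (fun t w => tlift (fun u v => u ⊗ (v ⊗ w)) t).

Section Spaces.
Variables U V W : vectType F.

Lemma tassoc_linear : linear (@tassoc U V W). Proof. exact: tlift_linear. Qed.
Lemma tassoc_inv_linear : linear (@tassoc_inv U V W). Proof. exact: tlift_linear. Qed.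

Lemma tassocE (u : U) (v : V) (w : W) : tassoc (u ⊗ (v ⊗ w)) = (u ⊗ v) ⊗ w.
Proof.
have b (u' : U) : bilin (fun (v : V) (w : W) => (u' ⊗ v) ⊗ w).
  split=> [x|y] a s t; first by rewrite (tens_bilin _ _).1.
  by rewrite (tens_bilin _ _).1 (tens_bilin _ _).2.
rewrite /tassoc tliftE ?tliftE //.
split=> [x|y]; first exact: tlift_linear.
apply: tlift_linear_param => x z a s t.
by rewrite !(tens_bilin _ _).2.
Qed.

Lemma tassoc_invE (u : U) (v : V) (w : W) : tassoc_inv ((u ⊗ v) ⊗ w) = u ⊗ (v ⊗ w).
Proof.
have b (w' : W) : bilin (fun (u : U) (v : V) => u ⊗ (v ⊗ w')).
  split=> [x|y] a s t; last by rewrite (tens_bilin _ _).2.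
  by rewrite (tens_bilin _ _).2 (tens_bilin _ _).1.
rewrite /tassoc_inv tliftE ?tliftE //.
split=> [x|y]; last exact: tlift_linear.
apply: tlift_linear_param => z z' a s t.
by rewrite !(tens_bilin _ _).1.
Qed.

Lemma tens3_extl (X : lmodType F) (f g : tens (tens U V) W -> X) :
  linear f -> linear g -> (forall u v w, f ((u ⊗ v) ⊗ w) = g ((u ⊗ v) ⊗ w)) -> f =1 g.
Proof.
move=> lf lg fg; apply: tens_ext => // t w; move: t.
apply: (tens_ext (f := fun t => f (t ⊗ w)) (g := fun t => g (t ⊗ w))) => // a x y.
  by rewrite (tens_bilin _ _).2 lf.
by rewrite (tens_bilin _ _).2 lg.
Qed.

Lemma tens3_extr (X : lmodType F) (f g : tens U (tens V W) -> X) :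
  linear f -> linear g -> (forall u v w, f (u ⊗ (v ⊗ w)) = g (u ⊗ (v ⊗ w))) -> f =1 g.
Proof.
move=> lf lg fg; apply: tens_ext => // u t; move: t.
apply: (tens_ext (f := fun t => f (u ⊗ t)) (g := fun t => g (u ⊗ t))) => // a x y.
  by rewrite (tens_bilin _ _).1 lf.
by rewrite (tens_bilin _ _).1 lg.
Qed.

Lemma tassocK : cancel (@tassoc U V W) (@tassoc_inv U V W).
Proof.
apply: (tens3_extr (g := id)) => // [|u v w]; last by rewrite tassocE tassoc_invE.
exact: linear_comp tassoc_inv_linear tassoc_linear.
Qed.

Lemma tassoc_invK : cancel (@tassoc_inv U V W) (@tassoc U V W).
Proof.
apply: (tens3_extl (g := id)) => // [|u v w]; last by rewrite tassoc_invE tassocE.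
exact: linear_comp tassoc_linear tassoc_inv_linear.
Qed.
End Spaces.

Lemma tassoc_act (A B C : falgType F) (M : fmod A) (N : fmod B) (P : fmod C)
    (t : tens A (tens B C)) (x : ext_mod M (ext_mod N P)) :
  tassoc (t · x : tens M (tens N P)) =
  tassoc t · (tassoc (x : tens M (tens N P)) : ext_mod (ext_mod M N) P).
Proof.
have lM (D : falgType F) (Y : fmod D) (d : D) := @fact_linear F D Y d.
move: t; apply: (tens3_extr
  (f := fun t => tassoc ((t : tens A (tens B C)) · x : tens M (tens N P)))
  (g := fun t => tassoc t · (tassoc (x : tens M (tens N P)) : ext_mod (ext_mod M N) P))).
- by move=> k s t; rewrite (fact_bilin (ext_mod M (ext_mod N P))).2 tassoc_linear.
- by move=> k s t; rewrite tassoc_linear (fact_bilin (ext_mod (ext_mod M N) P)).2.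
move=> a b c; move: x; apply: (tens3_extr
  (f := fun x => tassoc ((a ⊗ (b ⊗ c) : tens A (tens B C)) · (x : ext_mod M (ext_mod N P)) : tens M (tens N P)))
  (g := fun x => tassoc (a ⊗ (b ⊗ c)) · (tassoc (x : tens M (tens N P)) : ext_mod (ext_mod M N) P))).
- by move=> k s t; rewrite lM tassoc_linear.
- by move=> k s t; rewrite tassoc_linear lM.
move=> m n p; rewrite (tassocE a) (tassocE m).
have -> : (a ⊗ (b ⊗ c) : tens A (tens B C)) · (m ⊗ (n ⊗ p) : ext_mod M (ext_mod N P)) =
   (a · m) ⊗ ((b · n) ⊗ (c · p)) by rewrite !ext_pure.
by rewrite tassocE !ext_pure.
Qed.

(** Up to reassociation, both sides are induced from M ⊗ N ⊗ P along one and the same map to [E]. *)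
Lemma ind_ext_assoc (A B C D D' E : falgType F) (r1 : {lrmorphism tens A B -> D})
    (s1 : {lrmorphism tens D C -> E}) (r2 : {lrmorphism tens B C -> D'})
    (s2 : {lrmorphism tens A D' -> E}) (M : fmod A) (N : fmod B) (P : fmod C) :
  (forall a b c, s1 (r1 (a ⊗ b) ⊗ c) = s2 (a ⊗ r2 (b ⊗ c))) ->
  fiso (ind_mod s1 (ext_mod (ind_mod r1 (ext_mod M N)) P))
       (ind_mod s2 (ext_mod M (ind_mod r2 (ext_mod N P)))).
Proof.
move=> assoc.
have i1 := is_ind_ext (phi := r1) (phi' := (idfun : {lrmorphism C -> C}))
  (ind_is_ind r1 (ext_mod M N)) (is_ind_id P).
have j1 := is_ind_comp i1 (ind_is_ind s1 _).
have i2 := is_ind_ext (phi := (idfun : {lrmorphism A -> A})) (phi' := r2)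
  (is_ind_id M) (ind_is_ind r2 (ext_mod N P)).
have j2 := is_ind_comp i2 (ind_is_ind s2 _).
have k1 := @is_ind_twist F (tens A (tens B C)) _ _ _ (@tassoc A B C)
  (ext_mod M (ext_mod N P)) (ext_mod (ext_mod M N) P) _ _ (@tassoc M N P) j1.
apply: is_ind_fiso (k1 _ _ _ _) _ => [c||||].
- by exists (tassoc_inv c); exact: tassoc_invK.
- exact: tassoc_linear.
- exists (@tassoc_inv M N P); [exact: tassocK|exact: tassoc_invK].
- exact: tassoc_act.
apply: eq_is_ind j2; apply: tens3_extr => [||a b c].
- by move=> k x y; rewrite /= !linearP.
- by move=> k x y; rewrite /= tassoc_linear !linearP.
have tE (X Y X' Y' : falgType F) (f : {lrmorphism X -> X'}) (g : {lrmorphism Y -> Y'}) x y :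
   tmor f g (x ⊗ y) = f x ⊗ g y by apply: tmapE; exact: linearP.
by rewrite /= tassocE !tE assoc.
Qed.

(** As [B] is F, the map b ⊗ n ↦ r(b ⊗ 1) n is bijective, and it exhibits [N] as induced along the
    surjection [r]. *)
Lemma ind_unitl (B C : falgType F) (r : {lrmorphism tens B C -> C}) (N : fmod C) :
  bijective (fun c : F => c%:A : B) -> (forall c, r (1 ⊗ c) = c) ->
  fiso (ind_mod r (ext_mod (reg_mod B) N)) N.
Proof.
move=> [sc scK Ksc] r1.
pose th (t : tens B N) : N := tlift (fun (b : B) (n : N) => r (b ⊗ 1) · n) t.
have lth : linear th by exact: tlift_linear.
have bth : bilin (fun (b : B) (n : N) => r (b ⊗ 1) · n).
  split=> [b|n]; first exact: fact_linear.
  by move=> a x y; rewrite (tens_bilin _ _).2 linearP (fact_bilin N).2.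
have thE b n : th (b ⊗ n) = r (b ⊗ 1) · n by exact: tliftE.
have bE (b : B) : b = sc b *: 1 by rewrite -[LHS]Ksc.
have th1 n : th (1 ⊗ n) = n by rewrite thE r1 fact1.
have ti : bijective (th : ext_mod (reg_mod B) N -> N).
  exists (fun n => (1 : B) ⊗ n) => // t; move: t.
  apply: (tens_ext (f := fun t => 1 ⊗ th t) (g := id)) => // [a x y|b n].
    by rewrite lth (tens_bilin _ _).1.
  by rewrite [b]bE (bilinZl (@tens_bilin _ _ _)) (linearZf lth) th1 (bilinZr (@tens_bilin _ _ _)).
apply: is_ind_fiso (ind_is_ind r _) _; apply: (@is_ind_bij F _ _ r (ext_mod (reg_mod B) N) N th) => //.
  by move=> c; exists (1 ⊗ c).
move=> t x; pose N2 := res_mod r N.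
apply: (@ext_act_ext _ _ _ (reg_mod B) N N2 th lth) => b c b' n.
rewrite -[X in th (X ⊗ _)]/(b * (b' : B)) thE -[RHS]/(r (b ⊗ c) · th (b' ⊗ n)) thE -!factM -!rmorphM.
by rewrite -{1}[c]r1 -rmorphM !tensM !mulr1 !mul1r.
Qed.

Lemma ind_unitr (B C : falgType F) (r : {lrmorphism tens C B -> C}) (N : fmod C) :
  bijective (fun c : F => c%:A : B) -> (forall c, r (c ⊗ 1) = c) ->
  fiso (ind_mod r (ext_mod N (reg_mod B))) N.
Proof.
move=> [sc scK Ksc] r1.
pose th (t : tens N B) : N := tlift (fun (n : N) (b : B) => r (1 ⊗ b) · n) t.
have lth : linear th by exact: tlift_linear.
have bth : bilin (fun (n : N) (b : B) => r (1 ⊗ b) · n).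
  split=> [n|b]; last exact: fact_linear.
  by move=> a x y; rewrite (tens_bilin _ _).1 linearP (fact_bilin N).2.
have thE n b : th (n ⊗ b) = r (1 ⊗ b) · n by exact: tliftE.
have bE (b : B) : b = sc b *: 1 by rewrite -[LHS]Ksc.
have th1 n : th (n ⊗ 1) = n by rewrite thE r1 fact1.
have ti : bijective (th : ext_mod N (reg_mod B) -> N).
  exists (fun n => n ⊗ (1 : B)) => // t; move: t.
  apply: (tens_ext (f := fun t => th t ⊗ 1) (g := id)) => // [a x y|n b].
    by rewrite lth (tens_bilin _ _).2.
  by rewrite [b]bE (bilinZr (@tens_bilin _ _ _)) (linearZf lth) th1 (bilinZl (@tens_bilin _ _ _)).
apply: is_ind_fiso (ind_is_ind r _) _; apply: (@is_ind_bij F _ _ r (ext_mod N (reg_mod B)) N th) => //.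
  by move=> c; exists (c ⊗ 1).
move=> t x; pose N2 := res_mod r N.
apply: (@ext_act_ext _ _ _ N (reg_mod B) N2 th lth) => c b n b'.
rewrite -[X in th (_ ⊗ X)]/(b * (b' : B)) thE -[RHS]/(r (c ⊗ b) · th (n ⊗ b')) thE -!factM -!rmorphM.
by rewrite -{1}[c]r1 -rmorphM !tensM !mulr1 !mul1r.
Qed.
End TensorAssoc.

(** * Grothendieck groups of a tower *)

Section TowerMaps.
Variables (F : fieldType) (A : tower F).

Lemma existT_talg_inj n (x y : A n) :
  existT (fun k => A k : Type) n x = existT (fun k => A k : Type) n y -> x = y.
Proof. by apply: Eqdep_dec.inj_pair2_eq_dec; exact: eq_comparable. Qed.

Lemma rho_to_existT m n N (e : (m + n = N)%N) x :
  existT (fun k => A k : Type) N (rho_to A e x) = existT _ (m + n)%N (rho A m n x).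
Proof. by case: N / e. Qed.

Lemma rho_flat m n : flat (rho A m n).
Proof. by apply: projective_flat; exact: rho_projr. Qed.

Lemma rho_to_flat m n N (e : (m + n = N)%N) : flat (rho_to A e).
Proof. by case: N / e; exact: rho_flat. Qed.

(** Naming the intermediate degrees [s] and [t] lets their equations be eliminated; what remains is
    [rhoA] in the disjoint union. *)
Lemma rho_to_assoc m n p s t N (e1 : (m + n = s)%N) (e2 : (s + p = N)%N)
    (e3 : (n + p = t)%N) (e4 : (m + t = N)%N) (a : A m) (b : A n) (c : A p) :
  rho_to A e2 (rho_to A e1 (a ⊗ b) ⊗ c) = rho_to A e4 (a ⊗ rho_to A e3 (b ⊗ c)).
Proof.
case: s / e1 e2 => e2; case: t / e3 e4 => e4; apply: existT_talg_inj.
by rewrite !rho_to_existT [RHS]rhoA.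
Qed.

(** [rho1] is a scalar c times 1 because A_0 = F, and the unit law applied to 1 reads c 1 = 1. *)
Lemma rho1_eq1 : rho1 A = 1.
Proof.
have [sc _ Ksc] := talg0 A; have := existT_talg_inj (rho1l (1 : A 0)).
by rewrite -[rho1 A]Ksc (bilinZl (@tens_bilin _ _ _)) linearZ /= -tens1 rmorph1.
Qed.

Lemma rho_unitl n (a : A n) : rho A 0 n (1 ⊗ a) = a.
Proof. by have := existT_talg_inj (rho1l a); rewrite rho1_eq1. Qed.

Lemma rho_unitr n (a : A n) : rho_to A (addn0 n) (a ⊗ 1) = a.
Proof.
by apply: existT_talg_inj; rewrite rho_to_existT -[RHS]rho1r rho1_eq1.
Qed.
End TowerMaps.

(** * Classes of graded modules *)

Section GradedClasses.
Variables (F : fieldType) (T : groth F) (th : theory T).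
Local Notation ok := (tok th).
Local Notation cl := (gclass (g := T)).

Definition res_gr (C B : falgType F) (phi : {lrmorphism C -> B}) (x : gr T B) : gr T C :=
  glift (fun M => cl (res_mod phi M)) x.
Definition ind_gr (C B : falgType F) (phi : {lrmorphism C -> B}) (x : gr T C) : gr T B :=
  glift (fun M => cl (ind_mod phi M)) x.

Lemma res_gr_zmod (C B : falgType F) (phi : {lrmorphism C -> B}) : zmod_morphism (res_gr phi).
Proof. exact: glift_additive. Qed.
Lemma ind_gr_zmod (C B : falgType F) (phi : {lrmorphism C -> B}) : zmod_morphism (ind_gr phi).
Proof. exact: glift_additive. Qed.

Lemma res_gr_class (C B : falgType F) (phi : {lrmorphism C -> B}) (M : fmod B) :
  projective (left_via phi) -> ok M -> res_gr phi (cl M) = cl (res_mod phi M).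
Proof. by move=> pphi oM; rewrite /res_gr (glift_class (th := th)) //; exact: res_gr_additive. Qed.

Lemma ind_gr_class (C B : falgType F) (phi : {lrmorphism C -> B}) (M : fmod C) :
  flat phi -> ok M -> ind_gr phi (cl M) = cl (ind_mod phi M).
Proof. by move=> fphi oM; rewrite /ind_gr (glift_class (th := th)) //; exact: ind_gr_additive. Qed.

Lemma gr_additive_ext (B : falgType F) (W : zmodType) (f g : gr T B -> W) :
  zmod_morphism f -> zmod_morphism g -> (forall M, ok M -> f (cl M) = g (cl M)) -> f =1 g.
Proof.
move=> zf zg fg; apply: (gr_ind (t := th)) => // [|x y fx fy].
  by rewrite (addf0 zf) (addf0 zg).
by rewrite zf zg fx fy.
Qed.

Lemma dsum_additive_ext (I : eqType) (B : I -> falgType F) (W : zmodType)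
    (f g : dsum (fun i => gr T (B i)) -> W) :
  zmod_morphism f -> zmod_morphism g ->
  (forall i M, ok M ->
    f (dsum_inj (V := fun i => gr T (B i)) (cl M : gr T (B i)))
    = g (dsum_inj (V := fun i => gr T (B i)) (cl M : gr T (B i)))) -> f =1 g.
Proof.
move=> zf zg fg; apply: dsum_ind => [|x y fx fy|i v].
- by rewrite (addf0 zf) (addf0 zg).
- by rewrite (addfD zf) (addfD zg) fx fy.
move: v; apply: (gr_additive_ext (f := fun v => f (dsum_inj v)) (g := fun v => g (dsum_inj v))).
- exact: zmod_morphism_comp zf (@dsum_inj_zmod _ _ _).
- exact: zmod_morphism_comp zg (@dsum_inj_zmod _ _ _).
exact: fg.
Qed.

Section Families.
Variables (I J : eqType) (B : I -> falgType F) (C : J -> falgType F).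
Local Notation HB := (dsum (fun i => gr T (B i))).
Local Notation HC := (dsum (fun j => gr T (C j))).

Lemma pull_gr_zmod (D : pull_data B C) : zmod_morphism (pull_gr D : HB -> HC).
Proof. by move=> x y; apply: dsum_ext => j; exact: res_gr_zmod. Qed.

Lemma push_gr_zmod (D : push_data B C) : zmod_morphism (push_gr D : HB -> HC).
Proof.
move=> x y; apply: dsum_ext => j; rewrite dsumB /= -sumrB; apply: eq_bigr => t _.
exact: ind_gr_zmod.
Qed.

(** The hypothesis makes [t] the only summand of component [j] fed by the given degree; [stgt]
    excludes contributions to other components. *)
Lemma push_gr_inj (D : push_data B C) j (t : sty D j) (v : gr T (B (sidx t))) :
  (forall t' : sty D j, sidx t' = sidx t -> t' = t) ->
  push_gr D (dsum_inj (V := fun i => gr T (B i)) v) =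
  dsum_inj (V := fun j => gr T (C j)) (ind_gr (smap t) v).
Proof.
move=> ut; apply: dsum_ext => j' /=; have [e|jj] := eqVneq j j'.
  case: j' / e; rewrite (bigD1 t) // -[RHS]/(dsum_inj _ j) dsum_inj_eq.
  rewrite -/(ind_gr (smap t) _) -[X in ind_gr _ X]/(dsum_inj v (sidx t)) dsum_inj_eq.
  rewrite big1 => [|t' tt']; first exact: addr0.
  rewrite -/(ind_gr (smap t') _) -[X in ind_gr _ X]/(dsum_inj v (sidx t')).
  rewrite dsum_inj_neq; first exact: (addf0 (ind_gr_zmod _)).
  by apply: contra tt' => /eqP /esym /ut ->.
rewrite -[RHS]/(dsum_inj _ j') dsum_inj_neq // big1 // => t' _.
rewrite -/(ind_gr (smap t') _) -[X in ind_gr _ X]/(dsum_inj v (sidx t')).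
rewrite dsum_inj_neq; first exact: (addf0 (ind_gr_zmod _)).
by apply: contra jj => /eqP /(congr1 (@stgt _ _ _ _ _ D)); rewrite !sidxK => ->.
Qed.

(** The bridge from isomorphisms of functors to identities in Grothendieck groups. *)
Definition gmclass (M : gmod B) : HB.
Proof.
exists (fun i => cl (M i)); apply: sub_finite_set (gmod_finite M) => i /=.
by apply: contra_neq_not => M0; rewrite (gclass0 th M0).
Defined.
End Families.

Definition gsingle (I : eqType) (B : I -> falgType F) (i : I) (M : fmod (B i)) : gmod B.
Proof.
exists (fun j => match i =P j with
                 | ReflectT e => ecast k (fmod (B k)) e M
                 | ReflectF _ => zero_mod (B j) end).
apply: sub_finite_set (finite_set1 i) => j /=.
by case: eqP => // _ h; case: h; exact: zero_is_zero.
Defined.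

Lemma gsingle_eq (I : eqType) (B : I -> falgType F) (i : I) (M : fmod (B i)) :
  gsingle M i = M.
Proof. by rewrite /gsingle /=; case: eqP => // e; rewrite (eq_axiomK e). Qed.

Lemma gsingle_neq (I : eqType) (B : I -> falgType F) (i j : I) (M : fmod (B i)) :
  i <> j -> is_zero_mod (gsingle M j).
Proof. by move=> ij; rewrite /gsingle /=; case: eqP => // _; exact: zero_is_zero. Qed.

Lemma gsingle_ok (I : eqType) (B : I -> falgType F) (i : I) (M : fmod (B i)) j :
  ok M -> ok (gsingle M j).
Proof.
move=> oM; have [<-|/eqP ij] := eqVneq i j; first by rewrite gsingle_eq.
by apply: tok_zero; exact: gsingle_neq.
Qed.

Lemma gmclass_single (I : eqType) (B : I -> falgType F) (i : I) (M : fmod (B i)) :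
  gmclass (gsingle M) = dsum_inj (V := fun i => gr T (B i)) (cl M).
Proof.
apply: dsum_ext => j; rewrite -[LHS]/(cl (gsingle M j)).
have [<-|ij] := eqVneq i j; first by rewrite gsingle_eq dsum_inj_eq.
by rewrite dsum_inj_neq // (gclass0 th) //; apply: gsingle_neq; exact/eqP.
Qed.

Lemma gmclass_pull (I J : eqType) (B : I -> falgType F) (C : J -> falgType F)
    (D : pull_data B C) (M : gmod B) :
  (forall j, projective (left_via (Defs.pmap D j))) -> (forall i, ok (M i)) ->
  pull_gr D (gmclass M) = gmclass (pull D M).
Proof. by move=> pD oM; apply: dsum_ext => j; exact: res_gr_class. Qed.

Lemma gmclass_push (I J : eqType) (B : I -> falgType F) (C : J -> falgType F)
    (D : push_data B C) (M : gmod B) :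
  (forall j (t : sty D j), flat (smap t)) -> (forall i, ok (M i)) ->
  push_gr D (gmclass M) = gmclass (push D M).
Proof.
move=> fD oM; apply: dsum_ext => j; rewrite [RHS](gclass_bigsum (th := th)) => [|t].
  by apply: eq_bigr => t _; exact: ind_gr_class.
exact: tok_ind.
Qed.

Lemma gmclass_isom (I : eqType) (B : I -> falgType F) (M N : gmodc B) :
  (forall i, ok ((M : gmod B) i)) -> isom M N -> gmclass M = gmclass N.
Proof.
move=> oM [f [g [gf fg]]]; apply: dsum_ext => i; apply: (gclass_fiso (th := th)) => //.
exists (f i), (g i); split=> x.
  by have := congr1 (fun h : mor M M => h i x) gf.
by have := congr1 (fun h : mor N N => h i x) fg.
Qed.
End GradedClasses.
Arguments res_gr {F T C B} phi x.
Arguments ind_gr {F T C B} phi x.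

(** * The algebra structure on the Grothendieck groups of a tower *)

Section TowerGroth.
Variables (F : fieldType) (A : tower F) (T : groth F) (th : theory T).
Local Notation ok := (tok th).
Local Notation cl := (gclass (g := T)).
Local Notation H := (gr_tower A T).
Local Notation H2 := (dsum (fun p : nat * nat => gr T (A2 A p))).
Local Notation inj i := (@dsum_inj nat (fun k => gr T (A k)) i).
Local Notation inj2 i := (@dsum_inj _ (fun q : nat * nat => gr T (A2 A q)) i).
Local Notation mul := (@gr_mul F A T).
Local Notation one := (@gr_one F A T).

Lemma ext_dsum_biadditive : biadditive (@ext_dsum F T A).
Proof.
split=> [x y z|x y z]; apply: dsum_ext => p.
  exact: (ext_gr_biadditive th _ _).1.
exact: (ext_gr_biadditive th _ _).2.
Qed.

Lemma kappaE (x y : H) : kappa (zpure x y) = ext_dsum x y.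
Proof. exact: zliftE ext_dsum_biadditive. Qed.

Lemma kappa_zmod : zmod_morphism (@kappa F T A).
Proof. exact: zlift_additive. Qed.

Lemma ext_gr0l (B C : falgType F) (y : gr T C) : ext_gr (0 : gr T B) y = 0.
Proof. exact: (addf0 (ext_gr_zmodl y)). Qed.
Lemma ext_gr0r (B C : falgType F) (x : gr T B) : ext_gr x (0 : gr T C) = 0.
Proof. exact: (addf0 (ext_gr_zmodr th x)). Qed.

Lemma ext_dsum_inj m n (u : gr T (A m)) (v : gr T (A n)) :
  ext_dsum (inj m u) (inj n v) = inj2 (m, n) (ext_gr u v).
Proof.
apply: dsum_ext => -[p q]; rewrite -[LHS]/(ext_gr (inj m u p) (inj n v q)).
have [<-|mp] := eqVneq m p; last first.
  rewrite (dsum_inj_neq _ mp) ext_gr0l dsum_inj_neq //.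
  by apply: contra mp => /eqP [->].
have [<-|nq] := eqVneq n q; last first.
  rewrite (dsum_inj_neq _ nq) ext_gr0r dsum_inj_neq //.
  by apply: contra nq => /eqP [->].
by rewrite !dsum_inj_eq.
Qed.

Lemma push_nabla_inj m n N (e : (m + n = N)%N) (v : gr T (A2 A (m, n))) :
  push_gr (nabla_data A) (inj2 (m, n) v) = inj N (ind_gr (rho_to A e) v).
Proof.
(* [nabla_data] records the second index as [N - m], so [n] is replaced by it; equality proofs in
   nat are then unique. *)
have en : (N - m = n)%N by rewrite -e addKn.
have mN : (m < N.+1)%N by rewrite ltnS -e leq_addr.
case: n / en e v => e v; pose t : sty (nabla_data A) N := Ordinal mN.
rewrite (push_gr_inj (D := nabla_data A) (t := t)) => [|t' [tt' _]]; last exact: val_inj.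
exact: (congr1 (fun e' : (m + (N - m) = N)%N => inj N (ind_gr (rho_to A e') v)) (eq_irrelevance _ e)).
Qed.

(** The free target degree [N] allows the two bracketings of a triple product to be compared without
    casts. *)
Lemma gr_mul_inj m n N (e : (m + n = N)%N) (u : gr T (A m)) (v : gr T (A n)) :
  mul (inj m u) (inj n v) = inj N (ind_gr (rho_to A e) (ext_gr u v)).
Proof. by rewrite /gr_mul kappaE ext_dsum_inj (push_nabla_inj e). Qed.

Lemma gr_mul_biadditive : biadditive mul.
Proof.
have zp := push_gr_zmod (T := T) (nabla_data A).
have zk := kappa_zmod.
apply: biadditiveP => [y x x'|x y y']; rewrite /gr_mul.
  by rewrite (zpure_zmodl y) zk zp.
by rewrite (zpure_zmodr x) zk zp.
Qed.

(** Additivity reduces to classes in single degrees, where this is transitivity of induction,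
    [ind_ext_assoc]. *)
Lemma gr_mulA : associative mul.
Proof.
have bm := gr_mul_biadditive; have [bl br] := bm.
have zl y := biadditive_zmodl y bm; have zr x := biadditive_zmodr x bm.
move=> x y z; move: x; apply: (dsum_additive_ext (th := th) (B := A)
  (f := fun x => mul x (mul y z)) (g := fun x => mul (mul x y) z)) => [||m M oM].
- exact: zl.
- exact: zmod_morphism_comp (zl z) (zl y).
move: y; apply: (dsum_additive_ext (th := th) (B := A)
  (f := fun y => mul (inj m (cl M)) (mul y z)) (g := fun y => mul (mul (inj m (cl M)) y) z)) => [||n N oN].
- exact: zmod_morphism_comp (zr _) (zl z).
- exact: zmod_morphism_comp (zl z) (zr _).
move: z; apply: (dsum_additive_ext (th := th) (B := A)
  (f := fun z => mul (inj m (cl M)) (mul (inj n (cl N)) z))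
  (g := fun z => mul (mul (inj m (cl M)) (inj n (cl N))) z)) => [||p P oP].
- exact: zmod_morphism_comp (zr _) (zr _).
- exact: zr.
rewrite (gr_mul_inj (erefl (n + p)%N)) (gr_mul_inj (erefl (m + (n + p))%N)).
rewrite (gr_mul_inj (erefl (m + n)%N)) (gr_mul_inj (esym (addnA m n p))).
rewrite !(ext_gr_class (th := th)) //.
rewrite !(ind_gr_class (th := th)); do ?[exact: rho_flat | exact: rho_to_flat | exact: tok_ext].
rewrite !(ext_gr_class (th := th)) //; do ?[apply: tok_ind; exact: tok_ext].
rewrite !(ind_gr_class (th := th)); do ?[exact: rho_flat | exact: rho_to_flat | apply: tok_ext => //; apply: tok_ind; exact: tok_ext].
congr (dsum_inj _); apply: esym; apply: (gclass_fiso (th := th)).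
  by apply/tok_ind/tok_ext => //; apply/tok_ind/tok_ext.
apply: ind_ext_assoc => a b c.
exact: (rho_to_assoc (erefl (m + n)%N) (esym (addnA m n p)) (erefl (n + p)%N) (erefl _)).
Qed.

Lemma gr_mul1l : left_id one mul.
Proof.
apply: (dsum_additive_ext (th := th) (B := A) (f := mul one) (g := id)) => [||n N oN].
- exact: biadditive_zmodr gr_mul_biadditive.
- by [].
rewrite /gr_one (gr_mul_inj (erefl (0 + n)%N)).
rewrite (ext_gr_class (th := th)) ?(ind_gr_class (th := th)) //; try exact: tok_reg.
- congr (dsum_inj _); apply: (gclass_fiso (th := th)).
    by apply/tok_ind/tok_ext => //; exact: tok_reg.
  by apply: ind_unitl; [exact: talg0|exact: rho_unitl].
- exact: rho_flat.
by apply/tok_ext => //; exact: tok_reg.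
Qed.

Lemma gr_mul1r : right_id one mul.
Proof.
apply: (dsum_additive_ext (th := th) (B := A) (f := mul^~ one) (g := id)) => [||n N oN].
- exact: (biadditive_zmodl one gr_mul_biadditive).
- by [].
rewrite /gr_one (gr_mul_inj (addn0 n)).
rewrite (ext_gr_class (th := th)) ?(ind_gr_class (th := th)) //; try exact: tok_reg.
- congr (dsum_inj _); apply: (gclass_fiso (th := th)).
    by apply/tok_ind/tok_ext => //; exact: tok_reg.
  by apply: ind_unitr; [exact: talg0|exact: rho_unitr].
- exact: rho_to_flat.
by apply/tok_ext => //; exact: tok_reg.
Qed.
End TowerGroth.

(** * Degree zero: modules over F *)

Section ScalarAlgebra.
Variables (F : fieldType) (T : groth F) (th : theory T) (B : falgType F).
Hypothesis bB : bijective (fun c : F => c%:A : B).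
Local Notation cl := (gclass (g := T)).

Lemma scalar_algebra_dim : \dim {:B} = 1%N.
Proof.
have [s sK Ks] := bB; have -> : 1%N = \dim {:F^o} by rewrite dimvf.
apply/eqP; rewrite eqn_leq; apply/andP; split.
  apply: (@linear_dim_le F B F^o s) => [a x y|x x0]; last by rewrite -(Ks x) x0 scale0r.
  by apply: (can_inj sK); rewrite scalerDl -scalerA !Ks.
apply: (@linear_dim_le F F^o B (fun c : F => c%:A)) => [a x y|c c0].
  by rewrite scalerDl -scalerA.
by rewrite -[c]sK c0; apply: (can_inj sK); rewrite Ks scale0r.
Qed.

(** A nonzero vector spans a copy of the regular module. Linear maps are [B]-linear here, so this
    copy is a direct summand and can be split off. *)
Lemma scalar_algebra_class (M : fmod B) : tok th M -> cl M = cl (reg_mod B) *+ \dim {:M}.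
Proof.
have [s sK Ks] := bB; have [n] := ubnP (\dim {:M}); elim: n M => // n IH M dM oM.
case: (pselect (is_zero_mod M)) => [M0|nM].
  by rewrite (gclass0 th M0) (dim_eq0 M).2.
have [x x0] : exists x : M, x <> 0.
  by apply: contrapT => h; apply: nM => x; apply: contrapT => x0; apply: h; exists x.
have act (N : fmod B) (b : B) (y : N) : b · y = s b *: y.
  by rewrite -{1}(Ks b) (linearZf ((fact_bilin N).2 y)) fact1.
have fL : linear (fun b : reg_mod B => (b : B) · x) by exact: (fact_bilin M).2.
have fA b (c : reg_mod B) : (b · c : B) · x = b · ((c : B) · x) by exact: factM.
pose f := @FHom _ _ (reg_mod B) M _ fL fA.
have fi : injective f.
  apply: fhom_inj => b; rewrite -[f b]/((b : B) · x) act => /eqP; rewrite scaler_eq0.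
  by case/orP => /eqP // b0; rewrite -[b]Ks b0 scale0r.
have [ii ps ex] := im_short_exact fi.
have [r [_ [rL _ rK _ _]]] := linear_split (fhom_linear f) (fhom_linear _) ii ps ex.
have rA b y : r (b · y) = b · (r y : reg_mod B) by rewrite !act (linearZf rL).
have [Z iZ] := retract_summand (i := f) (p := FHom rL rA) rK.
have oZ : tok th Z by exact: tok_sumr (tok_fiso (fiso_sym iZ) oM).
have dZ : \dim {:M} = (\dim {:Z}).+1.
  rewrite (fiso_dim iZ) (short_exact_dim (sum_short_exact (reg_mod B) Z)).
  by rewrite -add1n scalar_algebra_dim.
have eZ : cl Z = cl (reg_mod B) *+ \dim {:Z} by apply: IH => //; move: dM; rewrite dZ ltnS.
by rewrite (gclass_fiso oM iZ) (gclass_sum (tok_reg th B) oZ) eZ dZ mulrS.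
Qed.

Definition dim_gr (x : gr T B) : int := glift (fun M : fmod B => (\dim {:M})%:Z) x.

Lemma dim_gr_zmod : zmod_morphism dim_gr. Proof. exact: glift_additive. Qed.

Lemma dim_gr_class (M : fmod B) : tok th M -> dim_gr (cl M) = \dim {:M}.
Proof.
by apply: (glift_class (th := th)) => // X Y Z i p _ _ _ se; rewrite (short_exact_dim se).
Qed.

Lemma scalar_algebra_gr (x : gr T B) : x = cl (reg_mod B) *~ dim_gr x.
Proof.
move: x; apply: (gr_additive_ext (th := th) (f := id)
   (g := fun x => cl (reg_mod B) *~ dim_gr x)) => // [x y|M oM].
  by rewrite dim_gr_zmod mulrzBr.
by rewrite dim_gr_class // scalar_algebra_class.
Qed.
End ScalarAlgebra.

(** * The coalgebra structure and the remaining Hopf axioms *)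

Section TowerCoalgebra.
Variables (F : fieldType) (A : tower F) (T : groth F) (th : theory T).
Local Notation ok := (tok th).
Local Notation cl := (gclass (g := T)).
Local Notation H := (gr_tower A T).
Local Notation H2 := (dsum (fun p : nat * nat => gr T (A2 A p))).
Local Notation inj i := (@dsum_inj nat (fun k => gr T (A k)) i).
Local Notation inj2 i := (@dsum_inj _ (fun q : nat * nat => gr T (A2 A q)) i).
Local Notation mul := (@gr_mul F A T).
Local Notation one := (@gr_one F A T).
Local Notation com := (@gr_comul F A T).
Local Notation eps := (@gr_counit F A T).

Lemma gr_counit_zmod : zmod_morphism eps.
Proof. by move=> x y; exact: dim_gr_zmod. Qed.

Lemma gr_counit_inj n (v : gr T (A n)) : n <> 0%N -> eps (inj n v) = 0.
Proof.
move=> n0; rewrite /gr_counit dsum_inj_neq; last exact/eqP.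
exact: (addf0 (@dim_gr_zmod F T (A 0))).
Qed.

Lemma gr_counit_one : eps one = 1.
Proof.
rewrite /gr_counit /gr_one dsum_inj_eq -[LHS]/(dim_gr (cl (reg_mod (A 0)))).
have e : \dim {:reg_mod (A 0%N)} = 1%N := scalar_algebra_dim (talg0 A).
by rewrite (dim_gr_class (tok_reg th _)) e.
Qed.

Lemma gr_component0 (x : H) : x 0%N = one 0%N *~ eps x.
Proof. by rewrite /gr_one dsum_inj_eq; exact: (scalar_algebra_gr th (talg0 A)). Qed.

Lemma gr_connected (x : H) : homog 0%N x -> x = one *~ eps x.
Proof.
move=> hx; rewrite [LHS](homog_inj hx) gr_component0 /gr_one dsum_inj_eq.
exact: (addfMz (@dsum_inj_zmod _ _ 0%N)).
Qed.

Lemma gr_mul_homog m n (x y : H) : homog m x -> homog n y -> homog (m + n)%N (mul x y).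
Proof.
move=> /homog_inj -> /homog_inj ->; rewrite (gr_mul_inj th (erefl (m + n)%N)).
exact: dsum_inj_homog.
Qed.

Lemma gr_counitM (x y : H) : eps (mul x y) = eps x * eps y.
Proof.
have bm := @gr_mul_biadditive F A T; have ze := gr_counit_zmod.
have bee : biadditive (fun x y : H => eps x * eps y).
  by split=> a b c; rewrite (addfD ze) (mulrDl, mulrDr).
move: x; apply: (dsum_ind (V := fun k => gr T (A k))) => [|x x' ex ex'|m u].
- by rewrite (addf0 (biadditive_zmodl y bm)) !(addf0 ze) mul0r.
- by rewrite bm.1 !(addfD ze) ex ex' mulrDl.
move: y; apply: (dsum_ind (V := fun k => gr T (A k))) => [|y y' ey ey'|n v].
- by rewrite (addf0 (biadditive_zmodr _ bm)) !(addf0 ze) mulr0.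
- by rewrite bm.2 !(addfD ze) ey ey' mulrDr.
case: m u => [|m] u; last first.
  by rewrite (gr_mul_inj th (erefl (m.+1 + n)%N)) (@gr_counit_inj (m.+1 + n)) // (@gr_counit_inj m.+1) // mul0r.
case: n v => [|n] v; last first.
  by rewrite (gr_mul_inj th (erefl (0 + n.+1)%N)) (@gr_counit_inj (0 + n.+1)) // (@gr_counit_inj n.+1) // mulr0.
set x := inj 0%N u; set y := inj 0%N v.
rewrite {1}[x](gr_connected (dsum_inj_homog u)) {1}[y](gr_connected (dsum_inj_homog v)).
rewrite (addfMz (biadditive_zmodl _ bm)) (addfMz (biadditive_zmodr _ bm)) (gr_mul1l th).
by rewrite !(addfMz ze) gr_counit_one -mulrzA intz mulrC.
Qed.

(** [tgen] makes [kappa] surjective and [kinj] makes it injective, which controls the preimage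
    chosen by [gr_comul]. Both are established for K and for G in the section on the pairing of a
    tower. *)
Hypothesis tgen : forall m n (Q : gr T (A2 A (m, n)) -> Prop),
  Q 0 -> (forall x y, Q x -> Q y -> Q (x - y)) ->
  (forall (M : fmod (A m)) (N : fmod (A n)), ok M -> ok N -> Q (cl (ext_mod M N))) ->
  forall x, Q x.
Hypothesis kinj : injective (@kappa F T A).

(** The preimage is built from homogeneous tensors of the right degrees, as the grading of the
    coproduct requires. *)
Lemma kappa_preimage p (w : gr T (A2 A p)) : exists s : seq (H * H),
  kappa (\sum_(q <- s) zpure q.1 q.2) = inj2 p w /\
  forall q, q \in s -> homog p.1 q.1 /\ homog p.2 q.2.
Proof.
case: p w => m n; have zk := @kappa_zmod F A T; apply: tgen => [|x y [s [sE sH]] [r [rE rH]]|M N oM oN].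
- by exists [::]; rewrite big_nil (addf0 zk) (addf0 (@dsum_inj_zmod _ _ _)).
- exists (s ++ [seq (- q.1, q.2) | q <- r]); split.
    rewrite big_cat big_map /= (addfD zk) sE dsum_inj_zmod -rE; congr (_ + _).
    by rewrite -(addfN zk) -sumrN; congr kappa; apply: eq_bigr => q _; rewrite (addfN (zpure_zmodl _)).
  move=> q; rewrite mem_cat => /orP [/sH //|/mapP [q' /rH [h1 h2] ->]].
  split; last exact: h2.
  by move=> k kp; rewrite -[LHS]/(- (q'.1 k)) h1 // oppr0.
exists [:: (inj m (cl M), inj n (cl N))]; rewrite big_seq1; split.
  by rewrite (kappaE th) (ext_dsum_inj th) (ext_gr_class oM oN).
by move=> q; rewrite inE => /eqP ->; split; exact: dsum_inj_homog.
Qed.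

Lemma kappa_surj (y : H2) : exists t, kappa t = y.
Proof.
have zk := @kappa_zmod F A T.
move: y; apply: (dsum_ind (V := fun q => gr T (A2 A q))) => [|_ _ [t <-] [t' <-]|p w].
- by exists 0; exact: (addf0 zk).
- by exists (t + t'); rewrite (addfD zk).
by have [s [sE _]] := kappa_preimage w; exists (\sum_(q <- s) zpure q.1 q.2).
Qed.

(** By surjectivity the default value 0 of [xget] is never taken. *)
Lemma kappa_comul x : kappa (com x) = pull_gr (delta_data A) x.
Proof. exact: (xgetPex 0 (kappa_surj (pull_gr (delta_data A) x))). Qed.

Lemma gr_comul_zmod : zmod_morphism com.
Proof.
move=> x y; apply: kinj; rewrite (kappa_zmod _ _) !kappa_comul.
exact: (pull_gr_zmod (T := T) (delta_data A)).
Qed.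

Lemma gr_comul_homog n (x : H) : homog n x -> exists s : seq (H * H),
  com x = \sum_(q <- s) zpure q.1 q.2 /\
  (forall q, q \in s -> exists k l, [/\ (k + l)%N = n, homog k q.1 & homog l q.2]).
Proof.
move=> hx; have zk := @kappa_zmod F A T.
have [l [_ lE]] := dsum_decomp (pull_gr (delta_data A) x).
suff [s [sE sH]] : exists s : seq (H * H),
    kappa (\sum_(q <- s) zpure q.1 q.2) = \sum_(i <- l) inj2 i (pull_gr (delta_data A) x i) /\
    (forall q, q \in s -> exists k l, [/\ (k + l)%N = n, homog k q.1 & homog l q.2]).
  by exists s; split=> //; apply: kinj; rewrite kappa_comul sE.
elim: l {lE} => [|p l [s [sE sH]]].
  by exists [::]; rewrite !big_nil (addf0 zk).
rewrite big_cons -sE; have [pn|pn] := eqVneq (p.1 + p.2)%N n.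
  have [r [rE rH]] := kappa_preimage (pull_gr (delta_data A) x p).
  exists (r ++ s); rewrite big_cat (addfD zk) rE; split=> // q.
  rewrite mem_cat => /orP [/rH [h1 h2]|/sH //].
  by exists p.1, p.2.
(* A bidegree whose sum is not [n] contributes 0, so nothing is added to the list. *)
exists s; split=> //; rewrite [X in X + _](_ : _ = 0) ?add0r //.
rewrite -[RHS](addf0 (@dsum_inj_zmod _ _ p)); congr dsum_inj.
rewrite -[LHS]/(res_gr (rho A p.1 p.2) (x (p.1 + p.2)%N)) hx; last exact/eqP.
exact: (addf0 (res_gr_zmod _)).
Qed.

Lemma gr_graded_connected : is_graded_connected mul one com eps.
Proof.
split.
- exact: gr_mul_homog.
- exact: dsum_inj_homog.
- exact: gr_comul_homog.
- by move=> n x n0 /homog_inj ->; exact: gr_counit_inj.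
by move=> x /gr_connected xE; exists (eps x).
Qed.

(** The premises are the axioms that duality and the Mackey formula will supply. *)
Lemma gr_hopf :
  (forall x, ztassoc (ztmap com id (com x)) = ztmap id com (com x)) ->
  (forall x, zlift (fun a b => b *~ eps a) (com x) = x) ->
  (forall x, zlift (fun a b => a *~ eps b) (com x) = x) ->
  (forall x y, com (mul x y) = ztmul mul (com x) (com y)) ->
  com one = zpure one one ->
  is_hopf mul one com eps /\
  @is_graded_connected (fun n => gr T (A n)) mul one com eps.
Proof.
move=> ca cl' cr cM c1; have gc := gr_graded_connected; split=> //; split=> //.
- exact: gr_mul_biadditive.
- exact: gr_mulA th.
- exact: gr_mul1l th.
- exact: gr_mul1r th.
- exact: gr_comul_zmod.
- exact: gr_counit_zmod.
- exact: gr_counitM.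
- exact: gr_counit_one.
exact: (antipode_exists (V := fun n => gr T (A n)) (@gr_mul_biadditive F A T) (gr_mulA th)
  (gr_mul1l th) (gr_mul1r th) gr_comul_zmod gr_counit_zmod ca cl' cr gr_counit_one gc).
Qed.
End TowerCoalgebra.

(** * External products against restriction, interchange and pairings *)

Section ExtRes.
Variable F : fieldType.

Lemma ext_res_fiso (C B C' B' : falgType F) (f : {lrmorphism C -> B})
    (g : {lrmorphism C' -> B'}) (M : fmod B) (N : fmod B') :
  fiso (ext_mod (res_mod f M) (res_mod g N)) (res_mod (tmor f g) (ext_mod M N)).
Proof.
pose X := ext_mod (res_mod f M) (res_mod g N); pose Y := res_mod (tmor f g) (ext_mod M N).
have XL : linear (id : X -> Y) by [].
have XA : forall t (x : X), (t · x : Y) = t · (x : Y).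
  apply: (@ext_act_ext _ _ _ (res_mod f M) (res_mod g N) Y id XL) => a b m n.
  have -> : (a ⊗ b : tens C C') · (m ⊗ n : Y) = (f a ⊗ g b : tens B B') · (m ⊗ n : ext_mod M N).
    rewrite -[LHS]/(tmor f g (a ⊗ b) · (m ⊗ n : ext_mod M N)).
    by rewrite (_ : tmor f g (a ⊗ b) = f a ⊗ g b) //; apply: tmapE; exact: linearP.
  by rewrite ext_pure.
apply: (bij_fiso (f := @FHom _ _ X Y id XL XA)) => [x y //|y]; by exists y.
Qed.

Definition mswap (U V U' V' : vectType F) : tens (tens U V) (tens U' V') ->
    tens (tens U U') (tens V V') :=
  tlift (fun x y => tlift (fun u v => tlift (fun u' v' => (u ⊗ u') ⊗ (v ⊗ v')) y) x).

Lemma mswap_linear (U V U' V' : vectType F) : linear (@mswap U V U' V').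
Proof. exact: tlift_linear. Qed.

Lemma mswapE (U V U' V' : vectType F) (u : U) (v : V) (u' : U') (v' : V') :
  mswap ((u ⊗ v) ⊗ (u' ⊗ v')) = (u ⊗ u') ⊗ (v ⊗ v').
Proof.
have b1 (a : U) (b : V) : bilin (fun (c : U') (d : V') => (a ⊗ c) ⊗ (b ⊗ d)).
  split=> [x|y] k s t /=; rewrite (tens_bilin _ _).1.
    by rewrite (tens_bilin _ _).1.
  by rewrite (tens_bilin _ _).2.
have b2 y : bilin (fun (a : U) (b : V) =>
    tlift (fun (c : U') (d : V') => (a ⊗ c) ⊗ (b ⊗ d)) y).
  split=> [x|x]; apply: tlift_linear_param => c d k s t.
    by rewrite (tens_bilin _ _).2 (tens_bilin _ _).1.
  by rewrite !(tens_bilin _ _).2.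
rewrite /mswap tliftE; first by rewrite tliftE // tliftE.
split=> [x|y]; last exact: tlift_linear.
by apply: tlift_linear_param => a b; exact: tlift_linear.
Qed.

Lemma tens4_ext (U V U' V' : vectType F) (W : lmodType F)
    (f g : tens (tens U V) (tens U' V') -> W) : linear f -> linear g ->
  (forall u v u' v', f ((u ⊗ v) ⊗ (u' ⊗ v')) = g ((u ⊗ v) ⊗ (u' ⊗ v'))) -> f =1 g.
Proof.
move=> lf lg fg; apply: tens3_extr => // t u' v'; move: t.
apply: (tens_ext (f := fun t => f (t ⊗ (u' ⊗ v'))) (g := fun t => g (t ⊗ (u' ⊗ v')))) => //.
  by move=> k x y; rewrite (tens_bilin _ _).2 lf.
by move=> k x y; rewrite (tens_bilin _ _).2 lg.
Qed.

Lemma mswapK (U V U' V' : vectType F) : cancel (@mswap U V U' V') (@mswap U U' V V').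
Proof.
apply: (tens4_ext (g := id)) => // [|u v u' v']; last by rewrite !mswapE.
exact: linear_comp (@mswap_linear _ _ _ _) (@mswap_linear _ _ _ _).
Qed.

Lemma tswapK (A B C D : falgType F) : cancel (@tswap F A B C D) (@tswap F A C B D).
Proof. exact: (@mswapK A B C D). Qed.

Lemma ext_swap_fiso (A B C D : falgType F) (M : fmod A) (N : fmod B) (P : fmod C)
    (Q : fmod D) :
  fiso (ext_mod (ext_mod M P) (ext_mod N Q))
       (res_mod (tswap A C B D) (ext_mod (ext_mod M N) (ext_mod P Q))).
Proof.
pose X := ext_mod (ext_mod M P) (ext_mod N Q).
pose Z := ext_mod (ext_mod M N) (ext_mod P Q); pose Y := res_mod (tswap A C B D) Z.
have XL : linear (@mswap M P N Q : X -> Y) by exact: mswap_linear.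
have XA : forall t (x : X), mswap (t · x : tens (tens M P) (tens N Q)) = t · (mswap x : Y).
  move=> t x; move: t; apply: (tens4_ext
    (f := fun t : tens (tens A C) (tens B D) => mswap (t · x : tens (tens M P) (tens N Q)))
    (g := fun t : tens (tens A C) (tens B D) => t · (mswap x : Y))) => [||a c b d].
  - by move=> k s t; rewrite (fact_bilin X).2 mswap_linear.
  - exact: (fact_bilin Y).2.
  move: x; apply: (tens4_ext
    (f := fun x : X => mswap (((a ⊗ c) ⊗ (b ⊗ d) : tens (tens A C) (tens B D)) · x : tens (tens M P) (tens N Q)))
    (g := fun x : X => ((a ⊗ c) ⊗ (b ⊗ d) : tens (tens A C) (tens B D)) · (mswap x : Y))) => [||m p n q].
  - by move=> k s t; rewrite (@fact_linear _ _ X) mswap_linear.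
  - by move=> k s t; rewrite mswap_linear (@fact_linear _ _ Y).
  have -> : ((a ⊗ c) ⊗ (b ⊗ d) : tens (tens A C) (tens B D)) · ((m ⊗ p) ⊗ (n ⊗ q) : X) =
     ((a · m) ⊗ (c · p)) ⊗ ((b · n) ⊗ (d · q)) by rewrite !ext_pure.
  rewrite !mswapE -[RHS]/(tswap A C B D ((a ⊗ c) ⊗ (b ⊗ d)) · ((m ⊗ n) ⊗ (p ⊗ q) : Z)).
  by rewrite [tswap _ _ _ _ _]tswapE !ext_pure.
apply: (bij_fiso (f := @FHom _ _ X Y _ XL XA)) => [|y]; first exact: can_inj (@mswapK _ _ _ _).
by exists (mswap (y : tens (tens M N) (tens P Q))); exact: mswapK.
Qed.

Lemma tswap_left_projective (A B C D : falgType F) :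
  projective (left_via (tswap A B C D)).
Proof.
exact: bijective_left_via_projective (@tswapK A B C D) (@tswapK A C B D).
Qed.

(** The form taken by [dim_hom_ext] on classes. *)
Lemma KG_ext (B C : falgType F) (u : K0 B) (v : K0 C) (x : G0 B) (y : G0 C) :
  KG_pairing (@ext_gr F (K_theory F) B C u v) (@ext_gr F (G_theory F) B C x y) =
  KG_pairing u x * KG_pairing v y.
Proof.
have z0 (W : zmodType) (f : W -> int) c : zmod_morphism f -> zmod_morphism (fun w => f w * c).
  by move=> zf a b; rewrite zf mulrBl.
have z1 (W : zmodType) (f : W -> int) c : zmod_morphism f -> zmod_morphism (fun w => c * f w).
  by move=> zf a b; rewrite zf mulrBr.
have kl := @KG_pairing_zmodl; have kr := @KG_pairing_zmodr.
have Kl := @ext_gr_zmodl F (K_theory F) B C; have Kr := ext_gr_zmodr (K_theoryP F) (B := B) (C := C).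
have Gl := @ext_gr_zmodl F (G_theory F) B C; have Gr := ext_gr_zmodr (G_theoryP F) (B := B) (C := C).
move: u; apply: (gr_additive_ext (th := K_theoryP F)
  (f := fun u => KG_pairing (@ext_gr F (K_theory F) B C u v) (@ext_gr F (G_theory F) B C x y))
  (g := fun u => KG_pairing u x * KG_pairing v y)) => [||P pP].
- exact: zmod_morphism_comp (kl _ _ _) (Kl v).
- exact/z0/kl.
move: v; apply: (gr_additive_ext (th := K_theoryP F)
  (f := fun v => KG_pairing (@ext_gr F (K_theory F) B C _ v) (@ext_gr F (G_theory F) B C x y))
  (g := fun v => KG_pairing _ x * KG_pairing v y)) => [||Q pQ].
- exact: zmod_morphism_comp (kl _ _ _) (Kr _).
- exact/z1/kl.
move: x; apply: (gr_additive_ext (th := G_theoryP F)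
  (f := fun x => KG_pairing _ (@ext_gr F (G_theory F) B C x y))
  (g := fun x => KG_pairing _ x * KG_pairing _ y)) => [||M _].
- exact: zmod_morphism_comp (kr _ _ _) (Gl _).
- exact/z0/kr.
move: y; apply: (gr_additive_ext (th := G_theoryP F)
  (f := fun y => KG_pairing _ (@ext_gr F (G_theory F) B C _ y))
  (g := fun y => KG_pairing _ _ * KG_pairing _ y)) => [||N _].
- exact: zmod_morphism_comp (kr _ _ _) (Gr _).
- exact/z1/kr.
rewrite (ext_gr_class (th := K_theoryP F)) // (ext_gr_class (th := G_theoryP F)) //.
rewrite [LHS]KG_pairing_class; last exact: projective_ext.
rewrite [X in _ = X * _]KG_pairing_class // [X in _ = _ * X]KG_pairing_class //.
by rewrite dim_hom_ext PoszM.
Qed.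

(** Frobenius reciprocity on classes; flatness makes induction additive on exact sequences, and so
    well defined on classes. *)
Lemma KG_ind_res (C B : falgType F) (phi : {lrmorphism C -> B}) (u : K0 C) (y : G0 B) :
  flat phi -> projective (left_via phi) ->
  KG_pairing (@ind_gr F (K_theory F) C B phi u) y =
  KG_pairing u (@res_gr F (G_theory F) C B phi y).
Proof.
move=> fphi pphi; have kl := @KG_pairing_zmodl; have kr := @KG_pairing_zmodr.
move: u; apply: (gr_additive_ext (th := K_theoryP F)
  (f := fun u => KG_pairing (@ind_gr F (K_theory F) C B phi u) y)
  (g := fun u => KG_pairing u (@res_gr F (G_theory F) C B phi y))) => [||P pP].
- exact: (zmod_morphism_comp (kl F B y) (@ind_gr_zmod F (K_theory F) C B phi)).
- exact: kl.
move: y; apply: (gr_additive_ext (th := G_theoryP F)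
  (f := fun y => KG_pairing _ y)
  (g := fun y => KG_pairing _ (@res_gr F (G_theory F) C B phi y))) => [||M _].
- exact: kr.
- exact: (zmod_morphism_comp (kr F C _) (@res_gr_zmod F (G_theory F) C B phi)).
rewrite (ind_gr_class (th := K_theoryP F)) // (res_gr_class (th := G_theoryP F)) //.
rewrite [LHS]KG_pairing_class; last exact: projective_ind.
by rewrite [RHS]KG_pairing_class // dim_hom_ind.
Qed.
End ExtRes.

(** * The pairing of a tower *)

Section TowerPairing.
Variables (F : fieldType) (A : tower F).
Local Notation injK i := (@dsum_inj nat (fun k => gr (K_theory F) (A k)) i).
Local Notation injG i := (@dsum_inj nat (fun k => gr (G_theory F) (A k)) i).
Local Notation pr := (@pairing F A).
Local Notation kl := (@KG_pairing_zmodl _ _).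
Local Notation kr := (@KG_pairing_zmodr _ _).

Lemma pairing_sum (x : KA A) (y : GA A) N :
  (forall n, (N <= n)%N -> KG_pairing (x n) (y n) = 0) ->
  pr x y = \sum_(n < N) KG_pairing (x n) (y n).
Proof.
move=> h; rewrite [RHS](fsbig_ord _ _ (fun n => KG_pairing (x n) (y n))) /pairing; apply: esym; apply: fsbig_widen => // n /= [_].
by move=> nN; apply: h; rewrite leqNgt; apply/negP.
Qed.

Lemma dsum_bound (V : nat -> zmodType) (x : dsum V) :
  exists N, forall n, (N <= n)%N -> x n = 0.
Proof.
have [N NE] := finite_set_ub (dsum_finite x); exists N => n nN; apply/eqP.
by apply: contraTT nN => xn; rewrite -ltnNge; exact: NE.
Qed.

Lemma pairing_zmodl y : zmod_morphism (fun x => pr x y).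
Proof.
move=> x x'; have [N yN] := dsum_bound y.
have h z n : (N <= n)%N -> KG_pairing ((z : KA A) n) (y n) = 0.
  by move=> nN; rewrite yN // (addf0 (kr _)).
rewrite !(@pairing_sum _ _ N) //; try exact: h.
by rewrite -sumrB; apply: eq_bigr => n _; exact: kl.
Qed.

Lemma pairing_zmodr x : zmod_morphism (pr x).
Proof.
move=> y y'; have [N xN] := dsum_bound x.
have h z n : (N <= n)%N -> KG_pairing (x n) ((z : GA A) n) = 0.
  by move=> nN; rewrite xN // (addf0 (kl _)).
rewrite !(@pairing_sum _ _ N) //; try exact: h.
by rewrite -sumrB; apply: eq_bigr => n _; exact: kr.
Qed.

Lemma pairing_biadditive : biadditive pr.
Proof. by apply: biadditiveP; [exact: pairing_zmodl|exact: pairing_zmodr]. Qed.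

Lemma pairing_injr x n (v : G0 (A n)) : pr x (injG n v) = KG_pairing (x n) v.
Proof.
rewrite (@pairing_sum _ _ n.+1) => [|k nk]; last first.
  by rewrite dsum_inj_neq ?(addf0 (kr _)) // neq_ltn nk.
rewrite (bigD1 ord_max) // big1 => [|k /eqP kn]; last first.
  rewrite dsum_inj_neq ?(addf0 (kr _)) //; apply/eqP => e; apply: kn; exact: val_inj.
by rewrite dsum_inj_eq; exact: addr0.
Qed.

Lemma pairing_injl n (u : K0 (A n)) y : pr (injK n u) y = KG_pairing u (y n).
Proof.
rewrite (@pairing_sum _ _ n.+1) => [|k nk]; last first.
  by rewrite dsum_inj_neq ?(addf0 (kl _)) // neq_ltn nk.
rewrite (bigD1 ord_max) // big1 => [|k /eqP kn]; last first.
  rewrite dsum_inj_neq ?(addf0 (kl _)) //; apply/eqP => e; apply: kn; exact: val_inj.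
by rewrite dsum_inj_eq; exact: addr0.
Qed.

Lemma dsum_truncate (V : nat -> zmodType) (x : dsum V) N :
  (forall n, (N <= n)%N -> x n = 0) -> x = \sum_(n < N) dsum_inj (V := V) (x n).
Proof.
move=> xN; apply: dsum_ext => k; rewrite dsum_sumE.
case: (ltnP k N) => [kN|Nk].
  rewrite (bigD1 (Ordinal kN)) // big1 => [|j /eqP jk].
    by rewrite dsum_inj_eq; exact: esym (addr0 _).
  by rewrite dsum_inj_neq //; apply/eqP => e; apply: jk; exact: val_inj.
rewrite xN // big1 // => j _; rewrite dsum_inj_neq //.
by rewrite neq_ltn (leq_trans (ltn_ord j) Nk).
Qed.

Lemma dsum_seq_bound (V : nat -> zmodType) (s : seq (dsum V : zmodType)) :
  exists N, forall x, x \in s -> forall n, (N <= n)%N -> x n = 0.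
Proof.
elim: s => [|x s [N NE]]; first by exists 0%N.
have [M ME] := dsum_bound x; exists (maxn M N) => y; rewrite inE => /orP [/eqP ->|ys] n.
  by rewrite geq_max => /andP [Mn _]; exact: ME.
by rewrite geq_max => /andP [_ Nn]; exact: NE.
Qed.

(** The union of the dual bases in degrees below [N], each pair tagged by its degree. *)
Lemma degree_bases (N : nat) : exists e : seq {n : nat & (K0 (A n) * G0 (A n))%type},
  (forall (x : GA A), (forall n, (N <= n)%N -> x n = 0) ->
     x = \sum_(q <- e) injG (tag q) (tagged q).2 *~ KG_pairing (tagged q).1 (x (tag q))) /\
  (forall (x : KA A), (forall n, (N <= n)%N -> x n = 0) ->
     x = \sum_(q <- e) injK (tag q) (tagged q).1 *~ KG_pairing (x (tag q)) (tagged q).2).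
Proof.
have hb : forall n, exists b : seq (K0 (A n) * G0 (A n)),
    (forall x, x = \sum_(q <- b) q.2 *~ KG_pairing q.1 x) /\
    (forall u, u = \sum_(q <- b) q.1 *~ KG_pairing u q.2).
  move=> n; have [d [P [S [_ GE KE]]]] := dual_basis_exists (talg_perfect A n).
  exists [seq (K0_class (P i), G0_class (S i)) | i <- enum 'I_d].
  by split=> x; rewrite big_map big_enum /=; [exact: GE|exact: KE].
pose b n := projT1 (cid (hb n)).
have bE n : (forall x, x = \sum_(q <- b n) q.2 *~ KG_pairing q.1 x) /\
    (forall u, u = \sum_(q <- b n) q.1 *~ KG_pairing u q.2) by rewrite /b; case: cid.
exists (flatten [seq [seq Tagged (fun n => (K0 (A n) * G0 (A n))%type) q | q <- b n] | n <- index_iota 0 N]).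
split=> x xN; rewrite big_flatten big_map big_mkord.
  rewrite [LHS](dsum_truncate xN); apply: eq_bigr => n _; rewrite big_map {1}((bE n).1 (x n)).
  rewrite (addf_sum (@dsum_inj_zmod _ _ _)); apply: eq_bigr => q _.
  exact: (addfMz (@dsum_inj_zmod _ _ _)).
rewrite [LHS](dsum_truncate xN); apply: eq_bigr => n _; rewrite big_map {1}((bE n).2 (x n)).
rewrite (addf_sum (@dsum_inj_zmod _ _ _)); apply: eq_bigr => q _.
exact: (addfMz (@dsum_inj_zmod _ _ _)).
Qed.

Lemma pairing_locally_dual : locally_dual pr.
Proof.
move=> s; have [N NE] := dsum_seq_bound s; have [e [eE _]] := degree_bases N.
exists [seq (injK (tag q) (tagged q).1, injG (tag q) (tagged q).2) | q <- e] => x xs.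
rewrite big_map {1}(eE x (NE x xs)); apply: eq_bigr => q _.
by rewrite pairing_injl.
Qed.

Lemma pairing_locally_dualC : locally_dual (fun x a => pr a x).
Proof.
move=> s; have [N NE] := dsum_seq_bound s; have [e [_ eE]] := degree_bases N.
exists [seq (injG (tag q) (tagged q).2, injK (tag q) (tagged q).1) | q <- e] => x xs.
rewrite big_map {1}(eE x (NE x xs)); apply: eq_bigr => q _.
by rewrite pairing_injr.
Qed.

(** Read through [kappa], the tensor pairing is the pairing of K_0 and G_0 of A_m ⊗ A_n. This yields
    injectivity of [kappa] and moves computations to the tensor algebras. *)
Lemma tpair_kappaG m n (u : K0 (A m)) (v : K0 (A n)) t :
  tpair pr pr (zpure (injK m u) (injK n v)) t =
  KG_pairing (@ext_gr F (K_theory F) _ _ u v) (kappa t (m, n)).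
Proof.
move: t; apply: ztens_ext => [||x y].
- exact: tpair_zmodr pairing_biadditive pairing_biadditive _.
- by move=> s t; rewrite kappa_zmod; exact: kr.
rewrite tpairE; try exact: pairing_biadditive.
by rewrite (kappaE (G_theoryP F)) !pairing_injl -KG_ext.
Qed.

Lemma tpair_kappaK m n (x : G0 (A m)) (y : G0 (A n)) s :
  tpair pr pr s (zpure (injG m x) (injG n y)) =
  KG_pairing (kappa s (m, n)) (@ext_gr F (G_theory F) _ _ x y).
Proof.
move: s; apply: ztens_ext => [||u v].
- exact: tpair_zmodl.
- by move=> s t; rewrite kappa_zmod; exact: kl.
rewrite tpairE; try exact: pairing_biadditive.
by rewrite (kappaE (K_theoryP F)) !pairing_injr -KG_ext.
Qed.

Lemma dsum_inj_ext2 (V : nat -> zmodType) (W : zmodType) (f g : ztens (dsum V) (dsum V) -> W) :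
  zmod_morphism f -> zmod_morphism g ->
  (forall m n (u : V m) (v : V n),
     f (zpure (dsum_inj u) (dsum_inj v)) = g (zpure (dsum_inj u) (dsum_inj v))) -> f =1 g.
Proof.
move=> zf zg fg; apply: ztens_ext => // a b.
move: a; apply: dsum_ind => [|x y fx fy|m u].
- by rewrite !(addf0 (zpure_zmodl _)) (addf0 zf) (addf0 zg).
- by rewrite !(addfD (zpure_zmodl _)) (addfD zf) (addfD zg) fx fy.
move: b; apply: dsum_ind => [|x y fx fy|n v].
- by rewrite !(addf0 (zpure_zmodr _)) (addf0 zf) (addf0 zg).
- by rewrite !(addfD (zpure_zmodr _)) (addfD zf) (addfD zg) fx fy.
exact: fg.
Qed.

Lemma tpair_extG t t' :
  (forall m n (u : K0 (A m)) (v : K0 (A n)),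
    tpair pr pr (zpure (injK m u) (injK n v)) t = tpair pr pr (zpure (injK m u) (injK n v)) t') ->
  t = t'.
Proof.
move=> h; have bp := pairing_biadditive; have ld := pairing_locally_dual.
apply: (tpair_nondegenerate bp bp ld ld) => a b.
by apply: (dsum_inj_ext2 (f := fun s => tpair pr pr s t) (g := fun s => tpair pr pr s t')) => //;
  exact: tpair_zmodl.
Qed.

Lemma tpair_extK s s' :
  (forall m n (x : G0 (A m)) (y : G0 (A n)),
    tpair pr pr s (zpure (injG m x) (injG n y)) = tpair pr pr s' (zpure (injG m x) (injG n y))) ->
  s = s'.
Proof.
move=> h; have bp := pairing_biadditive; have ld := pairing_locally_dualC.
have bq : biadditive (fun x a => pr a x) by split=> x y z; [exact: bp.2|exact: bp.1].
apply: (tpair_nondegenerate bq bq ld ld) => a b.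
rewrite [LHS](tpairC _ _ bp bp) [RHS](tpairC _ _ bp bp).
apply: (dsum_inj_ext2 (f := tpair pr pr s) (g := tpair pr pr s')) => //; exact: tpair_zmodr.
Qed.

Lemma kappaG_inj : injective (@kappa F (G_theory F) A).
Proof. by move=> t t' e; apply: tpair_extG => m n u v; rewrite !tpair_kappaG e. Qed.

Lemma kappaK_inj : injective (@kappa F (K_theory F) A).
Proof. by move=> t t' e; apply: tpair_extK => m n u v; rewrite !tpair_kappaK e. Qed.

Lemma G_tens_gen m n (Q : gr (G_theory F) (A2 A (m, n)) -> Prop) :
  Q 0 -> (forall x y, Q x -> Q y -> Q (x - y)) ->
  (forall (M : fmod (A m)) (N : fmod (A n)), tok (G_theoryP F) M -> tok (G_theoryP F) N ->
     Q (gclass (ext_mod M N))) -> forall x, Q x.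
Proof.
move=> Q0 QB Qe; apply: (G0_tens_ind (talg_perfect A n)) => // M N; exact: Qe.
Qed.

Lemma K_tens_gen m n (Q : gr (K_theory F) (A2 A (m, n)) -> Prop) :
  Q 0 -> (forall x y, Q x -> Q y -> Q (x - y)) ->
  (forall (M : fmod (A m)) (N : fmod (A n)), tok (K_theoryP F) M -> tok (K_theoryP F) N ->
     Q (gclass (ext_mod M N))) -> forall x, Q x.
Proof.
move=> Q0 QB Qe; apply: (K0_tens_ind (talg_perfect A m) (talg_perfect A n)) => // M N; exact: Qe.
Qed.

Definition kappa_comulG := kappa_comul (@G_tens_gen).
Definition kappa_comulK := kappa_comul (@K_tens_gen).

(** Frobenius reciprocity between ∇ and Δ, one bidegree at a time. *)
Lemma tower_pairing_mul (a b : KA A) (x : GA A) :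
  pr (gr_mul a b) x = tpair pr pr (zpure a b) (gr_comul x).
Proof.
have bm := @gr_mul_biadditive F A (K_theory F).
suff : (fun s => zlift (fun a b => pr (gr_mul a b) x) s) =1 (fun s => tpair pr pr s (gr_comul x)).
  move=> /(_ (zpure a b)) <-; rewrite zliftE //.
  by split=> u v w; rewrite ?bm.1 ?bm.2 (addfD (pairing_zmodl _)).
have bb : biadditive (fun a b : KA A => pr (gr_mul a b) x).
  by split=> u v w; rewrite ?bm.1 ?bm.2 (addfD (pairing_zmodl _)).
apply: dsum_inj_ext2 => [||m n u v].
- exact: zlift_additive.
- exact: tpair_zmodl.
rewrite zliftE // (gr_mul_inj (K_theoryP F) (erefl (m + n)%N)) pairing_injl tpair_kappaG.
rewrite kappa_comulG KG_ind_res //; [exact: rho_flat|exact: rho_projl].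
Qed.

Lemma tower_pairing_one (x : GA A) : pr (gr_one A (K_theory F)) x = gr_counit x.
Proof.
rewrite pairing_injl /gr_counit; move: (x 0%N).
apply: (gr_additive_ext (th := G_theoryP F)
  (f := fun y => KG_pairing (K0_class (reg_mod (A 0))) y) (g := @dim_gr F (G_theory F) (A 0))).
- exact: kr.
- exact: dim_gr_zmod.
move=> M _; rewrite (dim_gr_class (th := G_theoryP F)) // [LHS]KG_pairing_class; last exact: projective_reg.
by rewrite dim_hom_reg.
Qed.

Lemma tower_pairing_counit (a : KA A) : pr a (gr_one A (G_theory F)) = gr_counit a.
Proof.
rewrite pairing_injr (gr_component0 (K_theoryP F)) KG_pairingMzl /gr_one dsum_inj_eq.
rewrite [X in X * _]KG_pairing_class; last exact: projective_reg.
have e : \dim {:reg_mod (A 0)} = 1%N := scalar_algebra_dim (talg0 A).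
by rewrite dim_hom_reg e mul1r.
Qed.
End TowerPairing.

(** * The Mackey formula on Grothendieck groups *)

Section TowerComulM.
Variables (F : fieldType) (A : tower F) (T : groth F) (th : theory T).
Local Notation ok := (tok th).
Local Notation cl := (gclass (g := T)).
Local Notation H := (gr_tower A T).
Local Notation H2 := (dsum (fun p : nat * nat => gr T (A2 A p))).
Local Notation H4 := (dsum (fun p : (nat * nat) * (nat * nat) => gr T (A4 A p))).
Local Notation inj i := (@dsum_inj nat (fun k => gr T (A k)) i).
Local Notation inj2 i := (@dsum_inj _ (fun q : nat * nat => gr T (A2 A q)) i).
Local Notation inj4 i := (@dsum_inj _ (fun q : (nat * nat) * (nat * nat) => gr T (A4 A q)) i).
Local Notation mul := (@gr_mul F A T).

(** The analogue of [ext_dsum] one level up, over the fourfold tensor category. *)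
Definition ext_dsum2 (x y : H2) : H4.
Proof.
exists (fun p => ext_gr (x p.1) (y p.2)).
apply: (sub_finite_set (B :=
  ([set m | x m != 0] `*` [set n | y n != 0])%classic)); last first.
  by apply: finite_setX; exact: dsum_finite.
move=> [m n] /= nz; split; move: nz; apply: contra => /eqP ->.
  by rewrite ext_gr0l.
by rewrite (ext_gr0r th).
Defined.

Lemma ext_dsum2_biadditive : biadditive ext_dsum2.
Proof.
split=> [x y z|x y z]; apply: dsum_ext => p.
  exact: (ext_gr_biadditive th _ _).1.
exact: (ext_gr_biadditive th _ _).2.
Qed.

Lemma ext_dsum2_inj p q (u : gr T (A2 A p)) (v : gr T (A2 A q)) :
  ext_dsum2 (inj2 p u) (inj2 q v) = inj4 (p, q) (ext_gr u v).
Proof.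
apply: dsum_ext => -[p' q']; rewrite -[LHS]/(ext_gr (inj2 p u p') (inj2 q v q')).
have [<-|mp] := eqVneq p p'; last first.
  rewrite (dsum_inj_neq _ mp) ext_gr0l dsum_inj_neq //.
  by apply: contra mp => /eqP [->].
have [<-|nq] := eqVneq q q'; last first.
  rewrite (dsum_inj_neq _ nq) (ext_gr0r th) dsum_inj_neq //.
  by apply: contra nq => /eqP [->].
by rewrite !dsum_inj_eq.
Qed.

Lemma S23_inj i j k l (v : gr T (A4 A ((i, j), (k, l)))) :
  pull_gr (S23_data A) (inj4 ((i, j), (k, l)) v) =
  inj4 ((i, k), (j, l)) (res_gr (tswap (A i) (A k) (A j) (A l)) v).
Proof.
apply: dsum_ext => -[[i' k'] [j' l']].
rewrite -[LHS]/(res_gr (tswap (A i') (A k') (A j') (A l')) (inj4 ((i, j), (k, l)) v ((i', j'), (k', l')))).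
have [e|ne] := eqVneq ((i, j), (k, l)) ((i', j'), (k', l')).
  by case: e => e1 e2 e3 e4; subst i' j' k' l'; rewrite !dsum_inj_eq.
rewrite !dsum_inj_neq //; first exact: (addf0 (res_gr_zmod _)).
by apply: contra ne => /eqP [-> -> -> ->].
Qed.

Lemma push_nabla2_inj i j k l (v : gr T (A4 A ((i, j), (k, l)))) :
  push_gr (nabla2_data A) (inj4 ((i, j), (k, l)) v) =
  inj2 (i + j, k + l)%N (ind_gr (tmor (rho A i j) (rho A k l)) v).
Proof.
(* With free target degrees, [j] and [l] can be replaced by [P - i] and [Q - k], the form recorded
   in [nabla2_data]. *)
suff key P Q (e : (i + j = P)%N) (e' : (k + l = Q)%N) :
    push_gr (nabla2_data A) (inj4 ((i, j), (k, l)) v) =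
    inj2 (P, Q) (ind_gr (tmor (rho_to A e) (rho_to A e')) v) by rewrite (key _ _ erefl erefl).
have eP : (P - i = j)%N by rewrite -e addKn.
have eQ : (Q - k = l)%N by rewrite -e' addKn.
have iP : (i < P.+1)%N by rewrite ltnS -e leq_addr.
have kQ : (k < Q.+1)%N by rewrite ltnS -e' leq_addr.
case: j / eP e v => e v; case: l / eQ e' v => e' v.
pose t : sty (nabla2_data A) (P, Q) := (Ordinal iP, Ordinal kQ).
rewrite (push_gr_inj (D := nabla2_data A) (t := t)) => [|[t1 t2] [tt1 _ tt2 _]]; last first.
  by congr (_, _); exact: val_inj.
exact: (congr2 (fun (e1 : (i + (P - i) = P)%N) (e2 : (k + (Q - k) = Q)%N) =>
  inj2 (P, Q) (ind_gr (tmor (rho_to A e1) (rho_to A e2)) v))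
  (eq_irrelevance _ e) (eq_irrelevance _ e')).
Qed.

Lemma ext_gr_res (B C B' C' : falgType F) (f : {lrmorphism C -> B})
    (g : {lrmorphism C' -> B'}) (x : gr T B) (y : gr T B') :
  projective (left_via f) -> projective (left_via g) ->
  ext_gr (res_gr f x) (res_gr g y) = res_gr (tmor f g) (ext_gr x y).
Proof.
move=> pf pg; have rz := @res_gr_zmod F T; have el := @ext_gr_zmodl F T.
have er (B1 B2 : falgType F) := @ext_gr_zmodr F T th B1 B2.
move: x; apply: (gr_additive_ext (th := th) (f := fun x => ext_gr (res_gr f x) (res_gr g y))
  (g := fun x => res_gr (tmor f g) (ext_gr x y))) => [||M oM].
- exact: (zmod_morphism_comp (el _ _ _) (rz _ _ f)).
- exact: (zmod_morphism_comp (rz _ _ _) (el _ _ y)).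
move: y; apply: (gr_additive_ext (th := th) (f := fun y => ext_gr _ (res_gr g y))
  (g := fun y => res_gr (tmor f g) (ext_gr _ y))) => [||N oN].
- exact: (zmod_morphism_comp (er _ _ _) (rz _ _ g)).
- exact: (zmod_morphism_comp (rz _ _ _) (er _ _ _)).
rewrite !(res_gr_class (th := th)) // !(ext_gr_class (th := th)) //; try exact: tok_res.
rewrite (res_gr_class (th := th)); [|exact: left_via_tmor|exact: tok_ext].
by apply: (gclass_fiso (th := th)); [apply: tok_ext; exact: tok_res|exact: ext_res_fiso].
Qed.

Lemma ext_gr_ind (B C B' C' : falgType F) (f : {lrmorphism C -> B})
    (g : {lrmorphism C' -> B'}) (x : gr T C) (y : gr T C') : flat f -> flat g ->
  ext_gr (ind_gr f x) (ind_gr g y) = ind_gr (tmor f g) (ext_gr x y).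
Proof.
move=> pf pg; have rz := @ind_gr_zmod F T; have el := @ext_gr_zmodl F T.
have er (B1 B2 : falgType F) := @ext_gr_zmodr F T th B1 B2.
move: x; apply: (gr_additive_ext (th := th) (f := fun x => ext_gr (ind_gr f x) (ind_gr g y))
  (g := fun x => ind_gr (tmor f g) (ext_gr x y))) => [||M oM].
- exact: (zmod_morphism_comp (el _ _ _) (rz _ _ f)).
- exact: (zmod_morphism_comp (rz _ _ _) (el _ _ y)).
move: y; apply: (gr_additive_ext (th := th) (f := fun y => ext_gr _ (ind_gr g y))
  (g := fun y => ind_gr (tmor f g) (ext_gr _ y))) => [||N oN].
- exact: (zmod_morphism_comp (er _ _ _) (rz _ _ g)).
- exact: (zmod_morphism_comp (rz _ _ _) (er _ _ _)).
rewrite !(ind_gr_class (th := th)) // !(ext_gr_class (th := th)) //; try exact: tok_ind.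
rewrite (ind_gr_class (th := th)); [|exact: flat_tmor|exact: tok_ext].
apply: (gclass_fiso (th := th)); first by apply: tok_ext; exact: tok_ind.
apply: is_ind_fiso (is_ind_ext _ _) _; exact: ind_is_ind.
Qed.

Lemma ext_gr_swap (B C B' C' : falgType F) (u : gr T B) (v : gr T C) (w : gr T B')
    (z : gr T C') :
  ext_gr (ext_gr u w) (ext_gr v z) =
  res_gr (tswap B B' C C') (ext_gr (ext_gr u v) (ext_gr w z)).
Proof.
have rz := @res_gr_zmod F T _ _ (tswap B B' C C').
have el (B1 B2 : falgType F) := @ext_gr_zmodl F T B1 B2.
have er (B1 B2 : falgType F) := @ext_gr_zmodr F T th B1 B2.
move: u; apply: (gr_additive_ext (th := th)
  (f := fun u => ext_gr (ext_gr u w) (ext_gr v z))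
  (g := fun u => res_gr (tswap B B' C C') (ext_gr (ext_gr u v) (ext_gr w z)))) => [||M oM].
- exact: (zmod_morphism_comp (el _ _ _) (el _ _ _)).
- exact: (zmod_morphism_comp rz (zmod_morphism_comp (el _ _ _) (el _ _ _))).
move: v; apply: (gr_additive_ext (th := th)
  (f := fun v => ext_gr (ext_gr _ w) (ext_gr v z))
  (g := fun v => res_gr (tswap B B' C C') (ext_gr (ext_gr _ v) (ext_gr w z)))) => [||N oN].
- exact: (zmod_morphism_comp (er _ _ _) (el _ _ _)).
- exact: (zmod_morphism_comp rz (zmod_morphism_comp (el _ _ _) (er _ _ _))).
move: w; apply: (gr_additive_ext (th := th)
  (f := fun w => ext_gr (ext_gr _ w) (ext_gr _ z))
  (g := fun w => res_gr (tswap B B' C C') (ext_gr (ext_gr _ _) (ext_gr w z)))) => [||P oP].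
- exact: (zmod_morphism_comp (el _ _ _) (er _ _ _)).
- exact: (zmod_morphism_comp rz (zmod_morphism_comp (er _ _ _) (el _ _ _))).
move: z; apply: (gr_additive_ext (th := th)
  (f := fun z => ext_gr (ext_gr _ _) (ext_gr _ z))
  (g := fun z => res_gr (tswap B B' C C') (ext_gr (ext_gr _ _) (ext_gr _ z)))) => [||Q oQ].
- exact: (zmod_morphism_comp (er _ _ _) (er _ _ _)).
- exact: (zmod_morphism_comp rz (zmod_morphism_comp (er _ _ _) (er _ _ _))).
rewrite !(ext_gr_class (th := th)) //; try exact: tok_ext.
rewrite (res_gr_class (th := th)); [|exact: tswap_left_projective|by do !apply: tok_ext].
by apply: (gclass_fiso (th := th)); [do !apply: tok_ext|exact: ext_swap_fiso].
Qed.

Lemma pull_delta2_ext (x y : H) :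
  pull_gr (delta2_data A) (ext_dsum x y) =
  ext_dsum2 (pull_gr (delta_data A) x) (pull_gr (delta_data A) y).
Proof.
apply: dsum_ext => -[[p q] [r s]]; apply: esym.
by apply: (ext_gr_res (f := rho A p q) (g := rho A r s)); exact: rho_projl.
Qed.

Lemma ztmul_biadditive : biadditive (@ztmul H mul).
Proof.
have bm := @gr_mul_biadditive F A T.
apply: biadditiveP => [t|s t t']; first exact: zlift_additive.
have [r ->] := ztens_sum s.
have bl c d : biadditive (fun a b => zpure (mul a c) (mul b d)).
  exact: biadditive_comp (@zpure_biadditive _ _) (biadditive_zmodl _ bm) (biadditive_zmodl _ bm).
have br a b : biadditive (fun c d => zpure (mul a c) (mul b d)).
  exact: biadditive_comp (@zpure_biadditive _ _) (biadditive_zmodr _ bm) (biadditive_zmodr _ bm).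
rewrite /ztmul !zlift_sum; try exact: zlift_biadditive.
by rewrite -sumrB; apply: eq_bigr => q _; exact: zlift_additive.
Qed.

Lemma ztmulE (a b c d : H) : ztmul mul (zpure a b) (zpure c d) = zpure (mul a c) (mul b d).
Proof.
have := ztmul_sum [:: (a, b)] [:: (c, d)] (@gr_mul_biadditive F A T).
by rewrite !big_seq1.
Qed.

(** Through [kappa], the product of the tensor square becomes ∇⊗∇ after S_23, as in the Mackey
    isomorphism. *)
Lemma kappa_ztmul (s t : ztens H H) :
  kappa (ztmul mul s t) =
  push_gr (nabla2_data A) (pull_gr (S23_data A) (ext_dsum2 (kappa s) (kappa t))).
Proof.
have zk := @kappa_zmod F A T; have bz := ztmul_biadditive; have b2 := ext_dsum2_biadditive.
have zp := push_gr_zmod (T := T) (nabla2_data A).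
have zs := pull_gr_zmod (T := T) (S23_data A).
move: s; apply: (dsum_inj_ext2 (V := fun k => gr T (A k))
  (f := fun s => kappa (ztmul mul s t)) (g := fun s =>
   push_gr (nabla2_data A) (pull_gr (S23_data A) (ext_dsum2 (kappa s) (kappa t))))) => [||i j u v].
- exact: (zmod_morphism_comp zk (biadditive_zmodl t bz)).
- exact: (zmod_morphism_comp zp (zmod_morphism_comp zs (zmod_morphism_comp (biadditive_zmodl _ b2) zk))).
move: t; apply: (dsum_inj_ext2 (V := fun k => gr T (A k))
  (f := fun t => kappa (ztmul mul _ t)) (g := fun t =>
   push_gr (nabla2_data A) (pull_gr (S23_data A) (ext_dsum2 _ (kappa t))))) => [||k l w z].
- exact: (zmod_morphism_comp zk (biadditive_zmodr _ bz)).
- exact: (zmod_morphism_comp zp (zmod_morphism_comp zs (zmod_morphism_comp (biadditive_zmodr _ b2) zk))).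
rewrite ztmulE !(kappaE th) !(ext_dsum_inj th) ext_dsum2_inj S23_inj push_nabla2_inj.
rewrite (gr_mul_inj th (erefl (i + k)%N)) (gr_mul_inj th (erefl (j + l)%N)) (ext_dsum_inj th).
congr (dsum_inj _); rewrite -ext_gr_swap; apply: ext_gr_ind; exact: rho_flat.
Qed.

(** Isomorphic modules have equal classes, and by additivity modules in a single bidegree
    suffice. *)
Lemma strong_mackey : functor_iso (delta A ∘ nabla A) (nabla2 A ∘ S23 A ∘ delta2 A) ->
  forall y : H2, pull_gr (delta_data A) (push_gr (nabla_data A) y) =
    push_gr (nabla2_data A) (pull_gr (S23_data A) (pull_gr (delta2_data A) y)).
Proof.
move=> [eta [theta [_ te et]]].
apply: (dsum_additive_ext (th := th) (B := A2 A)
  (f := fun y => pull_gr (delta_data A) (push_gr (nabla_data A) y))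
  (g := fun y => push_gr (nabla2_data A) (pull_gr (S23_data A) (pull_gr (delta2_data A) y)))).
- exact: (zmod_morphism_comp (pull_gr_zmod _) (push_gr_zmod _)).
- exact: (zmod_morphism_comp (push_gr_zmod _) (zmod_morphism_comp (pull_gr_zmod _) (pull_gr_zmod _))).
move=> p M oM; rewrite -(gmclass_single th).
have oX i : ok (gsingle M i) by exact: gsingle_ok.
rewrite (gmclass_push (th := th)) //; last by move=> N t; exact: rho_to_flat.
rewrite (gmclass_pull (th := th)); first last.
- by move=> N; apply: tok_bigsum => t; apply: tok_ind; exact: oX.
- by move=> q; exact: rho_projl.
have pd2 q : projective (left_via (Defs.pmap (delta2_data A) q)).
  by apply: left_via_tmor; exact: rho_projl.
have oX2 i : ok (delta2 A (gsingle M) i) by exact: tok_res.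
have oX3 i : ok (S23 A (delta2 A (gsingle M)) i).
  by apply: tok_res => //; exact: tswap_left_projective.
rewrite [X in push_gr _ (pull_gr _ X)](gmclass_pull (th := th)) //.
rewrite [X in push_gr _ X](gmclass_pull (th := th)) //; last by move=> q; exact: tswap_left_projective.
rewrite [RHS](gmclass_push (th := th)) //; last first.
  by move=> q t; apply: flat_tmor; exact: rho_to_flat.
apply: (gmclass_isom (th := th)); last first.
  by exists (eta (gsingle M)), (theta (gsingle M)); split; [exact: te | exact: et].
move=> q; apply: tok_res; first exact: rho_projl.
by apply: tok_bigsum => t; apply: tok_ind; exact: oX.
Qed.

Hypothesis tgen : forall m n (Q : gr T (A2 A (m, n)) -> Prop),
  Q 0 -> (forall x y, Q x -> Q y -> Q (x - y)) ->
  (forall (M : fmod (A m)) (N : fmod (A n)), ok M -> ok N -> Q (cl (ext_mod M N))) ->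
  forall x, Q x.
Hypothesis kinj : injective (@kappa F T A).

Lemma gr_comulM : functor_iso (delta A ∘ nabla A) (nabla2 A ∘ S23 A ∘ delta2 A) ->
  forall x y : H, gr_comul (mul x y) = ztmul mul (gr_comul x) (gr_comul y).
Proof.
move=> fi x y; apply: kinj; rewrite kappa_ztmul !(kappa_comul tgen) -pull_delta2_ext.
by rewrite -(strong_mackey fi) /gr_mul (kappaE th).
Qed.
End TowerComulM.

(** * The adjunction *)

Section GradedHoms.
Variables (F : fieldType) (I : eqType) (B : I -> falgType F).

Definition degree_hom (M N : gmod B) i (f : fhom (M i) (N i)) :
    mor (M : gmodc B) (N : gmodc B) :=
  fun j => match i =P j with
           | ReflectT e => ecast k (fhom (M k) (N k)) e f
           | ReflectF _ => fzero (M j) (N j) end.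

Lemma degree_hom_eq (M N : gmod B) i (f : fhom (M i) (N i)) : degree_hom f i = f.
Proof. by rewrite /degree_hom; case: eqP => // e; rewrite (eq_axiomK e). Qed.

Lemma degree_hom_neq (M N : gmod B) i j (f : fhom (M i) (N i)) (x : M j) :
  i <> j -> degree_hom f j x = 0.
Proof. by rewrite /degree_hom; case: eqP. Qed.

(** A relation, because the morphism sets of the graded category carry no vector space structure. *)
Definition glin (M N : gmodc B) (a : F) (f g h : mor M N) : Prop :=
  forall i x, h i x = a *: f i x + g i x.

Lemma degree_hom_lin (M N : gmod B) i a (f g h : fhom (M i) (N i)) :
  (forall x, h x = a *: f x + g x) ->
  glin a (degree_hom f) (degree_hom g) (degree_hom h).
Proof.
move=> hE j x; have [ij|/eqP ij] := eqVneq i j; last first.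
  by rewrite !degree_hom_neq // scaler0 addr0.
by case: j / ij x => x; rewrite !degree_hom_eq.
Qed.

Lemma gmor_ext (M N : gmodc B) (f g : mor M N) : (forall i x, f i x = g i x) -> f = g.
Proof. by move=> fg; apply: functional_extensionality_dep => i; exact: fhom_ext. Qed.

Definition gzero (M N : gmodc B) : mor M N := fun i => fzero _ _.

Lemma gzero_lin (M N : gmodc B) (f : mor M N) : glin (-1) f f (gzero M N).
Proof. by move=> i x; rewrite scaleN1r addNr. Qed.

Lemma glinP (M N : gmodc B) (a : F) (f g : mor M N) : exists h, glin a f g h.
Proof. by exists (fun i => fadd (fscale a (f i)) (g i)). Qed.

Lemma glin_eq (M N : gmodc B) (a : F) (f g h k : mor M N) :
  glin a f g h -> glin a f g k -> h = k.
Proof.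
by move=> hE kE; apply: gmor_ext => i x; rewrite hE kE.
Qed.
End GradedHoms.

Section Adjunction.
Variables (F : fieldType) (I J : eqType) (B : I -> falgType F) (C : J -> falgType F).
Variables (D : push_data B C) (L : functor (gmodc C) (gmodc B)).

Lemma sums_hom_lin (K : falgType F) (T : Type) (s : seq T) (M N : T -> fmod K) a
    (f g h : forall t, fhom (M t) (N t)) : (forall t x, h t x = a *: f t x + g t x) ->
  forall x, sums_hom s h x = a *: sums_hom s f x + sums_hom s g x.
Proof.
move=> hE; elim: s => [|t s IHs] /= x; first by rewrite [LHS]thinmx0 [RHS]thinmx0.
by rewrite hE IHs.
Qed.

Lemma push_lin (M N : gmodc B) a (f g h : mor M N) : glin a f g h ->
  glin a (fmor (push D) f) (fmor (push D) g) (fmor (push D) h).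
Proof.
move=> hE j; apply: sums_hom_lin => t; apply: ind_lin_ext => [||b m].
- exact: fhom_linear.
- by move=> k u v; rewrite !fhom_linear !scalerDr addrACA !scalerA mulrC.
by rewrite !ind_homE hE (@ind_pure_bilin _ _ _ _ _).1.
Qed.

(* By naturality Phi f = R f ∘ Phi 1, so that Phi is linear. *)
Lemma right_adjoint_dim_hom : right_adjoint (push D) L ->
  forall (X : gmodc C) (Y : gmodc B) i j,
  (forall i', i <> i' -> is_zero_mod ((Y : gmod B) i')) ->
  (forall j', j <> j' -> is_zero_mod ((X : gmod C) j')) ->
  dim_hom ((L X : gmod B) i) ((Y : gmod B) i)
  = dim_hom ((X : gmod C) j) ((push D Y : gmod C) j).
Proof.
move=> [Phi [bPhi nPhi]] X Y i j Y0 X0.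
have [Psi PhiK PsiK] := bPhi X Y.
have PhiE f : Phi X Y f = compm (fmor (push D) f) (Phi X (L X) (idm (L X))).
  have := nPhi X X (L X) Y (idm X) f (idm (L X)).
  by rewrite fmor1 !compm1.
have PhiL a f g h : glin a f g h -> glin a (Phi X Y f) (Phi X Y g) (Phi X Y h).
  by move=> /push_lin hE k x; rewrite !PhiE; exact: hE.
have PsiL a f g h : glin a f g h -> glin a (Psi f) (Psi g) (Psi h).
  move=> hE; have [k kE] := glinP a (Psi f) (Psi g); suff -> : Psi h = k by [].
  rewrite -[RHS]PhiK; congr Psi; have := PhiL _ _ _ _ kE; rewrite !PsiK.
  exact: glin_eq hE.
(* As [Y] lives in degree [i], a morphism vanishing there is zero; [degree_hom] of zero names the
   common value. *)
have ext0 (f : mor (L X) Y) : (forall x, f i x = 0) -> f = degree_hom (fzero ((L X : gmod B) i) ((Y : gmod B) i)).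
  move=> f0; apply: gmor_ext => k x.
  have [ik|/eqP ik] := eqVneq i k; last by rewrite degree_hom_neq // [LHS](Y0 _ ik).
  by case: k / ik x => x; rewrite degree_hom_eq f0.
have ext0' (f : mor X (push D Y)) : (forall x, f j x = 0) -> f = degree_hom (fzero ((X : gmod C) j) ((push D Y : gmod C) j)).
  move=> f0; apply: gmor_ext => k x.
  have [ik|/eqP ik] := eqVneq j k.
    by case: k / ik x => x; rewrite degree_hom_eq f0.
  by rewrite [x](X0 _ ik) !fhom0.
have Phi0 : Phi X Y (gzero _ _) = gzero _ _.
  exact: glin_eq (PhiL _ _ _ _ (gzero_lin (gzero (L X) Y))) (gzero_lin _).
apply/eqP; rewrite eqn_leq; apply/andP; split.
  apply: (dim_hom_le (T := fun f => Phi X Y (degree_hom f) j)) => [a f g h hE x|f f0 x].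
    exact/PhiL/degree_hom_lin.
  have := ext0' _ f0; have := ext0' (gzero _ _) (fun=> erefl) => <-.
  rewrite -Phi0 => /(can_inj PhiK) /(congr1 (fun h : mor (L X) Y => h i x)).
  by rewrite degree_hom_eq.
have Psi0 : Psi (gzero _ _) = gzero _ _ by rewrite -Phi0 PhiK.
apply: (dim_hom_le (T := fun f => Psi (degree_hom f) i)) => [a f g h hE x|f f0 x].
  exact/PsiL/degree_hom_lin.
have := ext0 _ f0; have := ext0 (gzero _ _) (fun=> erefl) => <-.
rewrite -Psi0 => /(can_inj PsiK) /(congr1 (fun h : mor X (push D Y) => h j x)).
by rewrite degree_hom_eq.
Qed.
End Adjunction.

Section TowerAdjunction.
Variables (F : fieldType) (A : tower F) (Psi : conjugation A).
Local Notation KT := (K_theory F).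
Local Notation GT := (G_theory F).
Local Notation injK i := (@dsum_inj nat (fun k => gr KT (A k)) i).
Local Notation inj2G i := (@dsum_inj _ (fun q : nat * nat => gr GT (A2 A q)) i).
Local Notation pr := (@pairing F A).

Lemma aut_left_projective (B : falgType F) (u : algebra_aut B) :
  projective (left_via (aut_fun u)) /\ projective (left_via (aut_inv u)).
Proof.
by split; [exact: bijective_left_via_projective (aut_funK u) (aut_invK u)
          |exact: bijective_left_via_projective (aut_invK u) (aut_funK u)].
Qed.

Lemma psi_left_projective n : projective (left_via (Defs.pmap (psi_data Psi) n)).
Proof. exact: (aut_left_projective _).1. Qed.
Lemma psi_inv_left_projective n : projective (left_via (Defs.pmap (psi_inv_data Psi) n)).
Proof. exact: (aut_left_projective _).2. Qed.
Lemma psi2_left_projective p : projective (left_via (Defs.pmap (psi2_data Psi) p)).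
Proof. by apply: left_via_tmor; exact: (aut_left_projective _).1. Qed.

Local Notation L := (psi2 Psi ∘ delta A ∘ psi_inv Psi).

(** The map Δ' with values in the Grothendieck group of the tensor category, before [kappa] is
    inverted; [kappa_conj_comul] compares it with [conj_comul]. *)
Definition conj_delta (T : groth F) (a : gr_tower A T) :
    dsum (fun p : nat * nat => gr T (A2 A p)) :=
  pull_gr (psi2_data Psi) (pull_gr (delta_data A) (pull_gr (psi_inv_data Psi) a)).

Lemma gmclass_conj_delta (T : groth F) (th : theory T) (M : gmod A) :
  (forall n, tok th (M n)) -> conj_delta (gmclass th M) = gmclass th (L M : gmod (A2 A)).
Proof.
move=> oM; have o1 n : tok th ((psi_inv Psi M : gmod A) n).
  by apply: tok_res; [exact: psi_inv_left_projective|exact: oM].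
have o2 p : tok th ((delta A (psi_inv Psi M) : gmod (A2 A)) p).
  by apply: tok_res; [exact: rho_projl|exact: o1].
rewrite /conj_delta (gmclass_pull (th := th)) //; last exact: psi_inv_left_projective.
rewrite (gmclass_pull (th := th)) //; last by move=> p; exact: rho_projl.
by rewrite (gmclass_pull (th := th)) //; exact: psi2_left_projective.
Qed.

Lemma gmclass_nabla (T : groth F) (th : theory T) (M : gmod (A2 A)) :
  (forall p, tok th (M p)) ->
  push_gr (nabla_data A) (gmclass th M) = gmclass th (nabla A M : gmod A).
Proof.
by move=> oM; rewrite (gmclass_push (th := th)) // => n t; exact: rho_to_flat.
Qed.

Lemma push_nabla_homog (T : groth F) p (v : gr T (A2 A p)) :
  push_gr (nabla_data A) (@dsum_inj _ (fun q : nat * nat => gr T (A2 A q)) p v)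
  = @dsum_inj _ (fun n => gr T (A n)) (p.1 + p.2)%N (ind_gr (rho A p.1 p.2) v).
Proof. by case: p v => m n v; rewrite (push_nabla_inj (erefl (m + n)%N)). Qed.

(** The conjugate adjunction, in the form of [right_adjoint_dim_hom], for a projective module and a
    module placed in single degrees. *)
Lemma adjoint_KG_pairing : right_adjoint (nabla A) L ->
  forall p (x : K0 (A (p.1 + p.2)%N)) (y : G0 (A2 A p)),
  KG_pairing x (@ind_gr F GT _ _ (rho A p.1 p.2) y) =
  KG_pairing (@res_gr F KT _ _ (Defs.pmap (psi2_data Psi) p) (@res_gr F KT _ _ (rho A p.1 p.2)
    (@res_gr F KT _ _ (aut_inv (Psi (p.1 + p.2)%N)) x))) y.
Proof.
move=> adj p x; have kl := @KG_pairing_zmodl; have kr := @KG_pairing_zmodr.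
have zr := @res_gr_zmod F KT.
apply: (gr_additive_ext (th := G_theoryP F)
  (f := fun y => KG_pairing x (@ind_gr F GT _ _ (rho A p.1 p.2) y))
  (g := fun y => KG_pairing _ y)) => [||Z _].
- exact: (zmod_morphism_comp (kr _ _ x) (@ind_gr_zmod F GT _ _ _)).
- exact: kr.
move: x; apply: (gr_additive_ext (th := K_theoryP F)
  (f := fun x => KG_pairing x (@ind_gr F GT _ _ (rho A p.1 p.2) (gclass (g := GT) Z)))
  (g := fun x => KG_pairing (@res_gr F KT _ _ (Defs.pmap (psi2_data Psi) p)
    (@res_gr F KT _ _ (rho A p.1 p.2) (@res_gr F KT _ _ (aut_inv (Psi (p.1 + p.2)%N)) x)))
    (gclass (g := GT) Z))) => [||P pP].
- exact: kl.
- exact: (zmod_morphism_comp (kl _ _ _) (zmod_morphism_comp (zr _ _ _)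
    (zmod_morphism_comp (zr _ _ _) (zr _ _ _)))).
pose X : gmod A := gsingle P; pose Y : gmod (A2 A) := gsingle Z.
have <- : gmclass (G_theoryP F) (nabla A Y : gmod A) (p.1 + p.2)%N =
    @ind_gr F GT _ _ (rho A p.1 p.2) (gclass (g := GT) Z).
  rewrite -gmclass_nabla // gmclass_single.
  by rewrite push_nabla_homog dsum_inj_eq.
have pX n : projective (X n) by exact: (gsingle_ok (th := K_theoryP F)).
have -> : @res_gr F KT _ _ (Defs.pmap (psi2_data Psi) p) (@res_gr F KT _ _ (rho A p.1 p.2)
    (@res_gr F KT _ _ (aut_inv (Psi (p.1 + p.2)%N)) (gclass (g := KT) P)))
   = gmclass (K_theoryP F) (L X : gmod (A2 A)) p.
  rewrite -(gmclass_conj_delta (th := K_theoryP F)) // gmclass_single.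
  by rewrite -[RHS]/(res_gr _ (res_gr _ (res_gr _ (dsum_inj _ (p.1 + p.2)%N)))) dsum_inj_eq.
rewrite [LHS]KG_pairing_class // [RHS]KG_pairing_class; last first.
  apply: projective_res; first exact: psi2_left_projective.
  apply: projective_res; first exact: rho_projl.
  by apply: projective_res; first exact: psi_inv_left_projective.
have eX : X (p.1 + p.2)%N = P := gsingle_eq _.
have eY : Y p = Z := gsingle_eq _.
have := right_adjoint_dim_hom adj (X := X) (Y := Y) (i := p) (j := (p.1 + p.2)%N).
by rewrite eX eY => -> // i ij; exact: gsingle_neq.
Qed.

Lemma adjoint_pairing : right_adjoint (nabla A) L ->
  forall (a : KA A) p (y : G0 (A2 A p)),
  pr a (push_gr (nabla_data A) (inj2G p y)) = KG_pairing (conj_delta a p) y.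
Proof.
by move=> adj a p y; rewrite push_nabla_homog pairing_injr (adjoint_KG_pairing adj).
Qed.
End TowerAdjunction.

(** * Dualizing towers *)

Section DualizingCriterion.
Variables (F : fieldType) (A : tower F).
Local Notation KT := (K_theory F).
Local Notation GT := (G_theory F).
Local Notation injK i := (@dsum_inj nat (fun k => gr KT (A k)) i).
Local Notation injG i := (@dsum_inj nat (fun k => gr GT (A k)) i).
Local Notation pr := (@pairing F A).
Local Notation mulG := (@gr_mul F A GT).
Local Notation comK := (@gr_comul F A KT).

Definition comul_dual : Prop :=
  forall (a : KA A) (x y : GA A), pr a (mulG x y) = tpair pr pr (comK a) (zpure x y).

(** The other pairing axioms are automatic. Given the last one, each of K(A) and G(A) receives its
    coalgebra axioms by transposing the algebra axioms of the other. *)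
Lemma comul_dualP :
  functor_iso (delta A ∘ nabla A) (nabla2 A ∘ S23 A ∘ delta2 A) ->
  dualizing A <-> comul_dual.
Proof.
move=> mackey; split=> [[_ _ [_ pc _ _]]|pc]; first exact: pc.
have bp := @pairing_biadditive F A; have bq : biadditive (fun x a => pr a x).
  by split=> x y z; [exact: bp.2|exact: bp.1].
have ld := @pairing_locally_dual F A; have ldC := @pairing_locally_dualC F A.
have zcK : zmod_morphism comK.
  exact: gr_comul_zmod (@K_tens_gen F A) (@kappaK_inj F A).
have zcG : zmod_morphism (@gr_comul F A GT).
  exact: gr_comul_zmod (@G_tens_gen F A) (@kappaG_inj F A).
have pm := @tower_pairing_mul F A.
(* The flipped form lets the duality lemmas run with K(A) and G(A) exchanged. *)
have pcC x y a : pr a (mulG x y) =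
    tpair (fun x a => pr a x) (fun x a => pr a x) (zpure x y) (comK a).
  by rewrite pc [RHS](tpairC _ _ bp bp).
split.
- apply: (gr_hopf (@K_tens_gen F A) (@kappaK_inj F A)).
  + exact: (dual_coassoc bq ldC zcK pcC (gr_mulA (G_theoryP F))).
  + exact: (dual_counitl bq ldC pcC (@gr_counit_zmod F A KT) (@tower_pairing_counit F A) (gr_mul1l (G_theoryP F))).
  + exact: (dual_counitr bq ldC pcC (@gr_counit_zmod F A KT) (@tower_pairing_counit F A) (gr_mul1r (G_theoryP F))).
  + exact: (gr_comulM (@K_tens_gen F A) (@kappaK_inj F A) mackey).
  exact: (dual_comul1 bq ldC pcC (@tower_pairing_one F A) (gr_counitM (G_theoryP F))).
- apply: (gr_hopf (@G_tens_gen F A) (@kappaG_inj F A)).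
  + exact: (dual_coassoc bp ld zcG pm (gr_mulA (K_theoryP F))).
  + exact: (dual_counitl bp ld pm (@gr_counit_zmod F A GT) (@tower_pairing_one F A) (gr_mul1l (K_theoryP F))).
  + exact: (dual_counitr bp ld pm (@gr_counit_zmod F A GT) (@tower_pairing_one F A) (gr_mul1r (K_theoryP F))).
  + exact: (gr_comulM (@G_tens_gen F A) (@kappaG_inj F A) mackey).
  exact: (dual_comul1 bp ld pm (@tower_pairing_counit F A) (gr_counitM (K_theoryP F))).
by split; [exact: pm|exact: pc|exact: tower_pairing_one|exact: tower_pairing_counit].
Qed.

Variable Psi : conjugation A.

Definition conj_comul (T : groth F) (a : gr_tower A T) :=
  ztmap (gr_psi Psi) (gr_psi Psi) (gr_comul (gr_psi_inv Psi a)).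

Lemma ext_gr_psi2 (T : groth F) (th : theory T) m n (u : gr T (A m)) (v : gr T (A n)) :
  ext_gr (res_gr (aut_fun (Psi m)) u) (res_gr (aut_fun (Psi n)) v) =
  res_gr (Defs.pmap (psi2_data Psi) (m, n)) (ext_gr u v).
Proof. by apply: (ext_gr_res th); exact: (aut_left_projective _).1. Qed.

Lemma kappa_ztmap_psi (T : groth F) (th : theory T) t :
  kappa (ztmap (gr_psi (T := T) Psi) (gr_psi (T := T) Psi) t) = pull_gr (psi2_data Psi) (kappa t).
Proof.
have zk := @kappa_zmod F A T; have zp := pull_gr_zmod (T := T) (psi_data Psi).
have b : biadditive (fun u v : gr_tower A T => zpure (gr_psi Psi u) (gr_psi Psi v)).
  exact: (biadditive_comp (@zpure_biadditive _ _) zp zp).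
move: t; apply: (ztens_ext
  (f := fun t => kappa (ztmap (gr_psi (T := T) Psi) (gr_psi (T := T) Psi) t))
  (g := fun t => pull_gr (psi2_data Psi) (kappa t))) => [||u v].
- exact: (zmod_morphism_comp zk (@zlift_additive _ _ _ _)).
- exact: (zmod_morphism_comp (pull_gr_zmod _) zk).
rewrite [ztmap _ _ _](zliftE _ _ b) !(kappaE th); apply: dsum_ext => -[m n].
exact: (ext_gr_psi2 th (u m) (v n)).
Qed.

Lemma kappa_conj_comul (a : KA A) : kappa (conj_comul a) = conj_delta Psi a.
Proof. by rewrite (kappa_ztmap_psi (K_theoryP F)) kappa_comulK. Qed.

(** The adjunction gives <a, xy> = <Δ' a, x ⊗ y>; comparison with <Δ a, x ⊗ y> on homogeneous x and
    y decides, by nondegeneracy. *)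
Lemma adjoint_comul_dual :
  right_adjoint (nabla A) (psi2 Psi ∘ delta A ∘ psi_inv Psi) ->
  comul_dual <-> forall a : KA A, conj_comul a = comK a.
Proof.
move=> adj; have E m n (x : G0 (A m)) (y : G0 (A n)) (a : KA A) :
    pr a (mulG (injG m x) (injG n y)) = tpair pr pr (conj_comul a) (zpure (injG m x) (injG n y)).
  rewrite tpair_kappaK kappa_conj_comul -(adjoint_pairing adj).
  by rewrite /gr_mul (kappaE (G_theoryP F)) (ext_dsum_inj (G_theoryP F)).
have bm := @gr_mul_biadditive F A GT; have bp := @pairing_biadditive F A.
split=> [pc a|cc a x y]; first by apply: tpair_extK => m n x y; rewrite -E pc.
have b : biadditive (fun x y => pr a (mulG x y)).
  by split=> u v w; rewrite ?bm.1 ?bm.2 (addfD (pairing_zmodr a)).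
rewrite -(zliftE x y b); move: (zpure x y).
apply: dsum_inj_ext2 => [||m n u v]; first exact: zlift_additive.
  exact: tpair_zmodr.
by rewrite zliftE // E cc.
Qed.
End DualizingCriterion.

(** * Symmetric algebras *)

Section SymmetricAlgebras.
Variable F : fieldType.

Lemma linear_inj_surj (U V : vectType F) (f : U -> V) : linear f ->
  (forall x, f x = 0 -> x = 0) -> \dim {:U} = \dim {:V} -> forall y, exists x, f x = y.
Proof.
move=> lf f0 dUV y; have lE := linfunE lf.
have fU : limg (linfun f) = fullv.
  apply/eqP; rewrite eqEdim subvf limg_dim_eq ?dUV ?leqnn //.
  apply/eqP; rewrite -subv0; apply/subvP => x; rewrite memv_cap memv_ker lE.
  by case/andP=> _ /eqP /f0 ->; rewrite memv0.
have : y \in limg (linfun f) by rewrite fU memvf.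
by case/memv_imgP => x _ ->; exists x; rewrite lE.
Qed.

Lemma dim_row n : \dim {:'rV[F]_n} = n.
Proof. by rewrite dimvf /dim /= mul1n. Qed.

Lemma linear_vbasis_eq0 (V : vectType F) (f : V -> F^o) : linear f ->
  (forall i : 'I_(\dim {:V}), f (vbasis {:V})`_i = 0) -> forall v, f v = 0.
Proof.
move=> lf f0 v; rewrite (coord_vbasis (memvf v)) (linear_sumf lf) big1 // => i _.
by rewrite (linearZf lf) f0 scaler0.
Qed.

Lemma bilin_dim_le (U V : vectType F) (b : U -> V -> F^o) : bilin b ->
  (forall u, (forall v, b u v = 0) -> u = 0) -> (\dim {:U} <= \dim {:V})%N.
Proof.
move=> [lr ll] b0; rewrite -[leqRHS]dim_row.
apply: (linear_dim_le (f := fun u => \row_(i < \dim {:V}) b u (vbasis {:V})`_i)).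
  by move=> a x y; apply/rowP => i; rewrite !mxE ll.
move=> u /rowP u0; apply: b0; apply: linear_vbasis_eq0 => // i.
by have := u0 i; rewrite !mxE.
Qed.

Variable B : falgType F.

(** An F-basis of [P] gives a surjection from a free module; it splits, and the coordinates of the
    splitting are the phi_i. *)
Lemma projective_dual_basis (P : fmod B) : projective P ->
  exists n (x : 'I_n -> P) (phi : 'I_n -> fhom P (reg_mod B)),
    forall y, y = \sum_i (phi i y : B) · x i.
Proof.
move=> pP; pose n := \dim {:P}; pose x (i : 'I_n) : P := (vbasis {:P})`_i.
pose gen (c : free_mod B n) : P := \sum_i (c : {ffun 'I_n -> B}) i · x i.
have genL : linear gen.
  move=> a u v; rewrite /gen scaler_sumr -big_split; apply: eq_bigr => i _.
  by rewrite !ffunE /= (fact_bilin P).2.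
have genA b c : gen (b · c) = b · gen c.
  rewrite /gen (linear_sumf (@fact_linear _ _ P b)); apply: eq_bigr => i _.
  by rewrite ffunE factM.
have [|s sE] := pP _ _ (FHom genL genA) (fid P).
  move=> y; exists [ffun i => (coord (vbasis {:P}) i y)%:A]; rewrite [RHS](coord_vbasis (memvf y)).
  by apply: eq_bigr => i _; rewrite ffunE (bilinZl (fact_bilin P)) fact1.
have cL i : linear (fun c : free_mod B n => (c : {ffun 'I_n -> B}) i : reg_mod B).
  by move=> a u v; rewrite !ffunE.
have cA i b (c : free_mod B n) : (b · c : {ffun 'I_n -> B}) i = b · ((c : {ffun 'I_n -> B}) i : reg_mod B).
  by rewrite ffunE.
exists n, x, (fun i => fcomp (FHom (cL i) (cA i)) s) => y.
by rewrite -[LHS](sE y).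
Qed.

Variable tr : {scalar B}.
Hypotheses (trC : forall a b, tr (a * b) = tr (b * a))
  (tr0 : forall a, (forall b, tr (a * b) = 0) -> a = 0).

(** The map c ↦ tr(- c) from [B] to its linear dual is injective, hence onto by dimension. *)
Lemma trace_form_repr (f : B -> F^o) : linear f -> exists c, forall b, tr (b * c) = f b.
Proof.
move=> lf; have [|||c cE] := @linear_inj_surj B 'rV[F]_(\dim {:B})
    (fun c => \row_i tr ((vbasis {:B})`_i * c)) _ _ _ (\row_i f (vbasis {:B})`_i).
- by move=> a x y; apply/rowP => i; rewrite !mxE mulrDr -scalerAr linearP.
- move=> c /rowP c0; apply: tr0 => b; rewrite trC.
  apply: (linear_vbasis_eq0 (f := fun b => tr (b * c))) => [a x y|i].
    by rewrite mulrDl -scalerAl linearP.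
  by have := c0 i; rewrite !mxE.
- by rewrite dim_row.
exists c => b; apply/eqP; rewrite -subr_eq0; apply/eqP.
apply: (linear_vbasis_eq0 (f := fun b => tr (b * c) - f b)) => [a x y|i].
  by rewrite mulrDl -scalerAl linearP lf scalerBr opprD addrACA.
by have /rowP /(_ i) := cE; rewrite !mxE => ->; rewrite subrr.
Qed.

(** Composition with [tr] identifies Hom_B(M, B) with the linear dual of [M]. *)
Lemma trace_form_hom (M : fmod B) (f : M -> F^o) : linear f ->
  exists g : fhom M (reg_mod B), forall m, tr (g m : B) = f m.
Proof.
move=> lf; have h m : exists c, forall b, tr (b * c) = f (b · m).
  apply: (trace_form_repr (f := fun b => f (b · m))) => a x y.
  by rewrite (fact_bilin M).2 lf.
have {h} /choice [g gE] := h.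
have uniq x y : (forall b, tr (b * x) = tr (b * y)) -> x = y.
  move=> xy; apply/eqP; rewrite -subr_eq0; apply/eqP/tr0 => b.
  by rewrite mulrBl linearB /= trC xy trC subrr.
have gL : linear (g : M -> reg_mod B).
  move=> a x y; apply: uniq => b.
  by rewrite gE (@fact_linear _ _ M) lf mulrDr -scalerAr linearP !gE.
have gA b (m : M) : g (b · m) = b · (g m : reg_mod B).
  by apply: uniq => b'; rewrite gE -factM -gE mulrA.
by exists (FHom gL gA) => m; rewrite -[f m]/(f m) -[m in RHS]fact1 -gE mul1r.
Qed.

Section Symmetry.
Variables (P M : fmod B) (n : nat) (x : 'I_n -> P) (phi : 'I_n -> fhom P (reg_mod B)).
Hypothesis dual : forall y, y = \sum_i (phi i y : B) · x i.

(** [tr] of the Hattori-Stallings trace of the endomorphism g f of [P]. *)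
Definition trace_pairing (f : homV P M) (g : homV M P) : F^o :=
  \sum_i tr (phi i (of_homV g (of_homV f (x i))) : B).

Lemma trace_pairing_bilin : bilin trace_pairing.
Proof.
split=> [f|g] a u v; rewrite /trace_pairing scaler_sumr -big_split; apply: eq_bigr => i _.
  by rewrite of_homV_lin fhom_linear linearP.
by rewrite of_homV_lin !fhom_linear linearP.
Qed.

(** Test against y ↦ phi_j(y) b m: the dual basis identity and the symmetry of [tr] collapse the sum
    to tr(phi_j(g(m)) b). *)
Lemma trace_pairing_right (g : homV M P) : (forall f, trace_pairing f g = 0) -> g = 0.
Proof.
move=> g0; apply: homV_ext => m; rewrite of_homV0 [LHS]dual big1 // => j _.
suff -> : (phi j (of_homV g m) : B) = 0 by rewrite (linear0f ((fact_bilin P).2 _)).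
apply: tr0 => b.
have fL : linear (fun y : P => (phi j y * b : B) · m).
  by move=> a u v; rewrite fhom_linear mulrDl -scalerAl (fact_bilin M).2.
have fA c (y : P) : (phi j (c · y) * b : B) · m = c · ((phi j y * b : B) · m).
  by rewrite fhom_act -factM mulrA.
rewrite -[RHS](g0 (to_homV (FHom fL fA))) /trace_pairing.
rewrite [of_homV g m]dual (linear_sumf (fhom_linear (phi j))) trC mulr_sumr linear_sum.
apply: eq_bigr => i _; rewrite to_homVK.
rewrite -[FHom fL fA _]/((phi j (x i) * b : B) · m) !fhom_act.
rewrite -[LHS]/(tr (b * ((phi i (of_homV g m) : B) * phi j (x i)))).
by rewrite -[RHS]/(tr ((phi j (x i) * b) * (phi i (of_homV g m) : B))) -[in RHS]mulrA [RHS]trC mulrA.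
Qed.

(** Test against m ↦ g(m) x_j, where [tr] composed with g is a coordinate of [M]: the sum collapses
    to that coordinate of f(x_j). *)
Lemma trace_pairing_left (f : homV P M) : (forall g, trace_pairing f g = 0) -> f = 0.
Proof.
move=> f0; have fx j : of_homV f (x j) = 0.
  apply: vect_coord0 => k.
  have [|g gE] := @trace_form_hom M (fun m => coord (vbasis {:M}) k m).
    by move=> a u v; rewrite linearP.
  rewrite -gE.
  have hL : linear (fun m : M => (g m : B) · x j).
    by move=> a u v; rewrite fhom_linear (fact_bilin P).2.
  have hA c (m : M) : (g (c · m) : B) · x j = c · ((g m : B) · x j) by rewrite fhom_act -factM.
  rewrite -[RHS](f0 (to_homV (FHom hL hA))) /trace_pairing.
  rewrite [x j in LHS]dual !(linear_sumf (fhom_linear _)) linear_sum.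
  apply: eq_bigr => i _; rewrite to_homVK.
  rewrite -[FHom hL hA _]/((g (of_homV f (x i)) : B) · x j) !fhom_act; exact: trC.
by apply: homV_ext => y; rewrite of_homV0 [y]dual (linear_sumf (fhom_linear _)) big1 // => i _;
  rewrite fhom_act fx (linear0f ((fact_bilin M).1 _)).
Qed.
End Symmetry.

End SymmetricAlgebras.

(** The trace pairing between Hom(P, M) and Hom(M, P) is nondegenerate on both sides. *)
Lemma symmetric_dim_hom (F : fieldType) (B : falgType F) (P M : fmod B) :
  symmetric_algebra B -> projective P -> dim_hom P M = dim_hom M P.
Proof.
move=> [tr [trC tr0]] /projective_dual_basis [n [x [phi dual]]].
have [lr ll] := @trace_pairing_bilin F B tr P M n x phi.
apply/eqP; rewrite eqn_leq -!dim_homV; apply/andP; split.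
  by apply: (bilin_dim_le (b := trace_pairing tr x phi)); last exact: trace_pairing_left.
apply: (bilin_dim_le (b := fun g f => trace_pairing tr x phi f g)).
  by split; [exact: ll|exact: lr].
exact: trace_pairing_right.
Qed.

Lemma symmetric_tens (F : fieldType) (B C : falgType F) :
  symmetric_algebra B -> symmetric_algebra C -> symmetric_algebra (tens B C).
Proof.
move=> [tB [tBC tB0]] [tC [tCC tC0]].
pose f (b : B) (c : C) : F^o := tB b * tC c.
have bf : bilin f.
  split=> [b|c] a u v; rewrite /f linearP /=; first by rewrite mulrDr mulrCA.
  by rewrite mulrDl -mulrA.
pose tr : {scalar tens B C} := HB.pack (tlift f : tens B C -> F^o)
  (GRing.isLinear.Build _ _ _ _ _ (tlift_linear f)).
have trE b c : tr (b ⊗ c) = tB b * tC c by rewrite -[LHS]/(tlift f (b ⊗ c)) tliftE.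
have lM (t : tens B C) : linear (fun s => tr (t * s) : F^o) by move=> a u v; rewrite mulrDr -scalerAr linearP.
have lM' (t : tens B C) : linear (fun s => tr (s * t) : F^o) by move=> a u v; rewrite mulrDl -scalerAl linearP.
exists tr; split=> [s t|t t0].
  move: s; apply: (tens_ext (W := F^o) (f := fun s => tr (s * t)) (g := fun s => tr (t * s))) => // b c.
  move: t; apply: (tens_ext (W := F^o) (f := fun t => tr ((b ⊗ c) * t)) (g := fun t => tr (t * (b ⊗ c)))) => // b' c'.
  by rewrite !tensM !trE tBC tCC.
rewrite [t]tens_coord big1 // => i _.
suff -> : tcoord i t = 0 by rewrite (linear0f ((@tens_bilin _ _ _).1 _)).
apply: tC0 => c; rewrite -[RHS]/(0 : F).
(* [g] contracts the second factor against [c]. Nondegeneracy of [tB] kills the contraction of [t],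
   whose i-th coordinate is [tC (tcoord i t * c)]. *)
pose g (b : B) (c' : C) : B := tC (c' * c) *: b.
have bg : bilin g.
  split=> [b|c'] a u v; rewrite /g; last by rewrite scalerDr !scalerA mulrC.
  by rewrite mulrDl -scalerAl linearP scalerDl scalerA.
have gt0 : tlift g t = 0.
  apply: tB0 => b; rewrite -[RHS](t0 (b ⊗ c)); move: t {t0}.
  apply: (tens_ext (W := F^o) (f := fun t => tB (tlift g t * b)) (g := fun t => tr (t * (b ⊗ c)))) => //.
    by move=> a u v; rewrite tlift_linear mulrDl -scalerAl linearP.
  move=> b' c'; rewrite tliftE // tensM trE /g -scalerAl linearZ; exact: mulrC.
have : coord (vbasis {:B}) i (tlift g t) = 0 by rewrite gt0 linear0.
move=> <-; move: t {t0 gt0}.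
apply: (tens_ext (W := F^o) (f := fun t => tC (tcoord i t * c))
  (g := fun t => coord (vbasis {:B}) i (tlift g t))) => [a u v|a u v|b c'].
- by rewrite tcoord_linear mulrDl -scalerAl linearP.
- by rewrite tlift_linear linearP.
by rewrite tcoordE tliftE // /g -scalerAl !linearZ; exact: mulrC.
Qed.

Lemma K0_class_dim_hom (F : fieldType) (B : falgType F) (P Q S : fmod B) :
  projective P -> projective Q -> K0_class P = K0_class Q -> dim_hom P S = dim_hom Q S.
Proof.
move=> pP pQ e; have := congr1 (fun u => KG_pairing u (G0_class S)) e.
by rewrite !KG_pairing_class // => -[].
Qed.

(** * The equivalences and the sufficient conditions *)

Section Equivalence.
Variables (F : fieldType) (A : tower F) (Psi : conjugation A).
Local Notation KT := (K_theory F).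
Local Notation GT := (G_theory F).
Local Notation L := (psi2 Psi ∘ delta A ∘ psi_inv Psi).
Local Notation comK := (@gr_comul F A KT).

Lemma gmclass_delta (P : gmod A) : (forall n, projective (P n)) ->
  pull_gr (delta_data A) (gmclass (K_theoryP F) P) = gmclass (K_theoryP F) (delta A P : gmod (A2 A)).
Proof.
by move=> pP; rewrite (gmclass_pull (th := K_theoryP F)) // => p; exact: rho_projl.
Qed.

Lemma delta_isom_conj_comul :
  (forall P : gmod A, (forall n, projective (P n)) -> isom (L P) (delta A P)) ->
  forall a : KA A, conj_comul Psi a = comK a.
Proof.
move=> iso a; apply: kappaK_inj; rewrite kappa_conj_comul kappa_comulK.
move: a; apply: (dsum_additive_ext (th := K_theoryP F) (B := A)
  (f := fun a => conj_delta Psi a) (g := fun a : KA A => pull_gr (delta_data A) a)) => [||n P pP].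
- exact: (zmod_morphism_comp (pull_gr_zmod _) (zmod_morphism_comp (pull_gr_zmod _) (pull_gr_zmod _))).
- exact: pull_gr_zmod.
have pX k : projective (gsingle (B := A) P k) by exact: (gsingle_ok (th := K_theoryP F)).
rewrite -(gmclass_single (K_theoryP F)) gmclass_delta // (gmclass_conj_delta Psi (th := K_theoryP F)) //.
apply: (gmclass_isom (th := K_theoryP F)); last exact: iso.
move=> p; apply: tok_res; first exact: psi2_left_projective.
apply: tok_res; first exact: rho_projl.
by apply: tok_res; [exact: psi_inv_left_projective|exact: pX].
Qed.

(** Equal classes have equal Hom dimensions to simple modules, so [projective_isoP] gives
    isomorphisms in each bidegree. *)
Lemma conj_comul_delta_isom : (forall a : KA A, conj_comul Psi a = comK a) ->
  forall P : gmod A, (forall n, projective (P n)) -> isom (L P) (delta A P).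
Proof.
move=> cc P pP.
have pL p : projective ((L P : gmod (A2 A)) p).
  apply: projective_res; first exact: psi2_left_projective.
  apply: projective_res; first exact: rho_projl.
  by apply: projective_res; [exact: psi_inv_left_projective|exact: pP].
have pD p : projective ((delta A P : gmod (A2 A)) p).
  by apply: projective_res; [exact: rho_projl|exact: pP].
have iso p : fiso ((L P : gmod (A2 A)) p) ((delta A P : gmod (A2 A)) p).
  apply: projective_isoP => // S _.
  suff e : K0_class ((L P : gmod (A2 A)) p) = K0_class ((delta A P : gmod (A2 A)) p).
    exact: K0_class_dim_hom e.
  have := congr1 (fun y : dsum (fun p => gr KT (A2 A p)) => y p)
    (congr1 (@kappa F KT A) (cc (gmclass (K_theoryP F) P))).
  rewrite kappa_conj_comul kappa_comulK gmclass_delta //.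
  by rewrite (gmclass_conj_delta Psi (th := K_theoryP F)).
(* An isomorphism is chosen in every bidegree, to be assembled into one of graded modules. *)
have {}iso p : {fg : fhom ((L P : gmod (A2 A)) p) ((delta A P : gmod (A2 A)) p) *
    fhom ((delta A P : gmod (A2 A)) p) ((L P : gmod (A2 A)) p) |
    cancel fg.1 fg.2 /\ cancel fg.2 fg.1}.
  by apply: cid; have [f [g fg]] := iso p; exists (f, g).
exists (fun p => (sval (iso p)).1), (fun p => (sval (iso p)).2).
by split; apply: gmor_ext => p x; [exact: (svalP (iso p)).1|exact: (svalP (iso p)).2].
Qed.

Lemma gr_psiK (a : KA A) : gr_psi Psi (gr_psi_inv Psi a) = a.
Proof.
apply: dsum_ext => n.
rewrite -[LHS]/(res_gr (aut_fun (Psi n)) (res_gr (aut_inv (Psi n)) (a n))); move: (a n).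
apply: (gr_additive_ext (th := K_theoryP F)
  (f := fun x => res_gr (aut_fun (Psi n)) (res_gr (aut_inv (Psi n)) x)) (g := id)) => [|//|P pP].
  exact: (zmod_morphism_comp (res_gr_zmod _) (res_gr_zmod _)).
have [pf pi] := aut_left_projective (Psi n).
rewrite (res_gr_class (th := K_theoryP F)) // (res_gr_class (th := K_theoryP F)) //; last exact: projective_res pi pP.
apply: K0_class_fiso; first by do 2 apply: projective_res => //.
have idA b (x : P) : (aut_inv (Psi n) (aut_fun (Psi n) b) · x : P) = b · x.
  by rewrite aut_funK.
apply: (bij_fiso (f := @FHom _ _ (res_mod (aut_fun (Psi n)) (res_mod (aut_inv (Psi n)) P)) P
  id (fun a x y => erefl) idA)) => [x y //|y]; by exists y.
Qed.

Lemma trivial_conj_comul : (forall x : KA A, gr_psi Psi x = x) ->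
  forall a : KA A, conj_comul Psi a = comK a.
Proof.
move=> triv a.
have e : (gr_psi Psi : KA A -> KA A) = id by apply/funext.
(* Ψ^-1 is trivial too: Ψ^-1 a = Ψ Ψ^-1 a = a. *)
rewrite /conj_comul -[gr_psi_inv Psi a]triv gr_psiK e.
move: (comK a); apply: (ztens_ext (g := id)) => [|//|u v].
  exact: zlift_additive.
by rewrite /ztmap zliftE //; exact: zpure_biadditive.
Qed.

Lemma psi_iso_trivial : functor_iso (psi Psi) (id_functor (Amod A)) ->
  forall x : KA A, gr_psi Psi x = x.
Proof.
move=> [eta [theta [_ te et]]].
apply: (dsum_additive_ext (th := K_theoryP F) (B := A) (f := gr_psi Psi) (g := id)) => [|//|n P pP].
  exact: pull_gr_zmod.
have pX k : projective (gsingle (B := A) P k) by exact: (gsingle_ok (th := K_theoryP F)).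
rewrite -(gmclass_single (K_theoryP F)) [LHS](gmclass_pull (th := K_theoryP F)) //; last first.
  exact: psi_left_projective.
apply: (gmclass_isom (th := K_theoryP F)) => [k|].
  by apply: tok_res; [exact: psi_left_projective|exact: pX].
by exists (eta (gsingle P)), (theta (gsingle P)); split; [exact: te|exact: et].
Qed.
End Equivalence.

(** In dimensions, Hom(P, Ind Z) = Hom(Ind Z, P) = Hom(Z, Res P) = Hom(Res P, Z): symmetry,
    Frobenius reciprocity, symmetry. *)
Lemma symmetric_res_ind (F : fieldType) (C B : falgType F) (phi : {lrmorphism C -> B})
    (P : fmod B) (Z : fmod C) :
  symmetric_algebra B -> symmetric_algebra C -> projective (left_via phi) -> projective P ->
  dim_hom P (ind_mod phi Z) = dim_hom (res_mod phi P) Z.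
Proof.
move=> sB sC pphi pP.
by rewrite (symmetric_dim_hom _ sB) // dim_hom_ind [RHS]symmetric_dim_hom //; exact: projective_res.
Qed.

(** By [symmetric_res_ind], induction behaves on dimensions as a right adjoint of restriction; this
    gives the axiom directly, without passing through a conjugation. *)
Lemma symmetric_comul_dual (F : fieldType) (A : tower F) :
  (forall n, symmetric_algebra (A n)) -> comul_dual A.
Proof.
move=> sA; have kl := @KG_pairing_zmodl; have kr := @KG_pairing_zmodr.
have bm := @gr_mul_biadditive F A (G_theory F); have bp := @pairing_biadditive F A.
move=> a x y; have b : biadditive (fun x y => pairing a (gr_mul x y : GA A)).
  by split=> u v w; rewrite ?bm.1 ?bm.2 (addfD (pairing_zmodr a)).
rewrite -(zliftE x y b); move: (zpure x y).
apply: dsum_inj_ext2 => [||m n {}x {}y]; first exact: zlift_additive.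
  exact: tpair_zmodr.
rewrite zliftE // tpair_kappaK kappa_comulK.
rewrite (gr_mul_inj (G_theoryP F) (erefl (m + n)%N)) pairing_injr.
rewrite -[X in _ = KG_pairing X _]/(res_gr (rho A m n) (a (m + n)%N)).
move: (a (m + n)%N) (ext_gr x y) => u z; move: u.
apply: (gr_additive_ext (th := K_theoryP F) (f := fun u => KG_pairing u (ind_gr (rho A m n) z))
  (g := fun u => KG_pairing (res_gr (rho A m n) u) z)) => [||P pP].
- exact: kl.
- exact: (zmod_morphism_comp (kl _ _ z) (@res_gr_zmod F (K_theory F) _ _ (rho A m n))).
move: z; apply: (gr_additive_ext (th := G_theoryP F)
  (f := fun z => KG_pairing _ (ind_gr (rho A m n) z)) (g := fun z => KG_pairing _ z)) => [||Z _].
- exact: (zmod_morphism_comp (kr _ _ _) (@ind_gr_zmod F (G_theory F) _ _ (rho A m n))).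
- exact: kr.
have pr : projective (left_via (rho A m n)) by exact: rho_projl.
rewrite (ind_gr_class (th := G_theoryP F)) //; last exact: rho_flat.
rewrite (res_gr_class (th := K_theoryP F)) //.
rewrite [LHS]KG_pairing_class // [RHS]KG_pairing_class; last exact: projective_res.
by rewrite symmetric_res_ind //; exact: symmetric_tens.
Qed.

Theorem proposition3p7 (F : fieldType) (A : tower F) (Psi : conjugation A)
    (A_strong : strong Psi) :
  ((dualizing A <->
      (forall P : gmod A, (forall n, projective (P n)) ->
         isom ((psi2 Psi ∘ delta A ∘ psi_inv Psi) P) (delta A P))) /\
   (dualizing A <->
      (forall x : KA A,
         ztmap (gr_psi Psi) (gr_psi Psi) (gr_comul (gr_psi_inv Psi x))
         = gr_comul x))) /\
  ((forall n, symmetric_algebra (A n)) -> dualizing A) /\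
  (functor_iso (psi Psi) (id_functor (Amod A)) -> dualizing A) /\
  ((forall x : KA A, gr_psi Psi x = x) -> dualizing A).
Proof.
have [adj mackey] := A_strong.
(* Every claim reduces to this criterion, except the one on symmetric algebras, which uses
   [comul_dualP] itself. *)
have dual_conj : dualizing A <-> forall a : KA A, conj_comul Psi a = gr_comul a.
  exact: iff_trans (comul_dualP mackey) (adjoint_comul_dual adj).
split; last split; last split.
- split; last exact: dual_conj.
  split=> [/dual_conj cc|iso]; first exact: conj_comul_delta_isom cc.
  by apply/dual_conj; exact: delta_isom_conj_comul iso.
- by move=> /symmetric_comul_dual /(comul_dualP mackey).
- by move=> /psi_iso_trivial /trivial_conj_comul /dual_conj.
by move=> /trivial_conj_comul /dual_conj.
Qed.
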